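(* Let $\Lambda$ be any hereditary artin algebra of finite representation type, with set of positive roots $\Phi^+(\Lambda)$ and simple roots $\alpha_1,\dots,\alpha_n$ (listed in lateral order). There is a bijection between the set of maximal green sequences for $\Lambda$ and the set of positive expressions for the Coxeter element $c_Q=x(\alpha_1)\cdots x(\alpha_n)$ in the picture group $G(\Lambda)=G(\Phi^+(\Lambda))$.
   Context: Setting: $\Lambda$ is given by a $K$-modulated valued quiver $Q$: vertices $1,\dots,n$, no loops, oriented cycles or multiple edges; positive integers $f_i$ at the vertices and pairs $(d_{ij},d_{ji})$ on arrows $i\to j$ with $f_id_{ij}=f_jd_{ji}$; division algebras $F_i$ with $\dim_K F_i=f_i$ and $F_i$-$F_j$-bimodules $M_{ij}$ with $\dim_K M_{ij}=f_id_{ij}$ for each arrow $i\to j$. Modules are representations: right $F_i$-vector spaces $V_i$ with $F_j$-linear maps $V_i\otimes M_{ij}\to V_j$; the dimension vector has $i$th coordinate $\dim_{F_i}V_i$. $\Lambda$ has finite representation type, and $\Phi^+(\Lambda)$ is the finite set of positive roots, i.e. dimension vectors of indecomposable modules, all of which are exceptional (endomorphism ring a division algebra, no self-extensions); $M_\beta$ is the unique indecomposable module with dimension vector $\beta$. Write $hom(\alpha,\beta)=\dim_K\mathrm{Hom}_\Lambda(M_\alpha,M_\beta)$, $ext(\alpha,\beta)=\dim_K\mathrm{Ext}_\Lambda(M_\alpha,M_\beta)$; $\alpha\neq\beta$ are hom-orthogonal if $hom(\alpha,\beta)=0=hom(\beta,\alpha)$. $\beta'\subset\beta$ means $M_{\beta'}$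 is isomorphic to a submodule of $M_\beta$. A lateral order of the roots is a total order with $\alpha\le\beta$ if $hom(\alpha,\beta)\ne0$ and $\alpha>\beta$ if $ext(\alpha,\beta)\ne0$; for simple roots this means $\alpha_i$ comes before $\alpha_j$ whenever there is an arrow $j\to i$. List $\mathcal S=\Phi^+(\Lambda)=(\beta_1,\dots,\beta_m)$ in order of nondecreasing length of $M_\beta$. Maximal green sequences: $\langle x,y\rangle=\sum_i x_iy_if_i$ on $\mathbb R^n$, $H(\beta)=\{x:\langle x,\beta\rangle=0\}$, $D(\beta)=\{x\in\mathbb R^n:\langle x,\beta\rangle=0,\ \langle x,\beta'\rangle\le0\ \forall\beta'\subset\beta\}$; the positive side of $D(\beta)$ is where $\langle x,\beta\rangle>0$. For $\epsilon\in\{0,+,-\}^m$ put $\mathcal U_\epsilon=\{x:\langle x,\beta_i\rangle>0\text{ if }\epsilon_i=+,\ \langle x,\beta_j\rangle<0\text{ if }\epsilon_j=-\}$; $\epsilon$ is admissible if for all $k$: $\epsilon_k=0\iff D(\beta_k)\cap\mathcal U_{\epsilon_1,\dots,\epsilon_{k-1}}=\emptyset$ (the empty sequence giving $\mathbb R^n$). The compartments are the $\mathcal U_\epsilon$ with $\epsilon$ admissible. Two compartments are separated by $D(\beta)$ if they lie on opposite sides of it and the intersection of their closures contains a nonempty relatively open subset of $H(\beta)$ contained in $D(\beta)$. A maximal green sequence for $\Lambda$ is a sequence of compartments $\mathcal U_{\epsilon(0)},\dots,\mathcal U_{\epsilon(s)}$ such that each consecutive pair $\mathcal U_{\epsilon(i-1)},\mathcal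 U_{\epsilon(i)}$ is separated by a wall $D(\beta_{k_i})$ with $\epsilon(i-1)_{k_i}=-$, $\epsilon(i)_{k_i}=+$ and $\epsilon(i-1)_j=\epsilon(i)_j$ for $j<k_i$, $\mathcal U_{\epsilon(0)}$ contains the vectors with all coordinates negative, and $\mathcal U_{\epsilon(s)}$ contains the vectors with all coordinates positive. Picture group: $G(\Lambda)=G(\Phi^+(\Lambda))$ has one generator $x(\beta)$ for each $\beta\in\Phi^+(\Lambda)$ and, for each pair $\beta_i,\beta_j$ of hom-orthogonal roots with $ext(\beta_i,\beta_j)=0$, the relation $x(\beta_i)x(\beta_j)=\prod x(\gamma_k)$, where $\gamma_k$ runs over all roots in $\Phi^+(\Lambda)$ of the form $a_k\beta_i+b_k\beta_j$, $a_k,b_k\in\mathbb Z_{\ge0}$, in increasing order of $a_k/b_k$ (from $\beta_j$ at $0/1$ to $\beta_i$ at $1/0$). A positive expression for $g$ is a word in the generators $x(\beta)$ (no inverses) whose product is $g$. *)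

(* Defs.v *)
From HB Require Import structures.
From mathcomp Require Import all_boot all_order all_algebra all_field.
From mathcomp Require Import all_classical all_reals all_analysis.

Set Implicit Arguments.
Unset Strict Implicit.
Unset Printing Implicit Defensive.

Import GRing.Theory Num.Theory.
Import numFieldNormedType.Exports.

Local Open Scope classical_set_scope.
Local Open Scope ring_scope.

Record bimodule (K : fieldType) (A B : falgType K) := Bimodule {
  bim_space :> vectType K;
  lact : A -> bim_space -> bim_space;
  ract : bim_space -> B -> bim_space;
  lact_linearl : forall x, linear (lact^~ x);
  lact_linearr : forall a, linear (lact a);
  ract_linearl : forall b, linear (ract^~ b);
  ract_linearr : forall x, linear (ract x);
  lact1 : forall x, lact 1 x = x;
  lactM : forall a a' x, lact (a * a') x = lact a (lact a' x);
  ract1 : forall x, ract x 1 = x;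
  ractM : forall x b b', ract x (b * b') = ract (ract x b) b';
  lact_ract : forall a x b, ract (lact a x) b = lact a (ract x b)
}.

(* Loops and pairs of opposite arrows are cycles of length 1 and 2. *)
Record modulated_quiver (K : fieldType) (n : nat) := ModulatedQuiver {
  arrow : rel 'I_n;
  arrow_acyclic : forall c : seq 'I_n, c != [::] -> ~~ cycle arrow c;
  vval : 'I_n -> nat;
  aval : 'I_n -> 'I_n -> nat;
  vval_gt0 : forall i, (0 < vval i)%N;
  aval_gt0 : forall i j, arrow i j -> (0 < aval i j)%N /\ (0 < aval j i)%N;
  vval_aval : forall i j, arrow i j ->
    (vval i * aval i j = vval j * aval j i)%N;
  valg : 'I_n -> falgType K;
  valg_div : forall i (a : valg i), a != 0 -> a \is a GRing.unit;
  valg_dim : forall i, \dim {: valg i} = vval i;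
  abim : forall i j, arrow i j -> bimodule (valg i) (valg j);
  abim_dim : forall i j (a : arrow i j),
    \dim {: abim a} = (vval i * aval i j)%N
}.

Arguments abim {K n} _ {i j} a.

(* A right F-vector space is a left module over the converse ring F^c, so
   [c *: v] with [c : F^c] is v.c.  An F_j-linear map
   V_i (x)_{F_i} M_ij -> V_j is given as an F_i-balanced biadditive map
   V_i x M_ij -> V_j that is F_j-linear in M_ij; its K-bilinearity follows. *)
Record rep (K : fieldType) (n : nat) (Q : modulated_quiver K n) := Rep {
  rsp :> forall i, vectType (valg Q i)^c;
  rmap : forall i j (a : arrow Q i j), rsp i -> abim Q a -> rsp j;
  rmapDl : forall i j (a : arrow Q i j) u v x,
    @rmap i j a (u + v) x = @rmap i j a u x + @rmap i j a v x;
  rmapDr : forall i j (a : arrow Q i j) v (x y : abim Q a),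
    @rmap i j a v (x + y) = @rmap i j a v x + @rmap i j a v y;
  rmap_bal : forall i j (a : arrow Q i j) (c : valg Q i) v (x : abim Q a),
    @rmap i j a ((c : (valg Q i)^c) *: v) x = @rmap i j a v (lact c x);
  rmap_lin : forall i j (a : arrow Q i j) v (x : abim Q a) (c : valg Q j),
    @rmap i j a v (ract x c) = (c : (valg Q j)^c) *: @rmap i j a v x
}.

Arguments rmap {K n Q} _ {i j} a v x.

Record rhom (K : fieldType) (n : nat) (Q : modulated_quiver K n)
    (X Y : rep Q) := RHom {
  hmap :> forall i, {linear X i -> Y i};
  hmapP : forall i j (a : arrow Q i j) (v : X i) (x : abim Q a),
    hmap j (rmap X a v x) = rmap Y a (hmap i v) x
}.

Section Representations.
Context {K : fieldType} {n : nat} {Q : modulated_quiver K n}.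
Implicit Types X Y Z E S : rep Q.

(* [vector.dim] of a vectType over (F_i)^c is its F_i-dimension. *)
Definition dimvec X : {ffun 'I_n -> nat} := [ffun i => vector.dim (X i)].

Definition rep_zero X : Prop := forall i (v : X i), v = 0.

Definition rhom_inj X Y (g : rhom X Y) : Prop := forall i, injective (g i).
Definition rhom_surj X Y (g : rhom X Y) : Prop :=
  forall i (w : Y i), exists v, g i v = w.

Definition rep_iso X Y : Prop :=
  exists g : rhom X Y, rhom_inj g /\ rhom_surj g.

(* Y is isomorphic to a submodule of X. *)
Definition rep_sub Y X : Prop := exists g : rhom Y X, rhom_inj g.

Definition is_dirsum X Y Z : Prop :=
  exists (g : rhom Y X) (h : rhom Z X), forall i,
    bijective (fun p : Y i * Z i => g i p.1 + h i p.2).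

Definition indecomposable X : Prop :=
  ~ rep_zero X /\ forall Y Z, is_dirsum X Y Z -> rep_zero Y \/ rep_zero Z.

Definition rep_simple X : Prop :=
  ~ rep_zero X /\
  forall Y (g : rhom Y X), rhom_inj g -> rep_zero Y \/ rhom_surj g.

Definition short_exact X E Y (g : rhom X E) (h : rhom E Y) : Prop :=
  [/\ rhom_inj g, rhom_surj h &
      forall i (e : E i), h i e = 0 <-> exists v, g i v = e].

Definition hom_zero X Y : Prop := forall (g : rhom X Y) i v, g i v = 0.

(* Ext^1(X, Y) = 0 in the sense of Yoneda; Y is the subobject. *)
Definition ext_zero X Y : Prop :=
  forall E (g : rhom Y E) (h : rhom E X), short_exact g h ->
    exists s : rhom X E, forall i v, h i (s i v) = v.

Inductive has_length : rep Q -> nat -> Prop :=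
| has_length0 X : rep_zero X -> has_length X 0
| has_lengthS X Y S (g : rhom Y X) (h : rhom X S) l :
    short_exact g h -> rep_simple S -> has_length Y l -> has_length X l.+1.

Definition is_root (b : {ffun 'I_n -> nat}) : Prop :=
  exists X, indecomposable X /\ dimvec X = b.

End Representations.

Definition finite_rep_type (K : fieldType) (n : nat)
    (Q : modulated_quiver K n) : Prop :=
  exists (m : nat) (L : 'I_m -> rep Q),
    forall X, indecomposable X -> exists k, rep_iso X (L k).

(* M lists, for each positive root once, an indecomposable representation
   with that dimension vector, by nondecreasing length; the roots are
   beta_k = dimvec (M k), M k is M_{beta_k}, and from here on roots are
   referred to by their index k. *)
Record root_listing (K : fieldType) (n : nat) (Q : modulated_quiver K n)
    (m : nat) (M : 'I_m -> rep Q) : Prop := RootListing {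
  root_indec : forall k, indecomposable (M k);
  root_inj : injective (fun k => dimvec (M k));
  root_all : forall b, is_root (Q := Q) b -> exists k, dimvec (M k) = b;
  root_length : forall j k : 'I_m, (j <= k)%N ->
    forall p q, has_length (M j) p -> has_length (M k) q -> (p <= q)%N
}.

Section Presentation.
Variables (I : choiceType) (R : seq I -> seq I -> Prop).

(* The letter (k, false) is the generator k, (k, true) its inverse. *)
Definition letters (w : seq I) : seq (I * bool) := [seq (k, false) | k <- w].
Definition winv (u : seq (I * bool)) : seq (I * bool) :=
  rev [seq (l.1, ~~ l.2) | l <- u].

Inductive pres_eq : seq (I * bool) -> seq (I * bool) -> Prop :=
| pres_refl u : pres_eq u u
| pres_sym u v : pres_eq u v -> pres_eq v u
| pres_trans v u w : pres_eq u v -> pres_eq v w -> pres_eq u w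
| pres_cat u u' v v' : pres_eq u u' -> pres_eq v v' ->
    pres_eq (u ++ v) (u' ++ v')
| pres_inv k b : pres_eq [:: (k, b); (k, ~~ b)] [::]
| pres_rel u v : R u v -> pres_eq (letters u) (letters v).

Definition pres_eqb (u v : seq (I * bool)) : bool := `[< pres_eq u v >].

Fact pres_eqb_refl : reflexive pres_eqb.
Proof. by move=> u; apply/asboolP; exact: pres_refl. Qed.
Fact pres_eqb_sym : symmetric pres_eqb.
Proof. by move=> u v; apply/asboolP/asboolP; exact: pres_sym. Qed.
Fact pres_eqb_trans : transitive pres_eqb.
Proof.
move=> v u w /asboolP uv /asboolP vw; apply/asboolP; exact: pres_trans uv vw.
Qed.

Canonical pres_equiv := EquivRel pres_eqb pres_eqb_refl pres_eqb_sym
  pres_eqb_trans.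

Definition pres_group := {eq_quot pres_equiv}%qT.
HB.instance Definition _ := Choice.on pres_group.
HB.instance Definition _ := EqQuotient.on pres_group.

Definition pres_class (u : seq (I * bool)) : pres_group := \pi_pres_group%qT u.
Definition pres_mul (g h : pres_group) : pres_group :=
  pres_class (repr g ++ repr h).
Definition pres_invg (g : pres_group) : pres_group :=
  pres_class (winv (repr g)).

Fact pres_classP u v : pres_class u = pres_class v <-> pres_eq u v.
Proof.
split=> [/eqP|uv]; first by rewrite eqmodE => /asboolP.
by apply/eqP; rewrite eqmodE; apply/asboolP.
Qed.

Fact pres_reprP u : pres_eq (repr (pres_class u)) u.
Proof. by apply/pres_classP; rewrite /pres_class reprK. Qed.

Fact pres_class_repr g : pres_class (repr g) = g.
Proof. exact: reprK. Qed.

Fact pres_mulE u v : pres_mul (pres_class u) (pres_class v) = pres_class (u ++ v).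
Proof. by apply/pres_classP/pres_cat; exact: pres_reprP. Qed.

Fact pres_eq_winv u : pres_eq (u ++ winv u) [::].
Proof.
elim: u => [|[k b] u IH]; first exact: pres_refl.
rewrite /winv /= rev_cons -cats1 catA.
apply: (@pres_trans [:: (k, b); (k, ~~ b)]); last exact: pres_inv.
apply: (pres_cat (u := [:: (k, b)] ++ _) (u' := [:: (k, b)] ++ [::])).
  exact: pres_cat (pres_refl _) IH.
exact: pres_refl.
Qed.

Fact winvK : involutive winv.
Proof.
move=> u; rewrite /winv map_rev revK -map_comp -[RHS]map_id.
by apply: eq_map => -[k b] /=; rewrite negbK.
Qed.

Fact pres_mulA : associative pres_mul.
Proof.
move=> g h k; rewrite -(pres_class_repr g) -(pres_class_repr h).
by rewrite -(pres_class_repr k) !pres_mulE catA.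
Qed.
Fact pres_mul1g : left_id (pres_class [::]) pres_mul.
Proof. by move=> g; rewrite -(pres_class_repr g) pres_mulE. Qed.
Fact pres_mulg1 : right_id (pres_class [::]) pres_mul.
Proof. by move=> g; rewrite -(pres_class_repr g) pres_mulE cats0. Qed.
Fact pres_mulgV : right_inverse (pres_class [::]) pres_invg pres_mul.
Proof.
move=> g; rewrite -{1}(pres_class_repr g) /pres_invg pres_mulE.
by apply/pres_classP; exact: pres_eq_winv.
Qed.
Fact pres_mulVg : left_inverse (pres_class [::]) pres_invg pres_mul.
Proof.
move=> g; rewrite -{2}(pres_class_repr g) /pres_invg pres_mulE.
by apply/pres_classP; rewrite -{2}(winvK (repr g)); exact: pres_eq_winv.
Qed.

HB.instance Definition _ := isGroup.Build pres_group
  pres_mulA pres_mul1g pres_mulg1 pres_mulVg pres_mulgV.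

Definition pres_gen (k : I) : pres_group := pres_class [:: (k, false)].

End Presentation.

Section PictureGroup.
Context {K : fieldType} {n : nat} {Q : modulated_quiver K n}.
Variables (m : nat) (M : 'I_m -> rep Q).
Implicit Types i j k l : 'I_m.

Definition hom_orthogonal i j : Prop :=
  [/\ i != j, hom_zero (M i) (M j) & hom_zero (M j) (M i)].

Definition root_comb i j k (a b : nat) : Prop :=
  forall v, dimvec (M k) v = (a * dimvec (M i) v + b * dimvec (M j) v)%N.

(* [w] runs over all roots a beta_i + b beta_j by increasing a / b, where
   1 / 0 is infinite; a / b < a' / b' is written a b' < a' b. *)
Definition comb_word i j (w : seq 'I_m) : Prop :=
  [/\ uniq w,
      forall k, k \in w <-> exists a b, root_comb i j k a b &
      forall (p q : nat), (p < q < size w)%N ->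
      forall a b a' b',
        root_comb i j (nth i w p) a b -> root_comb i j (nth i w q) a' b' ->
        (a * b' < a' * b)%N].

Inductive picture_rel : seq 'I_m -> seq 'I_m -> Prop :=
| PictureRel i j w : hom_orthogonal i j -> ext_zero (M i) (M j) ->
    comb_word i j w -> picture_rel [:: i; j] w.

Definition picture_group := pres_group picture_rel.

Definition picture_gen k : picture_group := pres_gen picture_rel k.

Definition word_prod (w : seq 'I_m) : picture_group :=
  (\prod_(k <- w) picture_gen k)%g.

Definition simple_root k : Prop :=
  exists v, dimvec (M k) = [ffun u => nat_of_bool (u == v)].

Definition lateral (s : seq 'I_m) : Prop :=
  forall k l, k \in s -> l \in s ->
    (~ hom_zero (M k) (M l) -> (index k s <= index l s)%N) /\
    (~ ext_zero (M k) (M l) -> (index l s < index k s)%N).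

Definition simple_roots_listing (s : seq 'I_m) : Prop :=
  [/\ uniq s, forall k, k \in s <-> simple_root k & lateral s].

(* The words in the generators, without inverses, whose product is the
   Coxeter element c_Q defined by the listing s of the simple roots. *)
Definition positive_expressions (s : seq 'I_m) : set (seq 'I_m) :=
  [set w | word_prod w = word_prod s].

End PictureGroup.

Inductive sign := SZero | SPlus | SMinus.

Section GreenSequences.
Context {K : fieldType} {n : nat} {Q : modulated_quiver K n}.
Variables (m : nat) (M : 'I_m -> rep Q) (R : realType).
Implicit Types (x : 'rV[R]_n) (e : 'I_m -> sign) (A B C : set 'rV[R]_n).

Definition pairing x (k : 'I_m) : R :=
  \sum_(i < n) x ord0 i * (dimvec (M k) i)%:R * (vval Q i)%:R.

Definition hyperplane (k : 'I_m) : set 'rV[R]_n := [set x | pairing x k = 0].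

Definition wall (k : 'I_m) : set 'rV[R]_n :=
  [set x | pairing x k = 0 /\
           forall j, rep_sub (M j) (M k) -> pairing x j <= 0].

(* U_{e_1, ..., e_p}, only the first p signs being used *)
Definition region e (p : nat) : set 'rV[R]_n :=
  [set x | forall j : 'I_m, (j < p)%N ->
     (e j = SPlus -> 0 < pairing x j) /\ (e j = SMinus -> pairing x j < 0)].

Definition compartment e : set 'rV[R]_n := region e m.

Definition admissible e : Prop :=
  forall k : 'I_m, e k = SZero <-> wall k `&` region e k = set0.

Definition opposite_sides (k : 'I_m) A B : Prop :=
  (A `<=` [set x | pairing x k < 0] /\ B `<=` [set x | 0 < pairing x k]) \/
  (A `<=` [set x | 0 < pairing x k] /\ B `<=` [set x | pairing x k < 0]).

Definition wall_separated (k : 'I_m) A B : Prop :=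
  opposite_sides k A B /\
  exists O : set 'rV[R]_n,
    [/\ open O, O `&` hyperplane k !=set0,
        O `&` hyperplane k `<=` closure A `&` closure B &
        O `&` hyperplane k `<=` wall k].

Definition maximal_green_sequence (c : seq (set 'rV[R]_n)) : Prop :=
  exists (s : nat) (e : nat -> 'I_m -> sign),
    [/\ c = mkseq (fun t => compartment (e t)) s.+1,
        forall t, (t <= s)%N -> admissible (e t),
        forall t, (t < s)%N -> exists k : 'I_m,
          [/\ wall_separated k (compartment (e t)) (compartment (e t.+1)),
              e t k = SMinus, e t.+1 k = SPlus &
              forall j : 'I_m, (j < k)%N -> e t j = e t.+1 j],
        [set x : 'rV[R]_n | forall i, x ord0 i < 0] `<=` compartment (e 0%N) &
        [set x : 'rV[R]_n | forall i, 0 < x ord0 i] `<=` compartment (e s)].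

End GreenSequences.

(* Main.v *)
Require Import Defs.
From HB Require Import structures.
From mathcomp Require Import all_boot all_order all_algebra all_field.
From mathcomp Require Import all_classical all_reals all_analysis.
From mathcomp Require Import zify ring lra.

Set Implicit Arguments.
Unset Strict Implicit.
Unset Printing Implicit Defensive.

Import Order.TTheory GRing.Theory Num.Theory.

(* Both sides are in bijection with the maximal chains of torsion classes from 0
   to the whole module category.

   For a torsion class T with torsion-free class F, consider the open cone of the
   x that are positive on T and negative on F.  It is nonempty by Gordan's
   theorem, since a relation dim N = dim Z with N in T and Z in F would give
   0 < <N, N> = <N, Z> <= 0 for the Euler form.  These cones are exactly the
   compartments, and two of them are separated by the wall of beta_k, crossed in
   the positive direction, if and only if one torsion class covers the other and
   M_k is the only indecomposable in the larger class that is torsion-free for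
   the smaller one.  Hence a maximal green sequence is a maximal chain, and a
   chain is determined by the word of its labels; the simple roots in lateral
   order form such a word.

   Between two torsion classes the chains are connected by the rank two polygons,
   whose label words are the relations of the picture group, so all the words of
   maximal chains have the same product.  Conversely the picture group acts on
   pairs of dimension vectors in such a way that the word of a maximal chain
   sends (dim M, 0) to (0, dim M) for every rigid M.  A positive word with the
   same product acts in the same way, and this forces each of its letters to be
   a minimal extending module of the torsion class reached so far. *)

(** * Modules as matrices *)

(** The Euler form carries the homological algebra. Over a hereditary algebra it equals dim Hom
    minus dim Ext, so Ext enters only through its vanishing, which is the equality of [E X Y] with
    [homd X Y]; long exact sequences become additivity of [dv] together with [E X Y <= homd X Y].
    Finite type is used as a bound on the size of indecomposables: it makes each of them a rigid
    brick, whence a rigid module in the dimension vector of every module, and positivity of the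
    form. A positive word with the right product is joined to a chain only by rewriting with
    inverses, so an invariant of group elements is needed. Each letter acts by a piecewise linear
    bijection, invertible because the value [prg k] that fixes the amount moved is unchanged by the
    move. Moves go in one direction only, so the total displacement lies in the cone of the letters,
    and this excludes wrong letters. In the geometry, admissibility fixes the signs one at a time in
    order of length. Proper submodules and quotients have smaller total dimension, so torsion
    membership at different points of a region is compared by induction along that order. *)

Section Modules.
Local Open Scope ring_scope.
Context {K : fieldType} {n : nat} {Q : modulated_quiver K n}.

(* A representation is encoded as one K-space of row vectors on which the elements
   of the F_i (GV) and of the M_ij (GA) act by multiplication on the right. *)
Inductive gen :=
| GV (i : 'I_n) of valg Q i
| GA (i j : 'I_n) (a : arrow Q i j) of abim Q a.

Record is_mod N (op : gen -> 'M[K]_N) : Prop := IsMod {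
  op_lin : forall i k (c c' : valg Q i),
    op (GV (k *: c + c')) = k *: op (GV c) + op (GV c');
  op_mul : forall i (c c' : valg Q i), op (GV (c * c')) = op (GV c) *m op (GV c');
  op_orth : forall i j (c : valg Q i) (c' : valg Q j), i != j ->
    op (GV c) *m op (GV c') = 0;
  op_sum : \sum_i op (GV (1 : valg Q i)) = 1%:M;
  op_alin : forall i j (a : arrow Q i j) k (x y : abim Q a),
    op (GA (k *: x + y)) = k *: op (GA x) + op (GA y);
  op_lact : forall i j (a : arrow Q i j) (c : valg Q i) (x : abim Q a),
    op (GA (lact c x)) = op (GV c) *m op (GA x);
  op_ract : forall i j (a : arrow Q i j) (x : abim Q a) (c : valg Q j),
    op (GA (ract x c)) = op (GA x) *m op (GV c)
}.

Record qmod := QMod { sz : nat; op : gen -> 'M[K]_sz; opP : is_mod op }.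
Implicit Types X Y Z A B C : qmod.

(** Matrices act on row vectors from the right, so [f *m h] is f followed by h; injective is
    [row_free] and surjective is [row_full]. *)
Definition ishom X Y (f : 'M[K]_(sz X, sz Y)) := forall g, op X g *m f = f *m op Y g.

Lemma is_mod_sub N k (o : gen -> 'M[K]_N) (oo : gen -> 'M[K]_k) (f : 'M[K]_(k, N)) :
  row_free f -> (forall g, oo g *m f = f *m o g) -> is_mod o -> is_mod oo.
Proof.
move=> ff h [p1 p2 p3 p4 p5 p6 p7].
have inj := row_free_inj ff.
split=> [i k' c c'|i c c'|i j c c' ij||i j a k' x y|i j a c x|i j a x c];
  apply: inj => /=.
- by rewrite h p1 mulmxDr -scalemxAr mulmxDl -scalemxAl !h.
- by rewrite h p2 -[RHS]mulmxA h !mulmxA h.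
- by rewrite mul0mx -mulmxA h mulmxA h -mulmxA p3 // mulmx0.
- rewrite mulmx_suml mul1mx; under eq_bigr do rewrite h.
  by rewrite -mulmx_sumr p4 mulmx1.
- by rewrite h p5 mulmxDr -scalemxAr mulmxDl -scalemxAl !h.
- by rewrite h p6 -[RHS]mulmxA h !mulmxA h.
- by rewrite h p7 -[RHS]mulmxA h !mulmxA h.
Qed.

Lemma is_mod_quo N k (o : gen -> 'M[K]_N) (oo : gen -> 'M[K]_k) (f : 'M[K]_(N, k)) :
  row_full f -> (forall g, f *m oo g = o g *m f) -> is_mod o -> is_mod oo.
Proof.
move=> ff h [p1 p2 p3 p4 p5 p6 p7].
have inj := row_full_inj ff.
split=> [i k' c c'|i c c'|i j c c' ij||i j a k' x y|i j a c x|i j a x c];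
  apply: inj => /=.
- by rewrite h p1 mulmxDl -scalemxAl mulmxDr -scalemxAr !h.
- by rewrite h p2 mulmxA h -!mulmxA h.
- by rewrite mulmx0 mulmxA h -mulmxA h mulmxA p3 // mul0mx.
- rewrite mulmx_sumr mulmx1; under eq_bigr do rewrite h.
  by rewrite -mulmx_suml p4 mul1mx.
- by rewrite h p5 mulmxDl -scalemxAl mulmxDr -scalemxAr !h.
- by rewrite h p6 mulmxA h -!mulmxA h.
- by rewrite h p7 mulmxA h -!mulmxA h.
Qed.

Lemma ishom0 X Y : ishom (0 : 'M[K]_(sz X, sz Y)).
Proof. by move=> g; rewrite mulmx0 mul0mx. Qed.

Lemma ishom1 X : @ishom X X 1%:M.
Proof. by move=> g; rewrite mulmx1 mul1mx. Qed.

Lemma ishomM X Y Z (f : 'M[K]_(sz X, sz Y)) (h : 'M[K]_(sz Y, sz Z)) :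
  ishom f -> ishom h -> ishom (f *m h).
Proof. by move=> ff hh g; rewrite mulmxA ff -mulmxA hh mulmxA. Qed.

Lemma ishomD X Y (f h : 'M[K]_(sz X, sz Y)) : ishom f -> ishom h -> ishom (f + h).
Proof. by move=> ff hh g; rewrite mulmxDr mulmxDl ff hh. Qed.

Lemma ishomZ X Y k (f : 'M[K]_(sz X, sz Y)) : ishom f -> ishom (k *: f).
Proof. by move=> ff g; rewrite -scalemxAr -scalemxAl ff. Qed.

Lemma ishomN X Y (f : 'M[K]_(sz X, sz Y)) : ishom f -> ishom (- f).
Proof. by move=> ff g; rewrite mulmxN mulNmx ff. Qed.

Lemma ishomB X Y (f h : 'M[K]_(sz X, sz Y)) : ishom f -> ishom h -> ishom (f - h).
Proof. by move=> ff hh; apply/ishomD/ishomN. Qed.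

Definition stable X k (U : 'M[K]_(k, sz X)) := forall g, (U *m op X g <= U)%MS.

Lemma sub_ex X k (U : 'M[K]_(k, sz X)) : stable U ->
  exists Y (i : 'M[K]_(sz Y, sz X)), [/\ ishom i, row_free i & (i :=: U)%MS].
Proof.
move=> stU; pose b := row_base U.
have fb : row_free b by exact: row_base_free.
have bU : (b :=: U)%MS by exact: eq_row_base.
pose o g := b *m op X g *m pinvmx b.
have h g : o g *m b = b *m op X g.
  by rewrite mulmxKpV // bU (eqmxMr _ bU) stU.
exists (QMod (is_mod_sub fb h (opP X))), b; split=> //.
Qed.

Lemma quo_ex X k (U : 'M[K]_(k, sz X)) : stable U ->
  exists Z (p : 'M[K]_(sz X, sz Z)), [/\ ishom p, row_full p & (kermx p :=: U)%MS].
Proof.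
move=> stU; pose p := col_base (cokermx U).
have fp : row_full p by exact: col_base_full.
have rf : row_free (row_base (cokermx U)) by exact: row_base_free.
have pker m (v : 'M[K]_(m, sz X)) : (v *m p == 0) = (v <= U)%MS.
  have e : v *m cokermx U = v *m p *m row_base (cokermx U).
    by rewrite -mulmxA mulmx_base.
  rewrite submxE e; apply/eqP/eqP => [->|e']; first by rewrite mul0mx.
  by apply: (row_free_inj rf); rewrite /= e' mul0mx.
have pU : U *m p = 0 by apply/eqP; rewrite pker.
pose o g := pinvmx p *m op X g *m p.
have h g : p *m o g = op X g *m p.
  apply/eqP; rewrite -subr_eq0.
  have -> : p *m o g - op X g *m p = ((p *m pinvmx p - 1%:M) *m op X g) *m p.
    by rewrite !mulmxBl mul1mx /o !mulmxA.
  rewrite pker; apply: submx_trans (stU g); apply: submxMr; rewrite -pker.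
  by rewrite mulmxBl mul1mx -mulmxA mulVpmx // mulmx1 subrr.
exists (QMod (is_mod_quo fp h (opP X))), p; split=> //.
apply/eqmxP/andP; split; first by rewrite -pker mulmx_ker.
by rewrite sub_kermx pU.
Qed.

Lemma fac_surj X Y Z (p : 'M[K]_(sz X, sz Y)) (h : 'M[K]_(sz X, sz Z)) :
  ishom p -> row_full p -> ishom h -> (kermx p <= kermx h)%MS ->
  exists h' : 'M[K]_(sz Y, sz Z), ishom h' /\ h = p *m h'.
Proof.
move=> hp fp hh kk.
have e : h = p *m (pinvmx p *m h).
  apply/eqP; rewrite -subr_eq0 -[X in X - _]mul1mx mulmxA -mulmxBl -sub_kermx.
  apply: submx_trans kk; rewrite sub_kermx mulmxBl mul1mx -mulmxA mulVpmx //.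
  by rewrite mulmx1 subrr.
exists (pinvmx p *m h); split=> // g; apply: (row_full_inj fp).
by rewrite mulmxA -hp -mulmxA -e hh (mulmxA p (pinvmx p *m h)) -e.
Qed.

Lemma fac_inj X Y Z (i : 'M[K]_(sz Y, sz X)) (h : 'M[K]_(sz Z, sz X)) :
  ishom i -> row_free i -> ishom h -> (h <= i)%MS ->
  exists h' : 'M[K]_(sz Z, sz Y), ishom h' /\ h = h' *m i.
Proof.
move=> hi fi hh le; exists (h *m pinvmx i).
have e : h = h *m pinvmx i *m i by rewrite mulmxKpV.
split=> // g; apply: (row_free_inj fi).
by rewrite /= -mulmxA -e hh -[RHS]mulmxA hi [RHS]mulmxA -e.
Qed.

Lemma stable_img X Y (f : 'M[K]_(sz X, sz Y)) : ishom f -> stable f.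
Proof. by move=> hf g; rewrite -hf submxMl. Qed.

Lemma stable_ker X Y (f : 'M[K]_(sz X, sz Y)) : ishom f -> stable (kermx f).
Proof. by move=> hf g; rewrite sub_kermx -mulmxA hf mulmxA mulmx_ker mul0mx. Qed.

Lemma img_ex X Y (f : 'M[K]_(sz X, sz Y)) : ishom f ->
  exists I (p : 'M[K]_(sz X, sz I)) (i : 'M[K]_(sz I, sz Y)),
  [/\ ishom p, row_full p, ishom i, row_free i & f = p *m i].
Proof.
move=> hf; have [I [i [hi fi ei]]] := sub_ex (stable_img hf).
have [|p [hp e]] := fac_inj hi fi hf; first by rewrite ei.
exists I, p, i; split=> //.
rewrite /row_full; have: (i <= f)%MS by rewrite ei.
move: fi; rewrite /row_free => /eqP ri /mxrankS; rewrite ri e => le.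
rewrite eqn_leq rank_leq_col (leq_trans le) //; exact: mxrankM_maxl.
Qed.

Definition ses A X C (i : 'M[K]_(sz A, sz X)) (p : 'M[K]_(sz X, sz C)) :=
  [/\ ishom i, ishom p, row_free i, row_full p & (i :=: kermx p)%MS].

Lemma ses_mul0 A X C (i : 'M[K]_(sz A, sz X)) (p : 'M[K]_(sz X, sz C)) :
  ses i p -> i *m p = 0.
Proof. by case=> _ _ _ _ e; apply/eqP; rewrite -sub_kermx e. Qed.

Lemma ses_sz A X C (i : 'M[K]_(sz A, sz X)) (p : 'M[K]_(sz X, sz C)) :
  ses i p -> sz X = (sz A + sz C)%N.
Proof.
case=> _ _ /eqP fi /eqP fp e; have := mxrank_ker p.
by rewrite -e fi fp => ->; rewrite subnK // -fp rank_leq_row.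
Qed.

Lemma ker_ses X C (p : 'M[K]_(sz X, sz C)) : ishom p -> row_full p ->
  exists A (i : 'M[K]_(sz A, sz X)), ses i p.
Proof.
move=> hp fp; have [A [i [hi fi ei]]] := sub_ex (stable_ker hp).
by exists A, i.
Qed.

Lemma cok_ses A X (i : 'M[K]_(sz A, sz X)) : ishom i -> row_free i ->
  exists C (p : 'M[K]_(sz X, sz C)), ses i p.
Proof.
move=> hi fi; have [C [p [hp fp ep]]] := quo_ex (stable_img hi).
by exists C, p; split=> //; apply: eqmx_sym.
Qed.

Definition iso X Y := exists f : 'M[K]_(sz X, sz Y), [/\ ishom f, row_free f & row_full f].

Lemma iso_inv X Y : iso X Y -> exists (f : 'M[K]_(sz X, sz Y)) (h : 'M[K]_(sz Y, sz X)),
  [/\ ishom f, ishom h, f *m h = 1%:M & h *m f = 1%:M].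
Proof.
case=> f [hf ff uf]; have e : f *m pinvmx f = 1%:M by rewrite mulmxVp.
have e' : pinvmx f *m f = 1%:M by rewrite mulVpmx.
exists f, (pinvmx f); split=> // g.
apply: (row_full_inj uf).
by rewrite mulmxA -hf -mulmxA e mulmx1 mulmxA e mul1mx.
Qed.

Lemma iso_of_inv X Y (f : 'M[K]_(sz X, sz Y)) (h : 'M[K]_(sz Y, sz X)) :
  ishom f -> f *m h = 1%:M -> h *m f = 1%:M -> iso X Y.
Proof.
move=> hf e1 e2; exists f; split=> //; first by apply/row_freeP; exists h.
by apply/row_fullP; exists h.
Qed.

Lemma iso_sym X Y : iso X Y -> iso Y X.
Proof. by case/iso_inv=> f [h [hf hh e1 e2]]; exact: (iso_of_inv hh e2 e1). Qed.

Lemma iso_sz X Y : iso X Y -> sz X = sz Y.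
Proof. by case=> f [_ /eqP ff /eqP uf]; rewrite -uf ff. Qed.

Lemma inj_sz_iso X Y (f : 'M[K]_(sz X, sz Y)) : ishom f -> row_free f ->
  (sz Y <= sz X)%N -> iso X Y.
Proof.
move=> hf ff le; exists f; split=> //.
by rewrite /row_full eqn_leq rank_leq_col (eqP ff).
Qed.

Lemma surj_sz_iso X Y (f : 'M[K]_(sz X, sz Y)) : ishom f -> row_full f ->
  (sz X <= sz Y)%N -> iso X Y.
Proof.
move=> hf ff le; exists f; split=> //.
by rewrite /row_free eqn_leq rank_leq_row (eqP ff).
Qed.

Definition hz X Y := forall f : 'M[K]_(sz X, sz Y), ishom f -> f = 0.

Lemma nhz X Y : ~ hz X Y -> exists f : 'M[K]_(sz X, sz Y), ishom f /\ f != 0.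
Proof.
move=> h; apply: contrapT => h'; apply: h => f hf; apply/eqP/negP => /negP nf.
by apply: h'; exists f.
Qed.

Lemma mx_sz0 k m (f : 'M[K]_(k, m)) : k = 0%N -> f = 0.
Proof. by move=> e; apply/matrixP => i; have := ltn_ord i; rewrite {2}e. Qed.

Lemma mx_sz0r k m (f : 'M[K]_(k, m)) : m = 0%N -> f = 0.
Proof. by move=> e; apply/matrixP => i j; have := ltn_ord j; rewrite {2}e. Qed.

Lemma hz_id X : hz X X -> sz X = 0%N.
Proof.
move=> /(_ _ (@ishom1 X)) /eqP e; move: e.
case: (X) => -[//|s] o p /= /eqP e.
have := congr1 (fun M : 'M[K]_s.+1 => M ord0 ord0) e.
by rewrite !mxE eqxx => /eqP; rewrite oner_eq0.
Qed.

Lemma row_free_sz0 k m (f : 'M[K]_(k, m)) : row_free f -> f = 0 -> k = 0%N.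
Proof. by move=> /eqP ff f0; rewrite -ff f0 mxrank0. Qed.

Lemma row_full_sz0 k m (f : 'M[K]_(k, m)) : row_full f -> f = 0 -> m = 0%N.
Proof. by move=> /eqP ff f0; rewrite -ff f0 mxrank0. Qed.

Lemma hz_inj X Y Z (i : 'M[K]_(sz Y, sz Z)) : ishom i -> row_free i -> hz X Z -> hz X Y.
Proof.
move=> hi fi h f hf; apply: (row_free_inj fi); rewrite /= mul0mx.
by apply: h; apply: ishomM.
Qed.

Lemma hz_surj X Y Z (p : 'M[K]_(sz X, sz Y)) : ishom p -> row_full p -> hz X Z -> hz Y Z.
Proof.
move=> hp fp h f hf; apply: (row_full_inj fp); rewrite mulmx0.
by apply: h; apply: ishomM.
Qed.

Lemma hz_ext1 A X C Z (i : 'M[K]_(sz A, sz X)) (p : 'M[K]_(sz X, sz C)) : ses i p ->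
  hz A Z -> hz C Z -> hz X Z.
Proof.
case=> hi hp fi fp e hA hC f hf.
have [|h [hh ->]] := fac_surj hp fp hf; last by rewrite (hC _ hh) mulmx0.
by rewrite -e sub_kermx (hA (i *m f)) //; apply: ishomM.
Qed.

Lemma hz_ext2 A X C Z (i : 'M[K]_(sz A, sz X)) (p : 'M[K]_(sz X, sz C)) : ses i p ->
  hz Z A -> hz Z C -> hz Z X.
Proof.
case=> hi hp fi fp e hA hC f hf.
have [|h [hh ->]] := fac_inj hi fi hf; last by rewrite (hA _ hh) mul0mx.
by rewrite e sub_kermx (hC (f *m p)) //; apply: ishomM.
Qed.

End Modules.

(** * Hom spaces, direct sums and indecomposable modules *)

Section HomSpaces.
Local Open Scope ring_scope.

Lemma ex_max_nat (P : nat -> Prop) b : (exists k, P k) -> (forall k, P k -> (k <= b)%N) ->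
  exists2 k, P k & forall l, P l -> (l <= k)%N.
Proof.
move=> [k0 Pk0] bd.
have ex : exists k, `[< P k >] by exists k0; apply/asboolP.
have bd' k : `[< P k >] -> (k <= b)%N by move/asboolP; exact: bd.
case: (ex_maxnP ex bd') => k /asboolP Pk mx; exists k => // l Pl.
by apply: mx; apply/asboolP.
Qed.

Lemma ex_min_nat (P : nat -> Prop) : (exists k, P k) ->
  exists2 k, P k & forall l, P l -> (k <= l)%N.
Proof.
move=> [k0 Pk0].
have ex : exists k, `[< P k >] by exists k0; apply/asboolP.
case: (ex_minnP ex) => k /asboolP Pk mn; exists k => // l Pl.
by apply: mn; apply/asboolP.
Qed.

(** A subspace of maximal dimension among those contained in [P] is all of [P]: any further vector
    satisfying [P] could be adjoined. *)
Lemma vspace_pred (K : fieldType) (vT : vectType K) (P : vT -> Prop) : P 0 ->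
  (forall k u v, P u -> P v -> P (k *: u + v)) ->
  exists U : {vspace vT}, forall v, v \in U <-> P v.
Proof.
move=> P0 Plin.
pose R d := exists U : {vspace vT}, \dim U = d /\ forall v, v \in U -> P v.
have [||d [U [dU UP]] mx] := @ex_max_nat R (\dim {:vT}).
- exists 0%N, 0%VS; split; first by rewrite dimv0.
  by move=> v /[!memv0] /eqP ->.
- by move=> k [U [<- _]]; rewrite dimvS ?subvf.
exists U => v; split=> [/UP //|Pv]; apply: contrapT => /negP nvU.
have /mx : R (\dim (U + <[v]>)).
  exists (U + <[v]>)%VS; split=> // w /memv_addP[u uU [x /vlineP[k ->] ->]].
  by rewrite addrC; apply: Plin => //; apply: UP.
rewrite leqNgt -dU => /negP; apply.
rewrite ltn_neqAle dimvS ?addvSl // andbT.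
apply: contra nvU => /eqP e.
suff -> : U = (U + <[v]>)%VS by apply: subvP (addvSr _ _) _ (memv_line _).
by apply/eqP; rewrite -(dimv_leqif_eq (addvSl _ _)) e.
Qed.

Context {K : fieldType} {n : nat} {Q : modulated_quiver K n}.
Local Notation qmod := (@qmod K n Q).
Implicit Types X Y Z A B C : qmod.

Lemma homV_ex X Y : exists U : {vspace 'M[K]_(sz X, sz Y)}, forall f, f \in U <-> ishom f.
Proof.
apply: vspace_pred; first exact: ishom0.
by move=> k u v hu hv; apply: ishomD => //; apply: ishomZ.
Qed.

Definition homV X Y := sval (cid (homV_ex X Y)).

Lemma homVP X Y f : f \in homV X Y <-> @ishom _ _ _ X Y f.
Proof. exact: (svalP (cid (homV_ex X Y))). Qed.

Definition homd X Y := \dim (homV X Y).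

Lemma hom_hz X Y : hz X Y <-> homd X Y = 0%N.
Proof.
split=> [h|/eqP].
  apply/eqP; rewrite dimv_eq0 -subv0; apply/subvP => f /homVP /h ->.
  by rewrite memv0.
rewrite dimv_eq0 => /eqP e f /homVP; rewrite e.
by rewrite memv0 => /eqP.
Qed.

Lemma dim_limg_le (aT rT : vectType K) (f : 'Hom(aT, rT)) (U : {vspace aT}) :
  (\dim (f @: U) <= \dim U)%N.
Proof. by rewrite -(limg_ker_dim f U) leq_addl. Qed.

Lemma dim_img_ker (aT rT : vectType K) (f : 'Hom(aT, rT)) (U : {vspace aT}) (V W : {vspace _}) :
  (forall u, u \in U -> f u = 0 -> u \in V) ->
  (forall u, u \in U -> f u \in W) -> (\dim U <= \dim V + \dim W)%N.
Proof.
move=> hV hW; rewrite -(limg_ker_dim f U) leq_add //; apply: dimvS.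
  apply/subvP => u /memv_capP[uU]; rewrite memv_ker => /eqP; exact: hV.
by apply/subvP => w /memv_imgP[u uU ->]; apply: hW.
Qed.

Lemma linfun_mulmx k m p (A : 'M[K]_(k, m)) (f : 'M[K]_(m, p)) :
  linfun (mulmx A) f = A *m f.
Proof. by rewrite lfunE. Qed.

Lemma linfun_mulmxr k m p (A : 'M[K]_(m, k)) (f : 'M[K]_(p, m)) :
  linfun (mulmxr A) f = f *m A.
Proof. by rewrite lfunE. Qed.

Lemma dim_img_lt (aT rT : vectType K) (f : 'Hom(aT, rT)) (U : {vspace aT})
    (V W : {vspace _}) w :
  (forall u, u \in U -> f u = 0 -> u \in V) ->
  (forall u, u \in U -> f u \in W) -> w \in W -> (forall u, u \in U -> f u <> w) ->
  (\dim U < \dim V + \dim W)%N.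
Proof.
move=> hV hW wW nw; rewrite -(limg_ker_dim f U) -addnS leq_add //.
  apply: dimvS; apply/subvP => u /memv_capP[uU]; rewrite memv_ker => /eqP; exact: hV.
have sub : (f @: U <= W)%VS by apply/subvP => y /memv_imgP[u uU ->]; apply: hW.
rewrite ltn_neqAle dimvS // andbT; apply/negP => /eqP e.
have eW : (f @: U)%VS = W by apply/eqP; rewrite -(dimv_leqif_eq sub) e.
by move: wW; rewrite -eW => /memv_imgP[u uU wE]; apply: (nw u).
Qed.

Lemma homV_ker A X C (Y : qmod) (i : 'M[K]_(sz A, sz X)) (p : 'M[K]_(sz X, sz C)) :
  ses i p -> exists V : {vspace 'M[K]_(sz Y, sz X)},
  (\dim V <= homd Y A)%N /\ forall f, ishom f -> f *m p = 0 -> f \in V.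
Proof.
case=> hi hp fi fp e; exists (linfun (mulmxr i) @: homV Y A)%VS; split.
  exact: dim_limg_le.
move=> f hf fp0; have [|h [hh ->]] := fac_inj hi fi hf.
  by rewrite e sub_kermx fp0.
by rewrite -linfun_mulmxr memv_img //; apply/homVP.
Qed.

Lemma homV_coker A X C (Y : qmod) (i : 'M[K]_(sz A, sz X)) (p : 'M[K]_(sz X, sz C)) :
  ses i p -> exists V : {vspace 'M[K]_(sz X, sz Y)},
  (\dim V <= homd C Y)%N /\ forall f, ishom f -> i *m f = 0 -> f \in V.
Proof.
case=> hi hp fi fp e; exists (linfun (mulmx p) @: homV C Y)%VS; split.
  exact: dim_limg_le.
move=> f hf if0; have [|h [hh ->]] := fac_surj hp fp hf.
  by rewrite -e sub_kermx if0.
by rewrite -linfun_mulmx memv_img //; apply/homVP.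
Qed.

Lemma hom_sesr A X C Y (i : 'M[K]_(sz A, sz X)) (p : 'M[K]_(sz X, sz C)) : ses i p ->
  (homd Y X <= homd Y A + homd Y C)%N.
Proof.
move=> s; have [V [dV hV]] := homV_ker Y s; case: s => hi hp fi fp e.
apply: leq_trans (leq_add dV (leqnn _)); apply: (@dim_img_ker _ _ (linfun (mulmxr p))).
  by move=> f /homVP hf; rewrite linfun_mulmxr => /hV; apply.
by move=> f /homVP hf; rewrite linfun_mulmxr; apply/homVP/ishomM.
Qed.

(** The map g is missed by composition with p, so Hom(Y, X) has a proper image in Hom(Y, C). *)
Lemma hom_sesr_lt A X C Y (i : 'M[K]_(sz A, sz X)) (p : 'M[K]_(sz X, sz C))
    (g : 'M[K]_(sz Y, sz C)) : ses i p -> ishom g ->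
  (forall f : 'M[K]_(sz Y, sz X), ishom f -> f *m p <> g) ->
  (homd Y X < homd Y A + homd Y C)%N.
Proof.
move=> s hg ng; have [V [dV hV]] := homV_ker Y s; case: s => hi hp fi fp e.
apply: leq_trans (leq_add dV (leqnn _)).
apply: (@dim_img_lt _ _ (linfun (mulmxr p)) _ _ _ g).
- by move=> f /homVP hf; rewrite linfun_mulmxr => /hV; apply.
- by move=> f /homVP hf; rewrite linfun_mulmxr; apply/homVP/ishomM.
- exact/homVP.
- by move=> f /homVP hf; rewrite linfun_mulmxr; apply: ng.
Qed.

Lemma hom_sesl A X C Y (i : 'M[K]_(sz A, sz X)) (p : 'M[K]_(sz X, sz C)) : ses i p ->
  (homd X Y <= homd C Y + homd A Y)%N.
Proof.
move=> s; have [V [dV hV]] := homV_coker Y s; case: s => hi hp fi fp e.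
apply: leq_trans (leq_add dV (leqnn _)); apply: (@dim_img_ker _ _ (linfun (mulmx i))).
  by move=> f /homVP hf; rewrite linfun_mulmx => /hV; apply.
by move=> f /homVP hf; rewrite linfun_mulmx; apply/homVP/ishomM.
Qed.

Definition ds A B X := exists (iA : 'M[K]_(sz A, sz X)) (iB : 'M[K]_(sz B, sz X))
  (pA : 'M[K]_(sz X, sz A)) (pB : 'M[K]_(sz X, sz B)),
  [/\ ishom iA, ishom iB, ishom pA & ishom pB] /\
  [/\ iA *m pA = 1%:M, iB *m pB = 1%:M, iA *m pB = 0, iB *m pA = 0
    & pA *m iA + pB *m iB = 1%:M].

Lemma row_free1 k m (f : 'M[K]_(k, m)) h : f *m h = 1%:M -> row_free f.
Proof. by move=> e; apply/row_freeP; exists h. Qed.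
Lemma row_full1 k m (f : 'M[K]_(k, m)) h : f *m h = 1%:M -> row_full h.
Proof. by move=> e; apply/row_fullP; exists f. Qed.

Lemma ds_sym A B X : ds A B X -> ds B A X.
Proof.
case=> iA [iB [pA [pB [[? ? ? ?] [? ? ? ? e]]]]].
by exists iB, iA, pB, pA; do 2 split=> //; rewrite addrC.
Qed.

Lemma ds_ses A B X : ds A B X ->
  exists (i : 'M[K]_(sz A, sz X)) (p : 'M[K]_(sz X, sz B)), ses i p.
Proof.
case=> iA [iB [pA [pB [[hA hB hpA hpB] [eA eB e0 e0' e]]]]].
exists iA, pB; split=> //; [exact: row_free1 eA | exact: row_full1 eB |].
apply/eqmxP/andP; split; first by rewrite sub_kermx e0.
have -> : kermx pB = kermx pB *m pA *m iA.
  by rewrite -[LHS]mulmx1 -e mulmxDr !mulmxA mulmx_ker mul0mx addr0.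
exact: submxMl.
Qed.

Lemma ds_sz A B X : ds A B X -> sz X = (sz A + sz B)%N.
Proof. by case/ds_ses => i [p] /ses_sz. Qed.

Lemma ds_homr A B X Y : ds A B X -> homd Y X = (homd Y A + homd Y B)%N.
Proof.
move=> d; apply/eqP; rewrite eqn_leq; case: (ds_ses d) => i [p /hom_sesr ->] /=.
case: d => iA [iB [pA [pB [[hA hB hpA hpB] [eA eB e0 e0' e]]]]].
have -> : homd Y A = \dim (linfun (mulmxr iA) @: homV Y A).
  rewrite limg_dim_eq //; apply/eqP; rewrite -subv0; apply/subvP => f.
  rewrite memv_cap memv_ker linfun_mulmxr => /andP[_ /eqP fi].
  by rewrite memv0 -[f]mulmx1 -eA mulmxA fi mul0mx.
have -> : homd Y B = \dim (linfun (mulmxr iB) @: homV Y B).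
  rewrite limg_dim_eq //; apply/eqP; rewrite -subv0; apply/subvP => f.
  rewrite memv_cap memv_ker linfun_mulmxr => /andP[_ /eqP fi].
  by rewrite memv0 -[f]mulmx1 -eB mulmxA fi mul0mx.
rewrite -dimv_disjoint_sum.
  apply: dimvS; apply/subvP => f /memv_addP[x /memv_imgP[x' /homVP hx' ->]].
  rewrite linfun_mulmxr => -[y /memv_imgP[y' /homVP hy' ->]].
  by rewrite linfun_mulmxr => ->; apply/homVP/ishomD; apply: ishomM.
apply/eqP; rewrite -subv0; apply/subvP => f /memv_capP[/memv_imgP[x _ ->]].
rewrite linfun_mulmxr => /memv_imgP[y _]; rewrite linfun_mulmxr memv0 => ef.
have : x *m iA *m pA = 0 by rewrite ef -mulmxA e0' mulmx0.
by rewrite -mulmxA eA mulmx1 => ->; rewrite mul0mx.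
Qed.

Lemma ds_homl A B X Y : ds A B X -> homd X Y = (homd A Y + homd B Y)%N.
Proof.
move=> d; apply/eqP; rewrite eqn_leq; case: (ds_ses d) => i [p /hom_sesl].
rewrite addnC => -> /=.
case: d => iA [iB [pA [pB [[hA hB hpA hpB] [eA eB e0 e0' e]]]]].
have -> : homd A Y = \dim (linfun (mulmx pA) @: homV A Y).
  rewrite limg_dim_eq //; apply/eqP; rewrite -subv0; apply/subvP => f.
  rewrite memv_cap memv_ker linfun_mulmx => /andP[_ /eqP fi].
  by rewrite memv0 -[f]mul1mx -eA -mulmxA fi mulmx0.
have -> : homd B Y = \dim (linfun (mulmx pB) @: homV B Y).
  rewrite limg_dim_eq //; apply/eqP; rewrite -subv0; apply/subvP => f.
  rewrite memv_cap memv_ker linfun_mulmx => /andP[_ /eqP fi].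
  by rewrite memv0 -[f]mul1mx -eB -mulmxA fi mulmx0.
rewrite -dimv_disjoint_sum.
  apply: dimvS; apply/subvP => f /memv_addP[x /memv_imgP[x' /homVP hx' ->]].
  rewrite linfun_mulmx => -[y /memv_imgP[y' /homVP hy' ->]].
  by rewrite linfun_mulmx => ->; apply/homVP/ishomD; apply: ishomM.
apply/eqP; rewrite -subv0; apply/subvP => f /memv_capP[/memv_imgP[x _ ->]].
rewrite linfun_mulmx => /memv_imgP[y _]; rewrite linfun_mulmx memv0 => ef.
have : iB *m (pB *m x) = 0 by rewrite ef mulmxA e0' mul0mx.
by rewrite mulmxA eB mul1mx => ->; rewrite mulmx0.
Qed.

(* [f] with [f g] the off-diagonal block of an extension of A by B *)
Record is_coc A B (f : gen -> 'M[K]_(sz A, sz B)) : Prop := IsCoc {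
  coc_v : forall i (c : valg Q i), f (GV c) = 0;
  coc_lin : forall i j (a : arrow Q i j) k (x y : abim Q a),
    f (GA (k *: x + y)) = k *: f (GA x) + f (GA y);
  coc_l : forall i j (a : arrow Q i j) (c : valg Q i) (x : abim Q a),
    f (GA (lact c x)) = op A (GV c) *m f (GA x);
  coc_r : forall i j (a : arrow Q i j) (x : abim Q a) (c : valg Q j),
    f (GA (ract x c)) = f (GA x) *m op B (GV c)
}.

Lemma is_mod_ext A B (f : gen -> 'M[K]_(sz A, sz B)) : is_coc f ->
  is_mod (fun g => block_mx (op B g) 0 (f g) (op A g)).
Proof.
case: (opP A) => p1 p2 p3 p4 p5 p6 p7; case: (opP B) => q1 q2 q3 q4 q5 q6 q7 [r1 r2 r3 r4].
split=> [i k c c'|i c c'|i j c c' ij||i j a k x y|i j a c x|i j a x c].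
- by rewrite p1 q1 !r1 scale_block_mx add_block_mx !scaler0 !addr0.
- by rewrite p2 q2 !r1 mulmx_block !(mulmx0, mul0mx, addr0, add0r).
- by rewrite mulmx_block !r1 p3 // q3 // !(mulmx0, mul0mx, addr0, add0r) block_mx0.
- rewrite scalar_mx_block -p4 -q4; under eq_bigr do rewrite r1.
  elim/big_rec3: _ => [|i x y z _ ->]; first by rewrite block_mx0.
  by rewrite add_block_mx !addr0.
- by rewrite p5 q5 !r2 scale_block_mx add_block_mx !scaler0 !addr0.
- by rewrite p6 q6 !r3 r1 mulmx_block !(mulmx0, mul0mx, addr0, add0r).
- by rewrite p7 q7 !r4 r1 mulmx_block !(mulmx0, mul0mx, addr0, add0r).
Qed.

Definition extmod A B f (hf : @is_coc A B f) := QMod (is_mod_ext hf).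

Lemma ker_col_mx01 k m (i : 'M[K]_(k, k + m)) (p : 'M[K]_(k + m, m)) :
  i = row_mx 1%:M 0 -> p = col_mx 0 1%:M -> (i :=: kermx p)%MS.
Proof.
move=> -> ->; apply/eqmxP/andP; split.
  by rewrite sub_kermx mul_row_col mulmx0 mul0mx addr0.
rewrite -[kermx _]hsubmxK; set l := lsubmx _; set r := rsubmx _.
have : row_mx l r *m col_mx 0 1%:M = 0 by rewrite hsubmxK mulmx_ker.
rewrite mul_row_col mulmx0 add0r mulmx1 => ->.
have -> : row_mx l 0 = l *m row_mx 1%:M (0 : 'M[K]_(k, m)).
  by rewrite mul_mx_row mulmx1 mulmx0.
exact: submxMl.
Qed.

Lemma ext_ses A B f (hf : @is_coc A B f) :
  @ses _ _ _ B (extmod hf) A (row_mx 1%:M 0) (col_mx 0 1%:M).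
Proof.
have e1 : row_mx 1%:M (0 : 'M[K]_(sz B, sz A)) *m col_mx 1%:M 0 = 1%:M.
  by rewrite mul_row_col mulmx1 mulmx0 addr0.
have e2 : row_mx (0 : 'M[K]_(sz A, sz B)) 1%:M *m col_mx 0 1%:M = 1%:M.
  by rewrite mul_row_col mulmx1 mulmx0 add0r.
split; [| |exact: row_free1 e1|exact: row_full1 e2|exact: ker_col_mx01].
  by move=> g; rewrite mul_mx_row mul_row_block !(mulmx1, mul1mx, mulmx0, mul0mx, addr0).
move=> g; rewrite mul_block_col mul_col_mx.
by rewrite !(mulmx1, mul1mx, mulmx0, mul0mx, addr0, add0r).
Qed.

Lemma coc0 A B : is_coc (fun _ => 0 : 'M[K]_(sz A, sz B)).
Proof. by split=> *; rewrite ?scaler0 ?addr0 ?mulmx0 ?mul0mx. Qed.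

(** In [extmod] the submodule occupies the first block and is the second argument, hence the
    swap. *)
Definition dsum A B : qmod := extmod (coc0 B A).

Lemma dsumP A B : ds A B (dsum A B).
Proof.
exists (row_mx 1%:M 0), (row_mx 0 1%:M), (col_mx 1%:M 0), (col_mx 0 1%:M); split.
  split=> g; rewrite ?mul_mx_row ?mul_row_block ?mul_block_col ?mul_col_mx;
    by rewrite !(mulmx1, mul1mx, mulmx0, mul0mx, addr0, add0r).
split; rewrite ?mul_row_col ?(mulmx1, mul1mx, mulmx0, mul0mx, addr0, add0r) //.
rewrite !mul_col_row !(mulmx1, mul1mx, mulmx0, mul0mx, addr0, add0r).
by rewrite add_block_mx !addr0 !add0r -scalar_mx_block.
Qed.

Definition indec X := (0 < sz X)%N /\
  forall e : 'M[K]_(sz X), @ishom _ _ _ X X e -> e *m e = e -> e = 0 \/ e = 1%:M.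

Lemma idem_ds X (e : 'M[K]_(sz X)) : @ishom _ _ _ X X e -> e *m e = e ->
  e <> 0 -> e <> 1%:M ->
  exists A B, [/\ ds A B X, (0 < sz A)%N & (0 < sz B)%N].
Proof.
move=> he ee n0 n1.
have [A [pA [iA [hpA fpA hiA fiA eA]]]] := img_ex he.
have hf : @ishom _ _ _ X X (1%:M - e) by apply: ishomB => //; exact: ishom1.
have [B [pB [iB [hpB fpB hiB fiB eB]]]] := img_ex hf.
have c1 : iA *m pA = 1%:M.
  apply: (row_full_inj fpA); apply: (row_free_inj fiA) => /=.
  by rewrite mulmx1 mulmxA -eA -mulmxA -eA ee.
have ff : (1%:M - e) *m (1%:M - e) = 1%:M - e.
  by rewrite mulmxBl !mulmxBr !mulmx1 !mul1mx ee subrr subr0.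
have c2 : iB *m pB = 1%:M.
  apply: (row_full_inj fpB); apply: (row_free_inj fiB) => /=.
  by rewrite mulmx1 mulmxA -eB -mulmxA -eB ff.
have c3 : iA *m pB = 0.
  apply: (row_full_inj fpA); apply: (row_free_inj fiB) => /=.
  by rewrite mulmx0 mul0mx mulmxA -eA -mulmxA -eB mulmxBr mulmx1 ee subrr.
have c4 : iB *m pA = 0.
  apply: (row_full_inj fpB); apply: (row_free_inj fiA) => /=.
  by rewrite mulmx0 mul0mx mulmxA -eB -mulmxA -eA mulmxBl mul1mx ee subrr.
exists A, B; split.
- exists iA, iB, pA, pB; do 2 split=> //.
  by rewrite -eA -eB addrC subrK.
- rewrite lt0n; apply/eqP => z; apply: n0.
  by rewrite eA (mx_sz0 iA z) mulmx0.
- rewrite lt0n; apply/eqP => z; apply: n1; apply/eqP; rewrite eq_sym -subr_eq0.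
  by rewrite eB (mx_sz0 iB z) mulmx0.
Qed.

(** Induction on [sz]: a nontrivial idempotent endomorphism splits off two smaller modules. Additive
    properties are thereby reduced to indecomposables. *)
Lemma indec_ind (P : qmod -> Prop) :
  (forall X, sz X = 0%N -> P X) -> (forall X, indec X -> P X) ->
  (forall A B X, ds A B X -> (0 < sz A)%N -> (0 < sz B)%N -> P A -> P B -> P X) ->
  forall X, P X.
Proof.
move=> P0 P1 P2 X; have [N] := ubnP (sz X).
elim: N X => // N IH X lN.
have [/eqP z|z] := posnP (sz X); first exact/P0/eqP.
have [iX|niX] := pselect (indec X); first exact: P1.
have [e [he [ee [n0 n1]]]] : exists e : 'M[K]_(sz X),
    @ishom _ _ _ X X e /\ e *m e = e /\ e <> 0 /\ e <> 1%:M.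
  apply: contrapT => h; apply: niX; split=> // e he ee; apply: contrapT => h'.
  by apply: h; exists e; do 2 split=> //; split=> h''; apply: h'; [left|right].
have [A [B [d a b]]] := idem_ds he ee n0 n1.
have s := ds_sz d.
by apply: (P2 A B) => //; apply: IH; lia.
Qed.

Lemma ds_injl A B X : ds A B X -> exists i : 'M[K]_(sz A, sz X), ishom i /\ row_free i.
Proof.
case=> iA [iB [pA [pB [[hA hB hpA hpB] [eA eB e0 e0' e]]]]].
by exists iA; split=> //; exact: row_free1 eA.
Qed.

Lemma ds_surjl A B X : ds A B X -> exists p : 'M[K]_(sz X, sz A), ishom p /\ row_full p.
Proof.
case=> iA [iB [pA [pB [[hA hB hpA hpB] [eA eB e0 e0' e]]]]].
by exists pA; split=> //; exact: row_full1 eA.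
Qed.

Definition summand A X := exists B, ds A B X.

Lemma summand_refl X : summand X X.
Proof.
have p0 : is_mod (fun _ : @gen K n Q => 0 : 'M[K]_0).
  by split=> *; rewrite ?flatmx0 //; apply/matrixP=> -[].
exists (QMod p0), 1%:M, 0, 1%:M, 0; split; last first.
  by split; rewrite ?mulmx1 ?mul0mx ?mulmx0 ?addr0 //; symmetry; apply: mx_sz0.
by split=> //; try exact: ishom0; exact: ishom1.
Qed.

Lemma summandP A X : summand A X <-> exists (i : 'M[K]_(sz A, sz X)) (p : 'M[K]_(sz X, sz A)),
  [/\ ishom i, ishom p & i *m p = 1%:M].
Proof.
split=> [[B [iA [iB [pA [pB [[hA hB hpA hpB] [eA eB e0 e0' e]]]]]]]|].
  by exists iA, pA.
move=> [i [p [hi hp e]]].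
have hf : @ishom _ _ _ X X (1%:M - p *m i).
  by apply: ishomB; [exact: ishom1|exact: ishomM].
have [B [pB [iB [hpB fpB hiB fiB eB]]]] := img_ex hf.
have c3 : i *m pB = 0.
  apply: (row_free_inj fiB) => /=.
  by rewrite -mulmxA -eB mulmxBr mulmx1 mulmxA e mul1mx subrr mul0mx.
have c4 : iB *m p = 0.
  apply: (row_full_inj fpB).
  by rewrite mulmxA -eB mulmxBl mul1mx -mulmxA e mulmx1 subrr mulmx0.
have c2 : iB *m pB = 1%:M.
  apply: (row_free_inj fiB) => /=.
  by rewrite -mulmxA -eB mulmxBr mulmx1 mulmxA c4 mul0mx subr0 mul1mx.
by exists B, i, iB, p, pB; do 2 split=> //; rewrite -eB addrC subrK.
Qed.

Lemma summand_trans B A X : summand A B -> summand B X -> summand A X.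
Proof.
move=> /summandP[i [p [hi hp e]]] /summandP[i' [p' [hi' hp' e']]].
apply/summandP; exists (i *m i'), (p' *m p); split; try exact: ishomM.
by rewrite -mulmxA (mulmxA i') e' mul1mx.
Qed.

Lemma indec_summand X : (0 < sz X)%N -> exists A, indec A /\ summand A X.
Proof.
elim/indec_ind: X => [X ->//|X iX _|A B X d a b IHA _ _].
  by exists X; split=> //; exact: summand_refl.
have [C [iC sC]] := IHA a; exists C; split=> //.
by apply: summand_trans sC _; exists B.
Qed.

(** The idempotent [p *m i] of an indecomposable is 0 or 1, and 0 would make A zero. *)
Lemma summand_iso A X : indec X -> summand A X -> (0 < sz A)%N -> iso A X.
Proof.
move=> [_ iX] /summandP[i [p [hi hp e]]] sA.
have [||e0|e1] := iX (p *m i).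
- exact: ishomM.
- by rewrite -mulmxA (mulmxA i) e mul1mx.
- have i0 : i = 0.
    by rewrite -[i]mul1mx -e -mulmxA e0 mulmx0.
  by move: sA; rewrite (row_free_sz0 (row_free1 e) i0).
- exact: iso_of_inv e1.
Qed.

End HomSpaces.

(** * Bases over a division algebra *)

Section FreeBasis.
Import VectorInternalTheory.
Local Open Scope ring_scope.

Lemma linear_mx (K : fieldType) k m (f : 'rV[K]_k -> 'rV[K]_m) :
  (forall a u v, f (a *: u + v) = a *: f u + f v) ->
  exists A : 'M[K]_(k, m), forall u, u *m A = f u.
Proof.
move=> lf.
pose F := HB.pack f (@GRing.isLinear.Build _ _ _ _ f lf) : {linear 'rV[K]_k -> 'rV[K]_m}.
by exists (lin1_mx F) => u; rewrite mul_rV_lin1.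
Qed.

Context {K : fieldType} (F : falgType K).
Hypothesis divF : forall a : F, a != 0 -> a \is a GRing.unit.
Variables (N : nat) (r : F -> 'M[K]_N).
Hypothesis r_lin : forall k c c', r (k *: c + c') = k *: r c + r c'.
Hypothesis r_mul : forall c c', r (c * c') = r c *m r c'.

Let r0 : r 0 = 0.
Proof. by have := r_lin (-1) 0 0; rewrite scaler0 addr0 scaleN1r addNr. Qed.
Let rD c c' : r (c + c') = r c + r c'.
Proof. by have := r_lin 1 c c'; rewrite !scale1r. Qed.
Let rZ k c : r (k *: c) = k *: r c.
Proof. by have := r_lin k c 0; rewrite r0 !addr0. Qed.

Let rN c : r (- c) = - r c.
Proof. by rewrite -scaleN1r rZ scaleN1r. Qed.

(** A maximal family independent over F spans, F being a division algebra. The idempotent [r 1] need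
    not be the identity: when F_i acts on a whole module, its image is the space at the vertex i. *)
Lemma free_basis : exists (d : nat) (b : 'I_d -> 'rV[K]_N) (x : 'I_d -> 'rV[K]_N -> F),
  [/\ forall k, b k *m r 1 = b k,
      forall k a u v, x k (a *: u + v) = a *: x k u + x k v,
      forall u, u *m r 1 = \sum_k b k *m r (x k u),
      forall k l c, x k (b l *m r c) = if k == l then c else 0 &
      (d * \dim {: F})%N = \rank (r 1)].
Proof.
pose indep d (b : 'I_d -> 'rV[K]_N) := (forall k, b k *m r 1 = b k) /\
  forall c, \sum_k b k *m r (c k) = 0 -> forall k, c k = 0.
have [||d [b [b1 bI]] mx] := @ex_max_nat (fun d => exists b, @indep d b) N.
- by exists 0%N, (fun=> 0); split=> [k|c _ [//]]; rewrite mul0mx.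
- move=> d [b [b1 bI]].
  pose B := \matrix_k b k.
  have fB : row_free B.
    apply: inj_row_free => v vB; apply/rowP => k; rewrite mxE.
    have : (v 0 k)%:A = 0 :> F.
      apply: (bI (fun k => (v 0 k)%:A)); rewrite -[RHS]vB mulmx_sum_row.
      by apply: eq_bigr => l _; rewrite rZ -scalemxAr b1 rowK.
    by move/eqP; rewrite scaler_eq0 oner_eq0 orbF => /eqP.
  by move: fB => /eqP <-; exact: rank_leq_col.
have span u : exists c : 'I_d -> F, u *m r 1 = \sum_k b k *m r (c k).
  (* A vector outside the span, adjoined at the index [ord0], would give a larger independent
     family. *)
  apply: contrapT => nc; pose u' := u *m r 1.
  have u'1 : u' *m r 1 = u' by rewrite -mulmxA -r_mul mulr1.
  pose b' (k : 'I_d.+1) := oapp b u' (unlift ord0 k).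
  suff /mx : exists b, @indep d.+1 b by rewrite ltnn.
  exists b'; split=> [k|c].
    by rewrite /b'; case: unliftP => [j _|_] /=; rewrite ?b1.
  rewrite big_ord_recl {1}/b' unlift_none /=.
  under eq_bigr do rewrite /b' liftK /=.
  move=> e; have c0 : c ord0 = 0.
    apply: contrapT => /eqP c0; apply: nc; have cu := divF c0.
    exists (fun k => - (c (lift ord0 k) * (c ord0)^-1)).
    have -> : u *m r 1 = u' *m r (c ord0) *m r (c ord0)^-1.
      by rewrite -mulmxA -r_mul mulrV // u'1.
    move/eqP: e; rewrite addr_eq0 => /eqP ->; rewrite mulNmx mulmx_suml -sumrN.
    by apply: eq_bigr => k _; rewrite rN mulmxN r_mul mulmxA.
  move: e; rewrite c0 r0 mulmx0 add0r => /bI cI k.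
  by case: (unliftP ord0 k) => [j ->|->].
have [x xP] := choice span.
have uniq (c c' : 'I_d -> F) : \sum_k b k *m r (c k) = \sum_k b k *m r (c' k) -> c =1 c'.
  move=> /eqP; rewrite -subr_eq0 -sumrB => /eqP e k; apply/eqP; rewrite -subr_eq0.
  apply/eqP; move: k; apply: bI; rewrite -[RHS]e; apply: eq_bigr => k _.
  by rewrite rD rN mulmxBr.
exists d, b, (fun k u => x u k); split=> //.
- move=> k a u v; apply: (uniq (x (a *: u + v)) (fun k => a *: x u k + x v k)).
  rewrite -xP mulmxDl -scalemxAl !xP scaler_sumr -big_split /=.
  by apply: eq_bigr => l _; rewrite rD rZ mulmxDr scalemxAr.
- move=> k l c; apply: (uniq (x (b l *m r c)) (fun k => if k == l then c else 0)).
  rewrite -xP -mulmxA -r_mul mulr1 (bigD1 l) //= eqxx big1 ?addr0 // => j /negPf ->.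
  by rewrite r0 mulmx0.
(* Each F-coordinate is unfolded into K-coordinates, which turns the basis into a K-parametrisation
   of the image of [r 1]. *)
pose f := vector.dim F.
pose h (v : 'rV[K]_(d * f)) : 'rV[K]_N := \sum_k b k *m r (@r2v _ F (row k (vec_mx v))).
have [|B BP] := @linear_mx _ _ _ h.
  move=> a u v; rewrite /h scaler_sumr -big_split /=; apply: eq_bigr => k _.
  by rewrite !linearP r_lin mulmxDr scalemxAr.
rewrite dimvf -/f.
have fB : row_free B.
  apply: inj_row_free => v; rewrite BP => /bI e.
  rewrite -[v]vec_mxK; suff -> : vec_mx v = 0 by rewrite linear0.
  apply/row_matrixP => k; rewrite row0; apply: (can_inj (@r2vK _ F)).
  by rewrite e linear0.
rewrite -(eqP fB); apply: eqmx_rank; apply/andP; split.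
  apply/row_subP => k; rewrite rowE BP summx_sub // => l _.
  by rewrite -b1 -mulmxA -r_mul mul1r mulmx_sub // -{1}(mulr1 (@r2v _ F _)) r_mul submxMl.
apply/row_subP => k; rewrite rowE xP.
have -> : \sum_l b l *m r (x (delta_mx 0 k) l) =
   h (mxvec (\matrix_l v2r (x (delta_mx 0 k) l))).
  by rewrite /h mxvecK; apply: eq_bigr => l _; rewrite rowK v2rK.
by rewrite -BP submxMl.
Qed.

End FreeBasis.

(** * The Euler form *)

Section Euler.
Import VectorInternalTheory.
Local Open Scope ring_scope.
Context {K : fieldType} {n : nat} {Q : modulated_quiver K n}.
Local Notation qmod := (@qmod K n Q).
Implicit Types X Y Z A B C : qmod.

Definition ev X i : 'M[K]_(sz X) := op X (GV (1 : valg Q i)).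

Record vbas X i := VBas {
  vd : nat;
  vb : 'I_vd -> 'rV[K]_(sz X);
  vx : 'I_vd -> 'rV[K]_(sz X) -> valg Q i;
  vb1 : forall k, vb k *m ev X i = vb k;
  vx_lin : forall k a u v, vx k (a *: u + v) = a *: vx k u + vx k v;
  vxP : forall u, u *m ev X i = \sum_k vb k *m op X (GV (vx k u));
  vxb : forall k l c, vx k (vb l *m op X (GV c)) = if k == l then c else 0;
  vd_dim : (vd * vval Q i)%N = \rank (ev X i)
}.

Arguments vb {X i} v k : rename.
Arguments vx {X i} v k u : rename.
Arguments vb1 {X i} v k : rename.
Arguments vx_lin {X i} v k a u w : rename.
Arguments vxP {X i} v u : rename.
Arguments vxb {X i} v k l c : rename.

Lemma vbas_ex X i : inhabited (vbas X i).
Proof.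
have [d [b [x [h1 h2 h3 h4 h5]]]] := free_basis (valg_div (i := i))
  (r := fun c => op X (GV c)) (op_lin (opP X) (i := i)) (op_mul (opP X) (i := i)).
by constructor; apply: (@VBas X i d b x) => //; rewrite -h5 valg_dim.
Qed.

Definition vfree X i := inhabited_witness (vbas_ex X i).

(** A basis of M_ij as a right F_j-space; by [vval_aval] it has d_ji elements. *)
Record abas i j (a : arrow Q i j) := ABas {
  ad : nat;
  am : 'I_ad -> abim Q a;
  ax : 'I_ad -> abim Q a -> valg Q j;
  ax_lin : forall k c u v, ax k (c *: u + v) = c *: ax k u + ax k v;
  axP : forall x, x = \sum_k ract (am k) (ax k x);
  axm : forall k l c, ax k (ract (am l) c) = if k == l then c else 0;
  ad_dim : (ad * vval Q j)%N = (vval Q i * aval Q i j)%N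
}.

Arguments am {i j a} b k : rename.
Arguments ax {i j a} b k x : rename.
Arguments ax_lin {i j a} b k c u v : rename.
Arguments axP {i j a} b x : rename.
Arguments axm {i j a} b k l c : rename.

Lemma abas_ex i j (a : arrow Q i j) : inhabited (abas a).
Proof.
pose M : vectType K := abim Q a; pose N := vector.dim M.
have rlin c : linear ((@ract _ _ _ (abim Q a))^~ c) := ract_linearl c.
have [r rP] : exists r : valg Q j -> 'M[K]_N, forall c (x : M),
    v2r x *m r c = v2r (ract (x : abim Q a) c).
  have : forall c, exists A : 'M[K]_N, forall x : M, v2r x *m A = v2r (ract (x : abim Q a) c).
    move=> c; have [|A AP] := @linear_mx K N N (fun u => v2r (ract (@r2v _ M u : abim Q a) c)).
      by move=> k u v; rewrite linearP rlin linearP.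
    by exists A => x; rewrite AP v2rK.
  by move/choice => [r rP]; exists r.
have rE (A B : 'M[K]_N) : (forall x : M, v2r x *m A = v2r x *m B) -> A = B.
  by move=> h; apply/row_matrixP => k; rewrite !rowE -[delta_mx 0 k](@r2vK _ M) h.
have r_lin k c c' : r (k *: c + c') = k *: r c + r c'.
  by apply: rE => x; rewrite mulmxDr -scalemxAr !rP ract_linearr linearP.
have r_mul c c' : r (c * c') = r c *m r c'.
  by apply: rE => x; rewrite mulmxA !rP ractM.
have r1 : r 1 = 1%:M by apply: rE => x; rewrite rP ract1 mulmx1.
have [d [b [x [h1 h2 h3 h4 h5]]]] := free_basis (valg_div (i := j)) r_lin r_mul.
pose am k : abim Q a := @r2v _ M (b k).
have amP k c : @v2r _ M (ract (am k) c) = b k *m r c by rewrite -rP r2vK.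
constructor; apply: (@ABas i j a d am (fun k y => x k (@v2r _ M y))).
- by move=> k c u v; rewrite linearP /= h2.
- move=> y; apply: (can_inj (@v2rK _ M)); rewrite linear_sum /=.
  rewrite -[v2r y in LHS]mulmx1 -r1 h3; apply: eq_bigr => k _. by rewrite amP.
- by move=> k l c; rewrite amP h4.
- by move: h5; rewrite r1 mxrank1 valg_dim => ->; rewrite /N -dimvf abim_dim.
Qed.

Definition afree i j (a : arrow Q i j) := inhabited_witness (abas_ex a).

Definition arr := {p : 'I_n * 'I_n | arrow Q p.1 p.2}.

(** The dimension over F_i is the K-rank of the vertex idempotent divided by f_i. Rational entries
    make room for division in arguments about proportional vectors. *)
Definition dv X : 'rV[rat]_n := \row_i ((\rank (ev X i))%:R / (vval Q i)%:R).

(** The coefficient of an arrow is f_i d_ij = dim_K M_ij: the F_j-linear maps from the tensor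
    product of V_i and M_ij to W_j have K-dimension x_i y_j f_i d_ij. *)
Definition eul (x y : 'rV[rat]_n) : rat :=
  \sum_i (vval Q i)%:R * x 0 i * y 0 i -
  \sum_(p : arr) (vval Q (sval p).1 * aval Q (sval p).1 (sval p).2)%:R
     * x 0 (sval p).1 * y 0 (sval p).2.

(** Degree 0 of the two-term complex with kernel Hom and cokernel Ext: the maps linear over the
    vertex algebras. Degree 1 is [is_coc], the differential is [dl], and [ext0] says that it is
    onto. *)
Definition isC0 X Y (h : 'M[K]_(sz X, sz Y)) :=
  forall i (c : valg Q i), op X (GV c) *m h = h *m op Y (GV c).

Definition dl X Y (h : 'M[K]_(sz X, sz Y)) (g : gen) := op X g *m h - h *m op Y g.

Definition ext0 X Y := forall f : gen -> 'M[K]_(sz X, sz Y), is_coc f ->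
  exists2 h, isC0 h & forall g, f g = dl h g.

Lemma dl_coc X Y (h : 'M[K]_(sz X, sz Y)) : isC0 h -> is_coc (dl h).
Proof.
move=> h0; case: (opP X) => p1 p2 p3 p4 p5 p6 p7; case: (opP Y) => q1 q2 q3 q4 q5 q6 q7.
split=> [i c|i j a k x y|i j a c x|i j a x c]; rewrite /dl.
- by rewrite h0 subrr.
- rewrite p5 q5 mulmxDl mulmxDr -scalemxAl -scalemxAr scalerBr opprD !addrA.
  by congr (_ - _); rewrite -!addrA; congr (_ + _); rewrite addrC.
- by rewrite p6 q6 mulmxBr !mulmxA h0.
- by rewrite p7 q7 mulmxBl -!mulmxA h0.
Qed.

Lemma ev_sum X : \sum_i ev X i = 1%:M.
Proof. exact: op_sum (opP X). Qed.

Lemma evid X i : ev X i *m ev X i = ev X i.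
Proof. by rewrite -(op_mul (opP X)) mulr1. Qed.

Lemma ev_orth X i j : i != j -> ev X i *m ev X j = 0.
Proof. by move=> ij; rewrite /ev (op_orth (opP X)). Qed.

Lemma ev_l X i (c : valg Q i) : ev X i *m op X (GV c) = op X (GV c).
Proof. by rewrite -(op_mul (opP X)) mul1r. Qed.

Lemma ev_r X i (c : valg Q i) : op X (GV c) *m ev X i = op X (GV c).
Proof. by rewrite -(op_mul (opP X)) mulr1. Qed.

Lemma C0P X Y (h h' : 'M[K]_(sz X, sz Y)) : isC0 h -> isC0 h' ->
  (forall i k, vb (vfree X i) k *m h = vb (vfree X i) k *m h') -> h = h'.
Proof.
move=> h0 h0' e; rewrite -[h]mul1mx -[h']mul1mx -ev_sum !mulmx_suml.
apply: eq_bigr => i _; apply/row_matrixP => k; rewrite !rowE !mulmxA.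
rewrite !(vxP (vfree X i)) !mulmx_suml; apply: eq_bigr => l _.
by rewrite -!mulmxA h0 h0' !mulmxA e.
Qed.

(** The vertex spaces are free over the vertex algebras, so values on basis vectors may be
    prescribed within the right vertex space. With [C0P] this gives the dimension of degree 0. *)
Lemma C0_ex X Y (y : forall i, 'I_(vd (vfree X i)) -> 'rV[K]_(sz Y)) :
  (forall i k, y i k *m ev Y i = y i k) ->
  exists2 h : 'M[K]_(sz X, sz Y), isC0 h & forall i k, vb (vfree X i) k *m h = y i k.
Proof.
move=> ye.
pose H u := \sum_i \sum_k y i k *m op Y (GV (vx (vfree X i) k u)).
have [|h hP] := @linear_mx _ _ _ H.
  move=> a u v; rewrite /H scaler_sumr -big_split; apply: eq_bigr => i _ /=.
  rewrite scaler_sumr -big_split; apply: eq_bigr => k _ /=.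
  by rewrite vx_lin (op_lin (opP Y)) mulmxDr scalemxAr.
have vx0 i k : vx (vfree X i) k 0 = 0.
  by have := vx_lin (vfree X i) k (-1) 0 0; rewrite scaler0 addr0 scaleN1r addNr.
have vxs i k (I : finType) (F : I -> 'rV[K]_(sz X)) :
    vx (vfree X i) k (\sum_l F l) = \sum_l vx (vfree X i) k (F l).
  elim/big_rec2: _ => // l a b _ <-.
  by rewrite -[F l]scale1r vx_lin !scale1r.
have opY0 i : op Y (GV (0 : valg Q i)) = 0.
  by have := op_lin (opP Y) (i := i) (-1) 0 0; rewrite scaler0 addr0 scaleN1r addNr.
have vxj i j k u (c : valg Q j) : i != j -> vx (vfree X i) k (u *m op X (GV c)) = 0.
  move=> ij; have : u *m op X (GV c) *m ev X i = 0.
    by rewrite -mulmxA (op_orth (opP X)) ?mulmx0 // eq_sym.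
  rewrite (vxP (vfree X i)) => e.
  have := congr1 (vx (vfree X i) k) e; rewrite vxs vx0 (bigD1 k) //= vxb eqxx.
  rewrite big1 ?addr0 // => l /negPf nl.
  by rewrite vxb eq_sym nl.
have vxM i k u (c : valg Q i) : vx (vfree X i) k (u *m op X (GV c)) = vx (vfree X i) k u * c.
  rewrite -ev_l mulmxA (vxP (vfree X i)) mulmx_suml vxs (bigD1 k) //=.
  rewrite -mulmxA -(op_mul (opP X)) vxb eqxx big1 ?addr0 // => l /negPf nl.
  by rewrite -mulmxA -(op_mul (opP X)) vxb eq_sym nl.
exists h => [i c|i k].
  apply/row_matrixP => m; rewrite !rowE !mulmxA !hP /H mulmx_suml; apply: eq_bigr => j _.
  rewrite mulmx_suml; apply: eq_bigr => k _.
  have [ji|ji] := eqVneq j i; first by subst j; rewrite vxM (op_mul (opP Y)) mulmxA.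
  by rewrite vxj // opY0 mulmx0 -mulmxA (op_orth (opP Y)) // mulmx0.
rewrite hP /H (bigD1 i) //= [X in _ + X]big1 ?addr0 => [|j ji].
  rewrite (bigD1 k) //= [X in _ + X]big1 => [|l lk].
    by rewrite -(vb1 (vfree X i) k) vxb eqxx ye addr0.
  by rewrite -(vb1 (vfree X i) k) vxb (negPf lk) opY0 mulmx0.
rewrite big1 // => l _.
by rewrite -(vb1 (vfree X i) k) vxj // opY0 mulmx0.
Qed.
End Euler.

Arguments vb {K n Q X i} v k : rename.
Arguments vx {K n Q X i} v k u : rename.
Arguments vb1 {K n Q X i} v k : rename.
Arguments vx_lin {K n Q X i} v k a u w : rename.
Arguments vxP {K n Q X i} v u : rename.
Arguments vxb {K n Q X i} v k l c : rename.
Arguments am {K n Q i j a} b k : rename.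
Arguments ax {K n Q i j a} b k x : rename.
Arguments ax_lin {K n Q i j a} b k c u v : rename.
Arguments axP {K n Q i j a} b x : rename.
Arguments axm {K n Q i j a} b k l c : rename.
Arguments eul {K n} Q x y : rename.
Arguments arr {K n} Q.

Section Euler2.
Local Open Scope ring_scope.
Context {K : fieldType} {n : nat} {Q : modulated_quiver K n}.
Local Notation qmod := (@qmod K n Q).
Implicit Types X Y Z A B C : qmod.

Lemma linear_hom (aT rT : vectType K) (f : aT -> rT) :
  (forall a u v, f (a *: u + v) = a *: f u + f v) ->
  exists F : 'Hom(aT, rT), forall u, F u = f u.
Proof.
move=> lf.
pose F := HB.pack f (@GRing.isLinear.Build _ _ _ _ f lf) : {linear aT -> rT}.
by exists (linfun F) => u; rewrite lfunE.
Qed.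

Lemma coc_sum X Y f (hf : @is_coc _ _ _ X Y f) i j (a : arrow Q i j) (I : finType)
  (F : I -> abim Q a) : f (GA (\sum_l F l)) = \sum_l f (GA (F l)).
Proof.
elim/big_rec2: _ => [|l x y _ <-].
  by have := coc_lin hf (-1) (0 : abim Q a) 0; rewrite scaler0 addr0 scaleN1r addNr.
by rewrite -[F l]scale1r (coc_lin hf) !scale1r.
Qed.

Lemma coc_expand X Y f (hf : @is_coc _ _ _ X Y f) i j (a : arrow Q i j) (x : abim Q a) u :
  u *m f (GA x) = \sum_k \sum_l vb (vfree X i) k *m f (GA (am (afree a) l)) *m
     op Y (GV (ax (afree a) l (lact (vx (vfree X i) k u) x))).
Proof.
have -> : f (GA x) = ev X i *m f (GA x) by rewrite -(coc_l hf) lact1.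
rewrite mulmxA (vxP (vfree X i)) mulmx_suml; apply: eq_bigr => k _.
rewrite -mulmxA -(coc_l hf) {1}(axP (afree a) (lact _ x)) (coc_sum hf) mulmx_sumr.
by apply: eq_bigr => l _; rewrite (coc_r hf) mulmxA.
Qed.

Lemma cocP X Y f f' (hf : @is_coc _ _ _ X Y f) (hf' : is_coc f') :
  (forall (p : arr Q) k l,
    vb (vfree X (sval p).1) k *m f (GA (am (afree (proj2_sig p)) l)) =
    vb (vfree X (sval p).1) k *m f' (GA (am (afree (proj2_sig p)) l))) ->
  forall g, f g = f' g.
Proof.
move=> e [i c|i j a x]; first by rewrite !coc_v.
apply/row_matrixP => m; rewrite !rowE !coc_expand //.
apply: eq_bigr => k _; apply: eq_bigr => l _.
by have /= -> := e (exist _ (i, j) a) k l.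
Qed.

(** The tensor product of V_i and M_ij is free over F_j on products of basis elements, so a cocycle
    is given by arbitrary values there. With [cocP] this gives the dimension of degree 1. *)
Lemma coc_ex X Y (y : forall (p : arr Q),
    'I_(vd (vfree X (sval p).1)) -> 'I_(ad (afree (proj2_sig p))) -> 'rV[K]_(sz Y)) :
  (forall p k l, y p k l *m ev Y (sval p).2 = y p k l) ->
  exists2 f : gen -> 'M[K]_(sz X, sz Y), is_coc f & forall p k l,
    vb (vfree X (sval p).1) k *m f (GA (am (afree (proj2_sig p)) l)) = y p k l.
Proof.
move=> ye.
have opY0 i : op Y (GV (0 : valg Q i)) = 0.
  by have := op_lin (opP Y) (i := i) (-1) 0 0; rewrite scaler0 addr0 scaleN1r addNr.
have opYs i (I : finType) (F : I -> valg Q i) :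
    op Y (GV (\sum_l F l)) = \sum_l op Y (GV (F l)).
  elim/big_rec2: _ => // l x z _ <-.
  by rewrite -[F l]scale1r (op_lin (opP Y)) !scale1r.
have vx0 i k : vx (vfree X i) k 0 = 0.
  by have := vx_lin (vfree X i) k (-1) 0 0; rewrite scaler0 addr0 scaleN1r addNr.
have vxs i k (I : finType) (F : I -> 'rV[K]_(sz X)) :
    vx (vfree X i) k (\sum_l F l) = \sum_l vx (vfree X i) k (F l).
  elim/big_rec2: _ => // l a b _ <-.
  by rewrite -[F l]scale1r vx_lin !scale1r.
have vxM i k u (c : valg Q i) : vx (vfree X i) k (u *m op X (GV c)) = vx (vfree X i) k u * c.
  rewrite -ev_l mulmxA (vxP (vfree X i)) mulmx_suml vxs (bigD1 k) //=.
  rewrite -mulmxA -(op_mul (opP X)) vxb eqxx big1 ?addr0 // => l /negPf nl.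
  by rewrite -mulmxA -(op_mul (opP X)) vxb eq_sym nl.
have ax0 i j (a : arrow Q i j) k : ax (afree a) k 0 = 0.
  by have := ax_lin (afree a) k (-1) 0 0; rewrite scaler0 addr0 scaleN1r addNr.
have axs i j (a : arrow Q i j) k (I : finType) (F : I -> abim Q a) :
    ax (afree a) k (\sum_l F l) = \sum_l ax (afree a) k (F l).
  elim/big_rec2: _ => // l x z _ <-.
  by rewrite -[F l]scale1r ax_lin !scale1r.
have axM i j (a : arrow Q i j) k x (c : valg Q j) :
    ax (afree a) k (ract x c) = ax (afree a) k x * c.
  have ractS I (F : I -> abim Q a) (s : seq I) d :
      ract (\sum_(l <- s) F l) d = \sum_(l <- s) ract (F l) d.
    elim/big_rec2: _ => [|l u v _ <-].
      by have := @ract_linearl _ _ _ (abim Q a) d (-1) 0 0; rewrite scaler0 addr0 scaleN1r addNr.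
    by have := @ract_linearl _ _ _ (abim Q a) d 1 (F l) v; rewrite !scale1r.
  rewrite {1}(axP (afree a) x) ractS axs (bigD1 k) //= -ractM axm eqxx.
  by rewrite big1 ?addr0 // => l /negPf nl; rewrite -ractM axm eq_sym nl.
pose F i j (a : arrow Q i j) (x : abim Q a) u : 'rV[K]_(sz Y) := \sum_k \sum_l
  y (exist _ (i, j) a) k l *m op Y (GV (ax (afree a) l (lact (vx (vfree X i) k u) x))).
have Fl i j (a : arrow Q i j) (x : abim Q a) c u v :
    F i j a x (c *: u + v) = c *: F i j a x u + F i j a x v.
  rewrite /F scaler_sumr -big_split; apply: eq_bigr => k _ /=.
  rewrite scaler_sumr -big_split; apply: eq_bigr => l _ /=.
  by rewrite vx_lin lact_linearl ax_lin (op_lin (opP Y)) mulmxDr scalemxAr.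
have [f fP] : exists f : gen -> 'M[K]_(sz X, sz Y), forall g, match g with
    GV _ _ => f g = 0 | GA i j a x => forall u, u *m f g = F i j a x u end.
  have : forall g : gen, exists M : 'M[K]_(sz X, sz Y), match g with
    GV _ _ => M = 0 | GA i j a x => forall u, u *m M = F i j a x u end.
    by case=> [i c|i j a x]; [exists 0|exact: linear_mx (Fl i j a x)].
  move/choice => [f fP]; exists f; exact: fP.
have fA i j (a : arrow Q i j) (x : abim Q a) u : u *m f (GA x) = F i j a x u.
  by have /= := fP (GA x); apply.
exists f; first split.
- by move=> i c; have /= := fP (GV c).
- move=> i j a c x z; apply/row_matrixP => m; rewrite !rowE mulmxDr -scalemxAr !fA.
  rewrite /F scaler_sumr -big_split; apply: eq_bigr => k _ /=.
  rewrite scaler_sumr -big_split; apply: eq_bigr => l _ /=.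
  by rewrite lact_linearr ax_lin (op_lin (opP Y)) mulmxDr scalemxAr.
- move=> i j a c x; apply/row_matrixP => m; rewrite !rowE mulmxA !fA.
  by apply: eq_bigr => k _; apply: eq_bigr => l _; rewrite vxM lactM.
- move=> i j a x c; apply/row_matrixP => m; rewrite !rowE mulmxA !fA /F mulmx_suml.
  apply: eq_bigr => k _; rewrite mulmx_suml; apply: eq_bigr => l _.
  by rewrite -lact_ract axM (op_mul (opP Y)) mulmxA.
move=> [[i j] a] /= k l; rewrite fA /F (bigD1 k) //= [X in _ + X]big1 ?addr0.
  rewrite -(vb1 (vfree X i) k) vxb eqxx lact1 (bigD1 l) //= [X in _ + X]big1 ?addr0.
    by rewrite -(ract1 (am _ l)) axm eqxx (ye (exist _ (i, j) a)).
  by move=> l' /negPf nl; rewrite -(ract1 (am _ l)) axm nl opY0 mulmx0.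
move=> k' /negPf nk; rewrite big1 // => l' _.
rewrite -(vb1 (vfree X i) k) vxb nk.
have -> : lact (0 : valg Q i) (am (afree a) l) = 0.
  by have := @lact_linearl _ _ _ (abim Q a) (am (afree a) l) (-1) 0 0;
    rewrite scaler0 addr0 scaleN1r addNr.
by rewrite ax0 opY0 mulmx0.
Qed.

Lemma C0V_ex X Y : exists U : {vspace 'M[K]_(sz X, sz Y)}, forall f, f \in U <-> isC0 f.
Proof.
apply: vspace_pred; first by move=> i c; rewrite mulmx0 mul0mx.
move=> k u v hu hv i c.
by rewrite mulmxDr mulmxDl -scalemxAr -scalemxAl hu hv.
Qed.

Lemma isC0_hom X Y f : @ishom _ _ _ X Y f <-> isC0 f /\ forall g, dl f g = 0.
Proof.
split=> [h|[_ h] g]; first by split=> [i c|g]; rewrite /dl h ?subrr.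
by apply/eqP; rewrite -subr_eq0; apply/eqP/h.
Qed.

Lemma dl_lin X Y a (u v : 'M[K]_(sz X, sz Y)) g :
  dl (a *: u + v) g = a *: dl u g + dl v g.
Proof.
by rewrite /dl mulmxDr mulmxDl -scalemxAr -scalemxAl opprD addrACA -scalerBr.
Qed.

Section Coord.
Variables (Y : qmod) (j : 'I_n).
Definition crd (w : 'rV[K]_(sz Y)) : 'rV_(\rank (ev Y j)) := w *m pinvmx (row_base (ev Y j)).
Definition uncrd (v : 'rV[K]_(\rank (ev Y j))) : 'rV[K]_(sz Y) := v *m row_base (ev Y j).

Lemma uncrd_ev v : uncrd v *m ev Y j = uncrd v.
Proof.
have : (uncrd v <= ev Y j)%MS by rewrite (submx_trans (submxMl _ _)) // eq_row_base.
by case/submxP => z ->; rewrite -mulmxA evid.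
Qed.
Lemma crdK w : w *m ev Y j = w -> uncrd (crd w) = w.
Proof. by move=> e; rewrite /uncrd /crd mulmxKpV // eq_row_base -e submxMl. Qed.
Lemma uncrdK v : crd (uncrd v) = v.
Proof. by rewrite /uncrd /crd -mulmxA mulmxVp ?row_base_free // mulmx1. Qed.
End Coord.

Definition I0t X Y i : finType := ('I_(vd (vfree X i)) * 'I_(\rank (ev Y i)))%type.
Definition I0 X Y : finType := {i : 'I_n & I0t X Y i}.
Definition I1t X Y (p : arr Q) : finType := ('I_(vd (vfree X (sval p).1)) *
   'I_(ad (afree (proj2_sig p))) * 'I_(\rank (ev Y (sval p).2)))%type.
Definition I1 X Y : finType := {p : arr Q & I1t X Y p}.

Lemma vval_neq0 i : (vval Q i)%:R != 0 :> rat.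
Proof. by rewrite pnatr_eq0 -lt0n vval_gt0. Qed.

Lemma card_eul X Y : (#|I0 X Y|%:R : rat) - (#|I1 X Y|)%:R = eul Q (dv X) (dv Y).
Proof.
have dX i : dv X 0 i = (vd (vfree X i))%:R.
  by rewrite mxE -(vd_dim (vfree X i)) natrM mulfK ?vval_neq0.
rewrite !card_tagged !sumnE !big_map.
rewrite -!enumT !big_enum !natr_sum /eul; congr (_ - _).
  apply: eq_bigr => i _; rewrite card_prod !card_ord natrM dX !mxE.
  by have f0 := vval_neq0 i; field.
apply: eq_bigr => -[[i j] a] _ /=.
have aE : (ad (afree a) * vval Q j)%N = (vval Q i * aval Q i j)%N := ad_dim (afree a).
rewrite !card_prod !card_ord -aE !natrM dX [dv Y 0 j]mxE /=.
have := vval_neq0 j; move: (vval Q j)%:R => f f0.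
by field.
Qed.

(** Dimension count in the complex: [I0] and [I1] index K-bases of its two terms and the kernel of
    the differential is Hom. The difference of the two sides is the codimension of the image, which
    vanishes exactly when [ext0] holds. *)
Lemma euler X Y : eul Q (dv X) (dv Y) <= (homd X Y)%:R /\
  (ext0 X Y <-> eul Q (dv X) (dv Y) = (homd X Y)%:R).
Proof.
pose V0 := {ffun I0 X Y -> K^o}; pose V1 := {ffun I1 X Y -> K^o}.
have [C CP] := C0V_ex X Y.
pose t0 (h : 'M[K]_(sz X, sz Y)) : V0 :=
  [ffun t => crd (tag t) (vb (vfree X (tag t)) (tagged t).1 *m h) 0 (tagged t).2].
have [|T0 T0E] := @linear_hom _ _ t0.
  move=> a u v; apply/ffunP => t; rewrite !ffunE /crd mulmxDr mulmxDl.
  by rewrite -!scalemxAr -!scalemxAl !mxE.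
pose t1 (h : 'M[K]_(sz X, sz Y)) : V1 :=
  [ffun t => crd (sval (tag t)).2 (vb (vfree X (sval (tag t)).1) (tagged t).1.1 *m
      dl h (GA (am (afree (proj2_sig (tag t))) (tagged t).1.2))) 0 (tagged t).2].
have [|T1 T1E] := @linear_hom _ _ t1.
  move=> a u v; apply/ffunP => t; rewrite !ffunE /crd dl_lin.
  by rewrite mulmxDr mulmxDl -!scalemxAr -!scalemxAl !mxE.
have C0ev h i k : isC0 h -> vb (vfree X i) k *m h *m ev Y i = vb (vfree X i) k *m h.
  by move=> h0; rewrite -mulmxA -h0 mulmxA (vb1 (vfree X i)).
have C1ev f (p : arr Q) k l : @is_coc _ _ _ X Y f ->
    vb (vfree X (sval p).1) k *m f (GA (am (afree (proj2_sig p)) l)) *m ev Y (sval p).2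
    = vb (vfree X (sval p).1) k *m f (GA (am (afree (proj2_sig p)) l)).
  by move=> hf; rewrite -mulmxA -(coc_r hf) ract1.
have dimC : \dim C = #|I0 X Y|.
  have <- : \dim {: V0} = #|I0 X Y| by rewrite dimvf /vector.dim /= muln1.
  have <- : (T0 @: C)%VS = fullv.
    apply/eqP; rewrite eqEsubv subvf; apply/subvP => y _.
    have [|h h0 hE] := @C0_ex _ _ _ X Y (fun i k => uncrd (\row_l y (Tagged (I0t X Y) (k, l)))).
      by move=> i k; rewrite uncrd_ev.
    suff -> : y = T0 h by rewrite memv_img //; apply/CP.
    apply/ffunP => -[i [k l]]; rewrite T0E ffunE /= hE uncrdK mxE //.
  rewrite limg_dim_eq //; apply/eqP; rewrite -subv0; apply/subvP => h.
  rewrite memv_cap memv_ker memv0 T0E => /andP[/CP h0 /eqP e].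
  apply/eqP; apply: C0P => // [i c|i k]; first by rewrite mulmx0 mul0mx.
  rewrite mulmx0 -[LHS](crdK (C0ev _ _ _ h0)).
  suff -> : crd i (vb (vfree X i) k *m h) = 0 by rewrite /uncrd mul0mx.
  apply/rowP => l; have := congr1 (fun f : V0 => f (Tagged (I0t X Y) (k, l))) e.
  by rewrite ffunE /= ffunE => ->; rewrite mxE.
have kerE : (C :&: lker T1)%VS = homV X Y.
  apply/eqP; rewrite eqEsubv; apply/andP; split; apply/subvP => h.
    rewrite memv_cap memv_ker T1E => /andP[/CP h0 /eqP e]; apply/homVP/isC0_hom.
    split=> //; apply: cocP; [exact: dl_coc|exact: coc0|] => p k l.
    rewrite mulmx0 -[LHS](crdK (C1ev _ _ _ _ (dl_coc h0))).
    suff -> : crd (sval p).2 (vb (vfree X (sval p).1) k *m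
      dl h (GA (am (afree (proj2_sig p)) l))) = 0 by rewrite /uncrd mul0mx.
    apply/rowP => r; have := congr1 (fun f : V1 => f (Tagged (I1t X Y) (k, l, r))) e.
    by rewrite ffunE /= ffunE => ->; rewrite mxE.
  move/homVP/isC0_hom => [h0 e]; rewrite memv_cap memv_ker T1E; apply/andP.
  split; first exact/CP.
  by apply/eqP/ffunP => t; rewrite !ffunE e mulmx0 /crd mul0mx mxE.
have dimV1 : \dim {: V1} = #|I1 X Y| by rewrite dimvf /vector.dim /= muln1.
have := limg_ker_dim T1 C; rewrite kerE dimC -/(homd X Y) => dE.
have extP : ext0 X Y <-> (T1 @: C)%VS = fullv.
  split=> [x0|e f hf].
    apply/eqP; rewrite eqEsubv subvf; apply/subvP => y _.
    have [|f hf fE] := @coc_ex X Y (fun p k l => uncrd (\row_r y (Tagged (I1t X Y) (k, l, r)))).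
      by move=> p k l; rewrite uncrd_ev.
    have [h h0 hE] := x0 _ hf.
    suff -> : y = T1 h by rewrite memv_img //; apply/CP.
    by apply/ffunP => -[p [[k l] r]]; rewrite T1E ffunE /= -hE fE uncrdK mxE.
  pose y : V1 := [ffun t => crd (sval (tag t)).2 (vb (vfree X (sval (tag t)).1) (tagged t).1.1 *m
      f (GA (am (afree (proj2_sig (tag t))) (tagged t).1.2))) 0 (tagged t).2].
  have : y \in (T1 @: C)%VS by rewrite e memvf.
  case/memv_imgP => h /CP h0; rewrite T1E => yE; exists h => //.
  apply: cocP => //; first exact: dl_coc.
  move=> p k l; rewrite -[LHS](crdK (C1ev _ _ _ _ hf)) -[RHS](crdK (C1ev _ _ _ _ (dl_coc h0))).
  congr uncrd; apply/rowP => r.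
  by have := congr1 (fun f : V1 => f (Tagged (I1t X Y) (k, l, r))) yE; rewrite !ffunE.
have le1 : (\dim (T1 @: C) <= #|I1 X Y|)%N by rewrite -dimV1 dimvS ?subvf.
have eE : (homd X Y)%:R - eul Q (dv X) (dv Y) = (#|I1 X Y|)%:R - (\dim (T1 @: C))%:R.
  by rewrite -card_eul -dE natrD; ring.
split; first by rewrite -subr_ge0 eE subr_ge0 ler_nat.
apply: (iff_trans extP); split=> [e|/eqP].
  by apply/esym/eqP; rewrite -subr_eq0 eE e dimV1 subrr.
rewrite eq_sym -subr_eq0 eE subr_eq0 eqr_nat => /eqP e.
by apply/eqP; rewrite -(dimv_leqif_eq (subvf _)) -e dimV1.
Qed.

End Euler2.

(** * Vanishing of Ext and additivity of dimension vectors *)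

Section Ext.
Local Open Scope ring_scope.
Context {K : fieldType} {n : nat} {Q : modulated_quiver K n}.
Local Notation qmod := (@qmod K n Q).
Implicit Types X Y Z A B C : qmod.

Lemma ishom_C0 X Y f : @ishom _ _ _ X Y f -> isC0 f.
Proof. by move=> h i c. Qed.

(** The vertex algebras are semisimple: lift the basis vectors of Y by [pinvmx p] and project to the
    vertex space. *)
Lemma C0_section X Y (p : 'M[K]_(sz X, sz Y)) : isC0 p -> row_full p ->
  exists2 s : 'M[K]_(sz Y, sz X), isC0 s & s *m p = 1%:M.
Proof.
move=> hp fp.
have [|s s0 sE] := @C0_ex _ _ _ Y X (fun i k => vb (vfree Y i) k *m pinvmx p *m ev X i).
  by move=> i k; rewrite -[LHS]mulmxA evid.
exists s => //; apply: C0P => [i c|i c|i k]; last 2 first.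
- by rewrite mulmx1 mul1mx.
- by rewrite mulmxA sE -(mulmxA _ (ev X i)) [ev X i *m p]hp mulmxA -(mulmxA _ _ p)
    mulVpmx // mulmx1 vb1.
- by rewrite mulmxA s0 -!mulmxA hp.
Qed.

(** Hereditariness: a retraction r of degree 0 extends a cocycle from A to X, and a map bounding it
    on X restricts to A. *)
Lemma ext0_sub A X Z (i : 'M[K]_(sz A, sz X)) : ishom i -> row_free i ->
  ext0 X Z -> ext0 A Z.
Proof.
move=> hi fi xZ f hf.
have [C [p [_ hp _ fp ie]]] := cok_ses hi fi.
have [s s0 sp] := C0_section (ishom_C0 hp) fp.
have [r rE] : exists r, 1%:M - p *m s = r *m i.
  apply/submxP; rewrite ie sub_kermx mulmxBl mul1mx -mulmxA sp mulmx1.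
  by rewrite subrr.
have ir : i *m r = 1%:M.
  apply: (row_free_inj fi); rewrite /= -mulmxA -rE mulmxBr mulmx1 mulmxA.
  suff -> : i *m p = 0 by rewrite mul0mx subr0 mul1mx.
  by apply/eqP; rewrite -sub_kermx ie.
have r0 : isC0 r.
  move=> j c; apply: (row_free_inj fi) => /=.
  by rewrite -mulmxA -rE -mulmxA hi mulmxA -rE mulmxBr mulmxBl mulmx1 mul1mx
    -mulmxA -s0 !mulmxA hp.
have hf' : is_coc (fun g => r *m f g).
  split=> [j c|j l a k x y|j l a c x|j l a x c].
  - by rewrite (coc_v hf) mulmx0.
  - by rewrite (coc_lin hf) mulmxDr scalemxAr.
  - by rewrite (coc_l hf) !mulmxA r0.
  - by rewrite (coc_r hf) mulmxA.
have [h h0 hE] := xZ _ hf'; exists (i *m h) => [j c|g].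
  by rewrite mulmxA hi -!mulmxA h0.
by rewrite -[f g]mul1mx -ir -mulmxA hE /dl mulmxBr !mulmxA hi.
Qed.

(** Dual to [ext0_sub]: a section of degree 0 lifts a cocycle with values in Y to one with values in
    Z. *)
Lemma ext0_quo X Z Y (p : 'M[K]_(sz Z, sz Y)) : ishom p -> row_full p ->
  ext0 X Z -> ext0 X Y.
Proof.
move=> hp fp xZ f hf.
have [s s0 sp] := C0_section (ishom_C0 hp) fp.
have hf' : is_coc (fun g => f g *m s).
  split=> [j c|j l a k x y|j l a c x|j l a x c].
  - by rewrite (coc_v hf) mul0mx.
  - by rewrite (coc_lin hf) mulmxDl scalemxAl.
  - by rewrite (coc_l hf) mulmxA.
  - by rewrite (coc_r hf) -!mulmxA s0.
have [h h0 hE] := xZ _ hf'; exists (h *m p) => [j c|g].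
  by rewrite mulmxA h0 -!mulmxA hp.
by rewrite -[f g]mulmx1 -sp mulmxA hE /dl mulmxBl -!mulmxA hp.
Qed.

(** A section s of degree 0 fails to be a homomorphism by [dl s], which factors through i as a
    cocycle f. If h bounds f, then [s - h *m i] is a homomorphism. *)
Lemma ext_split A X C (i : 'M[K]_(sz A, sz X)) (p : 'M[K]_(sz X, sz C)) : ses i p ->
  ext0 C A -> exists2 s : 'M[K]_(sz C, sz X), ishom s & s *m p = 1%:M.
Proof.
case=> hi hp fi fp ie x0.
have [s s0 sp] := C0_section (ishom_C0 hp) fp.
have ip : i *m p = 0 by apply/eqP; rewrite -sub_kermx ie.
have [f fE] : exists f, forall g, dl s g = f g *m i.
  suff /choice : forall g, exists m, dl s g = m *m i.
    by case=> f fE; exists f.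
  move=> g; apply/submxP; rewrite ie sub_kermx /dl mulmxBl -mulmxA sp mulmx1.
  by rewrite -mulmxA hp mulmxA sp mul1mx subrr.
have cs := dl_coc s0.
have hf : is_coc f.
  split=> [j c|j l a k x y|j l a c x|j l a x c]; apply: (row_free_inj fi) => /=.
  - by rewrite -fE (coc_v cs) mul0mx.
  - by rewrite -fE (coc_lin cs) !fE mulmxDl scalemxAl.
  - by rewrite -fE (coc_l cs) fE mulmxA.
  - by rewrite -fE (coc_r cs) fE -!mulmxA hi.
have [h h0 hE] := x0 _ hf; exists (s - h *m i); last first.
  by rewrite mulmxBl sp -mulmxA ip mulmx0 subr0.
move=> g; apply/eqP; rewrite -subr_eq0; apply/eqP.
transitivity (dl s g - dl h g *m i); last by rewrite fE hE subrr.
have zz (a b c d : 'M[K]_(sz C, sz X)) : a - b - (c - d) = a - c - (b - d).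
  by rewrite !opprD !opprK addrACA.
by rewrite /dl mulmxBr !mulmxBl !mulmxA -!(mulmxA h) hi zz.
Qed.

(** A homomorphic section of the block extension has the form (l, 1), and l exhibits f as a
    coboundary. *)
Lemma ext_nonsplit C A : ~ ext0 C A -> exists X (i : 'M[K]_(sz A, sz X)) (p : 'M[K]_(sz X, sz C)),
  ses i p /\ forall s : 'M[K]_(sz C, sz X), ishom s -> s *m p <> 1%:M.
Proof.
move=> nx; apply: contrapT => h; apply: nx => f hf.
have ss := ext_ses hf.
have [s [hs sp]] : exists s : 'M[K]_(sz C, sz (extmod hf)), ishom s /\ s *m col_mx 0 1%:M = 1%:M.
  apply: contrapT => h'; apply: h.
  exists (extmod hf), (row_mx 1%:M 0), (col_mx 0 1%:M); split=> // s hs sp.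
  by apply: h'; exists s.
pose l : 'M[K]_(sz C, sz A) := lsubmx (s : 'M[K]_(sz C, sz A + sz C)).
have sE : s = row_mx l 1%:M.
  rewrite -[LHS](@hsubmxK _ _ (sz A) (sz C)); congr row_mx.
  by rewrite -sp -[s in RHS](@hsubmxK _ _ (sz A) (sz C)) mul_row_col mulmx0 add0r mulmx1.
have e g : op C g *m l = l *m op A g + f g.
  by have := hs g; rewrite sE /= mul_mx_row mul_row_block !mul1mx => /eq_row_mx[-> _].
exists l => [i c|g]; first by rewrite e (coc_v hf) addr0.
by rewrite /dl e addrAC subrr add0r.
Qed.

Lemma ses_rank A X C (i : 'M[K]_(sz A, sz X)) (p : 'M[K]_(sz X, sz C)) j : ses i p ->
  \rank (ev X j) = (\rank (ev A j) + \rank (ev C j))%N.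
Proof.
case=> hi hp fi fp ie.
have -> : \rank (ev A j) = \rank (i *m ev X j).
  by rewrite -hi mxrankMfree.
have -> : \rank (ev C j) = \rank (ev X j *m p).
  rewrite hp -[in LHS](mxrankMfree (ev C j) (B := 1%:M)); last by rewrite row_free_unit unitmx1.
  rewrite mulmx1 -(mxrank_tr (p *m _)) trmx_mul mxrankMfree ?mxrank_tr //.
  by rewrite /row_free mxrank_tr.
rewrite -(mxrank_mul_ker (ev X j) p) addnC; congr (_ + _)%N.
apply: eqmx_rank; apply/andP; split.
  apply/rV_subP => u; rewrite sub_capmx => /andP[uj]; rewrite -ie => /submxP[w wE].
  have -> : u = w *m (i *m ev X j).
    rewrite mulmxA -wE; case/submxP: uj => z ->; by rewrite -mulmxA evid.
  exact: submxMl.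
rewrite sub_capmx submxMl /= -ie; exact: (stable_img hi).
Qed.

Lemma dv_ses A X C (i : 'M[K]_(sz A, sz X)) (p : 'M[K]_(sz X, sz C)) : ses i p ->
  dv X = dv A + dv C.
Proof.
by move=> s; apply/rowP => j; rewrite !mxE (ses_rank j s) natrD mulrDl.
Qed.

Lemma dv_ds A B X : ds A B X -> dv X = dv A + dv B.
Proof. by case/ds_ses => i [p /dv_ses]. Qed.

Lemma dv_iso X Y : iso X Y -> dv X = dv Y.
Proof.
case/iso_inv => f [h [hf hh e1 e2]]; apply/rowP => j; rewrite !mxE; congr (_%:R / _).
apply/eqP; rewrite eqn_leq; apply/andP; split.
  have -> : ev X j = f *m ev Y j *m h by rewrite -hf -mulmxA e1 mulmx1.
  by rewrite (leq_trans (mxrankM_maxl _ _)) // mxrankM_maxr.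
have -> : ev Y j = h *m ev X j *m f by rewrite -hh -mulmxA e2 mulmx1.
by rewrite (leq_trans (mxrankM_maxl _ _)) // mxrankM_maxr.
Qed.

Lemma dv_ge0 X j : 0 <= dv X 0 j.
Proof. by rewrite mxE divr_ge0. Qed.

Lemma sz_rank X : sz X = (\sum_j \rank (ev X j))%N.
Proof.
have h (P : pred 'I_n) : \rank (\sum_(j | P j) ev X j)%R = (\sum_(j | P j) \rank (ev X j))%N.
  have [s] := ubnP #|P|; elim: s P => // s IH P lP.
  have [i Pi|P0] := pickP P; last first.
    by rewrite !big_pred0 ?mxrank0.
  rewrite (bigD1 i) //= [RHS](bigD1 i) //=.
  rewrite -IH; last first.
    move: lP; rewrite (cardD1 i) unfold_in Pi add1n ltnS => lP; apply: leq_trans lP.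
    by rewrite ltnS; apply/eq_leq/eq_card => j; rewrite !inE andbC.
  set S := \sum_(j | P j && (j != i)) ev X j.
  have o1 : ev X i *m S = 0.
    by rewrite mulmx_sumr big1 // => j /andP[_ ji]; rewrite ev_orth // eq_sym.
  have o2 : S *m ev X i = 0.
    by rewrite mulmx_suml big1 // => j /andP[_ ji]; rewrite ev_orth.
  have SS : S *m S = S.
    rewrite {1}/S mulmx_suml; apply: eq_bigr => j jP.
    rewrite mulmx_sumr (bigD1 j) //= evid big1 ?addr0 // => l /andP[_ lj].
    by rewrite ev_orth // eq_sym.
  rewrite -mxrank_disjoint_sum; last first.
    apply/eqP; rewrite -submx0; apply/rV_subP => u; rewrite sub_capmx => /andP[/submxP[w1 e1] /submxP[w2 e2]].
    have ue : u *m ev X i = u by rewrite {1}e1 -mulmxA evid -e1.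
    have : u *m ev X i = 0 by rewrite e2 -mulmxA o2 mulmx0.
    by rewrite ue => ->; rewrite sub0mx.
  apply: eqmx_rank; apply/andP; split; first exact: addmx_sub_adds.
  rewrite addsmx_sub; apply/andP; split.
    have eE : ev X i = ev X i *m (ev X i + S) by rewrite mulmxDr evid o1 addr0.
    by rewrite {1}eE submxMl.
  have eE : S = S *m (ev X i + S) by rewrite mulmxDr SS o2 add0r.
  by rewrite {1}eE submxMl.
by rewrite -h ev_sum mxrank1.
Qed.

Lemma dv0_sz X : dv X = 0 -> sz X = 0%N.
Proof.
move=> e; rewrite sz_rank big1 // => j _.
have := congr1 (fun v : 'rV[rat]_n => v 0 j) e; rewrite !mxE => /eqP.
by rewrite mulf_eq0 invr_eq0 (negPf (vval_neq0 j)) orbF pnatr_eq0 => /eqP.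
Qed.

Lemma sz0_dv X : sz X = 0%N -> dv X = 0.
Proof.
move=> e; apply/rowP => j; rewrite !mxE (_ : \rank _ = 0%N) ?mul0r //.
by apply/eqP; rewrite -leqn0 (leq_trans (rank_leq_row _)) // e.
Qed.

Lemma dv_sz_eq X Y : dv X = dv Y -> sz X = sz Y.
Proof.
move=> e; apply: (etrans (sz_rank X)); apply: (etrans _ (esym (sz_rank Y))).
apply: eq_bigr => j _.
have := congr1 (fun v : 'rV[rat]_n => v 0 j) e; rewrite !mxE.
by move=> /(divIf (vval_neq0 j)) /eqP; rewrite eqr_nat => /eqP.
Qed.

Lemma eul_linl a (x y z : 'rV[rat]_n) : eul Q (a *: x + y) z = a * eul Q x z + eul Q y z.
Proof.
rewrite /eul mulrBr !mulr_sumr addrACA -opprD -!big_split /=; congr (_ - _).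
  by apply: eq_bigr => i _; rewrite !mxE; ring.
by apply: eq_bigr => i _; rewrite !mxE; ring.
Qed.

Lemma eul_linr a (x y z : 'rV[rat]_n) : eul Q z (a *: x + y) = a * eul Q z x + eul Q z y.
Proof.
rewrite /eul mulrBr !mulr_sumr addrACA -opprD -!big_split /=; congr (_ - _).
  by apply: eq_bigr => i _; rewrite !mxE; ring.
by apply: eq_bigr => i _; rewrite !mxE; ring.
Qed.

Lemma eulDl x y z : eul Q (x + y) z = eul Q x z + eul Q y z.
Proof. by have := eul_linl 1 x y z; rewrite scale1r mul1r. Qed.
Lemma eulDr x y z : eul Q z (x + y) = eul Q z x + eul Q z y.
Proof. by have := eul_linr 1 x y z; rewrite scale1r mul1r. Qed.
Lemma eul0l z : eul Q 0 z = 0.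
Proof. by have := eulDl 0 0 z; rewrite addr0; lra. Qed.
Lemma eul0r z : eul Q z 0 = 0.
Proof. by have := eulDr 0 0 z; rewrite addr0; lra. Qed.
Lemma eulZl a x z : eul Q (a *: x) z = a * eul Q x z.
Proof. by have := eul_linl a x 0 z; rewrite addr0 eul0l addr0. Qed.
Lemma eulZr a x z : eul Q z (a *: x) = a * eul Q z x.
Proof. by have := eul_linr a x 0 z; rewrite addr0 eul0r addr0. Qed.
Lemma eulBr x y z : eul Q z (x - y) = eul Q z x - eul Q z y.
Proof. by rewrite eulDr -scaleN1r eulZr mulN1r. Qed.

Definition E X Y := eul Q (dv X) (dv Y).

Lemma E_le_hom X Y : E X Y <= (homd X Y)%:R.
Proof. by case: (euler X Y). Qed.

Lemma E_ext0 X Y : ext0 X Y <-> E X Y = (homd X Y)%:R.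
Proof. by case: (euler X Y). Qed.

Lemma E_hz X Y : hz X Y -> E X Y <= 0.
Proof. by move/hom_hz => h; have := E_le_hom X Y; rewrite h. Qed.

Lemma E_hz_ext0 X Y : hz X Y -> ext0 X Y -> E X Y = 0.
Proof. by move/hom_hz => h /E_ext0 ->; rewrite h. Qed.

Lemma E_nhz_ext0 X Y : ~ hz X Y -> ext0 X Y -> 0 < E X Y.
Proof.
move=> h /E_ext0 ->; rewrite ltr0n lt0n; apply/eqP => e; apply: h.
exact/hom_hz.
Qed.

Lemma ext0_ge0 X Y : ext0 X Y -> 0 <= E X Y.
Proof. by move/E_ext0 => ->. Qed.

Lemma hz_E_ext0 X Y : hz X Y -> E X Y = 0 -> ext0 X Y.
Proof. by move/hom_hz => h e; apply/E_ext0; rewrite e h. Qed.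

End Ext.

(** * Rigid bricks and positivity of the Euler form *)

Section Exceptional.
Local Open Scope ring_scope.
Context {K : fieldType} {n : nat} {Q : modulated_quiver K n}.
Local Notation qmod := (@qmod K n Q).
Implicit Types X Y Z A B C I N W : qmod.

Definition brick X := (0 < sz X)%N /\
  forall f : 'M[K]_(sz X), @ishom _ _ _ X X f -> f = 0 \/ row_free f.

Lemma row_freeM k m l (f : 'M[K]_(k, m)) (g : 'M[K]_(m, l)) :
  row_free f -> row_free g -> row_free (f *m g).
Proof. by move=> ff fg; rewrite /row_free mxrankMfree. Qed.

Lemma sq_free_inv X (f : 'M[K]_(sz X)) : @ishom _ _ _ X X f -> row_free f ->
  exists h : 'M[K]_(sz X), [/\ @ishom _ _ _ X X h, f *m h = 1%:M & h *m f = 1%:M].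
Proof.
move=> hf ff; have ifx : iso X X by exists f; split=> //; rewrite row_full_unit -row_free_unit.
have fu : f \in unitmx by rewrite -row_free_unit.
exists (invmx f); split; [|exact: mulmxV|exact: mulVmx].
move=> g; apply: (row_free_inj ff) => /=.
by rewrite -mulmxA mulVmx // mulmx1 -mulmxA hf mulmxA mulVmx // mul1mx.
Qed.

Lemma split_retract A X C (i : 'M[K]_(sz A, sz X)) (p : 'M[K]_(sz X, sz C)) s : ses i p ->
  ishom s -> s *m p = 1%:M -> exists2 r : 'M[K]_(sz X, sz A), ishom r & i *m r = 1%:M.
Proof.
move=> ss hs sp; have ip := ses_mul0 ss; case: ss => hi hp fi fp ie.
have hh : @ishom _ _ _ X X (1%:M - p *m s).
  by apply: ishomB; [exact: ishom1|exact: ishomM].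
have [|r [hr rE]] := fac_inj hi fi hh.
  by rewrite ie sub_kermx mulmxBl mul1mx -mulmxA sp mulmx1 subrr.
exists r => //; apply: (row_free_inj fi); rewrite /= -mulmxA -rE mulmxBr mulmx1.
by rewrite mulmxA ip mul0mx subr0 mul1mx.
Qed.

(** Following endomorphisms by a nonzero g embeds End B into Hom(B, Y), because nonzero
    endomorphisms of B are invertible. *)
Lemma brick_hom_le B Y : brick B -> ~ hz B Y -> (homd B B <= homd B Y)%N.
Proof.
move=> [_ bB] /nhz[g [hg ng]].
suff : (homd B B <= \dim (0 : {vspace 'M[K]_(sz B, sz B)})%VS + homd B Y)%N.
  by rewrite dimv0.
apply: (@dim_img_ker _ _ _ (linfun (mulmxr g))).
  move=> d /homVP hd; rewrite linfun_mulmxr memv0 => dg.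
  have [->//|fd] := bB d hd; case/eqP: ng.
  have [h [_ _ e]] := sq_free_inv hd fd.
  by rewrite -[g]mul1mx -e -mulmxA dg mulmx0.
by move=> d /homVP hd; rewrite linfun_mulmxr; apply/homVP/ishomM.
Qed.

Lemma homd_gt0 X : (0 < sz X)%N -> (0 < homd X X)%N.
Proof.
move=> s; rewrite lt0n; apply/eqP => /hom_hz /hz_id e.
by rewrite e in s.
Qed.

(** Iterate nonsplit extensions of B by the module already built. Since B is a brick, nonsplitness
    makes every map from B to the new module land in the old one, which keeps [homd B X] bounded;
    the surjection onto B keeps Ext(B, X) nonzero. *)
Lemma brick_chain B : brick B -> ~ ext0 B B -> forall k, exists X,
  [/\ sz X = (k.+1 * sz B)%N, (homd B X <= homd B B)%N,
      exists p : 'M[K]_(sz X, sz B), ishom p /\ row_full p &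
      forall Y, hz B Y -> hz X Y].
Proof.
move=> bB nx; elim=> [|k [X [sX hX [p [hp fp]] fX]]].
  exists B; split=> //; first by rewrite mul1n.
  by exists 1%:M; split; [exact: ishom1|rewrite row_full_unit unitmx1].
have nX : ~ ext0 B X by move=> /(ext0_quo hp fp).
have [X' [i [q [s ns]]]] := ext_nonsplit nX.
have sX' := ses_sz s.
exists X'; split=> //; first by rewrite sX' sX; lia.
- have [V [dV hV]] := homV_ker B s; apply: leq_trans (leq_trans dV hX).
  apply: dimvS; apply/subvP => f /homVP hf; apply: hV => //.
  have hq : ishom q by case: s.
  have [//|ff] := bB.2 _ (ishomM hf hq).
  have [h [hh _ e]] := sq_free_inv (ishomM hf hq) ff.
  by case: (ns (h *m f)); [exact: ishomM|rewrite -mulmxA].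
- by exists q; case: s.
- by move=> Y hY; apply: (hz_ext1 s) => //; exact: fX.
Qed.

(** In a decomposition of the module from [brick_chain] both parts would receive nonzero maps from
    B, so [homd B X] would be at least twice [homd B B]. *)
Lemma brick_unbounded B : brick B -> ~ ext0 B B ->
  forall k, exists2 X : qmod, indec X & (k < sz X)%N.
Proof.
move=> bB nx k; have [X [sX hX _ fX]] := brick_chain bB nx k.
have sB := bB.1.
exists X; last by rewrite sX; nia.
split; first by rewrite sX; nia.
move=> e he ee; apply: contrapT => ne.
have [||A [C [d sA sC]]] := idem_ds he ee.
- by move=> e0; apply: ne; left.
- by move=> e0; apply: ne; right.
have hA : ~ hz B A.
  move=> /fX h; have [p [hp fp]] := ds_surjl d.
  by have e0 := row_full_sz0 fp (h _ hp); rewrite e0 in sA.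
have hC : ~ hz B C.
  move=> /fX h; have [p [hp fp]] := ds_surjl (ds_sym d).
  by have e0 := row_full_sz0 fp (h _ hp); rewrite e0 in sC.
have := ds_homr B d; have := brick_hom_le bB hA; have := brick_hom_le bB hC.
have := homd_gt0 sB; lia.
Qed.

Lemma nonzero_component I N (g : 'M[K]_(sz I, sz N)) : ishom g -> g != 0 ->
  exists N1 (j : 'M[K]_(sz N1, sz N)) (q : 'M[K]_(sz N, sz N1)),
  [/\ indec N1, ishom j, ishom q, j *m q = 1%:M & g *m q != 0].
Proof.
elim/(@indec_ind K n Q): N g => [N s g _|N iN g hg ng|A B N d sA sB IA IB g hg ng].
- by rewrite (mx_sz0r g s) eqxx.
- by exists N, 1%:M, 1%:M; split; rewrite ?mulmx1 //; exact: ishom1.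
case: d => iA [iB [pA [pB [[hA hB hpA hpB] [eA eB e0 e0' e]]]]].
have [gA|gA] := eqVneq (g *m pA) 0; last first.
  have [N1 [j [q [iN hj hq jq gq]]]] := IA _ (ishomM hg hpA) gA.
  exists N1, (j *m iA), (pA *m q); split; rewrite ?mulmxA //; try exact: ishomM.
  by rewrite -(mulmxA j) eA mulmx1.
have gB : g *m pB != 0.
  apply: contra ng => /eqP gB.
  by rewrite -[g]mulmx1 -e mulmxDr !mulmxA gA gB !mul0mx addr0.
have [N1 [j [q [iN hj hq jq gq]]]] := IB _ (ishomM hg hpB) gB.
exists N1, (j *m iB), (pB *m q); split; rewrite ?mulmxA //; try exact: ishomM.
by rewrite -(mulmxA j) eB mulmx1.
Qed.

(** Take a nonzero endomorphism of least rank, with image I and kernel N. If its square were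
    nonzero, it would be invertible on I and I would split off; so I lies in N. Least rank makes I
    inject into an indecomposable summand N1 of N. If N1 had no self-extension, Ext(I, N1) would
    vanish by [ext0_sub], the pushout of X along N -> N1 would split, and the smaller N1 would be a
    summand of X. *)
Lemma nonbrick_selfext X : indec X -> ~ brick X ->
  exists N, [/\ indec N, (sz N < sz X)%N & ~ ext0 N N].
Proof.
move=> iX nb.
have sX := iX.1.
have [f0 [hf0 [nz0 nf0]]] : exists f : 'M[K]_(sz X), @ishom _ _ _ X X f /\ f <> 0 /\ ~ row_free f.
  apply: contrapT => h; apply: nb; split=> // f hf; apply: contrapT => h'.
  by apply: h; exists f; split=> //; split=> h''; apply: h'; [left|right].
pose R k := exists f : 'M[K]_(sz X), [/\ @ishom _ _ _ X X f, f != 0 & \rank f = k].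
have [|k [f [hf nf rf]] mn] := @ex_min_nat R; first by exists (\rank f0), f0; split=> //; exact/eqP.
have kX : (k < sz X)%N.
  rewrite ltn_neqAle -rf rank_leq_row andbT rf; apply/eqP => e.
  have [] : R (\rank f0) by exists f0; split=> //; exact/eqP.
  move=> _ _; have : (k <= \rank f0)%N by apply: mn; exists f0; split=> //; exact/eqP.
  rewrite e => le; apply: nf0; rewrite /row_free eqn_leq rank_leq_row //.
have [I [p [i [hp fp hi fi fE]]]] := img_ex hf.
have sI : sz I = k.
  by rewrite -rf fE mxrankMfree // (eqP fp).
have sI0 : (0 < sz I)%N.
  by rewrite sI -rf lt0n mxrank_eq0.
have hip : @ishom _ _ _ I I (i *m p) by exact: ishomM.
have ip0 : i *m p = 0.
  have [//|nip] := eqVneq (i *m p) 0.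
  have ff0 : f *m f != 0.
    apply: contra nip => /eqP; rewrite {1}fE -mulmxA {1}fE (mulmxA i) => e.
    apply/eqP; apply: (row_full_inj fp); apply: (row_free_inj fi) => /=.
    by rewrite mulmx0 mul0mx -mulmxA.
  have fip : row_free (i *m p).
    have le : (k <= \rank (f *m f))%N by apply: mn; exists (f *m f); split=> //; exact: ishomM.
    move: le; rewrite -sI /row_free eqn_leq rank_leq_row => le; apply: leq_trans le _.
    rewrite {1}fE -mulmxA {1}fE (mulmxA i) mulmxA.
    by apply: leq_trans (mxrankM_maxl _ _) _; exact: mxrankM_maxr.
  have [h [hh e1 e2]] := sq_free_inv hip fip.
  have [||e0|e0] := iX.2 (p *m h *m i).
  - by apply: ishomM => //; exact: ishomM.
  - by rewrite !mulmxA -(mulmxA _ i p) -(mulmxA p) e2 mulmx1.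
  - have : p *m h = 0 by apply: (row_free_inj fi); rewrite /= e0 mul0mx.
    move=> ph; have : p *m (h *m (i *m p)) = 0 by rewrite mulmxA ph mul0mx.
    rewrite e2 mulmx1 => /(row_full_sz0 fp) z.
    by exfalso; rewrite z in sI0.
  - have : row_full i by apply/row_fullP; exists (p *m h).
    move=> /eqP ri; move: kX; rewrite -sI -[X in (_ < X)%N]ri.
    by rewrite ltnNge rank_leq_row.
have [N [io s]] := ker_ses hp fp.
case: (s) => hio _ fio _ ioe.
have [|i' [hi' i'E]] := fac_inj hio fio hi; first by rewrite ioe sub_kermx ip0.
have ni' : i' != 0.
  by apply: contraTneq sI0 => z; rewrite (row_free_sz0 fi) // i'E z mul0mx.
have [N1 [j [q [iN1 hj hq jq nq]]]] := nonzero_component hi' ni'.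
have fj := row_free1 jq; have fq := row_full1 jq.
have fiq : row_free (i' *m q).
  have le : (k <= \rank (p *m (i' *m q) *m (j *m io)))%N.
    apply: mn; exists (p *m (i' *m q) *m (j *m io)); split=> //.
      by apply: ishomM; apply: ishomM => //; apply: ishomM.
    apply: contra nq => /eqP e; apply/eqP; apply: (row_full_inj fp).
    by apply: (row_free_inj (row_freeM fj fio)); rewrite /= e mulmx0 mul0mx.
  move: le; rewrite -sI /row_free eqn_leq rank_leq_row => le; apply: leq_trans le _.
  by apply: leq_trans (mxrankM_maxl _ _) _; exact: mxrankM_maxr.
have sN := ses_sz s.
have [N2 [ka sq]] := ker_ses hq fq; have sN' := ses_sz sq.
exists N1; split=> //; first by (clear - sN sN' sI0; lia).
move=> /(ext0_sub (ishomM hi' hq) fiq) x0.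
case: (sq) => hka _ fka _ kae.
(* W is X modulo the kernel of q, that is, the pushout of X along the projection of N onto N1. *)
have [W [pi sW]] := cok_ses (ishomM hka hio) (row_freeM fka fio).
have sW' := ses_sz sW; case: (sW) => _ hpi _ fpi pie.
have [|p' [hp' p'E]] := fac_surj hpi fpi hp.
  by rewrite -pie sub_kermx -mulmxA (ses_mul0 s) mulmx0.
pose u := j *m io *m pi.
have hu : @ishom _ _ _ N1 W u by apply: ishomM => //; apply: ishomM.
have fu : row_free u.
  apply: inj_row_free => v; rewrite /u !mulmxA => e.
  have : (v *m j *m io <= ka *m io)%MS by rewrite pie; apply/sub_kermxP.
  case/submxP => w; rewrite mulmxA => /(row_free_inj fio) vj.
  have : v *m j *m q = 0 by rewrite vj -mulmxA (ses_mul0 sq) mulmx0.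
  by rewrite -mulmxA jq mulmx1.
have up : u *m p' = 0.
  by rewrite /u -mulmxA -p'E -mulmxA (ses_mul0 s) mulmx0.
have fp' : row_full p'.
  rewrite /row_full eqn_leq rank_leq_col -[X in (X <= _)%N](eqP fp) p'E.
  exact: mxrankM_maxr.
have su : @ses _ _ _ N1 W I u p'.
  have le : (u <= kermx p')%MS by apply/sub_kermxP.
  split=> //; apply/eqmxP; have [_ <-] := mxrank_leqif_eq le.
  by rewrite mxrank_ker (eqP fu) (eqP fp'); apply/eqP; clear - sW' sN sN'; lia.
have [t ht tp] := ext_split su x0.
have [r hr ur] := split_retract su ht tp.
have sm : summand N1 X.
  apply/summandP; exists (j *m io), (pi *m r); split; try exact: ishomM.
  by rewrite mulmxA.
have := iso_sz (summand_iso iX sm iN1.1); clear - sN sN' sI0; lia.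
Qed.

Definition bounded := exists b, forall X : qmod, indec X -> (sz X <= b)%N.

Hypothesis bd : bounded.

(** Induction on size: a non-brick contains a smaller indecomposable with a self-extension, and a
    brick with a self-extension yields arbitrarily large indecomposables. *)
Lemma indec_exc X : indec X -> brick X /\ ext0 X X.
Proof.
have [N] := ubnP (sz X); elim: N X => // N IH X lN iX.
have bX : brick X.
  apply: contrapT => /(nonbrick_selfext iX)[N1 [iN lt]]; apply.
  by apply: (IH N1 _ iN).2; lia.
split=> //; apply: contrapT => nx; case: bd => b hb.
have [Y iY] := brick_unbounded bX nx b; have := hb _ iY; lia.
Qed.

Lemma sz0_ext0l X Y : sz X = 0%N -> ext0 X Y.
Proof.
move=> s; apply/E_ext0; rewrite /E (sz0_dv s) eul0l.
by rewrite (_ : homd X Y = 0%N) //; apply/hom_hz => f _; exact: mx_sz0.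
Qed.

Lemma ds_ext0l A B X Y : ds A B X -> ext0 A Y -> ext0 B Y -> ext0 X Y.
Proof.
move=> d /E_ext0 a /E_ext0 b; apply/E_ext0.
by rewrite /E (dv_ds d) eulDl (ds_homl Y d) natrD; congr (_ + _).
Qed.

Lemma ds_ext0r A B X Y : ds A B X -> ext0 Y A -> ext0 Y B -> ext0 Y X.
Proof.
move=> d /E_ext0 a /E_ext0 b; apply/E_ext0.
by rewrite /E (dv_ds d) eulDr (ds_homr Y d) natrD; congr (_ + _).
Qed.

(** Subadditivity of Hom in both arguments, strict at Hom(A, -) because the identity of A does not
    lift. *)
Lemma homd_ext_lt A B X E' (i : 'M[K]_(sz B, sz E')) (p : 'M[K]_(sz E', sz A)) : ds A B X ->
  ses i p -> (forall s : 'M[K]_(sz A, sz E'), ishom s -> s *m p <> 1%:M) ->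
  (homd E' E' < homd X X)%N.
Proof.
move=> d s ns.
have h1 := hom_sesl E' s; have h2 := hom_sesr B s.
have h3 := hom_sesr_lt s (@ishom1 _ _ _ A) ns.
by rewrite (ds_homl X d) !(ds_homr _ d); lia.
Qed.

(** Choose a member with least endomorphism dimension. A nonsplit extension between complementary
    summands would lower it, so Ext between them vanishes; indecomposable summands are rigid by
    [indec_exc]. *)
Lemma rigid_ex (W : qmod -> Prop) X :
  (forall A Y C (i : 'M[K]_(sz A, sz Y)) (p : 'M[K]_(sz Y, sz C)), ses i p -> W A -> W C -> W Y) ->
  (forall A Y, summand A Y -> W Y -> W A) -> W X ->
  exists Y, [/\ W Y, dv Y = dv X & ext0 Y Y].
Proof.
move=> We Ws WX.
have [|h [Y [WY dY hY]] mn] := @ex_min_nat (fun h => exists Y, [/\ W Y, dv Y = dv X & homd Y Y = h]).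
  by exists (homd X X), X.
exists Y; split=> //.
have x0 A B : ds A B Y -> ext0 A B.
  move=> d; apply: contrapT => nx; have [E' [i [p [s ns]]]] := ext_nonsplit nx.
  have lt := homd_ext_lt d s ns.
  have /mn : exists Z, [/\ W Z, dv Z = dv X & homd Z Z = homd E' E'].
    exists E'; split=> //; last by rewrite (dv_ses s) addrC -(dv_ds d).
    by apply: We s _ _; apply: Ws WY; [exists A; apply: ds_sym|exists B].
  lia.
suff : forall A, summand A Y -> ext0 A Y by apply; exact: summand_refl.
elim/(@indec_ind K n Q) => [A s _|A iA [B d]|A B A' d _ _ IA IB sA'].
- exact: sz0_ext0l.
- apply: (ds_ext0r d); first exact: (indec_exc iA).2.
  exact: x0.
- apply: (ds_ext0l d); [apply: IA|apply: IB]; apply: summand_trans sA'; first by exists B.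
  by exists A; apply: ds_sym.
Qed.

(** The form sees only the dimension vector, which is shared by a rigid Y, and there it is dim End
    Y. *)
Lemma E_pos X : (0 < sz X)%N -> 0 < E X X.
Proof.
move=> s; have [||//|Y [_ dY /E_ext0 x0]] := @rigid_ex (fun _ => True) X.
- by [].
- by [].
have : E X X = E Y Y by rewrite /E dY.
move=> ->; rewrite x0 ltr0n homd_gt0 //.
by rewrite (dv_sz_eq dY).
Qed.

End Exceptional.

(** * Torsion classes *)

Section Torsion.
Local Open Scope ring_scope.
Context {K : fieldType} {n : nat} {Q : modulated_quiver K n}.
Local Notation qmod := (@qmod K n Q).
Implicit Types X Y Z A B C I N W : qmod.
Implicit Types T P : qmod -> Prop.

Definition perp T Z := forall N, T N -> hz N Z.
Definition lperp P X := forall Z, P Z -> hz X Z.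
(** A torsion class as its own double perpendicular; closure under quotients and extensions is then
    formal. *)
Definition tors T := forall X, (forall Z, perp T Z -> hz X Z) -> T X.

Lemma tors_lperp P : tors (lperp P).
Proof. by move=> X h Z PZ; apply: h => N; apply. Qed.

Lemma hz_iso_r X Y Z : iso Y Z -> hz X Y -> hz X Z.
Proof.
case/iso_inv => f [h [hf hh e1 e2]] hXY g hg.
by rewrite -[g]mulmx1 -e2 mulmxA (hXY (g *m h)) ?mul0mx //; apply: ishomM.
Qed.

Lemma hz_iso_l X Y Z : iso X Y -> hz X Z -> hz Y Z.
Proof.
case/iso_inv => f [h [hf hh e1 e2]] hXZ g hg.
by rewrite -[g]mul1mx -e2 -mulmxA (hXZ (f *m g)) ?mulmx0 //; apply: ishomM.
Qed.

Lemma hz_sz0_l X Y : sz X = 0%N -> hz X Y.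
Proof. by move=> e f _; exact: mx_sz0. Qed.
Lemma hz_sz0_r X Y : sz Y = 0%N -> hz X Y.
Proof. by move=> e f _; exact: mx_sz0r. Qed.

Lemma tors_quo T X Y (p : 'M[K]_(sz X, sz Y)) : tors T -> ishom p -> row_full p -> T X -> T Y.
Proof. by move=> tT hp fp TX; apply: tT => Z /(_ _ TX); exact: hz_surj. Qed.

Lemma tors_iso T X Y : tors T -> iso X Y -> T X -> T Y.
Proof. by move=> tT [p [hp _ fp]]; exact: tors_quo tT hp fp. Qed.

Lemma tors_ext T A X C (i : 'M[K]_(sz A, sz X)) (p : 'M[K]_(sz X, sz C)) : tors T -> ses i p ->
  T A -> T C -> T X.
Proof. by move=> tT s TA TC; apply: tT => Z pZ; apply: (hz_ext1 s); apply: pZ. Qed.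

Lemma tors_sz0 T X : tors T -> sz X = 0%N -> T X.
Proof. by move=> tT s; apply: tT => Z _; exact: hz_sz0_l. Qed.

Lemma perp_sub T X Y (i : 'M[K]_(sz X, sz Y)) : ishom i -> row_free i -> perp T Y -> perp T X.
Proof. by move=> hi fi pY N TN; apply: hz_inj hi fi _; exact: pY. Qed.

Lemma perp_iso T X Y : iso X Y -> perp T X -> perp T Y.
Proof. by move=> i pX N TN; apply: hz_iso_r i _; exact: pX. Qed.

Lemma perp_ext T A X C (i : 'M[K]_(sz A, sz X)) (p : 'M[K]_(sz X, sz C)) : ses i p ->
  perp T A -> perp T C -> perp T X.
Proof. by move=> s pA pC N TN; apply: (hz_ext2 s); [apply: pA|apply: pC]. Qed.

Lemma perp_sz0 T X : sz X = 0%N -> perp T X.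
Proof. by move=> s N _; exact: hz_sz0_r. Qed.

Lemma tors_perp0 T X : T X -> perp T X -> sz X = 0%N.
Proof. by move=> TX /(_ _ TX) /hz_id. Qed.

Lemma summand_surj A X : summand A X -> exists p : 'M[K]_(sz X, sz A), ishom p /\ row_full p.
Proof. by case=> B; exact: ds_surjl. Qed.
Lemma summand_inj A X : summand A X -> exists i : 'M[K]_(sz A, sz X), ishom i /\ row_free i.
Proof. by case=> B; exact: ds_injl. Qed.

Lemma tors_summand T A X : tors T -> summand A X -> T X -> T A.
Proof. by move=> tT /summand_surj[p [hp fp]]; exact: tors_quo. Qed.
Lemma perp_summand T A X : summand A X -> perp T X -> perp T A.
Proof. by move=> /summand_inj[p [hp fp]]; exact: perp_sub. Qed.

Lemma tors_ds T A B X : tors T -> ds A B X -> T A -> T B -> T X.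
Proof. by move=> tT /ds_ses[i [p s]]; exact: tors_ext tT s. Qed.
Lemma perp_ds T A B X : ds A B X -> perp T A -> perp T B -> perp T X.
Proof. by move=> /ds_ses[i [p s]]; exact: perp_ext s. Qed.

(** X is the preimage in Y of the submodule B of C, constructed as the kernel of [q *m r]. *)
Lemma ses_pull A Y C B D (i : 'M[K]_(sz A, sz Y)) (q : 'M[K]_(sz Y, sz C))
    (j : 'M[K]_(sz B, sz C)) (r : 'M[K]_(sz C, sz D)) : ses i q -> ses j r ->
  exists X (i' : 'M[K]_(sz A, sz X)) (t' : 'M[K]_(sz X, sz B)) (t : 'M[K]_(sz X, sz Y)),
    [/\ ses i' t', ses t (q *m r), i = i' *m t & t *m q = t' *m j].
Proof.
move=> s sj; have sE := ses_sz s; have sjE := ses_sz sj.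
case: (s) => hi hq fi fq ie; case: (sj) => hj hr fj fr je.
have fqr : row_full (q *m r).
  by rewrite /row_full -mxrank_tr trmx_mul mxrankMfree ?mxrank_tr // /row_free mxrank_tr.
have [X [t st]] := ker_ses (ishomM hq hr) fqr; have stE := ses_sz st.
case: (st) => ht _ ft _ te.
have [|t' [ht' t'E]] := fac_inj hj fj (ishomM ht hq).
  by rewrite je; apply/sub_kermxP; rewrite -mulmxA (ses_mul0 st).
have [|i' [hi' i'E]] := fac_inj ht ft hi.
  by rewrite te; apply/sub_kermxP; rewrite mulmxA (ses_mul0 s) mul0mx.
have fi' : row_free i'.
  by apply: inj_row_free => v vi; apply: (row_free_inj fi); rewrite /= mul0mx i'E mulmxA vi mul0mx.
have i't' : i' *m t' = 0.
  by apply: (row_free_inj fj); rewrite /= mul0mx -mulmxA -t'E mulmxA -i'E (ses_mul0 s).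
have ft' : row_full t'.
  apply/negPn/negP => nf.
  have lt : (\rank t' < sz B)%N by rewrite ltn_neqAle nf rank_leq_col.
  have h1 : (\rank (t *m q) <= \rank t')%N by rewrite t'E mxrankM_maxl.
  have h2 : (sz X <= \rank (t *m q) + sz A)%N.
    rewrite -[X in (X <= _)%N](eqP ft) -(mxrank_mul_ker t q) leq_add2l.
    apply: leq_trans (mxrankS (capmxSr _ _)) _.
    by rewrite -ie rank_leq_row.
  clear - sE stE sjE h1 h2 lt; lia.
exists X, i', t', t; split=> //; split=> //.
have le : (i' <= kermx t')%MS by apply/sub_kermxP.
apply/eqmxP; have [_ <-] := mxrank_leqif_eq le.
by rewrite mxrank_ker (eqP fi') (eqP ft'); apply/eqP; clear - sE stE sjE; lia.
Qed.

(** N is a submodule in T of largest size. If a module of T maps to X / N with image I, the preimage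
    of I is in T by extension, so I is zero. *)
Lemma tors_dec T X : tors T -> exists N Z (i : 'M[K]_(sz N, sz X)) (p : 'M[K]_(sz X, sz Z)),
  [/\ ses i p, T N & perp T Z].
Proof.
move=> tT.
pose R k := exists N (i : 'M[K]_(sz N, sz X)), [/\ ishom i, row_free i, T N & sz N = k].
have [||k [N [i [hi fi TN sN]]] mx] := @ex_max_nat R (sz X).
- have st0 : stable (X := X) (0 : 'M[K]_(0, sz X)) by move=> g; rewrite mul0mx sub0mx.
  have [N [i [hi fi ie]]] := sub_ex st0.
  have sN : sz N = 0%N by rewrite -(eqP fi) ie mxrank0.
  by exists (sz N), N, i; split=> //; exact: tors_sz0.
- by move=> k [N [i [_ /eqP fi _ <-]]]; rewrite -fi rank_leq_col.
have [Z [p s]] := cok_ses hi fi.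
exists N, Z, i, p; split=> //; move=> M TM f hf.
have [I [q [j [hq fq hj fj fE]]]] := img_ex hf.
have TI := tors_quo tT hq fq TM.
have [C [r sj]] := cok_ses hj fj.
have [Y [i' [t' [t [s' st _ _]]]]] := ses_pull s sj.
have sE := ses_sz s'.
have : (sz Y <= k)%N.
  by apply: mx; exists Y, t; case: st => ? _ ? _ _; split=> //; exact: tors_ext tT s' TN TI.
move=> le; have zI : sz I = 0%N by clear - le sE sN; lia.
by rewrite fE (mx_sz0 j zI) mulmx0.
Qed.

Hypothesis bd : @bounded K n Q.

Lemma indec_rigid X : indec X -> ext0 X X.
Proof. by move=> iX; case: (indec_exc bd iX). Qed.

(** The image I is a quotient of Z, hence receives a nonzero map from X. Followed by the inclusion
    of I this is a nonzero endomorphism of a brick, hence invertible. *)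
Lemma surj_in_gen X Z (g : 'M[K]_(sz Z, sz X)) : brick X ->
  lperp (fun W => hz X W) Z -> ishom g -> g != 0 -> row_full g.
Proof.
move=> [sX bX] hZ hg ng.
have [I [p [i [hp fp hi fi gE]]]] := img_ex hg.
have nI : ~ hz X I.
  move=> /hZ /(_ _ hp) p0; case/eqP: ng; by rewrite gE p0 mul0mx.
have [f [hf nf]] := nhz nI.
have [fi0|ff] := bX _ (ishomM hf hi).
  by case/eqP: nf; apply: (row_free_inj fi); rewrite /= fi0 mul0mx.
rewrite /row_full eqn_leq rank_leq_col -[X in (X <= _)%N](eqP ff) gE.
rewrite (eqmxMfull i fp).
exact: mxrankM_maxr.
Qed.

(* Two exceptional modules with proportional dimension vectors generate the
   same torsion class, so each is a quotient of the other. *)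
Lemma indec_prop_in_gen X Y c : indec X -> indec Y -> 0 < c -> dv X = c *: dv Y ->
  lperp (fun W => hz X W) Y.
Proof.
move=> iX iY c0 e.
have [N [Z [i [p [s TN pZ]]]]] := tors_dec Y (@tors_lperp (fun W => hz X W)).
have [hp fp] : ishom p /\ row_full p by case: s.
have hXZ : hz X Z by apply: pZ => W; apply.
have x0 : ext0 Y Z by apply: ext0_quo hp fp _; exact: indec_rigid.
have zZ : sz Z = 0%N.
  apply: contrapT => nz.
  have : ~ hz Y Z by move=> /(_ _ hp) p0; apply: nz; exact: row_full_sz0 p0.
  move=> /E_nhz_ext0 /(_ x0); have := E_hz hXZ.
  by rewrite /E e eulZl => h1 h2; have := mulr_gt0 c0 h2; lra.
have sE := ses_sz s.
apply: (tors_iso (@tors_lperp _) _ TN).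
by apply: (@inj_sz_iso _ _ _ _ _ i); [case: s|case: s|clear - sE zZ; lia].
Qed.

Lemma indec_dv_prop X Y c : indec X -> indec Y -> dv X = c *: dv Y -> iso X Y.
Proof.
move=> iX iY e.
have c0 : 0 < c.
  have h : exists2 j, dv X 0 j != 0 & dv Y 0 j != 0 \/ True.
    apply: contrapT => h; have : sz X = 0%N.
      apply: dv0_sz; apply/rowP => j; rewrite [RHS]mxE; apply: contrapT => /eqP nj.
      by apply: h; exists j; [|right].
    by move=> z; have := iX.1; rewrite z.
  case: h => j nj _; move: nj (dv_ge0 X j) (dv_ge0 Y j).
  have -> : dv X 0 j = c * dv Y 0 j by rewrite e mxE.
  move: (dv Y 0 j) => y nj cy y0.
  have yp : 0 < y.
    by rewrite lt_def y0 andbT; apply: contra nj => /eqP ->; rewrite mulr0.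
  rewrite lt_def; apply/andP; split; last by rewrite -(pmulr_lge0 _ yp).
  by apply: contra nj => /eqP ->; rewrite mul0r.
have e' : dv Y = c^-1 *: dv X by rewrite e scalerA mulVf ?scale1r // gt_eqF.
have c0' : 0 < c^-1 by rewrite invr_gt0.
have gY := indec_prop_in_gen iX iY c0 e.
have gX := indec_prop_in_gen iY iX c0' e'.
have [bX bY] := ((indec_exc bd iX).1, (indec_exc bd iY).1).
have nYX : ~ hz Y X by move=> /gX /hz_id z; have := iX.1; rewrite z.
have nXY : ~ hz X Y by move=> /gY /hz_id z; have := iY.1; rewrite z.
have [g [hg ng]] := nhz nYX; have [f [hf nf]] := nhz nXY.
have fg := surj_in_gen bX gY hg ng; have ff := surj_in_gen bY gX hf nf.
apply: (surj_sz_iso hf ff).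
by rewrite -[X in (X <= _)%N](eqP fg) rank_leq_row.
Qed.

End Torsion.

Arguments indec_rigid {K n Q} bd [X] iX : rename.

(** * Covers of torsion classes, their labels, and chains *)

Section Steps.
Local Open Scope ring_scope.
Context {K : fieldType} {n : nat} {Q : modulated_quiver K n}.
Local Notation qmod := (@qmod K n Q).
Implicit Types X Y Z A B C I N W : qmod.
Implicit Types T P S J : qmod -> Prop.
Context {m : nat} (V : 'I_m -> qmod).

Record listing : Prop := Listing {
  V_indec : forall k, indec (V k);
  V_all : forall X, indec X -> exists k, iso X (V k);
  V_inj : forall k l, dv (V k) = dv (V l) -> k = l
}.
Hypothesis hV : listing.

Lemma V_bd : @bounded K n Q.
Proof.
exists (\max_k sz (V k))%N => X /(V_all hV)[k i].
by rewrite (iso_sz i) (leq_bigmax k).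
Qed.
Local Notation bd := V_bd.

Lemma V_iso k l : iso (V k) (V l) -> k = l.
Proof. by move/dv_iso/(V_inj hV). Qed.

Lemma V_rigid k : ext0 (V k) (V k).
Proof. exact (indec_rigid bd (V_indec hV k)). Qed.

Lemma V_brick k : brick (V k).
Proof. exact: (indec_exc bd (V_indec hV k)).1. Qed.

Lemma V_sz k : (0 < sz (V k))%N.
Proof. by case: (V_indec hV k). Qed.

Lemma V_prop k l c : dv (V k) = c *: dv (V l) -> k = l.
Proof. by move=> e; apply: V_iso; apply: indec_dv_prop e => //; [exact: bd|exact: V_indec|exact: V_indec]. Qed.

Lemma V_Epos k : 0 < E (V k) (V k).
Proof. exact: (E_pos bd (V_sz k)). Qed.

Lemma nz_summand X : (0 < sz X)%N -> exists k A, iso A (V k) /\ summand A X.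
Proof.
move=> /indec_summand[A [iA sA]]; have [k i] := V_all hV iA.
by exists k, A.
Qed.

Definition gen_tors T B := lperp (fun Z => perp T Z /\ hz B Z).

(* T1 covers T, and V k is the label of the cover. *)
Definition step T k T1 := [/\ tors T, tors T1, forall X, T X -> T1 X &
  forall l, T1 (V l) /\ perp T (V l) <-> l = k].

Lemma gen_tors_sub T B X : T X -> gen_tors T B X.
Proof. by move=> TX Z [pZ _]; exact: pZ. Qed.

Lemma gen_tors_in T B : gen_tors T B B.
Proof. by move=> Z []. Qed.

Lemma gen_tors_min T B S X : tors S -> (forall Y, T Y -> S Y) -> S B -> gen_tors T B X -> S X.
Proof.
move=> tS TS SB h; apply: tS => Z pZ; apply: h; split; last exact: pZ.
by move=> N TN; apply: pZ; exact: TS.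
Qed.

Lemma step_in T k T1 : step T k T1 -> T1 (V k) /\ perp T (V k).
Proof. by case=> _ _ _ /(_ k)[_]; apply. Qed.

Lemma step_only T k T1 A : step T k T1 -> indec A -> T1 A -> perp T A -> iso A (V k).
Proof.
move=> [tT tT1 _ st] iA T1A pA; have [l i] := V_all hV iA.
suff -> : k = l by [].
by apply/esym/st; split; [apply: tors_iso i T1A|apply: perp_iso i pA].
Qed.

(** Each indecomposable summand of X lies in T1 and is torsion-free for T, hence is a copy of V
    k. *)
Lemma step_dv T k T1 X : step T k T1 -> T1 X -> perp T X ->
  exists a : nat, dv X = a%:R *: dv (V k).
Proof.
move=> st; have tT1 : tors T1 by case: st.
elim/(@indec_ind K n Q): X => [X s _ _|X iX T1X pX|A B X d _ _ IA IB TX pX].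
- by exists 0%N; rewrite scale0r sz0_dv.
- by exists 1%N; rewrite scale1r; apply: dv_iso; exact: step_only st _ _ _.
have sA : summand A X by exists B.
have sB : summand B X by exists A; exact: ds_sym.
have [a ea] := IA (tors_summand tT1 sA TX) (perp_summand sA pX).
have [b eb] := IB (tors_summand tT1 sB TX) (perp_summand sB pX).
by exists (a + b)%N; rewrite (dv_ds d) ea eb natrD scalerDl.
Qed.

(** The image of a nonzero map from T1 to a torsion-free Z has only copies of V k as indecomposable
    summands, so V k itself maps to Z. This makes T1 a function of T and k. *)
Lemma step_gen T k T1 X : step T k T1 -> T1 X <-> gen_tors T (V k) X.
Proof.
move=> st; have [tT tT1 TT1 _] := st; have [T1k pk] := step_in st.
split; last exact: gen_tors_min.
move=> T1X Z [pZ hZ] f hf; apply: contrapT => /eqP nf.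
have [I [p [i [hp fp hi fi fE]]]] := img_ex hf.
have sI : (0 < sz I)%N.
  rewrite lt0n; apply: contra nf => /eqP s; apply/eqP.
  by rewrite fE (mx_sz0 i s) mulmx0.
have [A [iA sA]] := indec_summand sI.
have T1A := tors_summand tT1 sA (tors_quo tT1 hp fp T1X).
have pA := perp_summand sA (perp_sub hi fi pZ).
have [j [hj fj]] := summand_inj sA.
have := hz_iso_l (iso_sym (step_only st iA T1A pA)) hZ => /(_ _ (ishomM hj hi)).
by move=> /(row_free_sz0 (row_freeM fj fi)) s; have := iA.1; rewrite s.
Qed.

(* Together with [perp T B]: B is a minimal extending module of T. *)
Definition ext_quo T B := forall Y (p : 'M[K]_(sz B, sz Y)), ishom p -> row_full p ->
  (sz Y < sz B)%N -> T Y.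
Definition ext_tors T B := forall X N (i : 'M[K]_(sz B, sz X)) (p : 'M[K]_(sz X, sz N)),
  ses i p -> T N -> perp T X -> sz N = 0%N.

(** A map that is not injective factors through a proper quotient of B, which is in T and has no
    maps to Y. *)
Lemma perp_map_inj T B Y (f : 'M[K]_(sz B, sz Y)) : ext_quo T B -> perp T Y ->
  ishom f -> f != 0 -> row_free f.
Proof.
move=> P1 pY hf nf; have [I [p [i [hp fp hi fi fE]]]] := img_ex hf.
have [lt|ge] := ltnP (sz I) (sz B).
  case/eqP: nf; rewrite fE.
  have -> : p = 0.
    apply: (row_free_inj fi); rewrite /= mul0mx.
    by rewrite (pY _ (P1 _ _ hp fp lt) i hi) mulmx0.
  by rewrite mul0mx.
rewrite fE; apply: row_freeM => //.
by rewrite /row_free eqn_leq rank_leq_row (eqP fp).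
Qed.

Lemma step_ext_quo T k T1 : step T k T1 -> ext_quo T (V k).
Proof.
move=> st Y p hp fp lt; have [tT tT1 TT1 _] := st; have [T1k pk] := step_in st.
have T1Y := tors_quo tT1 hp fp T1k.
have [N [Z [i [q [s TN pZ]]]]] := tors_dec Y tT.
have [hq fq] : ishom q /\ row_full q by case: s.
have sZ : sz Z = 0%N.
  apply/eqP; rewrite -leqn0 leqNgt; apply/negP => /indec_summand[A [iA sA]].
  have T1A := tors_summand tT1 sA (tors_quo tT1 hq fq T1Y).
  have e := iso_sz (step_only st iA T1A (perp_summand sA pZ)).
  case: sA => B /ds_sz sz2; have sE := ses_sz s.
  clear - e sz2 sE lt; lia.
have sE := ses_sz s.
by apply: (tors_iso tT _ TN); apply: (@inj_sz_iso _ _ _ _ _ i); [case: s|case: s|clear - sE sZ; lia].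
Qed.

(** X is in T1 and torsion-free for T, so dim X = a b_k and dim N = (a - 1) b_k. As V k is
    torsion-free, [E N (V k) <= 0], which forces a <= 1. *)
Lemma step_ext_ses T k T1 : step T k T1 -> ext_tors T (V k).
Proof.
move=> st X N i p s TN pX; have [tT tT1 TT1 _] := st; have [T1k pk] := step_in st.
have T1X := tors_ext tT1 s T1k (TT1 _ TN).
have [a ea] := step_dv st T1X pX.
have eN : dv N = (a%:R - 1) *: dv (V k).
  by have := dv_ses s; rewrite ea scalerBl scale1r => ->; rewrite addrAC subrr add0r.
have := E_hz (pk _ TN); rewrite /E eN eulZl => h.
have fk := V_Epos k; rewrite /E in fk.
have a1 : a%:R - 1 <= 0 :> rat by rewrite -(pmulr_lle0 _ fk).
case: a ea eN h a1 => [|[|a]] ea eN _ a1.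
- by have := dv0_sz (etrans ea (scale0r _)); have := ses_sz s; have := V_sz k; lia.
- by apply: dv0_sz; rewrite eN subrr scale0r.
- by exfalso; move: a1; rewrite -natr1 addrK; rewrite lern0.
Qed.

(** By induction Ext(Y', B) = 0 for the smaller quotient Y', so the copy of B inside Y splits off,
    and an indecomposable Y equals it. *)
Lemma filt_one B P : indec B -> (forall A X, summand A X -> P X -> P A) ->
  (forall Y, P Y -> (0 < sz Y)%N -> exists Y' (i : 'M[K]_(sz B, sz Y)) (p : 'M[K]_(sz Y, sz Y')),
     ses i p /\ P Y') ->
  forall Y, P Y -> indec Y -> iso Y B.
Proof.
move=> iB Ps Pf Y PY iY.
suff h : forall Y, P Y -> ext0 Y B /\ (indec Y -> iso Y B) by case: (h Y PY) => _; apply.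
clear Y PY iY => Y; have [N] := ubnP (sz Y); elim: N Y => // N IH Y lN PY.
have [/eqP z|z] := posnP (sz Y).
  by split; [exact/sz0_ext0l/eqP|move=> [s _]; rewrite (eqP z) in s].
have iP : indec Y -> iso Y B.
  move=> iY; have [Y' [i [p [s PY']]]] := Pf Y PY z.
  have sE := ses_sz s; have sB := iB.1.
  have [|x0 _] := IH Y' _ PY'; first by clear - sE sB lN; lia.
  have [t ht tp] := ext_split s x0; have [r hr ir] := split_retract s ht tp.
  apply: iso_sym; apply: summand_iso => //; apply/summandP; exists i, r; split=> //.
  by case: s.
split=> //; have [/iP i|ni] := pselect (indec Y).
  case: i => f [hf ff _]; apply: ext0_sub hf ff _; exact: (indec_rigid bd iB).
have [e [he [ee [n0 n1]]]] : exists e : 'M[K]_(sz Y),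
    @ishom _ _ _ Y Y e /\ e *m e = e /\ e <> 0 /\ e <> 1%:M.
  apply: contrapT => h; apply: ni; split=> // e he ee; apply: contrapT => h'.
  by apply: h; exists e; do 2 split=> //; split=> h''; apply: h'; [left|right].
have [A [C [d a b]]] := idem_ds he ee n0 n1; have sE := ds_sz d.
apply: (ds_ext0l d).
  by apply: (IH A _ _).1; [clear - sE a b lN; lia|apply: Ps PY; exists C].
by apply: (IH C _ _).1; [clear - sE a b lN; lia|apply: Ps PY; exists A; exact: ds_sym].
Qed.

(** The preimage in Y of the torsion part N of the cokernel is a torsion-free extension of N by B,
    so [ext_tors] gives N = 0. *)
Lemma perp_coker T B Y (f : 'M[K]_(sz B, sz Y)) : tors T -> ext_tors T B -> perp T Y ->
  ishom f -> row_free f -> exists Y' (p : 'M[K]_(sz Y, sz Y')), ses f p /\ perp T Y'.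
Proof.
move=> tT P2 pY hf ff; have [Y' [p s]] := cok_ses hf ff.
exists Y', p; split=> //.
have [N [Z [i [q [s' TN pZ]]]]] := tors_dec Y' tT.
have [X [i' [t' [t [st s2 _ _]]]]] := ses_pull s s'.
have zN : sz N = 0%N.
  apply: P2 st TN _; case: s2 => ht _ ft _ _; exact: perp_sub ht ft pY.
have sE := ses_sz s'.
apply: perp_iso pZ; apply: iso_sym.
by apply: (@surj_sz_iso _ _ _ _ _ q); [case: s'|case: s'|clear - sE zN; lia].
Qed.

(** A nonzero torsion-free module of the generated class receives an injection from V k with
    torsion-free cokernel, so [filt_one] shows that V k is the only indecomposable there. *)
Lemma step_cover T k : tors T -> perp T (V k) -> ext_quo T (V k) -> ext_tors T (V k) ->
  step T k (gen_tors T (V k)).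
Proof.
move=> tT pk P1 P2; split=> //; first exact: tors_lperp.
  by move=> X; exact: gen_tors_sub.
move=> l; split=> [[gl pl]|->]; last by split=> //; exact: gen_tors_in.
apply: V_iso; apply: (@filt_one _ (fun Y => gen_tors T (V k) Y /\ perp T Y)) => //.
- exact: V_indec.
- move=> A X sA [gX pX]; split; last exact: perp_summand pX.
  by apply: tors_summand sA gX; exact: tors_lperp.
- move=> Y [gY pY] sY.
  have : ~ hz (V k) Y by move=> h; have := hz_id (gY Y (conj pY h)); lia.
  move=> /nhz[f [hf nf]]; have ff := perp_map_inj P1 pY hf nf.
  have [Y' [p [s pY']]] := perp_coker tT P2 pY hf ff.
  exists Y', f, p; do 2 split=> //.
  by case: s => _ hp _ fp _; apply: tors_quo hp fp gY; exact: tors_lperp.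
- exact: V_indec.
Qed.

(** A nonzero map X -> B is nonzero on B, since N has no maps to B, and hence invertible there. So N
    is a summand of X, although it has no maps to X. *)
Lemma split_perp B X N (i : 'M[K]_(sz B, sz X)) (p : 'M[K]_(sz X, sz N)) : ses i p ->
  brick B -> hz N B -> hz N X -> ~ hz X B -> sz N = 0%N.
Proof.
move=> s bB hNB hNX /nhz[g [hg ng]]; case: (s) => hi hp fi fp ie.
have [ig|fig] := bB.2 _ (ishomM hi hg).
  have [|g' [hg' g'E]] := fac_surj hp fp hg; first by rewrite -ie; exact/sub_kermxP.
  by case/eqP: ng; rewrite g'E (hNB _ hg') mulmx0.
have [h [hh e1 e2]] := sq_free_inv (ishomM hi hg) fig.
have hr : ishom (g *m h) by exact: ishomM.
have ir : i *m (g *m h) = 1%:M by rewrite mulmxA.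
have hs : @ishom _ _ _ X X (1%:M - g *m h *m i).
  by apply: ishomB; [exact: ishom1|exact: ishomM].
have [|s' [hs' s'E]] := fac_surj hp fp hs.
  by rewrite -ie; apply/sub_kermxP; rewrite mulmxBr mulmx1 mulmxA ir mul1mx subrr.
have s'0 := hNX _ hs'.
have e : p *m (s' *m p) = p.
  rewrite mulmxA -s'E mulmxBl mul1mx -(mulmxA (g *m h) i p) (ses_mul0 s).
  by rewrite mulmx0 subr0.
have p0 : p = 0 by rewrite -e s'0 mul0mx mulmx0.
exact: row_full_sz0 fp p0.
Qed.

Definition cnt T := #|[pred l | `[< T (V l) >]]|.

Lemma cnt_subset T S : (forall X, T X -> S X) ->
  [pred l | `[< T (V l) >]] \subset [pred l | `[< S (V l) >]].
Proof.
move=> TS; apply/fintype.subsetP => l; rewrite !unfold_in /= => /asboolP h.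
by apply/asboolP; apply: TS.
Qed.

Lemma cnt_le T S : (forall X, T X -> S X) -> (cnt T <= cnt S)%N.
Proof. by move=> TS; apply/subset_leq_card/cnt_subset. Qed.

Lemma cnt_eq T S l : (forall X, T X -> S X) -> (cnt S <= cnt T)%N -> S (V l) -> T (V l).
Proof.
move=> TS le Sl; have e : cnt T = cnt S by apply/eqP; rewrite eqn_leq le cnt_le.
have /(_ l) := subset_cardP e (cnt_subset TS).
by rewrite !unfold_in /= => h; apply/asboolP; rewrite h; apply/asboolP.
Qed.

Lemma cnt_step T k T1 : step T k T1 -> (cnt T < cnt T1)%N.
Proof.
move=> st; have [tT tT1 TT1 _] := st; have [T1k pk] := step_in st.
rewrite ltnNge; apply/negP => le; have := cnt_eq TT1 le T1k => Tk.
by have := tors_perp0 Tk pk; have := V_sz k; lia.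
Qed.

(** Let U have the least count among torsion classes strictly above T inside S, and let V k be a
    summand of a smallest nonzero module of U torsion-free for T. Proper quotients of V k then have
    zero torsion-free part. A module X as in [ext_tors] generates U over T by minimality, so X maps
    to V k and [split_perp] applies. *)
Lemma step_exists T S : tors T -> tors S -> (forall X, T X -> S X) ->
  (exists X, S X /\ ~ T X) -> exists k T1, step T k T1 /\ forall X, T1 X -> S X.
Proof.
move=> tT tS TS nST.
pose R c := exists S', [/\ tors S', forall X, T X -> S' X, forall X, S' X -> S X,
   exists X, S' X /\ ~ T X & cnt S' = c].
have [|c [U [tU TU US [X0 [UX0 nX0]] cU]] mn] := @ex_min_nat R; first by exists (cnt S), S.
pose R2 d := exists X, [/\ (0 < sz X)%N, U X, perp T X & sz X = d].
have [|d [B [sB UB pB dB]] mn2] := @ex_min_nat R2.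
  have [N [Z [i [p [s TN pZ]]]]] := tors_dec X0 tT.
  exists (sz Z), Z; split=> //; last first.
    by case: s => _ hp _ fp _; exact: tors_quo tU hp fp UX0.
  rewrite lt0n; apply/eqP => z; apply: nX0; have sE := ses_sz s.
  apply: (tors_iso tT _ TN).
  by apply: (@inj_sz_iso _ _ _ _ _ i); [case: s|case: s|clear - sE z; lia].
have [k [A [iA sA]]] := nz_summand sB.
have Uk : U (V k) by apply: tors_iso iA _ => //; exact: tors_summand sA UB.
have pk : perp T (V k) by apply: perp_iso iA _; exact: perp_summand sA pB.
have mnk X : (0 < sz X)%N -> U X -> perp T X -> (sz (V k) <= sz X)%N.
  move=> sX UX pX; apply: (@leq_trans d); last by apply: mn2; exists X.
  case: sA => C /ds_sz e; rewrite -(iso_sz iA) -dB; clear - e; lia.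
exists k, (gen_tors T (V k)); split; last first.
  by move=> X h; apply: US; apply: gen_tors_min h.
apply: step_cover => //.
  move=> Y p hp fp lt; have UY := tors_quo tU hp fp Uk.
  have [N [Z [i [q [s TN pZ]]]]] := tors_dec Y tT.
  have [hq fq] : ishom q /\ row_full q by case: s.
  have sE := ses_sz s.
  have z : sz Z = 0%N.
    apply/eqP; rewrite -leqn0 leqNgt; apply/negP => sZ.
    have := mnk Z sZ (tors_quo tU hq fq UY) pZ; clear - sE lt; lia.
  apply: (tors_iso tT _ TN).
  by apply: (@inj_sz_iso _ _ _ _ _ i); [case: s|case: s|clear - sE z; lia].
move=> X N i p s TN pX.
have UX : U X by apply: tors_ext tU s Uk (TU _ TN).
have sE := ses_sz s; have sk := V_sz k.
have genU Y : gen_tors T X Y -> U Y by exact: gen_tors_min.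
have gk : gen_tors T X (V k).
  apply: (cnt_eq genU) => //; rewrite cU; apply: mn.
  exists (gen_tors T X); split=> //; first exact: tors_lperp.
  - by move=> Y; exact: gen_tors_sub.
  - by move=> Y /genU /US.
  - exists X; split; first exact: gen_tors_in.
    by move=> TX; have := tors_perp0 TX pX; clear - sE sk; lia.
apply: split_perp s _ _ _ _; first exact: V_brick.
- exact: pk.
- exact: pX.
- by move=> h; have := hz_id (gk _ (conj pk h)); clear - sk; lia.
Qed.

Fixpoint chain T (w : seq 'I_m) T' : Prop := match w with
  | [::] => forall X, T X <-> T' X
  | k :: w => exists T1, step T k T1 /\ chain T1 w T'
  end.

Lemma chain_exists T S : tors T -> tors S -> (forall X, T X -> S X) -> exists w, chain T w S.
Proof.
have [N] := ubnP (cnt S - cnt T)%N; elim: N T => // N IH T lN tT tS TS.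
have [nST|h] := pselect (exists X, S X /\ ~ T X); last first.
  by exists [::] => X; split=> [/TS //|SX]; apply: contrapT => nT; apply: h; exists X.
have [k [T1 [st T1S]]] := step_exists tT tS TS nST.
have [||w cw] := IH T1 _ _ tS T1S; last by exists (k :: w), T1.
  by have := cnt_step st; have := cnt_le T1S; clear - lN; lia.
by case: st.
Qed.

Lemma chain_sub T w S X : chain T w S -> T X -> S X.
Proof.
elim: w T => [|k w IH] T /=; first by move=> h /h.
by move=> [T1 [[_ _ TT1 _] /IH h]] /TT1.
Qed.

Lemma chain_cat T u v S : chain T (u ++ v) S <-> exists T1, chain T u T1 /\ chain T1 v S.
Proof.
elim: u T => [|k u IH] T /=.
  split=> [h|[T1 [h1 h2]]]; first by exists T.
  have e : T = T1 by apply/funext => X; exact/propext.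
  by rewrite e.
split=> [[T1 [st /IH[T2 [h1 h2]]]]|[T2 [[T1 [st h1]] h2]]].
  by exists T2; split=> //; exists T1.
by exists T1; split=> //; apply/IH; exists T2.
Qed.

Lemma chain_nil T S : chain T [::] S -> T = S.
Proof. by move=> h; apply/funext => X; exact/propext. Qed.

Lemma step_fun T k T1 T2 : step T k T1 -> step T k T2 -> T1 = T2.
Proof.
move=> s1 s2; apply/funext => X; apply/propext.
by rewrite (step_gen X s1) (step_gen X s2).
Qed.

Lemma chain_fun T w T1 T2 : chain T w T1 -> chain T w T2 -> T1 = T2.
Proof.
elim: w T => [|k w IH] T; first by move=> /chain_nil <- /chain_nil.
by move=> [S1 [s1 c1]] [S2 [s2 c2]]; rewrite -(step_fun s1 s2) in c2; exact: IH c1 c2.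
Qed.

Lemma chain_letter T w S k : chain T w S -> k \in w -> S (V k) /\ perp T (V k).
Proof.
elim: w T => // l w IH T [T1 [st c]]; have [_ _ TT1 _] := st; rewrite inE => /orP[/eqP ->|kw].
  by have [T1l pl] := step_in st; split=> //; exact: chain_sub c T1l.
have [Sk pk] := IH T1 c kw; split=> // N TN; exact/pk/TT1.
Qed.

Lemma chain_hz T u k v S l : chain T (u ++ k :: v) S -> l \in k :: v -> forall j, j \in u ->
  hz (V j) (V l).
Proof.
move=> /chain_cat[T1 [c1 c2]] lv j ju.
by have [_ pl] := chain_letter c2 lv; have [T1j _] := chain_letter c1 ju; exact: pl.
Qed.

Lemma chain_uniq T w S : chain T w S -> uniq w.
Proof.
elim: w T => // k w IH T [T1 [st c]] /=; rewrite (IH _ c) andbT; apply/negP => kw.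
have [T1k pk] := step_in st; have [_ p1k] := chain_letter c kw.
by have := tors_perp0 T1k p1k; have := V_sz k; lia.
Qed.

End Steps.

Arguments V_rigid {K n Q m V} hV k.

(** * Rank two polygons *)

Section Polygon.
Local Open Scope ring_scope.
Context {K : fieldType} {n : nat} {Q : modulated_quiver K n}.
Local Notation qmod := (@qmod K n Q).
Implicit Types X Y Z A B C I N W : qmod.
Implicit Types T P S : qmod -> Prop.
Context {m : nat} (V : 'I_m -> qmod).
Hypothesis hV : listing V.
Local Notation step := (step V).
Local Notation chain := (chain V).
Local Notation b k := (dv (V k)).

Lemma chain_enter T w S X : chain T w S -> ~ T X -> S X ->
  exists u k v T1 T2, [/\ w = u ++ k :: v, chain T u T1, step T1 k T2, chain T2 v S &
    ~ T1 X /\ T2 X].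
Proof.
elim: w T => [|k w IH] T /=; first by move=> h nT /h.
move=> [T1 [st c]] nT SX; have [T1X|nT1] := pselect (T1 X).
  by exists [::], k, w, T, T1.
have [u [l [v [U1 [U2 [-> c1 st' c2 h]]]]]] := IH _ c nT1 SX.
exists (k :: u), l, v, U1, U2; split=> //.
by exists T1.
Qed.

Lemma chain_tors T w S : tors T -> chain T w S -> tors S.
Proof.
elim: w T => [|k w IH] T tT; first by move/chain_nil <-.
by move=> [T1 [[_ tT1 _ _] c]]; exact: IH c.
Qed.

(** The torsion parts of X along the chain filter it, and each layer has a multiple of a label as
    dimension vector by [step_dv]. *)
Lemma chain_neg (phi : 'rV[rat]_n -> rat) T w S X :
  (forall u v, phi (u + v) = phi u + phi v) -> (forall a u, phi (a *: u) = a * phi u) ->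
  (forall l, l \in w -> phi (b l) < 0) -> tors T -> chain T w S ->
  S X -> perp T X -> (0 < sz X)%N -> phi (dv X) < 0.
Proof.
move=> phiD phiZ; elim: w T X => [|k w IH] T X neg tT.
  by move/chain_nil => <- TX /(tors_perp0 TX) ->.
move=> [T1 [st c]] SX pX sX; have [_ tT1 _ _] := st.
have [N [Z [i [p [s TN pZ]]]]] := tors_dec X tT1.
have sE := ses_sz s; rewrite (dv_ses s) phiD.
have pN : perp T N by case: s => hi _ fi _ _; exact: perp_sub pX.
have [a aE] := step_dv hV st TN pN.
have SZ : S Z by case: s => _ hp _ fp _; apply: tors_quo hp fp SX; exact: chain_tors tT1 c.
have negk : phi (b k) < 0 by apply: neg; rewrite mem_head.
have leN : phi (dv N) <= 0 by rewrite aE phiZ; apply: mulr_ge0_le0 => //; exact: ltW.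
have negw l : l \in w -> phi (b l) < 0 by move=> lw; apply: neg; rewrite inE lw orbT.
have [/eqP zZ|zZ] := posnP (sz Z); last by have := IH T1 Z negw tT1 c SZ pZ zZ; lra.
have sN : (0 < sz N)%N by clear - sE zZ sX; move/eqP: zZ => zZ; lia.
rewrite (sz0_dv (eqP zZ)) -[0]addr0 phiD.
have -> : phi 0 = 0 by have := phiZ 0 0; rewrite scale0r mul0r.
rewrite !addr0 aE phiZ; case: a aE => [|a] aE.
  by have := dv0_sz (etrans aE (scale0r _)); lia.
by rewrite pmulr_rlt0 // ltr0n.
Qed.

(** A nonzero map is injective because proper quotients of V i are in T. Its cokernel is a proper
    quotient of V j, hence in T, and [ext_tors] makes it zero. *)
Lemma cover_hz T i Ti j Tj : step T i Ti -> step T j Tj -> i <> j -> hz (V i) (V j).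
Proof.
move=> si sj ij; apply: contrapT => /nhz[f [hf nf]].
have [Tii pi] := step_in si; have [Tjj pj] := step_in sj; have [tT _ _ _] := si.
have ff := perp_map_inj (step_ext_quo hV si) pj hf nf.
have [C [p s]] := cok_ses hf ff; have sE := ses_sz s.
have si0 := V_sz hV i.
have TC : T C.
  by case: (s) => _ hp _ fp _; apply: (step_ext_quo hV sj) hp fp _; clear - sE si0; lia.
have zC := step_ext_ses hV si s TC pj.
apply: ij; apply: (V_iso hV); apply: (inj_sz_iso hf ff); clear - sE zC; lia.
Qed.

Section Pair.
Variables (T : qmod -> Prop) (i j : 'I_m) (Ti Tj : qmod -> Prop).
Hypotheses (si : step T i Ti) (sj : step T j Tj) (ij : i <> j).

Let hij : hz (V i) (V j) := cover_hz si sj ij.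
Let hji : hz (V j) (V i) := cover_hz sj si (fun e => ij (esym e)).
Let tT : tors T. Proof. by case: si. Qed.
Let pi : perp T (V i). Proof. by case: (step_in si). Qed.
Let pj : perp T (V j). Proof. by case: (step_in sj). Qed.

(** The join of Ti and Tj. Its modules torsion-free for T, the heart, are filtered by copies of V i
    and V j. *)
Definition join_tors := lperp (fun Z => [/\ perp T Z, hz (V i) Z & hz (V j) Z]).
Local Notation J := join_tors.

Lemma join_torsP : tors J. Proof. exact: tors_lperp. Qed.
Lemma join_i : J (V i). Proof. by move=> Z []. Qed.
Lemma join_j : J (V j). Proof. by move=> Z []. Qed.
Lemma join_sub X : T X -> J X. Proof. by move=> TX Z [pZ _ _]; exact: pZ. Qed.
Lemma join_min S X : tors S -> (forall Y, T Y -> S Y) -> S (V i) -> S (V j) -> J X -> S X.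
Proof.
move=> tS TS Si Sj h; apply: tS => Z pZ; apply: h; split; try exact: pZ.
by move=> N TN; apply: pZ; exact: TS.
Qed.
Lemma join_subi X : Ti X -> J X.
Proof.
move/(step_gen hV X si) => h; apply: gen_tors_min h; [exact: join_torsP|exact: join_sub|exact: join_i].
Qed.
Lemma join_subj X : Tj X -> J X.
Proof.
move/(step_gen hV X sj) => h; apply: gen_tors_min h; [exact: join_torsP|exact: join_sub|exact: join_j].
Qed.

Lemma heart_pull l Tl Y : step T l Tl -> J Y -> perp T Y -> ~ hz (V l) Y ->
  exists Y' (f : 'M[K]_(sz (V l), sz Y)) (p : 'M[K]_(sz Y, sz Y')), [/\ ses f p, J Y' & perp T Y'].
Proof.
move=> sl JY pY /nhz[f [hf nf]].
have ff := perp_map_inj (step_ext_quo hV sl) pY hf nf.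
have [Y' [p [s pY']]] := perp_coker tT (step_ext_ses hV sl) pY hf ff.
exists Y', f, p; split=> //.
by case: s => _ hp _ fp _; apply: tors_quo hp fp JY; exact: join_torsP.
Qed.

Lemma heart_nz Y : J Y -> perp T Y -> (0 < sz Y)%N -> ~ hz (V i) Y \/ ~ hz (V j) Y.
Proof.
move=> JY pY sY; apply: contrapT => h.
have : hz Y Y.
  by apply: JY; split=> //; apply: contrapT => h'; apply: h; [left|right].
by move/hz_id => z; rewrite z in sY.
Qed.

Lemma heart_dv Y : J Y -> perp T Y -> exists a c : nat, dv Y = a%:R *: b i + c%:R *: b j.
Proof.
have [N] := ubnP (sz Y); elim: N Y => // N IH Y lN JY pY.
have [/eqP z|z] := posnP (sz Y).
  by exists 0%N, 0%N; rewrite !scale0r addr0; exact/sz0_dv/eqP.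
have si0 := V_sz hV i; have sj0 := V_sz hV j.
have [h|h] := heart_nz JY pY z.
  have [Y' [f [p [s JY' pY']]]] := heart_pull si JY pY h.
  have sE := ses_sz s.
  have [|a [c e]] := IH Y' _ JY' pY'; first by clear - sE si0 lN; lia.
  by exists a.+1, c; rewrite (dv_ses s) e addrA -natr1 scalerDl scale1r [X in X + _]addrC.
have [Y' [f [p [s JY' pY']]]] := heart_pull sj JY pY h.
have sE := ses_sz s.
have [|a [c e]] := IH Y' _ JY' pY'; first by clear - sE sj0 lN; lia.
by exists a, c.+1; rewrite (dv_ses s) e addrCA -natr1 scalerDl scale1r [X in _ + X]addrC.
Qed.

Hypothesis xij : ext0 (V i) (V j).

(** This is the side of length two of the polygon. A module of the heart without maps from V i
    contains V j, and Ext(V i, V j) = 0 lifts any map from V i to the cokernel, so the cokernel has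
    none either and [filt_one] applies. *)
Lemma step_join : step Ti j J.
Proof.
have [_ tTi TTi _] := si.
have pij : perp Ti (V j).
  by move=> N /(step_gen hV N si); apply; split.
split=> //; [exact: join_torsP|exact: join_subi|].
move=> l; split=> [[Jl pl]|->]; last by split=> //; exact: join_j.
apply: (V_iso hV).
pose P Y := [/\ J Y, perp T Y & hz (V i) Y].
apply: (@filt_one _ _ _ _ _ hV _ P) => //.
- exact: V_indec hV j.
- move=> A X sA [JX pX hX]; split; [exact: tors_summand join_torsP sA JX|exact: perp_summand pX|].
  by have [f [hf ff]] := summand_inj sA; exact: hz_inj hf ff hX.
- move=> Y [JY pY hY] sY; have [//|h] := heart_nz JY pY sY.
  have [Y' [f [p [s JY' pY']]]] := heart_pull sj JY pY h.
  exists Y', f, p; split=> //; split=> //; apply: contrapT => /nhz[g [hg ng]].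
  have fg := perp_map_inj (step_ext_quo hV si) pY' hg ng.
  have [D [r sg]] := cok_ses hg fg.
  have [X [i' [t' [t [st s2 _ e]]]]] := ses_pull s sg.
  have [u hu ut] := ext_split st xij.
  case: s2 => ht _ ft _ _.
  have u0 : u = 0.
    by apply: (row_free_inj ft); rewrite /= mul0mx; apply: hY; exact: ishomM.
  have e1 : (0 : 'M[K]_(sz (V i))) = 1%:M by rewrite -ut u0 mul0mx.
  have := row_free_sz0 (f := 1%:M : 'M[K]_(sz (V i))) _ (esym e1).
  have := V_sz hV i; rewrite row_free_unit unitmx1 => h1 /(_ isT) h2; by rewrite h2 in h1.
- by split=> //; [move=> N /TTi; exact: pl|apply: pl; case: (step_in si)].
- exact: V_indec hV l.
Qed.

Let eij : E (V i) (V j) = 0 := E_hz_ext0 hij xij.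
Let fi : 0 < E (V i) (V i) := V_Epos hV i.
Let fj : 0 < E (V j) (V j) := V_Epos hV j.

Definition comb k (a c : nat) := b k = a%:R *: b i + c%:R *: b j.

Lemma comb_a (a c : rat) : eul Q (b i) (a *: b i + c *: b j) = a * E (V i) (V i).
Proof. by rewrite eulDr !eulZr -!/(E _ _) eij mulr0 addr0. Qed.
Lemma comb_c (a c : rat) : eul Q (a *: b i + c *: b j) (b j) = c * E (V j) (V j).
Proof. by rewrite eulDl !eulZl -!/(E _ _) eij mulr0 add0r. Qed.

(** Because [E (V i) (V j) = 0], the identity [key] writes c times [eul Q v' v] as a nonnegative
    multiple of the slope difference a' c - a c' plus c' times [eul Q v v]. *)
Lemma slope_ge0 (a c a' c' : rat) v v' : v = a *: b i + c *: b j -> v' = a' *: b i + c' *: b j ->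
  0 <= a -> 0 <= c -> 0 <= a' -> 0 <= c' -> 0 < eul Q v v -> a * c' < a' * c ->
  0 <= eul Q v' v /\ (eul Q v' v = 0 -> a = 0 /\ c' = 0).
Proof.
move=> -> -> a0 c0 a0' c0' q lt.
have cp : 0 < c by rewrite lt_def c0 andbT; apply: contraTneq lt => ->; rewrite mulr0 -leNgt mulr_ge0.
move: q; rewrite !(eulDl, eulDr) !(eulZl, eulZr) -!/(E _ _) eij.
set fii := E (V i) (V i); set fjj := E (V j) (V j); set e := E (V j) (V i) => q.
set S := (X in 0 <= X).
have key : c * S = fii * a * (a' * c - a * c') +
   c' * (a * (a * fii) + a * (c * 0) + (c * (a * e) + c * (c * fjj))) by rewrite /S; ring.
have p1 : 0 <= fii * a * (a' * c - a * c').
  by apply: mulr_ge0; [apply: mulr_ge0 => //; exact: ltW|rewrite subr_ge0 ltW].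
have q' : 0 < a * (a * fii) + a * (c * 0) + (c * (a * e) + c * (c * fjj)) by lra.
have p2 := mulr_ge0 c0' (ltW q').
split; first by rewrite -(pmulr_rge0 _ cp) key addr_ge0.
move=> S0; have {}S0 : S = 0 by exact: S0.
rewrite S0 mulr0 in key.
have z1 : fii * a * (a' * c - a * c') = 0 by lra.
have z2 : c' * (a * (a * fii) + a * (c * 0) + (c * (a * e) + c * (c * fjj))) = 0 by lra.
move/eqP: z1; rewrite !mulf_eq0 (gt_eqF fi) subr_eq0 (gt_eqF lt) orbF /= => /eqP ->.
by move/eqP: z2; rewrite mulf_eq0 (gt_eqF q') orbF => /eqP ->.
Qed.

(** V k is rigid, so a nonzero quotient Z torsion-free for J has E (V k) Z > 0, whereas E (V i) Z
    and E (V j) Z are at most 0. The submodule in T is treated dually. *)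
Lemma comb_heart k a c : comb k a c -> J (V k) /\ perp T (V k).
Proof.
move=> e; have rk := V_rigid hV k.
split.
  have [N [Z [f [p [s JN pZ]]]]] := tors_dec (V k) join_torsP.
  case: (s) => _ hp _ fp _; have sE := ses_sz s.
  have zZ : sz Z = 0%N.
    apply: contrapT => nz; have nh : ~ hz (V k) Z.
      by move=> /(_ _ hp) p0; apply: nz; exact: row_full_sz0 p0.
    have := E_nhz_ext0 nh (ext0_quo hp fp rk); rewrite /E e eulDl !eulZl -!/(E _ _).
    have h1 := E_hz (pZ _ join_i); have h2 := E_hz (pZ _ join_j).
    have : a%:R * E (V i) Z <= 0 by apply: mulr_ge0_le0.
    have : c%:R * E (V j) Z <= 0 by apply: mulr_ge0_le0.
    lra.
  by apply: (tors_iso join_torsP _ JN); apply: (@inj_sz_iso _ _ _ _ _ f);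
    [case: s|case: s|clear - sE zZ; lia].
have [N [Z [f [p [s TN pZ]]]]] := tors_dec (V k) tT.
case: (s) => hf hp ff fp _; have sE := ses_sz s.
have zN : sz N = 0%N.
  apply: contrapT => nz; have nh : ~ hz N (V k).
    by move=> /(_ _ hf) f0; apply: nz; exact: row_free_sz0 f0.
  have := E_nhz_ext0 nh (ext0_sub hf ff rk); rewrite /E e eulDr !eulZr -!/(E _ _).
  have h1 := E_hz (pi TN); have h2 := E_hz (pj TN).
  have : a%:R * E N (V i) <= 0 by apply: mulr_ge0_le0.
  have : c%:R * E N (V j) <= 0 by apply: mulr_ge0_le0.
  lra.
by apply: (perp_iso _ pZ); apply: iso_sym; apply: (surj_sz_iso hp fp); clear - sE zN; lia.
Qed.

Lemma comb_Epos k : 0 < eul Q (b k) (b k).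
Proof. exact: V_Epos hV k. Qed.

Variable w : seq 'I_m.
Hypothesis cw : chain T (j :: w) J.

(** Proper quotients of V i are in T, so V i is torsion-free up to the step at which it enters, and
    this step has label i. From then on both V i and V j are in the class, which is therefore J. *)
Lemma polygon_last : exists w', w = rcons w' i.
Proof.
have [Tj' [sj' c]] := cw; rewrite -(step_fun hV sj sj') {Tj' sj'} in c.
have nTji : ~ Tj (V i).
  by move=> h; apply: ij; case: sj => _ _ _ /(_ i)[h' _]; apply: h'.
have [u [k [v [T1 [T2 [wE c1 st c2 [nT1 T2i]]]]]]] := chain_enter c nTji join_i.
have tTj : tors Tj by case: sj.
have tT1 := chain_tors tTj c1.
have TTj X : T X -> Tj X by case: sj => _ _ h _; exact: h.
have p1i : perp T1 (V i).
  have [N [Z [f [p [s TN pZ]]]]] := tors_dec (V i) tT1.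
  case: (s) => hf hp ff fp _; have sE := ses_sz s.
  have [lt|ge] := ltnP (sz Z) (sz (V i)).
    have TZ := step_ext_quo hV si hp fp lt.
    have T1Z : T1 Z by apply: chain_sub c1 _; exact: TTj.
    have z := tors_perp0 T1Z pZ; case: nT1.
    by apply: (tors_iso tT1 _ TN); apply: (inj_sz_iso hf ff); clear - sE z; lia.
  by apply: (perp_iso _ pZ); apply: iso_sym; exact: (surj_sz_iso hp fp).
have ik : i = k by case: st => _ _ _ /(_ i)[h _]; apply: h.
exists u; rewrite wE -ik -cats1; case: v c2 {wE} => // l v c2; exfalso.
have [Jl pl] := chain_letter c2 (mem_head _ _).
have tT2 : tors T2 by case: st.
have T2l : T2 (V l).
  apply: join_min Jl => //.
  - by move=> Y TY; case: st => _ _ h _; apply/h/(chain_sub c1)/TTj.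
  - case: st => _ _ h _; apply/h/(chain_sub c1); by case: (step_in sj).
by have := tors_perp0 T2l pl; have := V_sz hV l; lia.
Qed.

(** Hom from an earlier to a later label vanishes, so the Euler form is nonpositive on that pair.
    Equal slopes would make the roots proportional; a larger slope of the earlier one contradicts
    [slope_ge0], except in a degenerate case that would repeat the letter j. *)
Lemma polygon_order u l v l' a c a' c' : j :: w = u ++ l :: v -> l' \in u ->
  comb l' a c -> comb l a' c' -> (a * c' < a' * c)%N.
Proof.
move=> e lu e1 e2.
have un := chain_uniq hV cw.
have h : hz (V l') (V l).
  by have cw' := cw; rewrite e in cw'; apply: (chain_hz cw') lu; exact: mem_head.
have nl : l' <> l.
  move=> ll; move: un; rewrite e cat_uniq => /and3P[_ /hasPn /(_ l (mem_head _ _)) /=].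
  by rewrite -ll lu.
have le0 : eul Q (b l') (b l) <= 0 by exact: E_hz h.
have nz1 : (a%:R : rat) * c'%:R < a'%:R * c%:R -> (a * c' < a' * c)%N by rewrite -!natrM ltr_nat.
apply: nz1; rewrite ltNge; apply/negP; rewrite le_eqVlt => /orP[/eqP eq|lt].
  apply: nl; have [a'0|a'0] := eqVneq (a'%:R : rat) 0.
    have c'0 : c'%:R != 0 :> rat.
      apply/eqP => c'0; have := comb_Epos l; rewrite e2 a'0 c'0 !scale0r addr0 eul0l; lra.
    have a0 : a%:R = 0 :> rat.
      by apply/eqP; move/eqP: eq; rewrite a'0 mul0r eq_sym mulf_eq0 (negPf c'0) orbF.
    apply: (@V_prop _ _ _ _ _ hV _ _ (c%:R / c'%:R)).
    by rewrite e1 e2 a0 a'0 !scale0r !add0r scalerA divfK.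
  apply: (@V_prop _ _ _ _ _ hV _ _ (a%:R / a'%:R)).
  rewrite e1 e2 scalerDr !scalerA divfK //; congr (_ + _ *: _).
  by rewrite mulrAC -eq mulrAC mulfV // mul1r.
have [ge0 z] := slope_ge0 e2 e1 (ler0n _ _) (ler0n _ _) (ler0n _ _) (ler0n _ _) (comb_Epos l) lt.
have [a'0 c0] : a'%:R = 0 :> rat /\ c%:R = 0 :> rat by apply: z; apply/eqP; rewrite eq_le le0.
have lj : l = j.
  by apply: (@V_prop _ _ _ _ _ hV _ _ c'%:R); rewrite e2 a'0 scale0r add0r.
case: u e lu => // x u [<- wE] _; move: un; rewrite wE /= -lj mem_cat mem_head orbT //.
Qed.

(** For a root of the heart let l be the label of the step where V k enters, N its torsion part just
    before, and Z the quotient, a multiple of b_l. If N is zero, k = l. Otherwise N has smaller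
    slope than l, so [slope_ge0] gives E Z N >= 0; since Hom(Z, N) = 0 this means Ext(Z, N) = 0, and
    N would split off V k. *)
Lemma polygon_mem k : k \in j :: w <-> exists a c, comb k a c.
Proof.
split=> [kw|[a [c e]]].
  by have [Jk pk] := chain_letter cw kw; exact: heart_dv.
have [Jk pk] := comb_heart e; have rk := V_rigid hV k.
have nTk : ~ T (V k) by move=> Tk; have := tors_perp0 Tk pk; have := V_sz hV k; lia.
have [u [l [v [T1 [T2 [wE c1 st c2 [nT1 T2k]]]]]]] := chain_enter cw nTk Jk.
have tT1 := chain_tors tT c1; have [_ tT2 T12 stP] := st.
have [N [Z [f [p [s T1N pZ]]]]] := tors_dec (V k) tT1.
case: (s) => hf hp ff fp _; have sE := ses_sz s.
have [/eqP zN|sN] := posnP (sz N).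
  have p1 : perp T1 (V k).
    apply: (perp_iso _ pZ); apply: iso_sym; apply: (surj_sz_iso hp fp).
    by move/eqP: zN => zN; clear - sE zN; lia.
  have -> : k = l by apply/stP.
  by rewrite wE mem_cat mem_head orbT.
exfalso.
have T2Z : T2 Z by exact: tors_quo tT2 hp fp T2k.
have [d dE] := step_dv hV st T2Z pZ.
have sZ : (0 < sz Z)%N.
  rewrite lt0n; apply/eqP => z; apply: nT1; apply: (tors_iso tT1 _ T1N).
  by apply: (inj_sz_iso hf ff); clear - sE z; lia.
have d0 : (0 < d)%N.
  case: d dE => // dE; have := dv0_sz (etrans dE (scale0r _)); lia.
have lw : l \in j :: w by rewrite wE mem_cat mem_head orbT.
have [Jl pl] := chain_letter cw lw; have [al [cl el]] := heart_dv Jl pl.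
have pN : perp T N by exact: perp_sub hf ff pk.
have JN : J N.
  have : chain T (u ++ l :: v) J by rewrite -wE.
  (* The prefix ends in T1, which is therefore contained in J. *)
  by move=> /chain_cat[U [cU]]; rewrite -(chain_fun hV c1 cU) => /chain_sub; apply.
have [aN [cN eN]] := heart_dv JN pN.
(* The value of phi at x b_i + y b_j is x cl - al y, negative exactly when the slope is below that
   of l. *)
pose phi v := eul Q (b i) v / E (V i) (V i) * cl%:R - al%:R * (eul Q v (b j) / E (V j) (V j)).
have phiE (x y : rat) : phi (x *: b i + y *: b j) = x * cl%:R - al%:R * y.
  by rewrite /phi comb_a comb_c !mulfK // gt_eqF.
have lt : phi (dv N) < 0.
  apply: (chain_neg _ _ _ tT c1 T1N pN sN).
  - by move=> x y; rewrite /phi eulDl eulDr; ring.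
  - by move=> x y; rewrite /phi eulZl eulZr; ring.
  move=> l' lu; have l'w : l' \in j :: w by rewrite wE mem_cat lu.
  have [Jl' pl'] := chain_letter cw l'w; have [a' [c' e']] := heart_dv Jl' pl'.
  have := polygon_order wE lu e' el; rewrite e' phiE -!natrM subr_lt0 ltr_nat //.
rewrite eN phiE subr_lt0 in lt.
have eZ : dv Z = (d%:R * al%:R) *: b i + (d%:R * cl%:R) *: b j.
  by rewrite dE el scalerDr !scalerA.
have [|||||| ge0 _] := slope_ge0 eN eZ; try by rewrite ?mulr_ge0 ?ler0n.
- exact: (E_pos (V_bd hV) sN).
- have dd : 0 < d%:R :> rat by rewrite ltr0n.
  by rewrite mulrCA -mulrA ltr_pM2l.
have hZN : hz Z N.
  (* A map Z -> N induces an endomorphism of the brick V k of rank at most [sz Z], less than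
     [sz (V k)], hence zero. *)
  move=> g hg; have := (V_brick hV k).2 (p *m g *m f) (ishomM (ishomM hp hg) hf).
  case=> [z|/eqP r].
    by apply: (row_full_inj fp); apply: (row_free_inj ff); rewrite /= z mulmx0 mul0mx.
  have : (\rank (p *m g *m f) <= sz Z)%N.
    by rewrite -mulmxA; apply: leq_trans (mxrankM_maxl _ _) (rank_leq_col _).
  by rewrite r; clear - sE sN; lia.
have x0 : ext0 Z N by apply: hz_E_ext0 => //; apply/eqP; rewrite eq_le E_hz.
have [t ht tp] := ext_split s x0; have [r hr fr] := split_retract s ht tp.
have sm : summand N (V k) by apply/summandP; exists f, r.
have := iso_sz (summand_iso (V_indec hV k) sm sN); clear - sE sZ; lia.
Qed.

End Pair.

(** T consists of the modules in the torsion class generated by V i and V j that map to neither of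
    them; both are then minimal extending modules of T. *)
Lemma orth_steps i j : i <> j -> hz (V i) (V j) -> hz (V j) (V i) ->
  exists T Ti Tj, step T i Ti /\ step T j Tj.
Proof.
move=> ij hij hji.
pose G := lperp (fun Z => hz (V i) Z /\ hz (V j) Z).
pose T X := [/\ G X, hz X (V i) & hz X (V j)].
have tT : tors T.
  move=> X h; split.
  - by move=> Z hZ; apply: h => N [gN _ _]; exact: gN.
  - by apply: h => N [].
  - by apply: h => N [].
have Gi : G (V i) by move=> Z [].
have Gj : G (V j) by move=> Z [].
have tG : tors G by exact: tors_lperp.
have key k l : k <> l -> hz (V k) (V l) -> G (V k) ->
    (forall X, T X <-> [/\ G X, hz X (V k) & hz X (V l)]) -> step T k (gen_tors T (V k)).
  move=> kl hkl Gk TE; apply: step_cover => //.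
  - by move=> N /TE[].
  - move=> Y p hp fp lt; apply/TE; split.
    + exact: tors_quo tG hp fp Gk.
    + move=> g hg; have [z|/eqP r] := (V_brick hV k).2 (p *m g) (ishomM hp hg).
        by apply: (row_full_inj fp); rewrite z mulmx0.
      have : (\rank (p *m g) <= sz Y)%N by apply: leq_trans (mxrankM_maxl _ _) (rank_leq_col _).
      by rewrite r leqNgt lt.
    + exact: hz_surj hp fp hkl.
  move=> X N f p s TN pX; have /TE[GN hNk hNl] := TN.
  have GX : G X := tors_ext tG s Gk GN.
  have sE := ses_sz s.
  have [TX|nTX] := pselect (T X); first by have := tors_perp0 TX pX; clear - sE; lia.
  apply: (split_perp s (V_brick hV k) hNk (pX _ TN)).
  move=> hXk; apply: nTX; apply/TE; split=> //.
  exact: hz_ext1 s hkl hNl.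
exists T, (gen_tors T (V i)), (gen_tors T (V j)); split.
  exact: (key i j).
apply: (key j i) => //; first by move=> e; exact: ij (esym e).
by move=> X; split=> -[].
Qed.

End Polygon.

(** * The action of the picture group *)

Section Action.
Local Open Scope ring_scope.
Context {K : fieldType} {n : nat} {Q : modulated_quiver K n}.
Local Notation qmod := (@qmod K n Q).
Implicit Types X Y Z A B C I N W : qmod.
Implicit Types T P S : qmod -> Prop.
Context {m : nat} (V : 'I_m -> qmod).
Hypothesis hV : listing V.
Local Notation step := (step V).
Local Notation chain := (chain V).
Local Notation b k := (dv (V k)).
Local Notation f k := (E (V k) (V k)).
Local Notation state := ('rV[rat]_n * 'rV[rat]_n)%type.
Implicit Types x y : state.

(* The pair (dim Z, dim N) stands for a rigid module with torsion part N and
   torsion-free part Z; tau k moves to N the part of Z that is a multiple of V k. *)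
Definition prg k x : rat := eul Q (b k) x.1 + eul Q x.2 (b k).
Definition shift (v : 'rV[rat]_n) x : state := (x.1 - v, x.2 + v).
Definition coef k x : rat := Num.max 0 (prg k x) / f k.
Definition tau k x : state := shift (coef k x *: b k) x.
Definition acts (w : seq 'I_m) x : state := foldl (fun x k => tau k x) x w.

Lemma shift0 x : shift 0 x = x.
Proof. by case: x => u v; rewrite /shift subr0 addr0. Qed.
Lemma shiftD u v x : shift u (shift v x) = shift (v + u) x.
Proof. by rewrite /shift /= opprD !addrA. Qed.

Lemma f_gt0 k : 0 < f k. Proof. exact: V_Epos hV k. Qed.

Lemma prg_shift k v x : prg k (shift v x) = prg k x - eul Q (b k) v + eul Q v (b k).
Proof. by rewrite /prg /shift /= eulBr eulDl; ring. Qed.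

Lemma coef_ge0 k x : 0 <= coef k x.
Proof. by rewrite divr_ge0 ?le_max ?lexx // ltW // f_gt0. Qed.

Lemma coef_le0 k x : prg k x <= 0 -> coef k x = 0.
Proof. by move=> h; rewrite /coef max_l // mul0r. Qed.

Lemma coef_gt0 k x : 0 < prg k x -> coef k x = prg k x / f k.
Proof. by move=> h; rewrite /coef max_r // ltW. Qed.

Lemma tau_le0 k x : prg k x <= 0 -> tau k x = x.
Proof. by move=> h; rewrite /tau coef_le0 // scale0r shift0. Qed.

Lemma acts_cat u w x : acts (u ++ w) x = acts w (acts u x).
Proof. by rewrite /acts foldl_cat. Qed.

Lemma acts_le0 w x : (forall k, k \in w -> prg k x <= 0) -> acts w x = x.
Proof.
elim: w x => // k w IH x h; rewrite /= tau_le0; last by apply: h; rewrite mem_head.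
by apply: IH => l lw; apply: h; rewrite inE lw orbT.
Qed.

(** A shift by a multiple of b_k changes the two terms of [prg k] by opposite amounts. So the amount
    moved can be read off after the move, and [untau] inverts the piecewise linear [tau]. *)
Lemma prg_tau k x : prg k (tau k x) = prg k x.
Proof. by rewrite prg_shift eulZl eulZr subrK. Qed.

Definition untau k x : state := shift (- (coef k x *: b k)) x.

Lemma tauK k x : untau k (tau k x) = x.
Proof.
rewrite /untau {1}/coef prg_tau -/(coef k x) /tau shiftD addrN; exact: shift0.
Qed.

Lemma prg_untau k x : prg k (untau k x) = prg k x.
Proof. by rewrite prg_shift -scaleNr eulZl eulZr subrK. Qed.

Lemma untauK k x : tau k (untau k x) = x.
Proof.
rewrite /tau {1}/coef prg_untau -/(coef k x) /untau shiftD addNr; exact: shift0.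
Qed.

Lemma acts_shift w x : exists v, acts w x = shift v x /\
  forall (psi : 'rV[rat]_n -> rat), (forall u v, psi (u + v) = psi u + psi v) ->
    (forall a u, psi (a *: u) = a * psi u) ->
    (forall k, k \in w -> psi (b k) <= 0) -> psi v <= 0.
Proof.
elim: w x => [|k w IH] x.
  exists 0; split; first by rewrite shift0.
  by move=> psi _ pZ _; rewrite -(scale0r 0) pZ mul0r.
have [v [vE vP]] := IH (tau k x).
exists (coef k x *: b k + v); split; first by rewrite /= vE /tau shiftD.
move=> psi pD pZ neg; rewrite pD pZ.
have h1 : psi v <= 0 by apply: vP => // l lw; apply: neg; rewrite inE lw orbT.
have h2 : coef k x * psi (b k) <= 0.
  by apply: mulr_ge0_le0; [exact: coef_ge0|apply: neg; rewrite mem_head].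
lra.
Qed.

(** The K-dimension as a linear form; being positive on roots, it forbids cancellation between
    moves. *)
Definition wt (v : 'rV[rat]_n) : rat := \sum_j (vval Q j)%:R * v 0 j.

Lemma wtD u v : wt (u + v) = wt u + wt v.
Proof. by rewrite /wt -big_split; apply: eq_bigr => j _ /=; rewrite mxE mulrDr. Qed.
Lemma wtZ a u : wt (a *: u) = a * wt u.
Proof. by rewrite /wt mulr_sumr; apply: eq_bigr => j _; rewrite mxE; ring. Qed.
Lemma wt_dv X : wt (dv X) = (sz X)%:R.
Proof.
have -> : sz X = (\sum_j \rank (ev X j))%N by exact: sz_rank.
rewrite natr_sum; apply: eq_bigr => j _.
by rewrite mxE mulrC divfK // vval_neq0.
Qed.

Lemma wt_b k : 0 < wt (b k).
Proof. by rewrite wt_dv ltr0n; exact: V_sz hV k. Qed.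

Lemma acts_wt w x v : acts w x = shift v x -> 0 <= wt v.
Proof.
move=> e; have [u [uE uP]] := acts_shift w x.
have -> : v = u.
  by move: e; rewrite uE /shift => -[/addrI/oppr_inj].
suff : - wt u <= 0 by rewrite oppr_le0.
apply: (uP (fun u => - wt u)) => [a c|a c|k _].
- by rewrite wtD opprD.
- by rewrite wtZ mulrN.
- by rewrite oppr_le0 ltW // wt_b.
Qed.

(** The moves are nonnegative multiples of roots with sum zero, so positivity of [wt] makes every
    coefficient vanish. *)
Lemma acts_fix w x : acts w x = x -> forall k, k \in w -> prg k x <= 0.
Proof.
elim: w => // k w IH e.
have [v [vE vP]] := acts_shift w (tau k x).
have wv := acts_wt vE.
have e0 : coef k x *: b k + v = 0.
  move: e; rewrite /= vE /tau shiftD => /(congr1 snd) /= e.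
  by apply: (addrI x.2); rewrite e addr0.
have c0 : coef k x = 0.
  have h : coef k x * wt (b k) + wt v = 0 by rewrite -wtZ -wtD e0 -(scale0r 0) wtZ mul0r.
  have h1 := coef_ge0 k x; have h2 := wt_b k.
  have h3 : 0 <= coef k x * wt (b k) by apply: mulr_ge0 => //; exact: ltW.
  have /eqP : coef k x * wt (b k) = 0 by lra.
  by rewrite mulf_eq0 (gt_eqF h2) orbF => /eqP.
have tx : tau k x = x by rewrite /tau c0 scale0r shift0.
move=> l; rewrite inE => /orP[/eqP ->|lw]; last by apply: IH => //; move: e; rewrite /= tx.
rewrite leNgt; apply/negP => h; move: c0; rewrite coef_gt0 // => /eqP.
by rewrite mulf_eq0 invr_eq0 (gt_eqF h) (gt_eqF (f_gt0 k)).
Qed.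

(** A move depends on the state only through the values of [prg] on the letters, and is positively
    homogeneous in them. *)
Lemma acts_scale w x y c : 0 < c -> (forall k, k \in w -> prg k x = c * prg k y) ->
  exists v, acts w y = shift v y /\ acts w x = shift (c *: v) x.
Proof.
move=> c0; elim: w x y => [|k w IH] x y h.
  by exists 0; rewrite scaler0 !shift0.
have hk : coef k x = c * coef k y.
  rewrite /coef h ?mem_head // mulrA; congr (_ / _).
  by rewrite -{1}(mulr0 c) maxr_pMr // ltW.
have [|v [vy vx]] := IH (tau k x) (tau k y).
  move=> l lw; rewrite !prg_shift h ?inE ?lw ?orbT // hk !eulZl !eulZr; ring.
exists (coef k y *: b k + v); rewrite /= vy vx /tau !shiftD.
by rewrite hk scalerDr scalerA.
Qed.

Lemma homd_inj Y A X (i : 'M[K]_(sz A, sz X)) : ishom i -> row_free i -> (homd Y A <= homd Y X)%N.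
Proof.
move=> hi fi.
suff : (homd Y A <= \dim (0 : {vspace 'M[K]_(sz Y, sz A)})%VS + homd Y X)%N.
  by rewrite dimv0.
apply: (@dim_img_ker _ _ _ (linfun (mulmxr i))).
  move=> g /homVP hg; rewrite linfun_mulmxr memv0 => gi; apply/eqP.
  by apply: (row_free_inj fi); rewrite /= gi mul0mx.
by move=> g /homVP hg; rewrite linfun_mulmxr; apply/homVP/ishomM.
Qed.

(** Hom(N, Z) = 0 and, by hereditariness, Ext(N, Z) = 0, so E N N = E N M = dim Hom(N, M), which is
    at least dim Hom(N, N). *)
Lemma dec_rigid M N Z (i : 'M[K]_(sz N, sz M)) (p : 'M[K]_(sz M, sz Z)) : ses i p ->
  ext0 M M -> hz N Z -> ext0 N N.
Proof.
move=> s rM hNZ; case: (s) => hi hp fi fp _.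
have xNM := ext0_sub hi fi rM; have xNZ := ext0_quo hp fp xNM.
have eZ := E_hz_ext0 hNZ xNZ; have eM := (E_ext0 N M).1 xNM.
apply/E_ext0; apply/eqP; rewrite eq_le E_le_hom /=.
have -> : E N N = E N M by move: eZ; rewrite /E (dv_ses s) eulDr; lra.
by rewrite eM ler_nat; exact: homd_inj hi fi.
Qed.

(** The part B of Z that becomes torsion has dimension a b_k. If a > 0, rigidity of M gives E N (V
    k) = 0 and E (V k) Z' = 0, so [prg k] is a f_k and exactly B is moved. If a = 0, both terms of
    [prg k] are nonpositive and nothing moves. *)
Lemma peel_step T k T1 M N Z (i : 'M[K]_(sz N, sz M)) (p : 'M[K]_(sz M, sz Z)) :
  step T k T1 -> ext0 M M -> ses i p -> T N -> perp T Z ->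
  exists N' Z' (i' : 'M[K]_(sz N', sz M)) (p' : 'M[K]_(sz M, sz Z')),
    [/\ ses i' p', T1 N', perp T1 Z' & tau k (dv Z, dv N) = (dv Z', dv N')].
Proof.
move=> st rM s TN pZ; have [tT tT1 TT1 _] := st; have [T1k pk] := step_in st.
have [B [Z' [j [q [s2 T1B pZ']]]]] := tors_dec Z tT1.
have [N' [i1 [t1 [t [s3 s4 _ _]]]]] := ses_pull s s2.
have T1N : T1 N by exact: TT1.
have T1N' : T1 N' := tors_ext tT1 s3 T1N T1B.
exists N', Z', t, (p *m q); split=> //.
have pB : perp T B by case: (s2) => hj _ fj _ _; exact: perp_sub pZ.
have [a aE] := step_dv hV st T1B pB.
have [hi fi] : ishom i /\ row_free i by case: s.
have [ht ft] : ishom t /\ row_free t by case: s4.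
have [hp fp] : ishom p /\ row_full p by case: s.
have [hpq fpq] : ishom (p *m q) /\ row_full (p *m q) by case: s4.
have eNZ := E_hz_ext0 (pZ _ TN) (ext0_quo hp fp (ext0_sub hi fi rM)).
have eNZ' := E_hz_ext0 (pZ' _ T1N) (ext0_quo hpq fpq (ext0_sub hi fi rM)).
have eN'Z' := E_hz_ext0 (pZ' _ T1N') (ext0_quo hpq fpq (ext0_sub ht ft rM)).
have dZ := dv_ses s2; have dN' := dv_ses s3.
have fk := f_gt0 k.
have [a0|a0] := eqVneq (a%:R : rat) 0.
  rewrite a0 scale0r in aE.
  have -> : dv Z = dv Z' by rewrite dZ aE add0r.
  have -> : dv N' = dv N by rewrite dN' aE addr0.
  rewrite tau_le0 // /prg /=; have h1 := E_hz (pZ' _ T1k); have h2 := E_hz (pk _ TN).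
  by move: h1 h2; rewrite /E; lra.
have ap : 0 < (a%:R : rat) by rewrite lt_def a0 ler0n.
have eNB : a%:R * E N (V k) = 0.
  by move: eNZ; rewrite /E dZ aE eulDr eulZr; move: eNZ'; rewrite /E; lra.
have eBZ' : a%:R * E (V k) Z' = 0.
  by move: eN'Z'; rewrite /E dN' aE eulDl eulZl; move: eNZ'; rewrite /E; lra.
move/eqP: eNB; rewrite mulf_eq0 (negPf a0) /= => /eqP eNk.
move/eqP: eBZ'; rewrite mulf_eq0 (negPf a0) /= => /eqP ekZ'.
have pE : prg k (dv Z, dv N) = a%:R * f k.
  by rewrite /prg /= dZ aE eulDr eulZr -!/(E _ _) eNk ekZ'; ring.
have cE : coef k (dv Z, dv N) = a%:R.
  by rewrite coef_gt0 pE ?mulfK ?gt_eqF // mulr_gt0.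
by rewrite /tau cE /shift /= -aE dZ dN' addrAC subrr add0r.
Qed.

Lemma peel T w S M N Z (i : 'M[K]_(sz N, sz M)) (p : 'M[K]_(sz M, sz Z)) :
  chain T w S -> ext0 M M -> ses i p -> T N -> perp T Z ->
  exists N' Z' (i' : 'M[K]_(sz N', sz M)) (p' : 'M[K]_(sz M, sz Z')),
    [/\ ses i' p', S N', perp S Z' & acts w (dv Z, dv N) = (dv Z', dv N')].
Proof.
elim: w T N Z i p => [|k w IH] T N Z i p.
  by move=> /chain_nil <- _ s TN pZ; exists N, Z, i, p.
move=> [T1 [st c]] rM s TN pZ.
have [N1 [Z1 [i1 [p1 [s1 T1N pZ1 e1]]]]] := peel_step st rM s TN pZ.
by rewrite /= e1; exact: IH c rM s1 T1N pZ1.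
Qed.

Lemma peel_all T w S M : tors T -> chain T w S -> ext0 M M -> perp T M -> S M ->
  acts w (dv M, 0) = (0, dv M).
Proof.
move=> tT c rM pM SM; have [N [Z [i [p [s TN pZ]]]]] := tors_dec M tT.
have zN : sz N = 0%N.
  by case: (s) => hi _ fi _ _; apply: tors_perp0 TN _; exact: perp_sub pM.
have dN := sz0_dv zN; have dM := dv_ses s; rewrite dN add0r in dM.
have [N' [Z' [i' [p' [s' SN' pZ' e]]]]] := peel c rM s TN pZ.
have zZ' : sz Z' = 0%N.
  have tS := chain_tors tT c.
  by case: (s') => _ hp _ fp _; apply: tors_perp0 _ pZ'; exact: tors_quo tS hp fp SM.
have -> : (dv M, 0) = (dv Z, dv N) by rewrite dM dN.
by rewrite e (dv_ses s') (sz0_dv zZ') addr0.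
Qed.

Section PolyAct.
Variables (T : qmod -> Prop) (i j : 'I_m) (Ti Tj : qmod -> Prop).
Hypotheses (si : step T i Ti) (sj : step T j Tj) (ij : i <> j).
Hypothesis xij : ext0 (V i) (V j).
Variable w : seq 'I_m.
Hypothesis cw : chain T (j :: w) (join_tors V T i j).

Lemma pow_ex (p q : nat) : exists X, [/\ join_tors V T i j X, perp T X &
  dv X = p%:R *: b i + q%:R *: b j].
Proof.
have [tT _ _ _] := si; have tJ := @join_torsP _ _ _ _ V T i j.
have pi := (step_in si).2; have pj := (step_in sj).2.
have h : exists X, [/\ join_tors V T i j X, perp T X & dv X = q%:R *: b j].
  elim: q => [|q [X [JX pX e]]].
    have [N [Z [u [v [s TN pZ]]]]] := tors_dec (V i) (@tors_lperp _ _ _ (fun Z => True)).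
    have z : sz N = 0%N by apply/hz_id/TN.
    exists N; split; [exact: tors_sz0|exact: perp_sz0|by rewrite scale0r sz0_dv].
  exists (dsum X (V j)); have d := dsumP X (V j); split.
  - by apply: tors_ds tJ d JX _; exact: join_j.
  - exact: perp_ds d pX pj.
  - by rewrite (dv_ds d) e -natr1 scalerDl scale1r.
elim: p => [|p [X [JX pX e]]]; first by have [X [JX pX e]] := h; exists X; rewrite scale0r add0r.
exists (dsum X (V i)); have d := dsumP X (V i); split.
- by apply: tors_ds tJ d JX _; exact: join_i.
- exact: perp_ds d pX pi.
- by rewrite (dv_ds d) e -natr1 scalerDl scale1r addrAC.
Qed.

Lemma rat_common (r s : rat) : 0 <= r -> 0 <= s -> exists p q N : nat,
  [/\ (0 < N)%N, r = p%:R / N%:R & s = q%:R / N%:R].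
Proof.
move=> r0 s0.
exists (`|numq r| * `|denq s|)%N, (`|numq s| * `|denq r|)%N, (`|denq r| * `|denq s|)%N.
have h (t : rat) : 0 <= t -> t = `|numq t|%:R / `|denq t|%:R.
  move=> t0; rewrite -{1}[t]divq_num_den !natr_absz; congr (_%:~R / _%:~R).
    by rewrite ger0_norm // numq_ge0.
  by rewrite gtr0_norm // denq_gt0.
have d0 (t : rat) : (`|denq t|%:R : rat) != 0 by rewrite pnatr_eq0 absz_eq0 denq_eq0.
split; first by rewrite muln_gt0 !absz_gt0 !denq_eq0.
  by rewrite {1}(h r r0) !natrM; have dr := d0 r; have ds := d0 s; field; rewrite dr ds.
by rewrite {1}(h s s0) !natrM; have dr := d0 r; have ds := d0 s; field; rewrite dr ds.
Qed.

(** If [tau i] or the following [tau j] moves nothing, vanishing of Hom between labels makes the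
    letters of j :: w idle, except possibly j or i. If both move, x has, up to a positive scalar,
    the same values of [prg] as (dim M, 0) for a rigid M of the heart with dim M = p b_i + q b_j. By
    [peel_all] all of M is moved, and this is also what the word i, j moves. *)
Lemma polygon_acts x : acts [:: i; j] x = acts (j :: w) x.
Proof.
have hij := cover_hz hV si sj ij; have eij := E_hz_ext0 hij xij.
have hji := cover_hz hV sj si (fun e => ij (esym e)); have eji := E_hz hji.
have [w' wE] := polygon_last hV si sj ij cw.
have memc k : k \in j :: w -> exists a c, comb V i j k a c.
  by move/(polygon_mem hV si sj ij xij cw).
have prc k a c y : comb V i j k a c -> prg k y = a%:R * prg i y + c%:R * prg j y.
  by move=> e; rewrite /prg e !(eulDl, eulDr) !(eulZl, eulZr); ring.
have fi := f_gt0 i; have fj := f_gt0 j.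
have prj y : prg j (tau i y) = prg j y - coef i y * E (V j) (V i).
  by rewrite prg_shift !eulZl !eulZr -!/(E _ _) eij mulr0 addr0.
have pri y : prg i (tau j y) = prg i y + coef j y * E (V j) (V i).
  by rewrite prg_shift !eulZl !eulZr -!/(E _ _) eij mulr0 subr0.
rewrite [LHS](_ : _ = tau j (tau i x)) //.
have [A0|A0] := leP (prg i x) 0.
  rewrite (tau_le0 A0) (_ : acts (j :: w) x = acts w (tau j x)) //; have [B0|B0] := leP (prg j x) 0.
    rewrite (tau_le0 B0) acts_le0 // => k kw; have [|a [c e]] := memc k.
      by rewrite inE kw orbT.
    by rewrite (prc _ _ _ _ e); have := mulr_ge0_le0 (ler0n _ a) A0;
      have := mulr_ge0_le0 (ler0n _ c) B0; lra.
  rewrite acts_le0 // => k kw; have [|a [c e]] := memc k; first by rewrite inE kw orbT.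
  have hjk : hz (V j) (V k).
    by have [T1 [st c1]] := cw; apply: (chain_letter c1 kw).2; case: (step_in st).
  have := E_hz hjk; rewrite (prc _ _ _ _ e) pri {1}/tau prg_shift eulZl eulZr subrK.
  rewrite /E e eulDr !eulZr -!/(E _ _) => h; rewrite coef_gt0 //.
  have -> : a%:R * (prg i x + prg j x / f j * E (V j) (V i)) + c%:R * prg j x =
     a%:R * prg i x + prg j x / f j * (a%:R * E (V j) (V i) + c%:R * f j).
    by field; rewrite ?gt_eqF.
  have h1 := mulr_ge0_le0 (ler0n rat a) A0.
  have h2 : prg j x / f j * (a%:R * E (V j) (V i) + c%:R * f j) <= 0.
    by apply: mulr_ge0_le0 => //; apply: divr_ge0; exact: ltW.
  lra.
have cix : coef i x * f i = prg i x by rewrite coef_gt0 // divfK // gt_eqF.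
have [B0|B0] := leP (prg j (tau i x)) 0.
  have wE' : j :: w = (j :: w') ++ [:: i] by rewrite wE cats1.
  rewrite (tau_le0 B0) wE' acts_cat; suff -> : acts (j :: w') x = x by [].
  apply: acts_le0 => k kw.
  have kl : k \in j :: w by rewrite wE' mem_cat kw.
  have [a [c e]] := memc k kl.
  have hki : hz (V k) (V i).
    have cw' : chain T ((j :: w') ++ [:: i]) (join_tors V T i j) by rewrite -wE'.
    exact: (chain_hz cw' (mem_head _ _)).
  have := E_hz hki; rewrite /E e eulDl !eulZl -!/(E _ _) => h.
  rewrite (prc _ _ _ _ e) -cix; rewrite prj in B0.
  have h1 : c%:R * (prg j x - coef i x * E (V j) (V i)) <= 0 by apply: mulr_ge0_le0.
  have h2 := mulr_ge0_le0 (coef_ge0 i x) h.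
  have -> : a%:R * (coef i x * f i) + c%:R * prg j x =
    c%:R * (prg j x - coef i x * E (V j) (V i)) +
    coef i x * (a%:R * f i + c%:R * E (V j) (V i)) by ring.
  lra.
have cjx : coef j (tau i x) * f j = prg j (tau i x) by rewrite coef_gt0 // divfK // gt_eqF.
set al := coef i x in cix *; set be := coef j (tau i x) in cjx *.
have [p [q [N [N0 alE beE]]]] := rat_common (coef_ge0 i x) (coef_ge0 j (tau i x)).
rewrite -/al in alE; rewrite -/be in beE.
have [X [JX pX dX]] := pow_ex p q.
have tJ := @join_torsP _ _ _ _ V T i j.
have [|||M [[JM pM] dM rM]] := @rigid_ex _ _ _ (V_bd hV) (fun Y => join_tors V T i j Y /\ perp T Y) X.
- move=> A Y C u v s [JA pA] [JC pC]; split; first exact: tors_ext tJ s JA JC.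
  exact: perp_ext s pA pC.
- move=> A Y sA [JY pY]; split; first exact: tors_summand tJ sA JY.
  exact: perp_summand sA pY.
- by [].
have tT : tors T by case: si.
have eM := peel_all tT cw rM pM JM.
have N0' : 0 < (N%:R : rat) by rewrite ltr0n.
have [||v [vy vx]] := @acts_scale (j :: w) x (dv M, 0) (N%:R)^-1.
- by rewrite invr_gt0.
- move=> k kw; have [a [c e]] := memc k kw; rewrite !(prc _ _ _ _ e).
  have -> : prg i (dv M, 0) = N%:R * prg i x.
    rewrite -cix alE /prg /= eul0l addr0 dM dX eulDr !eulZr -!/(E _ _) eij mulr0 addr0.
    by field; rewrite ?gt_eqF.
  have -> : prg j (dv M, 0) = N%:R * prg j x.
    have -> : prg j x = be * f j + al * E (V j) (V i) by rewrite cjx prj subrK.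
    rewrite /prg /= eul0l addr0 dM dX eulDr !eulZr -!/(E _ _) alE beE.
    by field; rewrite ?gt_eqF.
  by field; rewrite ?gt_eqF.
have vE : v = dv M.
  by move: vy; rewrite eM /shift /= add0r => -[].
rewrite vx vE dM dX /= /tau -/al -/(tau i x) -/be {1}/tau -/al shiftD; congr shift.
rewrite scalerDr !scalerA alE beE; congr (_ *: _ + _ *: _); exact: mulrC.
Qed.

End PolyAct.
End Action.

(** * Positive words for the Coxeter element *)

Section Words.
Local Open Scope ring_scope.
Context {K : fieldType} {n : nat} {Q : modulated_quiver K n}.
Local Notation qmod := (@qmod K n Q).
Implicit Types X Y Z A B C I N W : qmod.
Implicit Types T P S : qmod -> Prop.
Context {m : nat} (M : 'I_m -> rep Q) (V : 'I_m -> qmod).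

(** The dictionary between the listed representations and matrix modules; [tr_len] turns the listing
    by length into one by total dimension. *)
Record transfer : Prop := Transfer {
  tr_listing : listing V;
  tr_hom : forall i j, hom_zero (M i) (M j) <-> hz (V i) (V j);
  tr_ext : forall i j, ext_zero (M i) (M j) <-> ext0 (V i) (V j);
  tr_dim : forall k v, dv (V k) 0 v = (dimvec (M k) v)%:R;
  tr_sub : forall j k, rep_sub (M j) (M k) <->
    exists f : 'M[K]_(sz (V j), sz (V k)), ishom f /\ row_free f;
  tr_len : forall j k : 'I_m, (\sum_v dimvec (M j) v < \sum_v dimvec (M k) v)%N -> (j < k)%N
}.
Hypothesis tr : transfer.
Local Notation hV := (tr_listing tr).
Local Notation step := (step V).
Local Notation chain := (chain V).
Local Notation b k := (dv (V k)).
Local Notation acts := (acts V).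
Local Notation state := ('rV[rat]_n * 'rV[rat]_n)%type.
Implicit Types x y : state.

Lemma comb_root i j k a c : comb V i j k a c <-> root_comb M i j k a c.
Proof.
have mxl (y z : 'rV[rat]_n) p q v : (p *: y + q *: z) 0 v = p * y 0 v + q * z 0 v.
  by rewrite !mxE.
split=> [e v|e].
  have := congr1 (fun u : 'rV[rat]_n => u 0 v) e; rewrite mxl !(tr_dim tr) => h.
  by apply/eqP; rewrite -(eqr_nat rat) natrD !natrM; apply/eqP.
by apply/rowP => v; rewrite mxl !(tr_dim tr) (e v) natrD !natrM.
Qed.

Lemma word_prodE w : word_prod M w = pres_class (picture_rel M) (letters w).
Proof.
rewrite /word_prod; elim: w => [|k w IH]; first by rewrite big_nil.
rewrite big_cons IH; exact: (pres_mulE (picture_rel M)).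
Qed.

Lemma word_prod_cat u w : word_prod M (u ++ w) = (word_prod M u * word_prod M w)%g.
Proof. by rewrite /word_prod big_cat. Qed.

Lemma word_prod_eq u w : word_prod M u = word_prod M w <->
  pres_eq (picture_rel M) (letters u) (letters w).
Proof. by rewrite !word_prodE; exact: pres_classP. Qed.

Lemma hom_orthP i j : hom_orthogonal M i j <-> [/\ i <> j, hz (V i) (V j) & hz (V j) (V i)].
Proof.
split=> [[/eqP ij /(tr_hom tr) h1 /(tr_hom tr) h2]|[/eqP ij h1 h2]]; split=> //.
  exact/(tr_hom tr).
exact/(tr_hom tr).
Qed.

Lemma polygon_comb_word T i j Ti Tj w : step T i Ti -> step T j Tj -> i <> j ->
  ext0 (V i) (V j) -> chain T (j :: w) (join_tors V T i j) -> comb_word M i j (j :: w).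
Proof.
move=> si sj ij xij cw; split.
- exact: (chain_uniq hV cw).
- move=> k; apply: (iff_trans (polygon_mem hV si sj ij xij cw k)).
  by split=> -[a [c /comb_root e]]; exists a, c.
move=> p q /andP[pq qs] a c a' c' /comb_root e1 /comb_root e2.
set l := j :: w in qs e1 e2 *.
have lE : l = take q l ++ nth i l q :: drop q.+1 l by rewrite -drop_nth // cat_take_drop.
apply: (polygon_order hV si sj ij xij cw lE _ e1 e2).
rewrite -(nth_take i pq); apply: mem_nth; rewrite size_take qs.
exact: pq.
Qed.

(** Both words have the same letters, and a first difference would put two roots in opposite strict
    slope orders. *)
Lemma comb_word_uniq i j w l : comb_word M i j w -> comb_word M i j l -> w = l.
Proof.
pose R k k' := forall a c a' c', root_comb M i j k a c -> root_comb M i j k' a' c' ->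
  (a * c' < a' * c)%N.
pose S (k : 'I_m) := exists a c, root_comb M i j k a c.
have h u : comb_word M i j u -> [/\ uniq u, forall k, k \in u -> S k &
    forall (x : 'I_m) u1 u2 (y : 'I_m), u = u1 ++ x :: u2 -> y \in u2 -> R x y].
  move=> [un mem ord]; split=> // [k|x u1 u2 y e yu]; first by move/mem.
  have np : nth i u (size u1) = x by rewrite e nth_cat ltnn subnn.
  have nq : nth i u (size u1 + (index y u2).+1)%N = y.
    by rewrite e nth_cat ltnNge leq_addr /= addKn /= nth_index.
  have := ord (size u1) (size u1 + (index y u2).+1)%N.
  rewrite np nq; apply; apply/andP; split; first by rewrite addnS ltnS leq_addr.
  by rewrite e size_cat /= ltn_add2l ltnS index_mem.
move=> cw cl; have [uw Sw Rw] := h w cw; have [ul Sl Rl] := h l cl.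
have mem : w =i l.
  by move=> k; apply/idP/idP; [move/(let: And3 _ a _ := cw in a)/(let: And3 _ a _ := cl in a)|
    move/(let: And3 _ a _ := cl in a)/(let: And3 _ a _ := cw in a)].
clear cw cl h; elim: w l uw ul Sw Sl Rw Rl mem => [|x w IH] [|y l] //.
- by move=> _ _ _ _ _ _ /(_ y); rewrite mem_head.
- by move=> _ _ _ _ _ _ /(_ x); rewrite mem_head.
move=> uw ul Sw Sl Rw Rl mem.
have xy : x = y.
  apply/eqP/negPn/negP => nxy.
  have yw : y \in w by have := mem y; rewrite mem_head inE eq_sym (negPf nxy).
  have xl : x \in l by have := mem x; rewrite mem_head inE (negPf nxy) /= => /esym.
  have [a [c e]] := Sw x (mem_head _ _); have [a' [c' e']] := Sl y (mem_head _ _).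
  have h1 := Rw x [::] w y erefl yw _ _ _ _ e e'.
  by have := ltn_trans h1 (Rl y [::] l x erefl xl _ _ _ _ e' e); rewrite ltnn.
subst y; congr (_ :: _); move: uw ul => /= /andP[xw uw] /andP[xl ul]; apply: IH => //.
- by move=> k kw; apply: Sw; rewrite inE kw orbT.
- by move=> k kw; apply: Sl; rewrite inE kw orbT.
- by move=> z u1 u2 y e; apply: (Rw z (x :: u1) u2 y); rewrite e.
- by move=> z u1 u2 y e; apply: (Rl z (x :: u1) u2 y); rewrite e.
move=> k; have := mem k; rewrite !inE; have [->|] := eqVneq k x; last by [].
by rewrite (negPf xw) (negPf xl).
Qed.

Definition lact_letter (l : 'I_m * bool) x : state := if l.2 then untau V l.1 x else tau V l.1 x.
Definition act (u : seq ('I_m * bool)) x : state := foldl (fun x l => lact_letter l x) x u.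

Lemma act_letters w x : act (letters w) x = acts w x.
Proof. by elim: w x => //= k w IH x; rewrite IH. Qed.

Lemma act_cat u w x : act (u ++ w) x = act w (act u x).
Proof. by rewrite /act foldl_cat. Qed.

(** Hom-orthogonal roots label two covers of a common torsion class, and uniqueness of the
    slope-ordered word identifies the relation with the two sides of that polygon. *)
Lemma rel_acts u w x : picture_rel M u w -> acts u x = acts w x.
Proof.
case=> i j {}w /hom_orthP[ij hij hji] /(tr_ext tr) xij cw.
have [T [Ti [Tj [si sj]]]] := orth_steps hV ij hij hji.
have [tT tTj TTj _] := sj.
have [l cl] := chain_exists hV tTj (@join_torsP _ _ _ _ V T i j)
  (fun X => @join_subj _ _ _ _ V hV T i j Tj sj X).
have cjl : chain T (j :: l) (join_tors V T i j) by exists Tj.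
rewrite (comb_word_uniq cw (polygon_comb_word si sj ij xij cjl)).
exact: (polygon_acts hV si sj ij xij cjl).
Qed.

Lemma pres_eq_act u w : pres_eq (picture_rel M) u w -> forall x, act u x = act w x.
Proof.
elim=> {u w}.
- by [].
- by move=> u w _ IH x.
- by move=> u v w _ IH1 _ IH2 x; rewrite IH1.
- by move=> u u' v v' _ IH1 _ IH2 x; rewrite !act_cat IH1.
- by move=> k [] x; rewrite /act /= /lact_letter /= ?tauK ?untauK.
- by move=> u v r x; rewrite !act_letters; exact: rel_acts.
Qed.

Lemma word_prod_acts u w x : word_prod M u = word_prod M w -> acts u x = acts w x.
Proof. by move/word_prod_eq/pres_eq_act => h; rewrite -!act_letters. Qed.

Lemma rel_prod u w : picture_rel M u w -> word_prod M u = word_prod M w.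
Proof. by move=> r; apply/word_prod_eq/pres_rel. Qed.

(** A nonsplit extension X of V k by V l has Hom(V k, X) = 0 and Hom(X, V l) = 0, which bounds E (V
    k) (V l) by -f_k and by -f_l. In both directions at once this would make the form nonpositive at
    b_i + b_j. *)
Lemma orth_ext i j : i <> j -> hz (V i) (V j) -> hz (V j) (V i) ->
  ext0 (V i) (V j) \/ ext0 (V j) (V i).
Proof.
have key k l : hz (V k) (V l) -> ~ ext0 (V k) (V l) ->
    E (V k) (V l) <= - E (V k) (V k) /\ E (V k) (V l) <= - E (V l) (V l).
  move=> hkl nx; have [X [f [p [s ns]]]] := ext_nonsplit nx; case: (s) => hf hp ff fp fe.
  have hkX : hz (V k) X.
    move=> g hg; have [gp|/(sq_free_inv (ishomM hg hp))[h [hh _ e]]] := (V_brick hV k).2 (g *m p) (ishomM hg hp).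
      have [|g' [hg' ->]] := fac_inj hf ff hg; first by rewrite fe; exact/sub_kermxP.
      by rewrite (hkl _ hg') mul0mx.
    by case: (ns (h *m g)); [exact: ishomM|rewrite -mulmxA].
  have hXl : hz X (V l).
    move=> g hg; have [gp|/(sq_free_inv (ishomM hf hg))[h [hh e e']]] := (V_brick hV l).2 (f *m g) (ishomM hf hg).
      have [|g' [hg' ->]] := fac_surj hp fp hg; first by rewrite -fe; exact/sub_kermxP.
      by rewrite (hkl _ hg') mulmx0.
    have hr : ishom (g *m h) by exact: ishomM.
    have hs : @ishom _ _ _ X X (1%:M - g *m h *m f).
      by apply: ishomB; [exact: ishom1|exact: ishomM].
    have [|t [ht tE]] := fac_surj hp fp hs.
      by rewrite -fe; apply/sub_kermxP; rewrite mulmxBr mulmx1 !mulmxA e mul1mx subrr.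
    case: (ns t ht); apply: (row_full_inj fp).
    by rewrite mulmxA -tE mulmxBl mul1mx mulmx1 -(mulmxA (g *m h)) (ses_mul0 s) mulmx0 subr0.
  have := E_hz hkX; have := E_hz hXl; rewrite /E (dv_ses s) eulDl eulDr; lra.
move=> ij hij hji; apply: contrapT => h.
have [h1 h2] : E (V i) (V j) <= - E (V i) (V i) /\ E (V i) (V j) <= - E (V j) (V j).
  by apply: key => // x; apply: h; left.
have [h3 h4] : E (V j) (V i) <= - E (V j) (V j) /\ E (V j) (V i) <= - E (V i) (V i).
  by apply: key => // x; apply: h; right.
have d := dsumP (V i) (V j); have sE := ds_sz d.
have : 0 < E (dsum (V i) (V j)) (dsum (V i) (V j)).
  by apply: (E_pos (V_bd hV)); have := V_sz hV i; rewrite sE; lia.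
by rewrite /E (dv_ds d) !eulDl !eulDr; move: h1 h2 h3 h4; rewrite /E; lra.
Qed.

(** Induction on the number of indecomposables still to enter. Chains with different first labels
    are both rerouted through the join of the two covers, where the polygon gives a defining
    relation. *)
Lemma chain_prod T S w w' : tors T -> tors S -> chain T w S -> chain T w' S ->
  word_prod M w = word_prod M w'.
Proof.
have [N] := ubnP (cnt V S - cnt V T)%N; elim: N T w w' => // N IH T w w' lN tT tS.
case: w => [|i u].
  move=> /chain_nil <-; case: w' => // k w' [T1 [st c]]; exfalso.
  have [T1k pk] := step_in st; have Tk := chain_sub c T1k.
  by have := tors_perp0 Tk pk; have := V_sz hV k; lia.
move=> [Ti [si ci]]; case: w' => [|j u'].
  move=> /chain_nil e; subst S; exfalso.
  have [T1k pk] := step_in si; have Tk := chain_sub ci T1k.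
  by have := tors_perp0 Tk pk; have := V_sz hV i; lia.
move=> [Tj [sj cj]].
have IHi k Tk w1 w2 : step T k Tk -> chain Tk w1 S -> chain Tk w2 S ->
    word_prod M (k :: w1) = word_prod M (k :: w2).
  move=> st c1 c2; rewrite -cat1s -[in RHS]cat1s !word_prod_cat; congr (_ * _)%g.
  have [_ tTk _ _] := st.
  have le := cnt_le V (fun X => @chain_sub _ _ _ _ _ _ _ _ X c1).
  have lt := cnt_step hV st.
  apply: IH c1 c2 => //; clear - lN le lt; lia.
have [e|/eqP ij] := eqVneq i j.
  by subst j; rewrite -(step_fun hV si sj) in cj; exact: IHi si ci cj.
have main k l Tk Tl w1 w2 : step T k Tk -> step T l Tl -> k <> l -> ext0 (V k) (V l) ->
    chain Tk w1 S -> chain Tl w2 S -> word_prod M (k :: w1) = word_prod M (l :: w2).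
  move=> sk sl kl x c1 c2.
  have tJ := @join_torsP _ _ _ _ V T k l; have [_ tTl _ _] := sl.
  have [r cr] := chain_exists hV tTl tJ (fun X => @join_subj _ _ _ _ V hV T k l Tl sl X).
  have clr : chain T (l :: r) (join_tors V T k l) by exists Tl.
  have JS X : join_tors V T k l X -> S X.
    apply: join_min => //.
    - by move=> Y TY; case: sk => _ _ h _; apply: chain_sub c1 _; exact: h.
    - by apply: chain_sub c1 _; case: (step_in sk).
    - by apply: chain_sub c2 _; case: (step_in sl).
  have [v cv] := chain_exists hV tJ tS JS.
  have skl : chain Tk [:: l] (join_tors V T k l).
    by exists (join_tors V T k l); split=> //; exact: (step_join hV sk sl kl x).
  have -> : word_prod M (k :: w1) = word_prod M (k :: ([:: l] ++ v)).
    by apply: (IHi _ _ _ _ sk c1); apply/chain_cat; exists (join_tors V T k l).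
  have -> : word_prod M (l :: w2) = word_prod M (l :: (r ++ v)).
    by apply: (IHi _ _ _ _ sl c2); apply/chain_cat; exists (join_tors V T k l).
  rewrite -[_ :: _]/([:: k; l] ++ v) -[_ :: r ++ v]/((l :: r) ++ v) !word_prod_cat.
  congr (_ * _)%g; apply: rel_prod; apply: PictureRel.
  - apply/hom_orthP; split=> //; first exact: (cover_hz hV sk sl kl).
    by apply: (cover_hz hV sl sk); exact: nesym.
  - exact/(tr_ext tr).
  - exact: (polygon_comb_word sk sl kl x clr).
have hij := cover_hz hV si sj ij; have hji := cover_hz hV sj si (nesym ij).
have [x|x] := orth_ext ij hij hji; first exact: main si sj ij x ci cj.
by symmetry; exact: main sj si (nesym ij) x cj ci.
Qed.

Definition Tzero X := sz X = 0%N.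
Definition Tall X := True.

Lemma tors_Tzero : tors Tzero.
Proof. by move=> X h; apply/hz_id/h => N sN; exact: hz_sz0_l. Qed.
Lemma tors_Tall : tors Tall. Proof. by []. Qed.
Lemma perp_Tzero X : perp Tzero X. Proof. by move=> N sN; exact: hz_sz0_l. Qed.

Section Coxeter.
Variable s : seq 'I_m.
Hypothesis cs : chain Tzero s Tall.

(** Only the dimension vector matters, so X may be replaced by a rigid module, to which [peel_all]
    applies along s. *)
Lemma acts_full w X : word_prod M w = word_prod M s -> acts w (dv X, 0) = (0, dv X).
Proof.
move/word_prod_acts => ->.
have [|||Y [_ <- rY]] := @rigid_ex _ _ _ (V_bd hV) (fun _ => True) X; try by [].
by apply: (peel_all hV tors_Tzero cs rY) => //; exact: perp_Tzero.
Qed.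

Lemma acts_perp u T X : chain Tzero u T -> perp T X -> acts u (dv X, 0) = (dv X, 0).
Proof.
move=> cu pX; apply: acts_le0 => k ku; have [Tk _] := chain_letter cu ku.
by rewrite /prg /= eul0l addr0; exact: E_hz (pX _ Tk).
Qed.

(** The torsion part N of V k is rigid, so u already moves all of it and v fixes (0, dim N). By
    [acts_fix] then E N (V k) <= 0, whereas a nonzero submodule N of the rigid V k has E N (V k) >
    0. *)
Lemma letters_perp u v T k : word_prod M (u ++ v) = word_prod M s -> chain Tzero u T ->
  k \in v -> perp T (V k).
Proof.
move=> e cu kv; have tT := chain_tors tors_Tzero cu.
have [N [Z [i [p [ss TN pZ]]]]] := tors_dec (V k) tT.
have rk := V_rigid hV k; case: (ss) => hi hp fi fp _.
have rN : ext0 N N := dec_rigid ss rk (pZ _ TN).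
have := acts_full N e; rewrite acts_cat.
rewrite (peel_all hV tors_Tzero cu rN (@perp_Tzero _) TN) => /(acts_fix hV)/(_ k kv).
rewrite /prg /= eul0r add0r -/(E N (V k)) => le0.
have zN : sz N = 0%N.
  apply: contrapT => nz; have nh : ~ hz N (V k).
    by move=> /(_ _ hi) f0; apply: nz; exact: row_free_sz0 f0.
  by have := E_nhz_ext0 nh (ext0_sub hi fi rk); lra.
have sE := ses_sz ss.
by apply: (perp_iso _ pZ); apply: iso_sym; apply: (surj_sz_iso hp fp); clear - sE zN; lia.
Qed.

(** The prefix u does not move (dim X, 0), so k acts first, with coefficient E (V k) X / f_k = dim
    Hom(V k, X) / dim End(V k), at least 1 by [brick_hom_le]. The remainder y is left to v. *)
Lemma coef_ge1 u k v T X : word_prod M (u ++ k :: v) = word_prod M s -> chain Tzero u T ->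
  perp T X -> ~ hz (V k) X -> ext0 (V k) X ->
  exists (a : rat) (y : 'rV[rat]_n), [/\ 1 <= a, dv X = a *: b k + y &
    forall psi : 'rV[rat]_n -> rat, (forall u v, psi (u + v) = psi u + psi v) ->
    (forall a u, psi (a *: u) = a * psi u) ->
    (forall l, l \in v -> psi (b l) <= 0) -> psi y <= 0].
Proof.
move=> e cu pX nh x0; have := acts_full X e.
rewrite acts_cat (acts_perp cu pX) /=; set x := (dv X, 0).
have [y [yE yP]] := acts_shift hV v (tau V k x); rewrite yE /tau shiftD => e'.
exists (coef V k x), y; split=> //.
  have f0 := f_gt0 hV k.
  have eX := (E_ext0 (V k) X).1 x0.
  have ek := (E_ext0 (V k) (V k)).1 (V_rigid hV k).
  have pE : prg V k x = E (V k) X by rewrite /prg /= eul0l addr0.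
  have le : E (V k) (V k) <= E (V k) X.
    by rewrite eX ek ler_nat; apply: brick_hom_le => //; exact: (V_brick hV k).
  have gt := lt_le_trans f0 le.
  by rewrite coef_gt0 pE // ler_pdivlMr // mul1r.
by move: e' => /(congr1 snd) /=; rewrite add0r => ->.
Qed.

(** By [coef_ge1] a nonzero torsion-free quotient Z of V k has dim Z = a b_k + y with a >= 1 and y
    of nonnegative weight, so it is no smaller than V k. *)
Lemma word_ext_quo u k v T : word_prod M (u ++ k :: v) = word_prod M s -> chain Tzero u T ->
  ext_quo T (V k).
Proof.
move=> e cu Y p hp fp lt; have tT := chain_tors tors_Tzero cu.
have [N [Z [i [q [ss TN pZ]]]]] := tors_dec Y tT; case: (ss) => hi hq fi fq _.
have sE := ses_sz ss.
have zZ : sz Z = 0%N.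
  apply: contrapT => nz.
  have hpq := ishomM hp hq.
  have fpq : row_full (p *m q).
    by rewrite /row_full -mxrank_tr trmx_mul mxrankMfree ?mxrank_tr // /row_free mxrank_tr.
  have nh : ~ hz (V k) Z by move=> /(_ _ hpq) z; apply: nz; exact: row_full_sz0 z.
  have [a [y [a1 dZ yP]]] := coef_ge1 e cu pZ nh (ext0_quo hpq fpq (V_rigid hV k)).
  have wy : 0 <= wt (Q := Q) y.
    rewrite -oppr_le0; apply: (yP (fun u => - wt u)) => [c d|c d|l _].
    - by rewrite wtD opprD.
    - by rewrite wtZ mulrN.
    - by rewrite oppr_le0; exact: (ltW (wt_b hV l)).
  have := wt_dv Z; rewrite dZ wtD wtZ wt_dv => wE.
  have : ((sz Z)%:R : rat) < (sz (V k))%:R by rewrite ltr_nat; clear - sE lt; lia.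
  have := ler_wpM2r (ler0n rat (sz (V k))) a1; rewrite mul1r; lra.
by apply: (tors_iso tT _ TN); apply: (inj_sz_iso hi fi); clear - sE zZ; lia.
Qed.

(** A counterexample X of least size is indecomposable, hence rigid, and dim X = a b_k + y as in
    [coef_ge1]. The later letters are torsion-free, so E N y <= 0 and E N X <= E N (V k); but E N X
    = E N (V k) + E N N with E N N > 0. *)
Lemma word_ext_ses u k v T : word_prod M (u ++ k :: v) = word_prod M s -> chain Tzero u T ->
  ext_tors T (V k).
Proof.
move=> e cu; have tT := chain_tors tors_Tzero cu.
have P1 := word_ext_quo e cu.
have pk : perp T (V k) by apply: letters_perp e cu (mem_head _ _).
have sk := V_sz hV k; have rk := V_rigid hV k.
have [//|nP] := pselect (ext_tors T (V k)); exfalso.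
pose R d := exists X N (i : 'M[K]_(sz (V k), sz X)) (p : 'M[K]_(sz X, sz N)),
  [/\ ses i p, T N, perp T X, (0 < sz N)%N & sz X = d].
have [|d [X [N [i [p [ss TN pX sN dX]]]]] mn] := @ex_min_nat R.
  apply: contrapT => h; apply: nP => X N i p ss TN pX; apply: contrapT => nz.
  by apply: h; exists (sz X), X, N, i, p; split=> //; rewrite lt0n; apply/eqP.
have sE := ses_sz ss; case: (ss) => hi hp fi fp ie.
(* If X decomposed, minimality would make both summands copies of V k, so dim N = b_k, against E N
   (V k) <= 0. *)
have iX : indec X.
  apply: contrapT => niX.
  have [f [hf [ff [n0 n1]]]] : exists f : 'M[K]_(sz X),
      @ishom _ _ _ X X f /\ f *m f = f /\ f <> 0 /\ f <> 1%:M.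
    apply: contrapT => h; apply: niX; split; first by clear - sE sk; lia.
    move=> f hf ff; apply: contrapT => h'.
    by apply: h; exists f; do 2 split=> //; split=> h''; apply: h'; [left|right].
  have [A [B [dAB sA sB]]] := idem_ds hf ff n0 n1; have sAB := ds_sz dAB.
  have part A' B' : ds A' B' X -> (0 < sz A')%N -> (0 < sz B')%N -> sz A' = sz (V k).
    move=> dA sA' sB'; have [pA [hpA fpA]] := ds_surjl dA.
    have pA' : perp T A' by apply: perp_summand pX; exists B'.
    have sA2 := ds_sz dA.
    have [z|nz] := eqVneq (i *m pA) 0.
      exfalso; have [|g [hg gE]] := fac_surj hp fp hpA; first by rewrite -ie; exact/sub_kermxP.
      have fg : row_full g.
        rewrite /row_full eqn_leq rank_leq_col -[X in (X <= _)%N](eqP fpA) gE; exact: mxrankM_maxr.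
      by have := tors_perp0 (tors_quo tT hg fg TN) pA'; clear - sA'; lia.
    have fiA := perp_map_inj P1 pA' (ishomM hi hpA) nz.
    have [C [q sC]] := cok_ses (ishomM hi hpA) fiA; have sEC := ses_sz sC.
    case: (sC) => _ hq _ fq _.
    have TC : T C.
      have hpq := ishomM hpA hq.
      have [|g [hg gE]] := fac_surj hp fp hpq.
        by rewrite -ie; apply/sub_kermxP; rewrite mulmxA (ses_mul0 sC).
      apply: (tors_quo tT hg _ TN).
      rewrite /row_full eqn_leq rank_leq_col /=.
      have fpq : row_full (pA *m q).
        by rewrite /row_full -mxrank_tr trmx_mul mxrankMfree ?mxrank_tr // /row_free mxrank_tr.
      rewrite -[X in (X <= _)%N](eqP fpq) gE; exact: mxrankM_maxr.
    have [/eqP zC|sC0] := posnP (sz C); first by move/eqP: zC => zC; clear - sEC zC; lia.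
    have /mn : R (sz A') by exists A', C, (i *m pA), q.
    rewrite -dX; clear - sA2 sA' sB'; lia.
  have eA := part A B dAB sA sB; have eB := part B A (ds_sym dAB) sB sA.
  have dvN : dv N = b k.
    have isoA A' B' : ds A' B' X -> (0 < sz A')%N -> (0 < sz B')%N -> dv A' = b k \/ i = 0.
      move=> dA sA' sB'; have eA' := part A' B' dA sA' sB'.
      have [pA [hpA fpA]] := ds_surjl dA.
      have pA' : perp T A' by apply: perp_summand pX; exists B'.
      have [z|nz] := eqVneq (i *m pA) 0.
        exfalso; have [|g [hg gE]] := fac_surj hp fp hpA; first by rewrite -ie; exact/sub_kermxP.
        have fg : row_full g.
          rewrite /row_full eqn_leq rank_leq_col -[X in (X <= _)%N](eqP fpA) gE; exact: mxrankM_maxr.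
        by have := tors_perp0 (tors_quo tT hg fg TN) pA'; clear - sA'; lia.
      have fiA := perp_map_inj P1 pA' (ishomM hi hpA) nz.
      by left; symmetry; apply: dv_iso; apply: (inj_sz_iso (ishomM hi hpA) fiA); rewrite eA'.
    have i0 : i <> 0 by move=> z; have := row_free_sz0 fi z; clear - sk; lia.
    have [dA|//] := isoA A B dAB sA sB; have [dB|//] := isoA B A (ds_sym dAB) sB sA.
    by have := dv_ses ss; rewrite (dv_ds dAB) dA dB => /addrI.
  have := E_hz (pk _ TN); rewrite /E dvN; have := V_Epos hV k; rewrite /E; lra.
have rX := indec_rigid (V_bd hV) iX.
have nh : ~ hz (V k) X by move=> /(_ _ hi) z; have := row_free_sz0 fi z; clear - sk; lia.
have [a [y [a1 dXE yP]]] := coef_ge1 e cu pX nh (ext0_sub hi fi rX).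
have yle : eul Q (dv N) y <= 0.
  apply: (yP (fun u => eul Q (dv N) u)) => [c c'|c c'|l lv].
  - exact: eulDr.
  - exact: eulZr.
  - by apply: E_hz; apply: (letters_perp e cu _ TN); rewrite inE lv orbT.
have qN := E_pos (V_bd hV) sN; have nk := E_hz (pk _ TN).
have dX1 := dv_ses ss.
have : eul Q (dv N) (dv X) = eul Q (dv N) (b k) + E N N by rewrite dX1 eulDr.
rewrite dXE eulDr eulZr -!/(E N (V k)) => h.
have : a * E N (V k) <= E N (V k) by rewrite -[X in _ <= X]mul1r ler_wnM2r.
lra.
Qed.

Lemma word_step u k v T : word_prod M (u ++ k :: v) = word_prod M s -> chain Tzero u T ->
  exists T1, step T k T1.
Proof.
move=> e cu; exists (gen_tors T (V k)); apply: (step_cover hV).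
- exact (chain_tors tors_Tzero cu).
- exact (letters_perp e cu (mem_head _ _)).
- exact (word_ext_quo e cu).
- exact (word_ext_ses e cu).
Qed.

Lemma word_chain w : word_prod M w = word_prod M s <-> chain Tzero w Tall.
Proof.
split=> [e|cw]; last exact: chain_prod tors_Tzero tors_Tall cw cs.
suff h u v T : u ++ v = w -> chain Tzero u T -> chain T v Tall.
  exact: (h [::] w Tzero).
elim: v u T => [|k v IH] u T uv cu.
  (* At the end of the word a torsion-free Z is not moved and yet moved completely, so Z = 0. *)
  rewrite cats0 in uv; subst w => X; split=> // _.
  have tT := chain_tors tors_Tzero cu.
  have [N [Z [i [p [ss TN pZ]]]]] := tors_dec X tT; case: (ss) => hi _ fi _ _.
  have sE := ses_sz ss.
  have := acts_full Z e; rewrite (acts_perp cu pZ) => -[/dv0_sz zZ _].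
  by apply: (tors_iso tT _ TN); apply: (inj_sz_iso hi fi); clear - sE zZ; lia.
have [T1 st] : exists T1, step T k T1 by apply: (@word_step u k v) => //; rewrite uv.
exists T1; split=> //; apply: (IH (u ++ [:: k])); first by rewrite -catA.
by apply/chain_cat; exists T; split=> //; exists T1.
Qed.

End Coxeter.
End Words.

(** * Comparison with representations *)

Section Model.
Import VectorInternalTheory.
Local Open Scope ring_scope.
Context {K : fieldType} {n : nat} {Q : modulated_quiver K n}.
Local Notation qmod := (@qmod K n Q).
Implicit Types U W : qmod.
Implicit Types X Y Z : rep Q.

(* U is X with all its spaces placed in one K-space of row vectors. *)
Record model X U (p : forall i, X i -> 'rV[K]_(sz U)) : Prop := Model {
  md_add : forall i (u v : X i), p i (u + v) = p i u + p i v;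
  md_inj : forall i, injective (p i);
  md_act : forall i (c : valg Q i) (v : X i), p i ((c : (valg Q i)^c) *: v) = p i v *m op U (GV c);
  md_arr : forall i j (a : arrow Q i j) (v : X i) x, p j (rmap X a v x) = p i v *m op U (GA x);
  md_img : forall i u, exists v, p i v = u *m ev U i
}.

Section ModelTheory.
Context {X : rep Q} {U : qmod} {p : forall i, X i -> 'rV[K]_(sz U)}.
Hypothesis mp : model p.
Arguments p : clear implicits.

Lemma md_ev i (v : X i) : p _ v *m ev U i = p _ v.
Proof. by rewrite -(md_act mp) scale1r. Qed.
Lemma md0 i : p _ (0 : X i) = 0.
Proof. by have := md_add mp (0 : X i) 0; rewrite addr0 => /eqP; rewrite -subr_eq0 opprD addNKr oppr_eq0 => /eqP. Qed.
Lemma md_eq0 i (v : X i) : p _ v = 0 -> v = 0.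
Proof. by rewrite -(md0 i) => /(md_inj mp). Qed.
Lemma md_inv : exists q : forall i, 'rV[K]_(sz U) -> X i,
  (forall i u, p _ (q i u) = u *m ev U i) /\ (forall i v, q i (p _ v) = v).
Proof.
have [q qP] : exists q : forall i, 'rV[K]_(sz U) -> X i, forall i u, p _ (q i u) = u *m ev U i.
  exists (fun i u => sval (cid (md_img mp i u))) => i u; exact: (svalP (cid (md_img mp i u))).
by exists q; split=> // i v; apply: (md_inj mp); rewrite qP md_ev.
Qed.
Lemma md_sum u : exists v : forall i, X i, u = \sum_i p i (v i).
Proof.
have [q [qP _]] := md_inv; exists (fun i => q i u).
by rewrite -[u in LHS]mulmx1 -ev_sum mulmx_sumr; apply: eq_bigr => i _; rewrite qP.
Qed.
Lemma md_ext N (A B : 'M[K]_(sz U, N)) : (forall i v, p i v *m A = p _ v *m B) -> A = B.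
Proof.
move=> e; apply/row_matrixP => k; rewrite !rowE; have [v ->] := md_sum (delta_mx 0 k).
by rewrite !mulmx_suml; apply: eq_bigr => i _.
Qed.
(** X i is a vector space over the converse of F_i only, so K acts through the scalars [k%:A]. *)
Lemma md_k i k (v : X i) : p _ ((k%:A : (valg Q i)^c) *: v) = k *: p _ v.
Proof.
rewrite (md_act mp).
have -> : op U (GV (k%:A : valg Q i)) = k *: ev U i.
  have := op_lin (opP U) (i := i) k 1 0; rewrite addr0 => ->.
  have -> : op U (GV (0 : valg Q i)) = 0.
    by have := op_lin (opP U) (i := i) (-1) 0 0; rewrite scaler0 addr0 scaleN1r addNr.
  by rewrite addr0.
by rewrite -scalemxAr md_ev.
Qed.
Lemma md_orth i j (v : X i) : i != j -> p _ v *m ev U j = 0.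
Proof. by move=> ij; rewrite -(md_ev v) -mulmxA ev_orth // mulmx0. Qed.
Lemma rep_zero_sz : rep_zero X <-> sz U = 0%N.
Proof.
split=> [z|z i v]; last by apply: md_eq0; apply: mx_sz0r.
have e : (1%:M : 'M[K]_(sz U)) = 0.
  by apply: md_ext => i v; rewrite (z i v) md0 !mul0mx.
by rewrite -[sz U](mxrank1 K) e mxrank0.
Qed.
End ModelTheory.

Section ModelHom.
Context {X Y : rep Q} {U W : qmod} {p : forall i, X i -> 'rV[K]_(sz U)}
  {q : forall i, Y i -> 'rV[K]_(sz W)}.
Arguments p : clear implicits.
Arguments q : clear implicits.
Hypotheses (mp : model p) (mq : model q).

Lemma rhom_hom (g : rhom X Y) : exists2 f : 'M[K]_(sz U, sz W), ishom f &
  forall i v, q i (g i v) = p i v *m f.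
Proof.
have [r [rP rK]] := md_inv mp.
have rD i u v : r i (u + v) = r i u + r i v.
  by apply: (md_inj mp); rewrite rP (md_add mp) !rP mulmxDl.
have rZ i k u : r i (k *: u) = (k%:A : (valg Q i)^c) *: r i u.
  by apply: (md_inj mp); rewrite rP (md_k mp) rP scalemxAl.
pose h u := \sum_i q i (g i (r i u)).
have hE i v : h (p i v) = q i (g i v).
  rewrite /h (bigD1 i) //= rK big1 ?addr0 // => j ji.
  have -> : r j (p i v) = 0.
    by apply: (md_eq0 mp); rewrite rP (md_orth mp) // eq_sym.
  by rewrite linear0 (md0 mq).
have [|f fP] := @linear_mx _ _ _ h.
  move=> k u v; rewrite /h scaler_sumr -big_split; apply: eq_bigr => i _ /=.
  by rewrite rD rZ !linearD linearZ (md_add mq) (md_k mq).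
exists f => [x|i v]; last by rewrite fP hE.
apply: (md_ext mp) => i v; rewrite !mulmxA.
case: x => [j c|j k a x].
  have [ij|ij] := eqVneq i j.
    by subst j; rewrite -(md_act mp) !fP !hE linearZ (md_act mq).
  rewrite -(md_ev mp v) -(mulmxA _ (ev U i)) (op_orth (opP U)) // mulmx0 mul0mx.
  by rewrite md_ev // fP hE -(md_ev mq) -mulmxA (op_orth (opP W)) // mulmx0.
have eA T (aT : arrow Q j k) y : op T (GA y) = ev T j *m op T (@GA _ _ _ j k aT y).
  by rewrite -(op_lact (opP T)) lact1.
have [ij|ij] := eqVneq i j.
  by subst j; rewrite -(md_arr mp) !fP !hE hmapP (md_arr mq).
rewrite (eA U) (eA W) !mulmxA (md_orth mp) // !mul0mx fP hE.
by rewrite (md_orth mq) // mul0mx.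
Qed.

Lemma hom_rhom (f : 'M[K]_(sz U, sz W)) : ishom f ->
  exists g : rhom X Y, forall i v, q i (g i v) = p i v *m f.
Proof.
move=> hf; have [r [rP rK]] := md_inv mq.
pose G i v := r i (p i v *m f).
have GE i v : q i (G i v) = p i v *m f.
  by rewrite rP -mulmxA -[f *m _](hf (GV 1)) mulmxA md_ev.
have Gl i : linear (G i).
  move=> c u v; apply: (md_inj mq).
  rewrite GE (md_add mp) (md_add mq) mulmxDl (md_act mp) (md_act mq) !GE.
  by rewrite -mulmxA hf mulmxA.
pose H i : {linear X i -> Y i} := HB.pack (G i) (@GRing.isLinear.Build _ _ _ _ (G i) (Gl i)).
have HP i j (a : arrow Q i j) (v : X i) x : H j (rmap X a v x) = rmap Y a (H i v) x.
  apply: (md_inj mq); rewrite [LHS]GE (md_arr mp) (md_arr mq) [q i _]GE.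
  by rewrite -!mulmxA hf.
by exists (RHom HP).
Qed.

Lemma rhom_inj_free (g : rhom X Y) (f : 'M[K]_(sz U, sz W)) :
  ishom f -> (forall i v, q i (g i v) = p i v *m f) -> rhom_inj g <-> row_free f.
Proof.
move=> hf e; split=> [gi|ff i u v guv].
  apply: inj_row_free => u uf.
  have [v vE] := md_sum mp u.
  suff z i : v i = 0 by rewrite vE big1 // => i _; rewrite z (md0 mp).
  apply: (gi i); rewrite linear0; apply: (md_eq0 mq); rewrite e.
  have -> : p i (v i) = u *m ev U i.
    rewrite vE mulmx_suml (bigD1 i) //= (md_ev mp) big1 ?addr0 // => j ji.
    by rewrite (md_orth mp).
  by rewrite -mulmxA [ev U i *m f]hf mulmxA uf mul0mx.
apply: (md_inj mp); apply: (row_free_inj ff) => /=.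
by rewrite -!e guv.
Qed.

Lemma rhom_surj_full (g : rhom X Y) (f : 'M[K]_(sz U, sz W)) :
  ishom f -> (forall i v, q i (g i v) = p i v *m f) -> rhom_surj g <-> row_full f.
Proof.
move=> hf e; split=> [gs|ff i w].
  rewrite -sub1mx; apply/row_subP => k; rewrite rowE mulmx1.
  have [w ->] := md_sum mq (delta_mx 0 k); apply: summx_sub => i _.
  by have [v <-] := gs i (w i); rewrite e submxMl.
have [v vE] := md_img mp i (q i w *m pinvmx f); exists v; apply: (md_inj mq).
rewrite e vE -mulmxA [ev U i *m f]hf mulmxA -(mulmxA (q i w)) mulVpmx // mulmx1.
exact: (md_ev mq).
Qed.
End ModelHom.

Lemma rank_param k N (h : 'rV[K]_k -> 'rV[K]_N) (e : 'M[K]_N) :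
  (forall a u v, h (a *: u + v) = a *: h u + h v) -> (forall u, h u = 0 -> u = 0) ->
  (forall u, exists v, h v = u *m e) -> (forall v, h v *m e = h v) -> \rank e = k.
Proof.
move=> hl hi hs he; have [B BP] := linear_mx hl.
have fB : row_free B by apply: inj_row_free => u; rewrite BP; exact: hi.
rewrite -(eqP fB); apply: eqmx_rank; apply/andP; split.
  by apply/row_subP => l; rewrite rowE; have [v <-] := hs (delta_mx 0 l); rewrite -BP submxMl.
by apply/row_subP => l; rewrite rowE BP -he submxMl.
Qed.

Lemma kcoords X i : exists (r : X i -> 'rV[K]_(dimvec X i * vval Q i)) r',
  [/\ cancel r r', cancel r' r &
      forall k u v, r ((k%:A : (valg Q i)^c) *: u + v) = k *: r u + r v].
Proof.
rewrite ffunE -valg_dim dimvf.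
pose F : falgType K := valg Q i; pose d := vector.dim (X i).
pose row_of (u : 'rV[K]_(d * vector.dim F)) : 'rV[F^c]_d :=
  \row_l (@r2v _ F (row l (vec_mx u)) : F^c).
pose r (v : X i) : 'rV[K]_(d * vector.dim F) := mxvec (\matrix_l @v2r _ F (v2r v 0 l)).
exists r, (fun u => @r2v _ (X i) (row_of u)); split=> [v|u|k u v].
- rewrite -[RHS]v2rK; congr r2v; apply/rowP => l.
  by rewrite mxE mxvecK rowK v2rK.
- rewrite -[RHS]vec_mxK; congr mxvec; apply/row_matrixP => l.
  by rewrite rowK r2vK mxE r2vK.
rewrite /r -linearP; congr mxvec; apply/row_matrixP => l.
rewrite rowK linearP [RHS]linearP /= !rowK.
transitivity (@v2r _ F (k *: (v2r u 0 l : F) + (v2r v 0 l : F))); last by rewrite linearP.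
have e : ((k%:A : F^c) *: v2r u + v2r v) 0 l = k *: (v2r u 0 l : F) + (v2r v 0 l : F).
  rewrite !mxE; congr (_ + _). exact: (mulr_algr k (v2r u 0 l : F)).
exact: (congr1 (@v2r _ F) e).
Qed.

Lemma md_dim X U (p : forall i, X i -> 'rV[K]_(sz U)) : model p ->
  forall i, \rank (ev U i) = (dimvec X i * vval Q i)%N.
Proof.
move=> mp i; have [r [r' [rK rK' rl]]] := kcoords X i.
apply: (@rank_param _ _ (fun u => p i (r' u))) => [k u v|u|u|v].
- have -> : r' (k *: u + v) = (k%:A : (valg Q i)^c) *: r' u + r' v.
    by apply: (can_inj rK); rewrite rl !rK'.
  by rewrite (md_add mp) (md_k mp).
- move=> /(md_eq0 mp) z; rewrite -[u]rK' z.
  by have := rl (-1) 0 0; rewrite scaler0 addr0 => ->; rewrite scaleN1r addNr.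
- by have [v <-] := md_img mp i u; exists (r v); rewrite rK.
- exact: md_ev.
Qed.

End Model.

(** * Every representation has a matrix model *)

Section ModelExists.
Import VectorInternalTheory.
Local Open Scope ring_scope.

Lemma block_sum_decomp {K : fieldType} {n : nat} (N : 'I_n -> nat) :
  exists (E : forall i, 'M[K]_(N i, \sum_i N i)) (R : forall i, 'M[K]_(\sum_i N i, N i)),
  [/\ forall i, E i *m R i = 1%:M, forall i j, i != j -> E i *m R j = 0 &
      \sum_i R i *m E i = 1%:M].
Proof.
exists (submxcol 1%:M), (submxrow 1%:M); split=> [i|i j ij|].
- rewrite mul_submxrow mulmx1 -submxblockEv -mxdiagZ.
  by rewrite submxblock_diag.
- rewrite mul_submxrow mulmx1 -submxblockEv -mxdiagZ /mxdiag mxblockK.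
  by rewrite (negPf ij).
by rewrite -mul_mxrow_mxcol submxrowK submxcolK mulmx1.
Qed.

Context {K : fieldType} {n : nat} {Q : modulated_quiver K n}.
Local Notation qmod := (@qmod K n Q).
Implicit Types X Y Z : rep Q.

Lemma rmap_k X i j (a : arrow Q i j) k v (x : abim Q a) :
  rmap X a v (k *: x) = (k%:A : (valg Q j)^c) *: rmap X a v x.
Proof.
rewrite -rmap_lin; congr rmap.
have := ract_linearr x k 1 0; rewrite !addr0 ract1 => ->.
have -> : ract x (0 : valg Q j) = 0.
  by have := ract_linearr x (-1) 0 0; rewrite scaler0 addr0 scaleN1r addNr.
by rewrite addr0.
Qed.

Lemma rmap_kl X i j (a : arrow Q i j) k v (x : abim Q a) :
  rmap X a ((k%:A : (valg Q i)^c) *: v) x = (k%:A : (valg Q j)^c) *: rmap X a v x.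
Proof.
rewrite (rmap_bal (r := X)) -rmap_k; congr rmap.
have := lact_linearl x k 1 0; rewrite !addr0 lact1 => ->.
have -> : lact (0 : valg Q i) x = 0.
  by have := lact_linearl x (-1) 0 0; rewrite scaler0 addr0 scaleN1r addNr.
by rewrite addr0.
Qed.

Lemma rep_model X : exists (U : qmod) (p : forall i, X i -> 'rV[K]_(sz U)), model p.
Proof.
pose N i := (dimvec X i * vval Q i)%N.
have [r [r' rP]] : exists (r : forall i, X i -> 'rV[K]_(N i)) r', forall i,
    [/\ cancel (r i) (r' i), cancel (r' i) (r i) &
      forall k u v, r i ((k%:A : (valg Q i)^c) *: u + v) = k *: r i u + r i v].
  exists (fun i => sval (cid (kcoords X i))).
  exists (fun i => sval (cid (svalP (cid (kcoords X i))))) => i.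
  exact: (svalP (cid (svalP (cid (kcoords X i))))).
have rK i := let: And3 a _ _ := rP i in a.
have rK' i := let: And3 _ a _ := rP i in a.
have rl i := let: And3 _ _ a := rP i in a.
have rD i u v : r i (u + v) = r i u + r i v.
  by rewrite -[in RHS](scale1r (r i u)) -rl !scale1r.
have r0 i : r i 0 = 0 by have := rD i 0 0; rewrite addr0 => /eqP; rewrite -subr_eq0 opprD addNKr oppr_eq0 => /eqP.
have rk i k v : r i ((k%:A : (valg Q i)^c) *: v) = k *: r i v.
  by have := rl i k v 0; rewrite r0 !addr0.
have mx i j (f : X i -> X j) :
    (forall k u v, f ((k%:A : (valg Q i)^c) *: u + v) = (k%:A : (valg Q j)^c) *: f u + f v) ->
    exists A : 'M[K]_(N i, N j), forall v, r i v *m A = r j (f v).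
  move=> fl; have [|A AP] := @linear_mx K _ _ (fun u => r j (f (r' i u))).
    move=> k u v; rewrite -rl -fl; congr (r j (f _)).
    by apply: (can_inj (rK i)); rewrite rl !rK'.
  by exists A => v; rewrite AP rK.
have rext i L (A B : 'M[K]_(N i, L)) : (forall v, r i v *m A = r i v *m B) -> A = B.
  by move=> e; apply/row_matrixP => k; rewrite !rowE -[delta_mx 0 k]rK' e.
have [av avP] : exists av : forall i, valg Q i -> 'M[K]_(N i), forall i c v,
    r i v *m av i c = r i ((c : (valg Q i)^c) *: v).
  have h i (c : valg Q i) : exists A : 'M[K]_(N i), forall v, r i v *m A = r i ((c : (valg Q i)^c) *: v).
    apply: mx => k u v; rewrite scalerDr !scalerA; congr (_ *: _ + _).
    by rewrite -[LHS](_ : k%:A * c = _) // -[RHS](_ : c * k%:A = _) // mulr_algl mulr_algr.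
  exists (fun i c => sval (cid (h i c))) => i c; exact: (svalP (cid (h i c))).
have [aa aaP] : exists aa : forall i j (a : arrow Q i j), abim Q a -> 'M[K]_(N i, N j),
    forall i j (a : arrow Q i j) x v, r i v *m aa i j a x = r j (rmap X a v x).
  have h i j (a : arrow Q i j) (x : abim Q a) : exists A : 'M[K]_(N i, N j), forall v,
      r i v *m A = r j (rmap X a v x).
    by apply: mx => k u v; rewrite (rmapDl (r := X)) rmap_kl.
  exists (fun i j a x => sval (cid (h i j a x))) => i j a x; exact: (svalP (cid (h i j a x))).
have [E [R [ER ER0 RE]]] := @block_sum_decomp K n N.
pose o (g : @gen K n Q) := match g with
  | GV i c => R i *m av i c *m E i | GA i j a x => R i *m aa i j a x *m E j end.
have oP : is_mod o.
  split=> [i k c c'|i c c'|i j c c' ij||i j a k x y|i j a c x|i j a x c] /=.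
  - rewrite scalemxAl -mulmxDl scalemxAr -mulmxDr; congr (_ *m _ *m _).
    apply: rext => v; rewrite mulmxDr -scalemxAr !avP -rk -rD scalerA -scalerDl.
    by congr (r i ((_ + _) *: v)); rewrite -[RHS](_ : c * k%:A = _) // mulr_algr.
  - rewrite !mulmxA -(mulmxA _ (E i)) ER mulmx1 -[in RHS](mulmxA (R i)); congr (_ *m _ *m _).
    by apply: rext => v; rewrite mulmxA !avP scalerA.
  - by rewrite !mulmxA -(mulmxA _ (E i)) ER0 // mulmx0 !mul0mx.
  - rewrite -RE; apply: eq_bigr => i _; rewrite [av i 1](_ : _ = 1%:M) ?mulmx1 //.
    by apply: rext => v; rewrite avP scale1r mulmx1.
  - rewrite scalemxAl -mulmxDl scalemxAr -mulmxDr; congr (_ *m _ *m _).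
    by apply: rext => v; rewrite mulmxDr -scalemxAr !aaP -rk -rD (rmapDr (r := X)) rmap_k.
  - rewrite !mulmxA -(mulmxA _ (E i)) ER mulmx1 -[in RHS](mulmxA (R i)); congr (_ *m _ *m _).
    by apply: rext => v; rewrite mulmxA avP !aaP (rmap_bal (r := X)).
  - rewrite !mulmxA -(mulmxA _ (E j)) ER mulmx1 -[in RHS](mulmxA (R i)); congr (_ *m _ *m _).
    by apply: rext => v; rewrite mulmxA !aaP avP (rmap_lin (r := X)).
exists (QMod oP), (fun i v => r i v *m E i); split=> [i u v|i u v|i c v|i j a v x|i u] /=.
- by rewrite rD mulmxDl.
- move=> /(congr1 (mulmx^~ (R i))); rewrite -!mulmxA ER !mulmx1.
  exact: (can_inj (rK i)).
- by rewrite !mulmxA -(mulmxA _ (E i)) ER mulmx1 avP.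
- by rewrite !mulmxA -(mulmxA _ (E i)) ER mulmx1 aaP.
exists (r' i (u *m R i)); rewrite rK' /ev /= [av i 1](_ : _ = 1%:M) ?mulmx1 ?mulmxA //.
by apply: rext => v; rewrite avP scale1r mulmx1.
Qed.

End ModelExists.

Section RepOfModule.
Local Open Scope ring_scope.
Context {K : fieldType} {n : nat} {Q : modulated_quiver K n}.
Local Notation qmod := (@qmod K n Q).
Implicit Types (X Y Z S E : rep Q) (U V W A B C N : qmod).

(** The space at i is a coordinate space over F_i with respect to the basis [vfree U i]; F and G
    translate between coordinates and row vectors. *)
Lemma model_rep U : exists (X : rep Q) (p : forall i, X i -> 'rV[K]_(sz U)), model p.
Proof.
pose d i := vd (vfree U i).
pose T i : vectType (valg Q i)^c := 'rV[(valg Q i)^c]_(d i).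
pose F i (w : T i) : 'rV[K]_(sz U) := \sum_k vb (vfree U i) k *m op U (GV (w 0 k : valg Q i)).
pose G i (u : 'rV[K]_(sz U)) : T i := \row_k (vx (vfree U i) k u : (valg Q i)^c).
have opD i (c c' : valg Q i) : op U (GV (c + c')) = op U (GV c) + op U (GV c').
  by have := op_lin (opP U) (i := i) 1 c c'; rewrite !scale1r.
have vD i k u v : vx (vfree U i) k (u + v) = vx (vfree U i) k u + vx (vfree U i) k v.
  by have := vx_lin (vfree U i) k 1 u v; rewrite !scale1r.
have v0 i k : vx (vfree U i) k 0 = 0.
  by have := vD i k 0 0; rewrite addr0 => /eqP; rewrite -subr_eq0 opprD addNKr oppr_eq0 => /eqP.
have FD i u v : F i (u + v) = F i u + F i v.
  by rewrite -big_split /=; apply: eq_bigr => k _; rewrite mxE opD mulmxDr.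
have GF i u : G i (F i u) = u.
  apply/rowP => l; rewrite mxE.
  rewrite (big_morph (vx (vfree U i) l) (vD i l) (v0 i l)) (bigD1 l) //= vxb eqxx.
  by rewrite big1 ?addr0 // => k /negPf kl; rewrite vxb eq_sym kl.
have FG i u : F i (G i u) = u *m ev U i.
  by rewrite (vxP (vfree U i)); apply: eq_bigr => k _; rewrite mxE.
have FZ i (c : valg Q i) v : F i ((c : (valg Q i)^c) *: v) = F i v *m op U (GV c).
  rewrite mulmx_suml; apply: eq_bigr => k _; rewrite mxE.
  by rewrite -[X in GV X](_ : (v 0 k : valg Q i) * c = _) // (op_mul (opP U)) mulmxA.
have GD i u v : G i (u + v) = G i u + G i v by apply/rowP => k; rewrite !mxE vD.
have Gev i u : G i (u *m ev U i) = G i u by rewrite -FG GF.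
have GZ i (c : valg Q i) u : G i (u *m op U (GV c)) = (c : (valg Q i)^c) *: G i u.
  by apply: (can_inj (GF i)); rewrite FG FZ FG -!mulmxA ev_r ev_l.
pose rm i j (a : arrow Q i j) (v : T i) (x : abim Q a) : T j := G j (F i v *m op U (GA x)).
have h1 i j (a : arrow Q i j) u v x : rm i j a (u + v) x = rm i j a u x + rm i j a v x.
  by rewrite /rm FD mulmxDl GD.
have h2 i j (a : arrow Q i j) v (x y : abim Q a) :
    rm i j a v (x + y) = rm i j a v x + rm i j a v y.
  rewrite /rm; have := op_alin (opP U) (a := a) 1 x y; rewrite !scale1r => ->.
  by rewrite mulmxDr GD.
have h3 i j (a : arrow Q i j) (c : valg Q i) v (x : abim Q a) :
    rm i j a ((c : (valg Q i)^c) *: v) x = rm i j a v (lact c x).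
  by rewrite /rm FZ -mulmxA (op_lact (opP U)).
have h4 i j (a : arrow Q i j) v (x : abim Q a) (c : valg Q j) :
    rm i j a v (ract x c) = (c : (valg Q j)^c) *: rm i j a v x.
  by rewrite /rm (op_ract (opP U)) mulmxA GZ.
pose X := @Rep K n Q T rm h1 h2 h3 h4.
exists X, F; split=> //.
- by move=> i; apply: (can_inj (GF i)).
- move=> i j a v x; rewrite [LHS]FG -mulmxA.
  by rewrite -(op_ract (opP U)) ract1.
- by move=> i u; exists (G i u); rewrite FG.
Qed.

Section Transport.
Context {X Y : rep Q} {U W : qmod} {p : forall i, X i -> 'rV[K]_(sz U)}
  {q : forall i, Y i -> 'rV[K]_(sz W)}.
Arguments p : clear implicits.
Arguments q : clear implicits.
Hypotheses (mp : model p) (mq : model q).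

Lemma hom_zero_hz : hom_zero X Y <-> hz U W.
Proof.
split=> [z f hf|z g i v].
  have [g gP] := hom_rhom mp mq hf.
  by apply: (md_ext mp) => i v; rewrite -gP z (md0 mq) mulmx0.
have [f hf gP] := rhom_hom mp mq g; apply: (md_eq0 mq).
by rewrite gP (z f) // mulmx0.
Qed.

Lemma rep_sub_mx : rep_sub X Y <-> exists f : 'M[K]_(sz U, sz W), ishom f /\ row_free f.
Proof.
split=> [[g gi]|[f [hf ff]]].
  have [f hf gP] := rhom_hom mp mq g; exists f; split=> //.
  exact/(rhom_inj_free mp mq hf gP).
have [g gP] := hom_rhom mp mq hf; exists g.
exact/(rhom_inj_free mp mq hf gP).
Qed.

Lemma rep_iso_iso : rep_iso X Y <-> iso U W.
Proof.
split=> [[g [gi gs]]|[f [hf ff fu]]].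
  have [f hf gP] := rhom_hom mp mq g; exists f; split=> //.
    exact/(rhom_inj_free mp mq hf gP).
  exact/(rhom_surj_full mp mq hf gP).
have [g gP] := hom_rhom mp mq hf; exists g; split.
  exact/(rhom_inj_free mp mq hf gP).
exact/(rhom_surj_full mp mq hf gP).
Qed.
End Transport.

Lemma md_ker X U (p : forall i, X i -> 'rV[K]_(sz U)) W (f : 'M[K]_(sz U, sz W)) (u : 'rV_(sz U)) :
  model p -> ishom f -> u *m f = 0 ->
  exists v : forall i, X i, u = \sum_i p i (v i) /\ forall i, p i (v i) *m f = 0.
Proof.
move=> mp hf uf; have [q [qP _]] := md_inv mp; exists (fun i => q i u); split.
  by rewrite -[u in LHS]mulmx1 -ev_sum mulmx_sumr; apply: eq_bigr => i _; rewrite qP.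
by move=> i; rewrite qP -mulmxA [ev U i *m f]hf mulmxA uf mul0mx.
Qed.

Lemma short_exact_ses Y E X A U C (p : forall i, Y i -> 'rV[K]_(sz A))
    (q : forall i, E i -> 'rV[K]_(sz U)) (r : forall i, X i -> 'rV[K]_(sz C))
    (g : rhom Y E) (h : rhom E X) (f : 'M[K]_(sz A, sz U)) (k : 'M[K]_(sz U, sz C)) :
  model p -> model q -> model r -> ishom f -> ishom k ->
  (forall i v, q i (g i v) = p i v *m f) -> (forall i v, r i (h i v) = q i v *m k) ->
  short_exact g h <-> ses f k.
Proof.
move=> mp mq mr hf hk gP hP; split=> [[gi hs ex]|[_ _ ff fk e]].
  split=> //; [exact/(rhom_inj_free mp mq hf gP)|exact/(rhom_surj_full mq mr hk hP)|].
  apply/eqmxP/andP; split.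
    rewrite sub_kermx; apply/eqP; apply: (md_ext mp) => i v.
    rewrite mulmxA -gP -hP mulmx0 (ex i (g i v)).2 ?(md0 mr) //; by exists v.
  apply/row_subP => l; set u := row l _.
  have [|v [-> vk]] := md_ker (u := u) mq hk.
    by rewrite /u -row_mul mulmx_ker row0.
  apply: summx_sub => i _.
  have /(ex i (v i)).1 [w <-] : h i (v i) = 0 by apply: (md_eq0 mr); rewrite hP vk.
  by rewrite gP submxMl.
split; [exact/(rhom_inj_free mp mq hf gP)|exact/(rhom_surj_full mq mr hk hP)|].
move=> i v; split=> [h0|[w <-]].
  have : (q i v <= f)%MS by rewrite e sub_kermx -hP h0 (md0 mr).
  move=> /submxP[w vE]; have [y yE] := md_img mp i w; exists y.
  apply: (md_inj mq); rewrite gP yE -mulmxA [ev A i *m f]hf mulmxA -vE.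
  exact: (md_ev mq).
apply: (md_eq0 mr); rewrite hP gP -mulmxA.
have -> : f *m k = 0 by apply/eqP; rewrite -sub_kermx e.
by rewrite mulmx0.
Qed.

Lemma ext_zero_ext0 X Y U W (p : forall i, X i -> 'rV[K]_(sz U))
    (q : forall i, Y i -> 'rV[K]_(sz W)) : model p -> model q ->
  ext_zero X Y <-> ext0 U W.
Proof.
move=> mp mq; split=> [xy|x0 E g h ex].
  apply: contrapT => /ext_nonsplit[N [f [k [ss ns]]]].
  have [E [r mr]] := model_rep N.
  case: (ss) => hf hk _ _ _.
  have [g gP] := hom_rhom mq mr hf; have [h hP] := hom_rhom mr mp hk.
  have [s sP] := xy E g h ((short_exact_ses mq mr mp hf hk gP hP).2 ss).
  have [S hS SP] := rhom_hom mp mr s; apply: (ns S hS).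
  by apply: (md_ext mp) => i v; rewrite mulmxA -SP -hP sP mulmx1.
have [N [r mr]] := rep_model E.
have [f hf gP] := rhom_hom mq mr g; have [k hk hP] := rhom_hom mr mp h.
have [S hS SP] := ext_split ((short_exact_ses mq mr mp hf hk gP hP).1 ex) x0.
have [s sP] := hom_rhom mp mr hS; exists s => i v; apply: (md_inj mp).
by rewrite hP sP -mulmxA SP mulmx1.
Qed.

Lemma is_dirsum_ds X Y Z U A B (p : forall i, X i -> 'rV[K]_(sz U))
    (q : forall i, Y i -> 'rV[K]_(sz A)) (r : forall i, Z i -> 'rV[K]_(sz B)) :
  model p -> model q -> model r -> is_dirsum X Y Z <-> ds A B U.
Proof.
move=> mp mq mr; split=> [[g [h bij]]|].
  have [f hf gP] := rhom_hom mq mp g; have [k hk hP] := rhom_hom mr mp h.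
  have iD : iso (dsum A B) U.
    exists (col_mx f k); split=> [x||].
    - by rewrite /= mul_block_col mul_col_mx !mul0mx addr0 add0r hf hk.
    - apply: inj_row_free => u; rewrite -[u](@hsubmxK _ _ (sz A) (sz B)).
      set a := lsubmx _; set b := rsubmx _; rewrite mul_row_col => e.
      have [a' [aP _]] := md_inv mq; have [b' [bP _]] := md_inv mr.
      have z i : g i (a' i a) + h i (b' i b) = 0.
        apply: (md_eq0 mp); rewrite (md_add mp) gP hP aP bP -!mulmxA.
        by rewrite [ev A i *m f]hf [ev B i *m k]hk !mulmxA -mulmxDl e mul0mx.
      have zz i : a' i a = 0 /\ b' i b = 0.
        have := bij_inj (bij i) (x1 := (a' i a, b' i b)) (x2 := (0, 0)).
        by rewrite /= z !linear0 addr0 => /(_ erefl)[-> ->].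
      have -> : a = 0.
        rewrite -[a]mulmx1 -ev_sum mulmx_sumr big1 // => i _.
        by rewrite -aP (zz i).1 (md0 mq).
      have -> : b = 0.
        rewrite -[b]mulmx1 -ev_sum mulmx_sumr big1 // => i _.
        by rewrite -bP (zz i).2 (md0 mr).
      exact: row_mx0.
    rewrite -sub1mx; apply/row_subP => l; rewrite rowE mulmx1.
    have [v ->] := md_sum mp (delta_mx 0 l); apply: summx_sub => i _.
    case: (bij i) => b bK bK'; rewrite -[v i]bK' /= (md_add mp) gP hP.
    rewrite -addsmxE; apply: addmx_sub_adds; exact: submxMl.
  have [F [G [hF hG FG GF]]] := iso_inv iD.
  have [iA [iB [pA [pB [[h1 h2 h3 h4] [e1 e2 e3 e4 e5]]]]]] := dsumP A B.
  exists (iA *m F), (iB *m F), (G *m pA), (G *m pB); split.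
    by split; apply: ishomM.
  have c (L M : nat) (u : 'M[K]_(L, _)) (v : 'M[K]_(_, M)) : u *m F *m (G *m v) = u *m v.
    by rewrite mulmxA -(mulmxA u) FG mulmx1.
  split; rewrite ?c //.
  by rewrite !mulmxA -!(mulmxA G) -!mulmxA -mulmxDr !mulmxA -mulmxDl e5 mul1mx.
case=> iA [iB [pA [pB [[h1 h2 h3 h4] [e1 e2 e3 e4 e5]]]]].
have [g gP] := hom_rhom mq mp h1; have [h hP] := hom_rhom mr mp h2.
have [g' gP'] := hom_rhom mp mq h3; have [h' hP'] := hom_rhom mp mr h4.
exists g, h => i; exists (fun v => (g' i v, h' i v)) => [[a b]|v] /=.
  congr (_, _); [apply: (md_inj mq)|apply: (md_inj mr)];
    by rewrite ?gP' ?hP' (md_add mp) gP hP mulmxDl -!mulmxA ?e1 ?e2 ?e3 ?e4 ?mulmx0 ?mulmx1 ?addr0 ?add0r.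
apply: (md_inj mp); rewrite (md_add mp) gP hP gP' hP' -!mulmxA -mulmxDr e5.
by rewrite mulmx1.
Qed.

Lemma indecomposable_indec X U (p : forall i, X i -> 'rV[K]_(sz U)) : model p ->
  indecomposable X <-> indec U.
Proof.
move=> mp; split=> [[nz d]|iU].
  have U0 : (0 < sz U)%N by rewrite lt0n; apply/eqP => z; apply: nz; exact/(rep_zero_sz mp).
  split=> // e he ee; have [|e0] := pselect (e = 0); first by left.
  have [|e1] := pselect (e = 1%:M); first by right.
  have [A [B [dd a b]]] := idem_ds he ee e0 e1.
  have [Y [q mq]] := model_rep A; have [Z [r mr]] := model_rep B.
  have [] := d Y Z ((is_dirsum_ds mp mq mr).2 dd).
    by move=> /(rep_zero_sz mq) z; rewrite z in a.
  by move=> /(rep_zero_sz mr) z; rewrite z in b.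
split=> [/(rep_zero_sz mp) z|Y Z]; first by have := iU.1; rewrite z.
have [A [q mq]] := rep_model Y; have [B [r mr]] := rep_model Z.
move=> /(is_dirsum_ds mp mq mr) dd.
have [A0|A0] := posnP (sz A); first by left; apply/(rep_zero_sz mq).
right; apply/(rep_zero_sz mr); have := ds_sz dd.
rewrite -(iso_sz (summand_iso iU _ A0)); first by lia.
by exists B.
Qed.

End RepOfModule.

(** * Simple tops, length and the dictionary *)

Section Transfer.
Import VectorInternalTheory.
Local Open Scope ring_scope.
Context {K : fieldType} {n : nat} {Q : modulated_quiver K n}.
Local Notation qmod := (@qmod K n Q).
Implicit Types (X Y Z S E : rep Q) (U V W A B C N : qmod).

Lemma acyclic_path_uniq x p : path (arrow Q) x p -> uniq (x :: p).
Proof.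
elim: p x => [//|y p IH] x xp; have /andP[xy yp] := xp.
rewrite cons_uniq (IH _ yp) andbT; apply/negP => xi.
case/splitPr: xi xp => p1 p2; rewrite -cat_rcons cat_path => /andP[c _].
by move/negP: (@arrow_acyclic _ _ Q (x :: p1) isT); apply.
Qed.

(** Otherwise one could walk backwards along arrows inside P indefinitely, but a path visits no
    vertex twice. *)
Lemma source_ex (P : pred 'I_n) i0 : P i0 ->
  exists2 i, P i & forall j, P j -> ~~ arrow Q j i.
Proof.
move=> P0; apply: contrapT => h.
have pr i : P i -> exists2 j, P j & arrow Q j i.
  move=> Pi; apply: contrapT => h'; apply: h; exists i => // j Pj; apply/negP => a.
  by apply: h'; exists j.
have /(_ n) [x [p [_ xp sp]]] : forall l, exists x p, [/\ P x, path (arrow Q) x p & size p = l].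
  elim=> [|l [x [p [Px xp sp]]]]; first by exists i0, [::].
  have [y Py yx] := pr _ Px; exists y, (x :: p); split=> //=; last by rewrite sp.
  by rewrite yx.
have /card_uniqP e := acyclic_path_uniq xp.
by have := max_card [in x :: p]; rewrite e card_ord /= sp ltnn.
Qed.

Lemma vd_model X U (p : forall i, X i -> 'rV[K]_(sz U)) i : model p ->
  dimvec X i = vd (vfree U i).
Proof.
move=> mp; have := md_dim mp i; rewrite -(vd_dim (vfree U i)).
by move/eqP; rewrite eqn_pmul2r ?vval_gt0 // => /eqP.
Qed.

(** Nothing arrives at a source i of the support, so the kernel of a single F_i-coordinate at i is a
    submodule; the quotient is the simple module at i. *)
Lemma top_ex U : (0 < sz U)%N -> exists A C (f : 'M[K]_(sz A, sz U)) (p : 'M[K]_(sz U, sz C)) i,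
  [/\ ses f p, vd (vfree C i) = 1%N & forall j, j != i -> ev C j = 0].
Proof.
move=> U0; have [i0 ri0] : exists i, \rank (ev U i) != 0%N.
  apply: contrapT => h; move: U0; rewrite sz_rank big1 // => j _.
  by apply/eqP/negPn/negP => h'; apply: h; exists j.
have [i ri src] := @source_ex (fun i => \rank (ev U i) != 0%N) i0 ri0.
have vi := vval_gt0 Q i.
have dU := vd_dim (vfree U i).
have d0 : (0 < vd (vfree U i))%N.
  by rewrite lt0n; apply/eqP => d0; rewrite d0 mul0n in dU; rewrite -dU eqxx in ri.
pose k : 'I_(vd (vfree U i)) := Ordinal d0.
pose F : vectType K := valg Q i.
have xl a u v : vx (vfree U i) k (a *: u + v) = a *: vx (vfree U i) k u + vx (vfree U i) k v.
  exact: vx_lin.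
have xD u v : vx (vfree U i) k (u + v) = vx (vfree U i) k u + vx (vfree U i) k v.
  by have := xl 1 u v; rewrite !scale1r.
have x0 : vx (vfree U i) k 0 = 0.
  by have := xD 0 0; rewrite addr0 => /eqP; rewrite -subr_eq0 opprD addNKr oppr_eq0 => /eqP.
have xop u (c : valg Q i) : vx (vfree U i) k (u *m op U (GV c)) = vx (vfree U i) k u * c.
  rewrite -(ev_l U c) mulmxA (vxP (vfree U i)) mulmx_suml.
  rewrite (big_morph (vx (vfree U i) k) xD x0) (bigD1 k) //= big1 => [|l lk].
    by rewrite addr0 -mulmxA -(op_mul (opP U)) vxb eqxx.
  by rewrite -mulmxA -(op_mul (opP U)) vxb eq_sym (negPf lk).
have xev u : vx (vfree U i) k u = vx (vfree U i) k (u *m ev U i) by rewrite xop mulr1.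
have [B BP] := @linear_mx K (sz U) _ (fun u => @v2r _ F (vx (vfree U i) k u))
  (fun a u v => etrans (congr1 (@v2r _ F) (xl a u v)) (linearP (@v2r _ F) a _ _)).
have kB m (u : 'M[K]_(m, sz U)) : (u *m B == 0) = [forall l, vx (vfree U i) k (row l u) == 0].
  apply/eqP/forallP => [e l|h].
    apply/eqP/(can_inj (@v2rK _ F)); rewrite linear0 -BP -row_mul e; exact: row0.
  by apply/row_matrixP => l; rewrite row_mul BP (eqP (h l)) linear0 row0.
have st : stable (kermx B).
  move=> g; rewrite sub_kermx kB; apply/forallP => l; rewrite row_mul.
  set u := row l _; have u0 : vx (vfree U i) k u = 0.
    have : kermx B *m B == 0 by rewrite mulmx_ker.
    by rewrite kB => /forallP /(_ l) /eqP.
  case: g => [j c|j j' a x].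
    have [ij|ij] := eqVneq j i; first by subst j; rewrite xop u0 mul0r.
    by rewrite xev -mulmxA (op_orth (opP U)) // mulmx0 x0.
  have [ij|ij] := eqVneq j' i; last first.
    by rewrite xev -(ract1 x) (op_ract (opP U)) -!mulmxA (op_orth (opP U)) // !mulmx0 x0.
  subst j'; have /negPn/eqP : ~~ (\rank (ev U j) != 0%N) by apply/negP => /src; rewrite a.
  move/eqP; rewrite mxrank_eq0 => /eqP z.
  by rewrite -(lact1 x) (op_lact (opP U)) -/(ev U j) z mul0mx mulmx0 x0.
have [C [p [hp fp ep]]] := quo_ex st.
have [A [f ss]] := ker_ses hp fp.
exists A, C, f, p, i.
have C0 j : j != i -> ev C j = 0.
  move=> ji; apply: (row_full_inj fp); rewrite mulmx0 -[p *m ev C j]hp.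
  apply/eqP; rewrite -sub_kermx ep sub_kermx kB; apply/forallP => l.
  by rewrite rowE xev -mulmxA ev_orth // mulmx0 x0.
split=> //.
have sC : sz C = \rank (ev C i).
  by apply: (etrans (sz_rank C)); rewrite (bigD1 i) //= big1 ?addn0 // => j ji; rewrite C0 ?mxrank0.
have rC : sz C = \rank B.
  have := mxrank_ker p; rewrite ep mxrank_ker (eqP fp).
  have := rank_leq_row B; have := rank_leq_row p; rewrite (eqP fp); lia.
have dC := vd_dim (vfree C i).
have : (vd (vfree C i) * vval Q i <= 1 * vval Q i)%N.
  by rewrite dC -sC rC mul1n -valg_dim dimvf rank_leq_col.
rewrite leq_pmul2r // => le.
suff : (0 < vd (vfree C i) * vval Q i)%N by rewrite muln_gt0 => /andP[]; lia.
rewrite dC -sC rC lt0n mxrank_eq0; apply/eqP => B0.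
have : vb (vfree U i) k *m op U (GV (1 : valg Q i)) *m B == 0 by apply/eqP; rewrite B0; exact: mulmx0.
rewrite kB => /forallP /(_ ord0); rewrite (_ : row ord0 _ = vb (vfree U i) k *m op U (GV (1 : valg Q i))).
  by rewrite vxb eqxx oner_eq0.
by apply/rowP => l; rewrite mxE.
Qed.

Lemma top_simple S C (p : forall i, S i -> 'rV[K]_(sz C)) i : model p ->
  vd (vfree C i) = 1%N -> (forall j, j != i -> ev C j = 0) -> rep_simple S.
Proof.
move=> mp d1 C0; have dC := vd_dim (vfree C i).
have sC : sz C = vval Q i.
  apply: (etrans (sz_rank C)); rewrite (bigD1 i) //= big1 ?addn0 => [|j ji]; last by rewrite C0 ?mxrank0.
  by rewrite -dC d1 mul1n.
have vi := vval_gt0 Q i.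
split=> [/(rep_zero_sz mp)|Y g gi]; first by rewrite sC; lia.
have [A [q mq]] := rep_model Y; have [f hf gP] := rhom_hom mq mp g.
have ff : row_free f by apply/(rhom_inj_free mq mp hf gP).
have dA := vd_dim (vfree A i).
have sA : sz A = \rank (ev A i).
  apply: (etrans (sz_rank A)); rewrite (bigD1 i) //= big1 ?addn0 // => j ji.
  have -> : ev A j = 0 by apply: (row_free_inj ff); rewrite /= mul0mx [ev A j *m f]hf [op C _]C0 // mulmx0.
  by rewrite mxrank0.
have [A0|A0] := posnP (vd (vfree A i)).
  by left; apply/(rep_zero_sz mq); rewrite sA -dA A0.
right; apply/(rhom_surj_full mq mp hf gP).
have := rank_leq_col f; rewrite /row_full (eqP ff) sA -dA sC; move: A0 vi; clear; nia.
Qed.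

(** Simple tops lower the total dimension by one, so it is a length; the length order of the listing
    thus compares total dimensions. *)
Lemma has_length_dim X : has_length X (\sum_i dimvec X i).
Proof.
have [l] := ubnP (\sum_i dimvec X i)%N; elim: l X => // l IH X lX.
have [U [p mp]] := rep_model X.
have [U0|U0] := posnP (sz U).
  rewrite big1; first by apply: has_length0; apply/(rep_zero_sz mp).
  move=> i _; have := md_dim mp i; rewrite (_ : \rank _ = 0%N).
    by move/esym/eqP; rewrite muln_eq0 -leqn0 [(vval _ _ == _)%N]gtn_eqF ?vval_gt0 // orbF leqn0 => /eqP.
  by apply/eqP; rewrite -leqn0 -U0 rank_leq_row.
have [A [C [f [k [i [ss d1 C0]]]]]] := top_ex U0.
have [Y [q mq]] := model_rep A; have [S [r mr]] := model_rep C.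
case: (ss) => hf hk _ _ _.
have [g gP] := hom_rhom mq mp hf; have [h hP] := hom_rhom mp mr hk.
have sS := top_simple mr d1 C0.
have se := (short_exact_ses mq mp mr hf hk gP hP).2 ss.
have e : (\sum_i dimvec X i = (\sum_i dimvec Y i).+1)%N.
  have D j : (dimvec X j = dimvec Y j + (j == i))%N.
    rewrite (vd_model j mp) (vd_model j mq).
    have : (j == i) = vd (vfree C j) :> nat.
      have [->|ji] := eqVneq; first by rewrite d1.
      have := vd_dim (vfree C j); rewrite C0 // mxrank0 => /eqP.
      by rewrite muln_eq0 [(vval _ _ == _)%N]gtn_eqF ?vval_gt0 // orbF => /eqP ->.
    move=> ->; apply/eqP; rewrite -(eqn_pmul2r (vval_gt0 Q j)) mulnDl !vd_dim.
    by apply/eqP; exact: ses_rank ss.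
  rewrite (eq_bigr _ (fun j _ => D j)) big_split /=.
  suff -> : (\sum_j (j == i) = 1)%N by rewrite addn1.
  transitivity (\sum_(j | j == i) 1)%N; last by rewrite big_pred1_eq.
  by rewrite [RHS]big_mkcond; apply: eq_bigr => j _; case: (j == i).
rewrite e; apply: has_lengthS se sS _; apply: IH; rewrite e in lX; lia.
Qed.

Lemma bounded_of_finite : finite_rep_type Q -> @bounded K n Q.
Proof.
case=> m [L LP].
have [U UP] := choice (fun k => rep_model (L k)).
exists (\max_k sz (U k))%N => N iN.
have [X [p mp]] := model_rep N.
have [k i] := LP X ((indecomposable_indec mp).2 iN).
have [q mq] := UP k.
by rewrite (iso_sz ((rep_iso_iso mp mq).1 i)) (leq_bigmax k).
Qed.

Lemma transfer_ex m (M : 'I_m -> rep Q) : finite_rep_type Q -> root_listing M ->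
  exists V : 'I_m -> qmod, transfer M V.
Proof.
move=> fin hM; have bd := bounded_of_finite fin.
have [V VP] := choice (fun k => rep_model (M k)).
exists V.
have iV k : indec (V k).
  have [p mp] := VP k; apply/(indecomposable_indec mp); exact: root_indec hM k.
have dV X U (p : forall i, X i -> 'rV[K]_(sz U)) v : model p -> dv U 0 v = (dimvec X v)%:R.
  move=> mp; rewrite mxE (md_dim mp) natrM mulfK //.
  by rewrite pnatr_eq0 -lt0n vval_gt0.
have dVk k v : dv (V k) 0 v = (dimvec (M k) v)%:R by have [p mp] := VP k; exact: (dV _ _ p).
split=> //.
- split=> // [N iN|k l e].
    have [X [p mp]] := model_rep N.
    have [|k kX] := root_all hM (b := dimvec X).
      by exists X; split=> //; apply/(indecomposable_indec mp).
    exists k; apply: (@indec_dv_prop _ _ _ bd _ _ 1) => //.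
    rewrite scale1r; apply/rowP => v; by rewrite (dV _ _ _ v mp) dVk kX.
  apply: (root_inj hM); apply/ffunP => v; apply/eqP.
  by rewrite -(eqr_nat rat) -!dVk e.
- by move=> i j; have [p mp] := VP i; have [q mq] := VP j; exact: (hom_zero_hz mp mq).
- by move=> i j; have [p mp] := VP i; have [q mq] := VP j; exact: (ext_zero_ext0 mp mq).
- by move=> i j; have [p mp] := VP i; have [q mq] := VP j; exact: (rep_sub_mx mp mq).
move=> j k lt; rewrite ltnNge; apply/negP => le.
have := root_length hM le (has_length_dim _) (has_length_dim _); lia.
Qed.

End Transfer.

(** * The chain of the simple modules in lateral order *)

Section SimpleChain.
Local Open Scope ring_scope.
Context {K : fieldType} {n : nat} {Q : modulated_quiver K n}.
Local Notation qmod := (@qmod K n Q).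
Implicit Types (X Y Z S E : rep Q) (U W A B C N : qmod) (P : 'I_n -> Prop).

Lemma simple_indecomposable X : rep_simple X -> indecomposable X.
Proof.
case=> nz sX; split=> // Y Z [g [h bij]].
have inj i (a b : Y i * Z i) : g i a.1 + h i a.2 = g i b.1 + h i b.2 -> a = b.
  exact: (bij_inj (bij i)).
have [|Y0|gs] := sX Y g; [|by left|right].
  move=> i u v e; suff [] : (u, 0) = (v, 0 : Z i) by [].
  by apply: inj; rewrite /= e.
move=> i z; have [v gv] := gs i (h i z).
by suff [_ <-] : (v, 0) = (0, z) by []; apply: inj; rewrite /= gv !linear0 addr0 add0r.
Qed.

Lemma simple_root_ex i : is_root (Q := Q) [ffun u => nat_of_bool (u == i)].
Proof.
pose T j : vectType (valg Q j)^c := 'rV[(valg Q j)^c]_(j == i).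
have [h1 h2 h3 h4] : let rm j k (a : arrow Q j k) (u : T j) (x : abim Q a) := 0 : T k in
  [/\ forall j k (a : arrow Q j k) u v x, rm j k a (u + v) x = rm j k a u x + rm j k a v x,
      forall j k (a : arrow Q j k) v (x y : abim Q a), rm j k a v (x + y) = rm j k a v x + rm j k a v y,
      forall j k (a : arrow Q j k) (c : valg Q j) v (x : abim Q a),
        rm j k a ((c : (valg Q j)^c) *: v) x = rm j k a v (lact c x) &
      forall j k (a : arrow Q j k) v (x : abim Q a) (c : valg Q k),
        rm j k a v (ract x c) = (c : (valg Q k)^c) *: rm j k a v x].
  by split=> * ; rewrite ?addr0 ?scaler0.
pose X := @Rep K n Q T _ h1 h2 h3 h4.
have dX : dimvec X = [ffun u => nat_of_bool (u == i)].
  by apply/ffunP => j; rewrite !ffunE; exact: mul1n.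
exists X; split=> //; have [U [p mp]] := rep_model X.
apply/simple_indecomposable/(top_simple mp (i := i)).
  by rewrite -(vd_model i mp) dX ffunE eqxx.
by move=> j ji; apply/eqP; rewrite -mxrank_eq0 (md_dim mp) dX ffunE (negPf ji).
Qed.

Definition supp P N := forall i, ~ P i -> ev N i = 0.
Definition closed_succ P := forall i j, arrow Q i j -> P i -> P j.

Lemma ev_hom U W (f : 'M[K]_(sz U, sz W)) i : ishom f -> ev U i *m f = f *m ev W i.
Proof. exact. Qed.

(** Arrows do not leave P, so the part of N on P is a submodule. This is the torsion decomposition
    of N for [supp P]. *)
Lemma supp_sub P N : closed_succ P -> exists A C (f : 'M[K]_(sz A, sz N)) (p : 'M[K]_(sz N, sz C)),
  [/\ ses f p, supp P A & forall i, P i -> ev C i = 0].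
Proof.
move=> cP; pose U := \sum_(i | `[< P i >]) ev N i.
have st : stable U.
  case=> [i c|i j a x].
    have [Pi|nPi] := pselect (P i).
      rewrite -(ev_r N c) mulmxA; apply: (submx_trans (submxMl _ _)).
      by apply: submx_trans (submxMl (ev N i) U); rewrite /U mulmx_sumr (bigD1 i) ?asboolE //= evid
         big1 ?addr0 // => j /andP[_ ji]; rewrite ev_orth // eq_sym.
    rewrite -(ev_l N c) mulmxA mulmx_suml big1 ?mul0mx ?sub0mx // => j /asboolP Pj.
    by rewrite ev_orth //; apply/eqP => e; subst j.
  rewrite -(lact1 x) (op_lact (opP N)) -/(ev N i).
  have [Pi|nPi] := pselect (P i); last first.
    rewrite mulmxA mulmx_suml big1 ?mul0mx ?sub0mx // => k /asboolP Pk.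
    by rewrite ev_orth //; apply/eqP => e; subst k.
  have Pj := cP _ _ a Pi.
  rewrite -(ract1 x) (op_ract (opP N)) !mulmxA; apply: (submx_trans (submxMl _ _)).
  by apply: submx_trans (submxMl (ev N j) U); rewrite /U mulmx_sumr (bigD1 j) ?asboolE //= evid
     big1 ?addr0 // => k /andP[_ jk]; rewrite ev_orth // eq_sym.
have [C [p [hp fp ep]]] := quo_ex st.
have [A [f ss]] := ker_ses hp fp.
exists A, C, f, p; split=> // [i nPi|i Pi].
  case: ss => hf _ ff _ e; apply: (row_free_inj ff); rewrite /= mul0mx ev_hom //.
  have /submxP[D ->] : (f <= U)%MS by rewrite e ep.
  rewrite -mulmxA mulmx_suml big1 ?mulmx0 // => j /asboolP Pj.
  by rewrite ev_orth //; apply/eqP => e'; subst j.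
apply: (row_full_inj fp); rewrite mulmx0 -ev_hom //; apply/eqP; rewrite -sub_kermx ep.
by apply: submx_trans (submxMl (ev N i) U); rewrite /U mulmx_sumr (bigD1 i) ?asboolE //= evid
     big1 ?addr0 // => k /andP[_ jk]; rewrite ev_orth // eq_sym.
Qed.

Lemma supp_perp P N : closed_succ P -> perp (supp P) N <-> forall i, P i -> ev N i = 0.
Proof.
move=> cP; split=> [pN i Pi|h A sA f hf].
  have [A [C [f [p [ss sA C0]]]]] := supp_sub N cP; case: (ss) => hf hp ff fp e.
  have f0 := pN A sA f hf.
  have fk : row_free p by rewrite -kermx_eq0 -submx0 -e f0 sub0mx.
  by apply: (row_free_inj fk); rewrite /= mul0mx ev_hom // C0 // mulmx0.
rewrite -[f]mul1mx -ev_sum mulmx_suml big1 // => i _.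
have [Pi|nPi] := pselect (P i); last by rewrite sA // mul0mx.
by rewrite ev_hom // h // mulmx0.
Qed.

Lemma supp_tors P : closed_succ P -> tors (supp P).
Proof.
move=> cP N h; have [A [C [f [p [ss sA C0]]]]] := supp_sub N cP; case: (ss) => hf hp ff fp e.
have p0 : p = 0 by apply: h => //; apply/(supp_perp _ cP).
have fu : row_full f by rewrite -sub1mx e sub_kermx p0 mulmx0.
by move=> i nPi; apply: (row_full_inj fu); rewrite mulmx0 -ev_hom // sA // mul0mx.
Qed.

Context {m : nat} {M : 'I_m -> rep Q} {V : 'I_m -> qmod}.
Hypotheses (tr : transfer M V) (hM : root_listing M).

Lemma simple_root_dv k : simple_root M k <-> exists i, dv (V k) = delta_mx 0 i.
Proof.
split=> -[i e]; exists i.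
  by apply/rowP => v; rewrite (tr_dim tr) e ffunE !mxE eqxx.
apply/ffunP => v; apply/eqP; rewrite -(eqr_nat rat) -(tr_dim tr) e ffunE !mxE eqxx //=.
Qed.

Lemma dv_ev0 N i : dv N 0 i = 0 <-> ev N i = 0.
Proof.
rewrite mxE; split=> [/eqP|->]; last by rewrite mxrank0 mul0r.
by rewrite mulf_eq0 invr_eq0 (negPf (vval_neq0 i)) orbF pnatr_eq0 mxrank_eq0 => /eqP.
Qed.

(** The Euler form of the two simples is negative: an arrow from i to j contributes -f_i d_ij. *)
Lemma arrow_simple_next i j k l : arrow Q i j -> dv (V k) = delta_mx 0 i -> dv (V l) = delta_mx 0 j ->
  ~ ext0 (V k) (V l).
Proof.
move=> a ek el /ext0_ge0; rewrite /E ek el; apply/negP; rewrite -ltNge.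
have ij : i != j by apply/eqP => e; subst j; have := @arrow_acyclic _ _ Q [:: i] isT; rewrite /= a.
rewrite /eul big1 ?sub0r => [|v _]; last first.
  by rewrite !mxE !eqxx /=; have [->|] := eqVneq v i; rewrite ?(negPf ij) ?mulr0 ?mul0r.
rewrite oppr_lt0 (bigD1 (exist _ (i, j) a : arr Q)) //= !mxE !eqxx !mulr1.
apply: ltr_wpDr; last by rewrite ltr0n muln_gt0 vval_gt0 (aval_gt0 a).1.
by apply: sumr_ge0 => p _; rewrite !mxE !mulr_ge0 ?ler0n.
Qed.

(** In lateral order the target of an arrow comes before its source, so every prefix is closed under
    successors, and the classes [supp] of the prefixes grow by one simple module at a time. *)
Lemma simple_chain s : simple_roots_listing M s -> chain V (@Tzero K n Q) s (@Tall K n Q).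
Proof.
case=> us sP ls.
pose P (u : seq 'I_m) (i : 'I_n) := exists2 k, k \in u & dv (V k) = delta_mx 0 i.
have all i : P s i.
  have [X [iX dX]] := simple_root_ex i.
  have [|k kX] := root_all hM (b := dimvec X); first by exists X.
  have sk : simple_root M k by exists i; rewrite kX.
  exists k; first exact/sP.
  by apply/rowP => v; rewrite (tr_dim tr) kX dX ffunE !mxE eqxx.
have dinj i j : delta_mx 0 i = delta_mx 0 j :> 'rV[rat]_n -> i = j.
  move=> e; have := congr1 (fun x : 'rV[rat]_n => x 0 i) e; rewrite !mxE !eqxx /=.
  by have [//|_ /eqP] := eqVneq i j; rewrite oner_eq0.
have cP u t : s = u ++ t -> closed_succ (P u).
  move=> sE i j a [k ku ek]; have [l ls' el] := all j; exists l => //.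
  have ks : k \in s by rewrite sE mem_cat ku.
  have [_ /(_ _)] := ls _ _ ks ls'; rewrite sE !index_cat ku.
  case: ifP => // _ H; have : (size u + index l t < index k u)%N.
    by apply: H => /(tr_ext tr); exact: arrow_simple_next a ek el.
  move=> lt; move: ku; rewrite -[k \in u]index_mem => lt'.
  by have := ltn_trans lt lt'; rewrite ltnNge leq_addr.
suff main u t : s = u ++ t -> chain V (supp (P u)) t (@Tall K n Q).
  have := main [::] s erefl; congr (chain V _ s _); apply/funext => N; apply/propext.
  split=> [h|h i _]; last by apply: mx_sz0.
  apply: dv0_sz; apply/rowP => i; rewrite [RHS]mxE; apply/dv_ev0/h.
  by case.
elim: t u => [|k t IH] u sE /=.
  move=> N; split=> // _ i; case; rewrite -[u]cats0 -sE; exact: all.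
exists (supp (P (rcons u k))); split; last by apply: IH; rewrite cat_rcons.
have c0 := cP _ _ sE; have c1 : closed_succ (P (rcons u k)) by apply: (cP _ t); rewrite cat_rcons.
have /sP/simple_root_dv[i0 ek] : k \in s by rewrite sE mem_cat mem_head orbT.
have Pr i : P (rcons u k) i <-> P u i \/ i = i0.
  split=> [[l]|[[l lu el]|->]].
  - rewrite mem_rcons inE => /orP[/eqP -> e|lu el]; last by left; exists l.
    by right; apply: dinj; rewrite -ek -e.
  - by exists l => //; rewrite mem_rcons inE lu orbT.
  - by exists k => //; rewrite mem_rcons mem_head.
have nP : ~ P u i0.
  move=> [l lu el]; have e : l = k by apply: (V_inj (tr_listing tr)); rewrite el ek.
  by move: us; rewrite sE cat_uniq => /and3P[_ /hasPn /(_ k (mem_head _ _))]; rewrite -e lu.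
split; [exact: supp_tors|exact: supp_tors| |].
  by move=> N h i nPi; apply: h => Pi; apply: nPi; apply/Pr; left.
move=> l; split=> [[h1 /(supp_perp _ c0) h2]|->].
  apply: (V_prop (tr_listing tr) (c := dv (V l) 0 i0)); rewrite ek.
  apply/rowP => i; rewrite [RHS]mxE [X in _ * X]mxE eqxx /=; have [->|ii] := eqVneq i i0; first by rewrite mulr1.
  rewrite mulr0; apply/dv_ev0.
  have [Pi|nPi] := pselect (P u i); first exact: h2.
  by apply: h1 => /Pr[]// e; rewrite e eqxx in ii.
have z i : i != i0 -> ev (V k) i = 0.
  by move=> ii; apply/dv_ev0; rewrite ek mxE (negPf ii) andbF.
split; first by move=> i nPi; apply: z; apply/eqP => e; apply: nPi; apply/Pr; right.
by apply/(supp_perp _ c0) => i Pi; apply: z; apply/eqP => e; subst i.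
Qed.

End SimpleChain.

(** * Chambers and compartments *)

Section Gordan.
Local Open Scope ring_scope.
Context {F : realFieldType}.

(** P holds for all sufficiently small positive d; such conditions are stable under finite
    conjunctions. *)
Definition small (P : F -> Prop) := exists2 e, 0 < e & forall d, 0 < d <= e -> P d.

Lemma small_and (P P' : F -> Prop) : small P -> small P' -> small (fun d => P d /\ P' d).
Proof.
move=> [e e0 h] [e' e0' h']; exists (Num.min e e'); first by rewrite lt_min e0 e0'.
by move=> d /andP[d0]; rewrite le_min => /andP[d1 d2]; split; [apply: h|apply: h']; rewrite d0.
Qed.

Lemma small_all (I : finType) (P : I -> F -> Prop) :
  (forall i, small (P i)) -> small (fun d => forall i, P i d).
Proof.
move=> h; suff [e e0 he] : small (fun d => forall i, i \in enum I -> P i d).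
  by exists e => // d hd i; apply: (he d hd); rewrite mem_enum.
elim: (enum I) => [|i s IH]; first by exists 1; rewrite ?ltr01.
have [e e0 he] := small_and (h i) IH; exists e => // d /he [Pi Ps] j.
by rewrite inE => /orP[/eqP ->|/Ps].
Qed.

Lemma small_ex (P : F -> Prop) : small P -> exists2 d, 0 < d & P d.
Proof. by case=> e e0 h; exists e => //; apply: h; rewrite e0 lexx. Qed.

Lemma small_imp (P P' : F -> Prop) : small P -> (forall d, 0 < d -> P d -> P' d) -> small P'.
Proof. by case=> e e0 h i; exists e => // d hd; apply: i (h d hd); case/andP: hd. Qed.

Lemma small_le a : 0 < a -> small (fun d => d <= a).
Proof. by move=> a0; exists a => // d /andP[]. Qed.

Lemma small_lin a b : 0 < a -> small (fun d => 0 < a + d * b).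
Proof.
move=> a0; have B0 : 0 < `|b| + 1 by have := normr_ge0 b; lra.
exists (a / (2 * (`|b| + 1))); first by rewrite divr_gt0 // mulr_gt0.
move=> d /andP[d0]; rewrite ler_pdivlMr ?mulr_gt0 // => h.
have : `|d * b| <= d * (`|b| + 1).
  by rewrite normrM (gtr0_norm d0) ler_pM2l // lerDl ler01.
by rewrite ler_norml => /andP[h' _]; lra.
Qed.

Definition dot n (a z : 'rV[F]_n) := \sum_i a 0 i * z 0 i.

Lemma dotDl n (a b z : 'rV[F]_n) : dot (a + b) z = dot a z + dot b z.
Proof. by rewrite -big_split; apply: eq_bigr => i _; rewrite mxE mulrDl. Qed.
Lemma dotDr n (a b z : 'rV[F]_n) : dot z (a + b) = dot z a + dot z b.
Proof. by rewrite -big_split; apply: eq_bigr => i _; rewrite mxE mulrDr. Qed.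
Lemma dotZl n c (a z : 'rV[F]_n) : dot (c *: a) z = c * dot a z.
Proof. by rewrite mulr_sumr; apply: eq_bigr => i _; rewrite mxE mulrA. Qed.
Lemma dotZr n c (a z : 'rV[F]_n) : dot z (c *: a) = c * dot z a.
Proof. by rewrite mulr_sumr; apply: eq_bigr => i _; rewrite mxE mulrCA. Qed.
Lemma dot_gt0 n (a : 'rV[F]_n) : a != 0 -> 0 < dot a a.
Proof.
move=> a0; rewrite lt_def sumr_ge0 ?andbT => [|i _]; last by rewrite -expr2 sqr_ge0.
apply: contra a0 => /eqP e; apply/eqP/rowP => i; rewrite mxE; apply/eqP.
rewrite -sqrf_eq0 expr2; apply/eqP.
by apply: (psumr_eq0P _ e) => // j _; rewrite -expr2 sqr_ge0.
Qed.

(** Induction on the number of vectors. If z is positive on the others but negative on b, apply the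
    induction to the vectors a'_k - l_k b, which are orthogonal to z: adding a multiple of z to a
    solution y adjusts its value at b freely. If z vanishes on b, add a small multiple of b to z. *)
Lemma gordan n r (a : 'I_r -> 'rV[F]_n) :
  (exists z, forall k, 0 < dot (a k) z) \/
  (exists c : 'I_r -> F, [/\ forall k, 0 <= c k, exists k, 0 < c k & \sum_k c k *: a k = 0]).
Proof.
elim: r a => [|r IH] a; first by left; exists 0; case.
pose a' k := a (lift ord0 k); pose b := a ord0.
have caseT (P : 'I_r.+1 -> Prop) : P ord0 -> (forall k, P (lift ord0 k)) -> forall k, P k.
  by move=> P0 PS k; case: (unliftP ord0 k) => [j|] ->.
have [b0|b0] := eqVneq b 0.
  right; exists (fun k => if k == ord0 then 1 else 0); split.
  - by move=> k; case: ifP; rewrite ?ler01.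
  - by exists ord0; rewrite eqxx ltr01.
  rewrite big_ord_recl eqxx -/b b0 scaler0 add0r big1 // => k _.
  by rewrite (_ : (_ == _) = false) ?scale0r.
have ext c0 (c : 'I_r -> F) : 0 <= c0 -> (forall k, 0 <= c k) -> (exists k, 0 < c k) ->
    c0 *: b + \sum_k c k *: a' k = 0 -> 
    exists c : 'I_r.+1 -> F, [/\ forall k, 0 <= c k, exists k, 0 < c k & \sum_k c k *: a k = 0].
  move=> h0 hc [k hk] e; exists (fun k => if unlift ord0 k is Some j then c j else c0); split.
  - by apply: caseT => [|j]; rewrite ?unlift_none ?liftK.
  - by exists (lift ord0 k); rewrite liftK.
  by rewrite big_ord_recl unlift_none -[RHS]e; congr (_ + _); apply: eq_bigr => j _; rewrite liftK.
have [[z hz]|[c [c0 c1 e]]] := IH a'; last first.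
  by right; apply: (ext 0 c) => //; rewrite scale0r add0r.
have [bz|bz|bz] := ltgtP 0 (dot b z).
- by left; exists z; apply: caseT.
- pose l k := dot (a' k) z / dot b z.
  have l0 k : l k < 0 by rewrite pmulr_rlt0 // invr_lt0.
  have [[y hy]|[c [c0 [k ck] e]]] := IH (fun k => a' k - l k *: b); last first.
    right; apply: (ext (- \sum_k c k * l k) c) => //; last 2 first.
    - by exists k.
    - rewrite -[RHS]e scaleNr scaler_suml -sumrN -big_split; apply: eq_bigr => j _.
      by rewrite /= scalerBr scalerA addrC.
    by rewrite oppr_ge0; apply: sumr_le0 => j _; rewrite mulr_ge0_le0 // ltW.
  have [e e0 he] := small_ex (small_all (fun k => small_lin (l k) (hy k))).
  left; pose t := (e - dot b y) / dot b z; exists (y + t *: z).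
  have bw : dot b (y + t *: z) = e.
    by rewrite dotDr dotZr divfK ?lt_eqF // addrC subrK.
  apply: caseT; first by rewrite -/b bw.
  move=> k; have := he k; rewrite !dotDr !dotDl -scaleNr dotZl !dotZr -/(a' k).
  have -> : e = dot b y + t * dot b z by rewrite -bw dotDr dotZr.
  have -> : dot (a' k) z = l k * dot b z by rewrite divfK ?lt_eqF.
  by move=> h; apply: lt_le_trans h _; rewrite le_eqVlt; apply/orP; left; apply/eqP; ring.
have [d d0 hd] := small_ex (small_all (fun k => small_lin (dot (a' k) b) (hz k))).
left; exists (z + d *: b); apply: caseT => [|k]; rewrite dotDr dotZr; last exact: hd.
by rewrite -/b -bz add0r mulr_gt0 // dot_gt0.
Qed.

End Gordan.

(** * Stability conditions and the cones of torsion classes *)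

Section Chambers.
Local Open Scope ring_scope.
Context {K : fieldType} {n : nat} {Q : modulated_quiver K n} {R : realType}.
Local Notation qmod := (@qmod K n Q).
Implicit Types (X Y Z N A B C W : qmod) (T : qmod -> Prop) (x y : 'rV[R]_n) (d : 'rV[rat]_n).

(** The pairing that defines the walls, extended from roots to rational vectors so that it is
    additive on exact sequences. *)
Definition pr x d : R := \sum_i x 0 i * ratr (d 0 i) * (vval Q i)%:R.
Definition q x X := pr x (dv X).

Lemma prD x d d' : pr x (d + d') = pr x d + pr x d'.
Proof. by rewrite -big_split; apply: eq_bigr => i _ /=; rewrite mxE rmorphD /=; ring. Qed.
Lemma prZ x a d : pr x (a *: d) = ratr a * pr x d.
Proof. by rewrite mulr_sumr; apply: eq_bigr => i _ /=; rewrite mxE rmorphM /=; ring. Qed.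
Lemma pr0 x : pr x 0 = 0.
Proof. by have := prZ x 0 0; rewrite scale0r rmorph0 mul0r. Qed.
Lemma prDl x y d : pr (x + y) d = pr x d + pr y d.
Proof. by rewrite -big_split; apply: eq_bigr => i _ /=; rewrite mxE; ring. Qed.
Lemma prZl a x d : pr (a *: x) d = a * pr x d.
Proof. by rewrite mulr_sumr; apply: eq_bigr => i _ /=; rewrite mxE; ring. Qed.
Lemma qDl x y X : q (x + y) X = q x X + q y X. Proof. exact: prDl. Qed.
Lemma qZl a x X : q (a *: x) X = a * q x X. Proof. exact: prZl. Qed.
Lemma q_ses x A X C (i : 'M[K]_(sz A, sz X)) (p : 'M[K]_(sz X, sz C)) : ses i p ->
  q x X = q x A + q x C.
Proof. by move=> /dv_ses e; rewrite /q e prD. Qed.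
Lemma q_sz0 x X : sz X = 0%N -> q x X = 0.
Proof. by move=> /sz0_dv e; rewrite /q e pr0. Qed.
Lemma q_iso x X Y : iso X Y -> q x X = q x Y.
Proof. by move/dv_iso => e; rewrite /q e. Qed.

(* King's torsion class of the stability condition x *)
Definition semistable_tors x X := forall Y (p : 'M[K]_(sz X, sz Y)), ishom p -> row_full p ->
  (0 < sz Y)%N -> 0 < q x Y.
Local Notation Tx := semistable_tors.

(** A smallest nonzero quotient Y of X with q <= 0 is torsion-free: the image of a nonzero map from
    the class has q > 0, so it would leave a smaller nonzero quotient with q < 0. *)
Lemma Tx_tors x : tors (Tx x).
Proof.
move=> X hX; apply: contrapT => nT.
pose S s := exists Y (p : 'M[K]_(sz X, sz Y)), [/\ ishom p, row_full p, (0 < sz Y)%N, q x Y <= 0 & sz Y = s].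
have [|s [Y [p [hp fp Y0 qY sY]]] mn] := @ex_min_nat S.
  apply: contrapT => h; apply: nT => Y p hp fp Y0; rewrite ltNge; apply/negP => qY.
  by apply: h; exists (sz Y), Y, p.
have pY : perp (Tx x) Y.
  move=> N TN f hf; apply: contrapT => /eqP nf.
  have [I [g [i [hg fg hi fi fE]]]] := img_ex hf.
  have I0 : (0 < sz I)%N.
    by rewrite lt0n; apply/eqP => I0; case/eqP: nf; rewrite fE (mx_sz0 i I0) mulmx0.
  have qI := TN I g hg fg I0.
  have [C [r ss]] := cok_ses hi fi; have := q_ses x ss; have := ses_sz ss.
  case: ss => _ hr _ fr _ sE qE.
  have C0 : (0 < sz C)%N by rewrite lt0n; apply/eqP => C0; rewrite (q_sz0 x C0) in qE; lra.
  have : S (sz C).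
    exists C, (p *m r); split=> //; [exact: ishomM| |lra].
    by apply/row_fullP; have [b bp] := row_fullP fp; have [b' br] := row_fullP fr;
      exists (b' *m b); rewrite mulmxA -(mulmxA b') bp mulmx1.
  by move/mn; rewrite -sY sE; lia.
by have p0 := hX Y pY p hp; have := row_full_sz0 fp p0; lia.
Qed.

(** A smallest submodule with q > 0 would be in the class, since the kernels of its nonzero
    quotients have q <= 0. *)
Lemma Tx_perp_sub x Z A (i : 'M[K]_(sz A, sz Z)) : perp (Tx x) Z -> ishom i -> row_free i ->
  q x A <= 0.
Proof.
move=> pZ; have [s] := ubnP (sz A); elim: s A i => // s IH A i lA hi fi.
rewrite leNgt; apply/negP => qA.
have A0 : (0 < sz A)%N by rewrite lt0n; apply/eqP => A0; rewrite (q_sz0 x A0) ltxx in qA.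
have TA : Tx x A.
  move=> Y p hp fp Y0; have [B [f ss]] := ker_ses hp fp.
  have := q_ses x ss; have := ses_sz ss; case: ss => hf _ ff _ _ sE qE.
  have := IH B (f *m i) _ (ishomM hf hi) (row_freeM ff fi).
  by move=> /(_ ltac:(lia)); lra.
have /row_free_sz0 := pZ A TA i hi; move=> /(_ fi); lia.
Qed.

Context {m : nat} {V : 'I_m -> qmod}.
Hypothesis hV : listing V.
Local Notation b k := (dv (V k)).
Local Notation bd := (V_bd hV).

Lemma add_pos (P : qmod -> Prop) (phi : 'rV[rat]_n -> R) : phi 0 = 0 ->
  (forall d d', phi (d + d') = phi d + phi d') ->
  (forall X A, summand A X -> P X -> P A) -> (forall X Y, iso X Y -> P X -> P Y) ->
  (forall k, P (V k) -> 0 < phi (b k)) -> forall X, P X -> (0 < sz X)%N -> 0 < phi (dv X).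
Proof.
move=> phi0 phiD Ps Pi pk X.
suff : P X -> 0 <= phi (dv X) /\ ((0 < sz X)%N -> 0 < phi (dv X)) by move=> h /h[].
elim/(@indec_ind K n Q): X => [X X0 _|X iX PX|A B X dd _ _ IA IB PX].
- by rewrite (sz0_dv X0) X0 phi0.
- have [k ik] := V_all hV iX; rewrite (dv_iso ik).
  have h := pk k (Pi _ _ ik PX); split=> //; exact: ltW.
have PA : P A by apply: Ps PX; exists B.
have PB : P B by apply: Ps PX; exists A; exact: ds_sym.
have [[a0 a1] [b0 b1]] := (IA PA, IB PB).
rewrite (dv_ds dd) phiD (ds_sz dd) addr_ge0 // addn_gt0; split=> // /orP[/a1|/b1] h; lra.
Qed.

Definition in_chamber T x := (forall k, T (V k) -> 0 < q x (V k)) /\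
  (forall k, perp T (V k) -> q x (V k) < 0).

Lemma tors_gt0 T x : tors T -> (forall k, T (V k) -> 0 < q x (V k)) ->
  forall X, T X -> (0 < sz X)%N -> 0 < q x X.
Proof.
move=> tT h; apply: (@add_pos T (pr x)) => //; [exact: pr0|exact: prD| |].
  by move=> Y A s; exact: tors_summand.
by move=> Y Z i; exact: tors_iso.
Qed.

Lemma perp_lt0 T x : (forall k, perp T (V k) -> q x (V k) < 0) ->
  forall X, perp T X -> (0 < sz X)%N -> q x X < 0.
Proof.
move=> h X pX X0; rewrite -oppr_gt0.
apply: (@add_pos (perp T) (fun d => - pr x d)) => //.
- by rewrite pr0 oppr0.
- by move=> d d'; rewrite prD opprD.
- by move=> Y A s; exact: perp_summand.
- by move=> Y Z i; exact: perp_iso.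
by move=> k /h; rewrite oppr_gt0.
Qed.

Lemma chamber_tors T x X : tors T -> in_chamber T x -> T X -> (0 < sz X)%N -> 0 < q x X.
Proof. by move=> tT [h _]; exact: tors_gt0. Qed.

Lemma chamber_perp T x X : in_chamber T x -> perp T X -> (0 < sz X)%N -> q x X < 0.
Proof. by move=> [_ h]; exact: perp_lt0. Qed.

(** A point of the cone recovers T as its King class, so cones of distinct torsion classes are
    disjoint. *)
Lemma chamber_Tx T x : tors T -> in_chamber T x -> Tx x = T.
Proof.
move=> tT hx; apply/funext => X; apply/propext; split=> [TX|TX Y p hp fp Y0].
  apply: tT => Z pZ f hf; apply: contrapT => /eqP nf.
  have [I [g [i [hg fg hi fi fE]]]] := img_ex hf.
  have I0 : (0 < sz I)%N.
    by rewrite lt0n; apply/eqP => I0; case/eqP: nf; rewrite fE (mx_sz0 i I0) mulmx0.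
  have := TX I g hg fg I0; have := chamber_perp hx (perp_sub hi fi pZ) I0; lra.
by apply: (chamber_tors tT hx _ Y0); exact: (tors_quo tT hp fp TX).
Qed.

Lemma chamber_inj T T' x : tors T -> tors T' -> in_chamber T x -> in_chamber T' x -> T = T'.
Proof. by move=> tT tT' /(chamber_Tx tT) <- /(chamber_Tx tT'). Qed.

End Chambers.

(** * Signs and torsion membership *)

Section Compartments.
Local Open Scope classical_set_scope.
Local Open Scope ring_scope.
Context {K : fieldType} {n : nat} {Q : modulated_quiver K n} {R : realType}.
Local Notation qmod := (@qmod K n Q).
Context {m : nat} {M : 'I_m -> rep Q} {V : 'I_m -> qmod}.
Hypothesis tr : transfer M V.
Local Notation hV := (tr_listing tr).
Local Notation Tx := semistable_tors.
Local Notation in_chamber := (in_chamber (V := V)).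
Local Notation wall := (@wall K n Q m M R).
Local Notation region := (@region K n Q m M R).
Implicit Types (X Y Z N A B C W : qmod) (T : qmod -> Prop) (x y z w : 'rV[R]_n).
Implicit Types (e : 'I_m -> sign) (j k l : 'I_m).

Lemma pairing_q x k : pairing M x k = q x (V k).
Proof.
by rewrite /q /pr /pairing; apply: eq_bigr => i _; rewrite (tr_dim tr) ratr_nat.
Qed.

Definition td X : rat := \sum_i dv X 0 i.
Lemma td_ses A X C (i : 'M[K]_(sz A, sz X)) (p : 'M[K]_(sz X, sz C)) : ses i p ->
  td X = td A + td C.
Proof. by move/dv_ses; rewrite /td -big_split => ->; apply: eq_bigr => v _; rewrite mxE. Qed.
Lemma td_ge0 X : 0 <= td X.
Proof. by apply: sumr_ge0 => v _; exact: dv_ge0. Qed.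
Lemma td_gt0 X : (0 < sz X)%N -> 0 < td X.
Proof.
rewrite lt_def td_ge0 andbT => X0; apply: contraTneq X0 => e.
suff /dv0_sz -> : dv X = 0 by [].
by apply/rowP => v; rewrite [RHS]mxE; apply: (psumr_eq0P _ e) => // i _; exact: dv_ge0.
Qed.
Lemma td_lt j k : td (V j) < td (V k) -> (j < k)%N.
Proof.
move=> lt; apply: (tr_len tr); rewrite -(ltr_nat rat) !natr_sum.
have e l : \sum_v (dimvec (M l) v)%:R = td (V l).
  by apply: eq_bigr => v _; rewrite (tr_dim tr).
by rewrite !e.
Qed.

Lemma sub_lt j k (f : 'M[K]_(sz (V j), sz (V k))) : ishom f -> row_free f -> j <> k -> (j < k)%N.
Proof.
move=> hf ff jk; apply: td_lt; have [C [p s]] := cok_ses hf ff.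
rewrite (td_ses s) ltrDl; apply: td_gt0; rewrite lt0n; apply/eqP => C0; apply: jk.
by apply: (V_iso hV); apply: (inj_sz_iso hf ff); rewrite (ses_sz s) C0 addn0.
Qed.

Lemma tors_le_below T T' (t : rat) : tors T -> tors T' ->
  (forall j, td (V j) <= t -> T (V j) -> T' (V j)) -> forall X, td X <= t -> T X -> T' X.
Proof.
move=> tT tT' h; elim/(@indec_ind K n Q) => [X X0 _ _|X iX le TX|A B X dd _ _ IA IB le TX].
- exact: tors_sz0.
- have [k ik] := V_all hV iX; apply: (tors_iso tT' (iso_sym ik)).
  apply: h; last exact: (tors_iso tT ik).
  by rewrite /td -(dv_iso ik).
have [i [p ss]] := ds_ses dd.
have := td_ses ss; have := td_ge0 A; have := td_ge0 B => b0 a0 e.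
apply: (tors_ds tT' dd).
  by apply: IA; [lra|apply: (tors_summand tT _ TX); exists B].
by apply: IB; [lra|apply: (tors_summand tT _ TX); exists A; exact: ds_sym].
Qed.

Lemma tors_eq T T' : tors T -> tors T' -> (forall j, T (V j) <-> T' (V j)) -> T = T'.
Proof.
move=> tT tT' h; apply/funext => X; apply/propext; split; [move: tT tT'|move: tT' tT] => t1 t2.
  by apply: (tors_le_below (t := td X) t1 t2) => // j _ /h.
by apply: (tors_le_below (t := td X) t1 t2) => // j _ /h.
Qed.

Lemma tors_sub_indec T N X (i : 'M[K]_(sz N, sz X)) : tors T -> T N -> (0 < sz N)%N ->
  ishom i -> row_free i -> exists j (f : 'M[K]_(sz (V j), sz X)),
  [/\ T (V j), ishom f, row_free f & (sz (V j) <= sz N)%N].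
Proof.
move=> tT TN N0 hi fi; have [j [A [iA sA]]] := nz_summand hV N0.
have [u [hu fu]] := summand_inj sA; have [g [hg fg _]] := iso_sym iA.
exists j, (g *m u *m i); split.
- exact: (tors_iso tT iA (tors_summand tT sA TN)).
- by apply: ishomM => //; exact: ishomM.
- by apply: row_freeM => //; exact: row_freeM.
rewrite -(iso_sz iA); have := eqP fu; have := rank_leq_col u; lia.
Qed.

(** A nonzero torsion part of V k contains a listed torsion module, which by hypothesis is V k
    itself. *)
Lemma tors_dichotomy T k : tors T ->
  (forall j (f : 'M[K]_(sz (V j), sz (V k))), T (V j) -> ishom f -> row_free f -> j = k) ->
  T (V k) \/ perp T (V k).
Proof.
move=> tT h; have [N [Z [i [p [ss TN pZ]]]]] := tors_dec (V k) tT.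
case: (ss) => hi hp fi fp _; have sE := ses_sz ss.
have [N0|N0] := posnP (sz N); last first.
  have [j [f [Tj hf ff _]]] := tors_sub_indec tT TN N0 hi fi.
  by left; rewrite -(h j f).
by right; apply: (perp_iso _ pZ); apply: iso_sym; apply: (surj_sz_iso hp fp); rewrite sE N0.
Qed.

Lemma Tx_gt0 x X : Tx x X -> (0 < sz X)%N -> 0 < q x X.
Proof. by move=> h; apply: (h X 1%:M) => //; [exact: ishom1|rewrite row_full_unit unitmx1]. Qed.

(** If V k is torsion-free for the King class of x, all its submodules have q <= 0, so q = 0 at V k
    would put x on the wall of k. *)
Lemma nwall_chamber x : (forall k, ~ wall k x) -> in_chamber (Tx x) x.
Proof.
move=> nw; split=> k; first by move/Tx_gt0; apply; exact: V_sz hV k.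
move=> pk; have le A (i : 'M[K]_(sz A, sz (V k))) := @Tx_perp_sub _ _ _ _ x _ A i pk.
have le0 : q x (V k) <= 0 by apply: (le _ 1%:M); rewrite ?row_free_unit ?unitmx1 //; exact: ishom1.
rewrite lt_def le0 andbT; apply/eqP => q0; apply: (nw k); split; first by rewrite pairing_q.
by move=> j /(tr_sub tr)[f [hf ff]]; rewrite pairing_q; exact: le hf ff.
Qed.

Definition adm_at e k := e k = SZero <-> wall k `&` region e k = set0.

Lemma regionP e p x : region e p x <-> forall j, (j < p)%N ->
  (e j = SPlus -> 0 < q x (V j)) /\ (e j = SMinus -> q x (V j) < 0).
Proof. by split=> h j /h; rewrite pairing_q. Qed.

Lemma region_ext e e' p : (forall j, (j < p)%N -> e j = e' j) -> region e p = region e' p.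
Proof.
by move=> h; apply/seteqP; split=> x hx j jp; have := hx j jp; rewrite h.
Qed.

Lemma region_le e p p' x : (p <= p')%N -> region e p' x -> region e p x.
Proof. by move=> le h j jp; apply: h; lia. Qed.

(** At a first disagreement j, proper quotients of V j are smaller and so lie in both classes. Hence
    q y (V j) <= 0 < q x (V j), and only the sign 0 is possible. The combination w of x and y with q
    w (V j) = 0 stays in the region; proper quotients of V j have q w > 0, so submodules have q w <=
    0 and w is on the wall of j, against admissibility. *)
Lemma region_tors e p x y : (forall j, (j < p)%N -> adm_at e j) -> region e p x -> region e p y ->
  forall j, (j < p)%N -> Tx x (V j) -> Tx y (V j).
Proof.
move=> ad rx ry j; have [s] := ubnP j; elim: s j x y rx ry => // s IH j x y rx ry js jp Tj.
apply: contrapT => nT.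
have prop X : td X < td (V j) -> Tx x X -> Tx y X.
  move=> lt; apply: (tors_le_below (t := td X) (Tx_tors (x := x)) (Tx_tors (x := y))) => // l ll.
  have lj : (l < j)%N by apply: td_lt; lra.
  by apply: IH => //; lia.
have qy : q y (V j) <= 0.
  rewrite leNgt; apply/negP => qy; apply: nT => Y p0 hp fp Y0.
  have [B [f ss]] := ker_ses hp fp; have [B0|B0] := posnP (sz B).
    have iY : iso (V j) Y by apply: (surj_sz_iso hp fp); rewrite (ses_sz ss) B0.
    by rewrite -(q_iso y iY).
  apply: Tx_gt0 => //; apply: prop; last exact: (tors_quo (Tx_tors (x := x)) hp fp Tj).
  by rewrite (td_ses ss) ltrDr td_gt0.
have qx : 0 < q x (V j) := Tx_gt0 Tj (V_sz hV j).
have [h1 h2] := (regionP e p x).1 rx j jp; have [h3 h4] := (regionP e p y).1 ry j jp.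
case ej : (e j); [|by have := h3 ej; lra|by have := h2 ej; lra].
have [/(_ ej) /seteqP[w0 _] _] := ad j jp.
pose w := - q y (V j) *: x + q x (V j) *: y.
have qw X : q w X = - q y (V j) * q x X + q x (V j) * q y X by rewrite qDl !qZl.
apply: (w0 w); split; last first.
  apply/regionP => l lj; rewrite qw; have lp : (l < p)%N by lia.
  have [g1 g2] := (regionP e p x).1 rx l lp; have [g3 g4] := (regionP e p y).1 ry l lp.
  by split=> el; [have := g1 el; have := g3 el|have := g2 el; have := g4 el] => a b; nra.
split; first by rewrite pairing_q qw; ring.
move=> l /(tr_sub tr)[f [hf ff]]; rewrite pairing_q.
have [Y [p0 ss]] := cok_ses hf ff; have := q_ses w ss; rewrite qw.
have [Y0|Y0] := posnP (sz Y); first by rewrite (q_sz0 w Y0); nra.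
case: (ss) => _ hp _ fp _.
have TY := tors_quo (Tx_tors (x := x)) hp fp Tj.
have TY' : Tx y Y by apply: prop TY; rewrite (td_ses ss) ltrDr td_gt0 // (V_sz hV).
have := Tx_gt0 TY Y0; have := Tx_gt0 TY' Y0; rewrite (qw Y); nra.
Qed.

(** A wall point w of the region has the same torsion modules as x before k. A proper torsion
    submodule of V k would thus have q w > 0, against the wall inequalities. *)
Lemma sign_dichotomy e k x : (forall j, (j <= k)%N -> adm_at e j) -> region e k x ->
  wall k `&` region e k !=set0 -> Tx x (V k) \/ perp (Tx x) (V k).
Proof.
move=> ad rx [w [[_ ws] rw]]; apply: tors_dichotomy => [|j f Tj hf ff]; first exact: Tx_tors.
apply: contrapT => jk; have lt := sub_lt hf ff jk.
have Tw : Tx w (V j) by apply: (region_tors (p := k) _ rx rw lt Tj) => l ll; apply: ad; exact: ltnW.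
have := ws j; rewrite pairing_q => h; have : q w (V j) <= 0.
  by apply: h; apply/(tr_sub tr); exists f.
have := Tx_gt0 Tw (V_sz hV j); lra.
Qed.

Lemma admissible_sign e x k : @admissible K n Q m M R e -> compartment M e x ->
  (e k = SPlus -> Tx x (V k)) /\ (e k = SMinus -> perp (Tx x) (V k)).
Proof.
move=> ad cx; have [h1 h2] := (regionP e m x).1 cx k (ltn_ord k).
have dich : e k <> SZero -> Tx x (V k) \/ perp (Tx x) (V k).
  move=> nz; apply: (sign_dichotomy (e := e)) => [j _||]; first exact: ad.
    exact: region_le (ltnW (ltn_ord k)) cx.
  by apply/set0P/negP => /eqP /(ad k).2.
split=> ek; (have [|p|p] := dich; first by rewrite ek) => //.
  have := @Tx_perp_sub _ _ _ _ x _ _ 1%:M p (@ishom1 _ _ _ _).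
  rewrite row_free_unit unitmx1 => /(_ isT); have := h1 ek; lra.
by have := Tx_gt0 p (V_sz hV k); have := h2 ek; lra.
Qed.

End Compartments.

(** * Compartments are the cones of torsion classes *)

Section CompartmentsAreChambers.
Local Open Scope classical_set_scope.
Local Open Scope ring_scope.
Context {K : fieldType} {n : nat} {Q : modulated_quiver K n} {R : realType}.
Local Notation qmod := (@qmod K n Q).
Context {m : nat} {M : 'I_m -> rep Q} {V : 'I_m -> qmod}.
Hypothesis tr : transfer M V.
Local Notation hV := (tr_listing tr).
Local Notation Tx := (@semistable_tors K n Q R).
Local Notation in_chamber := (@in_chamber K n Q R m V).
Local Notation wall := (@wall K n Q m M R).
Local Notation region := (@region K n Q m M R).
Local Notation b k := (dv (V k)).
Implicit Types (X Y Z N A B C W : qmod) (T : qmod -> Prop) (x y z w : 'rV[R]_n).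
Implicit Types (e : 'I_m -> sign) (j k l : 'I_m).

Lemma q_gt0 x X : (forall i, 0 < x 0 i) -> (0 < sz X)%N -> 0 < q x X.
Proof.
move=> x0 X0; have nn i : 0 <= x 0 i * ratr (dv X 0 i) * (vval Q i)%:R.
  by apply: mulr_ge0; [apply: mulr_ge0; [exact: ltW|rewrite ler0q; exact: dv_ge0]|exact: ler0n].
rewrite lt_def /q /pr sumr_ge0 ?andbT //; apply: contraTneq X0 => e.
suff /dv0_sz -> : dv X = 0 by [].
apply/rowP => v; rewrite [RHS]mxE.
have : x 0 v * ratr (dv X 0 v) * (vval Q v)%:R = 0 by exact: (psumr_eq0P (fun i _ => nn i) e).
move/eqP; rewrite mulf_eq0 pnatr_eq0 (gtn_eqF (vval_gt0 Q v)) orbF mulf_eq0 (gt_eqF (x0 v)) /=.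
by rewrite eq_le lerq0 ler0q -eq_le => /eqP.
Qed.

Lemma q_opp x X : q (- x) X = - q x X.
Proof. by rewrite -scaleN1r qZl mulN1r. Qed.

(** If the next sign is nonzero, admissibility gives a point of the region on the wall. A small step
    along [const_mx 1], on which every nonzero module is positive, or against it, reaches the
    prescribed side and preserves the earlier strict inequalities. *)
Lemma region_nonempty e p : @admissible K n Q m M R e -> (p <= m)%N -> exists x, region e p x.
Proof.
move=> ad; elim: p => [|p IH] pm; first by exists 0 => j.
have [x rx] := IH (ltnW pm); pose k := Ordinal pm.
have lt_p j : (j < p.+1)%N -> (j < p)%N \/ j = k.
  rewrite ltnS leq_eqVlt => /orP[/eqP e'|]; [right|by left].
  exact: val_inj.
have pert (s : R) y : region e p y -> wall k y -> exists2 d, 0 < d & 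
    (forall j, (j < p)%N -> (e j = SPlus -> 0 < q (y + (d * s) *: const_mx 1) (V j)) /\
      (e j = SMinus -> q (y + (d * s) *: const_mx 1) (V j) < 0)).
  move=> ry wy; apply: small_ex; apply: small_all => j.
  have [jp|jp] := ltnP j p; last by exists 1 => // d _.
  have [h1 h2] := (regionP tr e p y).1 ry j jp.
  case ej : (e j); first by exists 1.
    apply: (small_imp (small_lin (s * q (const_mx 1) (V j)) (h1 ej))) => d d0 h _; split=> // _.
    by rewrite qDl qZl -mulrA.
  have h3 : 0 < - q y (V j) by have := h2 ej; lra.
  apply: (small_imp (small_lin (- (s * q (const_mx 1) (V j))) h3)) => d d0 h _; split=> // _.
  by rewrite qDl qZl -mulrA; lra.
have qc : 0 < q (const_mx 1 : 'rV[R]_n) (V k) by apply: q_gt0 => [i|]; rewrite ?mxE ?(V_sz hV).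
have fin (s : R) : e k <> SZero ->
   (forall d, 0 < d -> (e k = SPlus -> 0 < d * s) /\ (e k = SMinus -> d * s < 0)) ->
   exists x, region e p.+1 x.
  move=> nz hs; have [y [wy ry]] : wall k `&` region e k !=set0.
    by apply/set0P/negP => /eqP /(ad k).2.
  have [d d0 hd] := pert s y ry wy; exists (y + (d * s) *: const_mx 1).
  apply/(regionP tr) => j /lt_p[/hd //|->].
  have q0 := wy.1; rewrite (pairing_q tr) in q0; have [h1 h2] := hs d d0.
  by rewrite qDl qZl q0 add0r; split=> ek; [apply: mulr_gt0|rewrite nmulr_rlt0] => //; auto.
case ek : (e k).
- by exists x => j /lt_p[/rx //|->]; rewrite ek.
- by apply: (fin 1); rewrite ek // => d d0; rewrite mulr1.
by apply: (fin (-1)); rewrite ek // => d d0; split=> // _; lra.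
Qed.

Lemma compartment_nwall e x k : @admissible K n Q m M R e -> compartment M e x -> ~ wall k x.
Proof.
move=> ad cx wx; have [h1 h2] := cx k (ltn_ord k); have w0 := wx.1.
case ek : (e k); [|by have := h1 ek; lra|by have := h2 ek; lra].
have [/(_ ek) /seteqP[h _] _] := ad k; apply: (h x); split=> //.
exact: region_le (ltnW (ltn_ord k)) cx.
Qed.

(** By [region_tors] all points of a compartment have the same King class, and they lie off the
    walls, hence in its cone. Conversely the nonzero signs are dictated by membership in that class
    or its perpendicular. *)
Lemma compartment_chamber e : @admissible K n Q m M R e ->
  exists T, [/\ tors T, exists x, in_chamber T x, compartment M e = in_chamber T &
    forall k, (e k = SPlus -> T (V k)) /\ (e k = SMinus -> perp T (V k))].
Proof.
move=> ad; have [x cx] := region_nonempty ad (leqnn m).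
have cc y : compartment M e y -> in_chamber (Tx y) y.
  by move=> cy; apply: (nwall_chamber tr) => k; exact: compartment_nwall.
have eqT y : compartment M e y -> Tx y = Tx x.
  move=> cy; have adm l : (l < m)%N -> @adm_at _ _ _ R _ M e l by move=> _; exact: ad.
  have h (u v : 'rV[R]_n) j : compartment M e u -> compartment M e v -> Tx u (V j) -> Tx v (V j).
    by move=> cu cv Tu; exact: (region_tors tr adm cu cv (ltn_ord j) Tu).
  apply: (tors_eq tr (T := Tx y) (T' := Tx x)) => [||j]; try exact: Tx_tors.
  by split; exact: h.
have sg k := admissible_sign tr k ad cx.
exists (Tx x); split=> //; [exact: Tx_tors|by exists x; exact: cc|].
apply/seteqP; split=> y cy; first by rewrite -(eqT y cy); exact: cc.
apply/(regionP tr) => j _; have [h1 h2] := sg j; split=> ej.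
  exact: cy.1 (h1 ej).
exact: cy.2 (h2 ej).
Qed.

(** Fix a point z of the cone and choose the signs in order: 0 if the wall of k misses the region so
    far, otherwise the side of z, which is defined because V k is then torsion or torsion-free. *)
Lemma admissible_ex T : tors T -> (exists x, in_chamber T x) ->
  exists e, @admissible K n Q m M R e /\ compartment M e = in_chamber T.
Proof.
move=> tT [z cz]; have zT := chamber_Tx hV tT cz.
suff /(_ m (leqnn m)) [e [ad rz]] : forall p, (p <= m)%N -> exists e,
    (forall k, (k < p)%N -> @adm_at _ _ _ R _ M e k) /\ region e p z.
  have ad' : @admissible K n Q m M R e by move=> k; exact: ad.
  exists e; split=> //; have [T' [tT' _ ce _]] := compartment_chamber ad'.
  by rewrite ce (chamber_inj hV tT tT' cz) // -ce.
elim=> [|p IH] pm; first by exists (fun=> SZero); split=> // j.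
have [e [ad rz]] := IH (ltnW pm); pose k := Ordinal pm.
have lt_p j : (j < p.+1)%N -> (j < p)%N \/ j = k.
  rewrite ltnS leq_eqVlt => /orP[/eqP e'|]; [right|by left].
  exact: val_inj.
suff [s [hs hz]] : exists s, (s = SZero <-> wall k `&` region e k = set0) /\
    ((s = SPlus -> 0 < q z (V k)) /\ (s = SMinus -> q z (V k) < 0)).
  pose e' j := if j == k then s else e j.
  have ee j : (j < p)%N -> e j = e' j.
    by move=> jp; rewrite /e'; case: eqVneq => // jk; rewrite jk /= ltnn in jp.
  have e'k : e' k = s by rewrite /e' eqxx.
  exists e'; split=> [j|].
    move=> /lt_p[jp|->]; rewrite /adm_at.
      rewrite -ee // -(@region_ext _ _ _ R _ M e) => [|l lj]; first exact: ad.
      by apply: ee; exact: ltn_trans lj jp.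
    by rewrite e'k -(@region_ext _ _ _ R _ M e).
  apply/(regionP tr) => j /lt_p[jp|->]; last by rewrite e'k.
  by rewrite -ee //; exact: (regionP tr e p z).1 rz j jp.
have [w0|w0] := pselect (wall k `&` region e k = set0); first by exists SZero.
have w1 : wall k `&` region e k !=set0 by apply/set0P/eqP.
have dich : T (V k) \/ perp T (V k).
  rewrite -zT; have [w [ww rw]] := w1.
  apply: (tors_dichotomy tr); [exact: Tx_tors|move=> j f Tj hf ff].
  apply: contrapT => jk; have lt := sub_lt tr hf ff jk.
  have Tw : Tx w (V j) by apply: (region_tors tr (p := k) ad rz rw lt Tj).
  have := ww.2 j; rewrite (pairing_q tr) => h; have : q w (V j) <= 0.
    by apply: h; apply/(tr_sub tr); exists f.
  have := Tx_gt0 Tw (V_sz hV j); lra.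
case: dich => [/cz.1 h|/cz.2 h]; [exists SPlus|exists SMinus]; split=> //; split=> //.
Qed.

Lemma zero_module : exists N, sz N = 0%N.
Proof.
have h : @is_mod K n Q 0 (fun=> 0) by split=> *; apply/matrixP => -[].
by exists (QMod h).
Qed.

(** D is a common denominator of the coefficients, so D times the combination is the dimension
    vector of a direct sum. *)
Lemma nonneg_comb (P : qmod -> Prop) (I : eqType) (s : seq I) (c : I -> rat) (f : I -> 'I_m) :
  (forall N, sz N = 0%N -> P N) -> (forall A B X, ds A B X -> P A -> P B -> P X) ->
  (forall i, 0 <= c i) -> (forall i, i \in s -> P (V (f i))) ->
  exists (D : nat) N, [/\ (0 < D)%N, P N & dv N = D%:R *: \sum_(i <- s) c i *: b (f i)].
Proof.
move=> P0 Pd c0; have mult X (a : nat) : P X -> exists2 N, P N & dv N = a%:R *: dv X.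
  move=> PX; elim: a => [|a [N PN eN]].
    by have [N N0] := zero_module; exists N; [exact: P0|rewrite scale0r sz0_dv].
  exists (dsum X N); first exact: Pd (dsumP _ _) PX PN.
  by rewrite (dv_ds (dsumP _ _)) eN -(addn1 a) natrD scalerDl scale1r addrC.
elim: s => [|i s IH] hs.
  by have [N N0] := zero_module; exists 1%N, N; split; [|exact: P0|rewrite big_nil scaler0 sz0_dv].
have [|D [N [D0 PN eN]]] := IH; first by move=> j js; apply: hs; rewrite inE js orbT.
have [a [d [d0 cE]]] : exists (a d : nat), (0 < d)%N /\ c i = a%:R / d%:R.
  exists `|numq (c i)|%N, `|denq (c i)|%N; split; first by rewrite absz_gt0 denq_eq0.
  by rewrite !natr_absz !ger0_norm ?numq_ge0 ?denq_ge0 // divq_num_den.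
have [N1 P1 e1] := mult N d PN.
have [N2 P2 e2] := mult (V (f i)) (D * a)%N (hs i (mem_head _ _)).
exists (D * d)%N, (dsum N2 N1); split.
- by rewrite muln_gt0 D0.
- exact: Pd (dsumP _ _) P2 P1.
rewrite (dv_ds (dsumP _ _)) e1 e2 eN big_cons scalerDr !scalerA; congr (_ *: _ + _ *: _).
  by rewrite cE !natrM mulrA mulrAC mulfK // pnatr_eq0 -lt0n.
by rewrite -natrM mulnC.
Qed.

Lemma chamber_ex T : tors T -> exists x, in_chamber T x.
Proof.
move=> tT; pose A := [pred k | `[< T (V k) \/ perp T (V k) >]].
pose f (i : 'I_#|A|) : 'I_m := enum_val i.
pose pos i := `[< T (V (f i)) >].
have excl k : T (V k) -> perp T (V k) -> False.
  by move=> h1 h2; have := tors_perp0 h1 h2; have := V_sz hV k; lia.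
have fP i : ~~ pos i -> perp T (V (f i)).
  move=> /asboolPn np; have : f i \in A := enum_valP i.
  by rewrite inE => -[/np|].
have [[z hz]|[c [c0 [i ci] e]]] := gordan (fun i => (if pos i then 1 else -1) *: b (f i)).
  (* Division by f_v converts the standard dot product into the weighted pairing. *)
  pose x : 'rV[R]_n := \row_v (ratr (z 0 v) / (vval Q v)%:R).
  have xE k : q x (V k) = ratr (dot (b k) z).
    rewrite /q /pr /dot rmorph_sum; apply: eq_bigr => v _ /=; rewrite mxE rmorphM /=.
    have : (vval Q v)%:R != 0 :> R by rewrite pnatr_eq0 -lt0n vval_gt0.
    by move=> v0; rewrite mulrAC divfK // mulrC.
  exists x; split=> k h; rewrite xE.
    have kA : k \in A by rewrite inE; left.
    have := hz (enum_rank_in kA k); rewrite dotZl /pos /f enum_rankK_in //.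
    by rewrite asboolT // mul1r => h'; rewrite ltr0q.
  have kA : k \in A by rewrite inE; right.
  have := hz (enum_rank_in kA k); rewrite dotZl /pos /f enum_rankK_in //.
  rewrite asboolF; last by move=> h'; exact: excl h' h.
  by rewrite mulN1r oppr_gt0 => h'; rewrite ltrq0.
pose v := \sum_(i | pos i) c i *: b (f i); pose v' := \sum_(i | ~~ pos i) c i *: b (f i).
have vv : v = v'.
  apply/eqP; rewrite -subr_eq0 -e (bigID pos) /= /v /v' -sumrN; apply/eqP; congr (_ + _).
    by apply: eq_bigr => j ->; rewrite scale1r.
  by apply: eq_bigr => j /negPf ->; rewrite scaleN1r scalerN.
have [||||D [N [D0 TN eN]]] := @nonneg_comb T _ (seq.filter pos (enum 'I_#|A|)) c f.
- by move=> X; exact: tors_sz0.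
- by move=> X Y Z; exact: tors_ds.
- exact: c0.
- by move=> j; rewrite mem_filter => /andP[/asboolP].
have [||||D' [N' [D0' TN' eN']]] := @nonneg_comb (perp T) _ (seq.filter (predC pos) (enum 'I_#|A|)) c f.
- by move=> X; exact: perp_sz0.
- by move=> X Y Z; exact: perp_ds.
- exact: c0.
- by move=> j; rewrite mem_filter => /andP[/fP].
have {}eN : dv N = D%:R *: v by rewrite eN big_filter big_enum_cond.
have {}eN' : dv N' = D'%:R *: v by rewrite eN' vv big_filter big_enum_cond.
have dp (j : nat) : (0 < j)%N -> 0 < j%:R :> rat by rewrite ltr0n.
have := dp _ D0; have := dp _ D0' => d' d.
have le0 : eul Q v v <= 0.
  have := E_hz (TN' N TN); rewrite /E eN eN' eulZl eulZr.
  by rewrite !pmulr_rle0.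
have [N0|N0] := posnP (sz N); last first.
  have := E_pos (V_bd hV) N0; rewrite /E eN eulZl eulZr !pmulr_rgt0 //; lra.
have v0 : v = 0.
  move: (sz0_dv N0); rewrite eN => /eqP; rewrite scaler_eq0 gt_eqF //= => /eqP //.
(* Both halves of the relation are sums of nonnegative vectors equal to 0, so the term with c i > 0
   vanishes too, although V (f i) is nonzero. *)
have bi : c i *: b (f i) = 0.
  apply/rowP => l; rewrite [RHS]mxE.
  have nn (j : 'I_#|A|) : 0 <= (c j *: b (f j)) 0 l by rewrite mxE mulr_ge0 ?dv_ge0.
  have [pi|pi] := boolP (pos i).
    have := congr1 (fun u : 'rV[rat]_n => u 0 l) v0; rewrite summxE [RHS]mxE.
    by move=> h; apply: (psumr_eq0P _ h) => // j _; exact: nn.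
  have := congr1 (fun u : 'rV[rat]_n => u 0 l) vv; rewrite v0 summxE [LHS]mxE => /esym h.
  by apply: (psumr_eq0P _ h) => // j _; exact: nn.
move/eqP: bi; rewrite scaler_eq0 gt_eqF //= => /eqP /dv0_sz.
by have := V_sz hV (f i); lia.
Qed.

End CompartmentsAreChambers.

(** * The facet between the cones of a cover *)

Section Adjacency.
Import numFieldNormedType.Exports.
Local Open Scope classical_set_scope.
Local Open Scope ring_scope.
Context {K : fieldType} {n : nat} {Q : modulated_quiver K n} {R : realType}.
Local Notation qmod := (@qmod K n Q).
Context {m : nat} {M : 'I_m -> rep Q} {V : 'I_m -> qmod}.
Hypothesis tr : transfer M V.
Local Notation hV := (tr_listing tr).
Local Notation in_chamber := (@in_chamber K n Q R m V).
Local Notation wall := (@wall K n Q m M R).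
Local Notation region := (@region K n Q m M R).
Local Notation admissible := (@admissible K n Q m M R).
Local Notation b k := (dv (V k)).
Implicit Types (X Y Z N A B C W : qmod) (T : qmod -> Prop) (x y z w : 'rV[R]_n).
Implicit Types (e : 'I_m -> sign) (j k l : 'I_m).

Lemma q_nbhs x X : 0 < q x X ->
  small (fun d => forall y, (forall i, `|x 0 i - y 0 i| < d) -> 0 < q y X).
Proof.
move=> q0; pose c i : R := ratr (dv X 0 i) * (vval Q i)%:R.
have c0 i : 0 <= c i by apply: mulr_ge0; [rewrite ler0q; exact: dv_ge0|exact: ler0n].
apply: (small_imp (small_lin (- \sum_i c i) q0)) => d d0 h y xy.
apply: lt_le_trans h _; rewrite mulrN mulr_sumr -sumrB.
apply: ler_sum => i _.
have a (t : R) : t * ratr (dv X 0 i) * (vval Q i)%:R = t * c i by exact: (esym (mulrA _ _ _)).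
rewrite !a -mulrBl; apply: ler_wpM2r => //.
by have := xy i; rewrite ltr_norml => /andP[]; lra.
Qed.

Lemma open_of_small (O : set 'rV[R]_n) :
  (forall x, O x -> small (fun d => forall y, (forall i, `|x 0 i - y 0 i| < d) -> O y)) -> open O.
Proof.
move=> h; rewrite openE => x /h[d d0 hd]; apply/nbhs_ballP; exists d => // y [_ xy].
apply: (hd d); first by rewrite d0 lexx.
by move=> i; have := xy 0 i; rewrite -ball_normE.
Qed.

Lemma closure_segment (A : set 'rV[R]_n) x z :
  (forall d : R, 0 < d <= 1 -> A ((1 - d) *: x + d *: z)) -> closure A x.
Proof.
move=> h B /nbhs_ballP[r /= r0 rB].
have sm i : small (fun d => 0 < r + d * - `|x 0 i - z 0 i|) := small_lin _ r0.
have [d d0 [d1 hd]] := small_ex (small_and (small_le (@ltr01 R)) (small_all sm)).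
exists ((1 - d) *: x + d *: z); split; first by apply: h; rewrite d0.
apply: rB; split=> // i j; rewrite -ball_normE /= (ord1 i) !mxE.
have -> : x 0 j - ((1 - d) * x 0 j + d * z 0 j) = d * (x 0 j - z 0 j) by ring.
by rewrite normrM (gtr0_norm d0); have := hd j; lra.
Qed.

Section Face.
Variables (T T1 : qmod -> Prop) (k : 'I_m).
Hypothesis st : step V T k T1.
Let tT : tors T. Proof. by case: st. Qed.
Let tT1 : tors T1. Proof. by case: st. Qed.
Let TT1 X : T X -> T1 X. Proof. by case: st => _ _ h _; exact: h. Qed.
Let perp_le X : perp T1 X -> perp T X. Proof. by move=> h N TN; exact/h/TT1. Qed.

(** The strict inequalities that survive from both cones form an open set; adding the equation of
    the wall gives the relatively open common facet [face]. *)
Definition transversal x := (forall l, T (V l) -> 0 < q x (V l)) /\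
  (forall l, perp T1 (V l) -> q x (V l) < 0).
Definition face x := transversal x /\ q x (V k) = 0.

Lemma heart_q0 x X : face x -> T1 X -> perp T X -> q x X = 0.
Proof.
by move=> fx T1X pX; have [a e] := step_dv hV st T1X pX; rewrite /q e prZ [pr _ _]fx.2 mulr0.
Qed.

(** The torsion part for T has q >= 0, and the quotient, a multiple of V k in dimension, has q =
    0. *)
Lemma face_ge0 x X : face x -> T1 X -> 0 <= q x X.
Proof.
move=> fx T1X; have [N [Z [i [p [ss TN pZ]]]]] := tors_dec X tT.
rewrite (q_ses x ss); case: ss => _ hp _ fp _.
rewrite (heart_q0 fx (tors_quo tT1 hp fp T1X) pZ) addr0.
have [N0|N0] := posnP (sz N); first by rewrite q_sz0.
exact/ltW/(tors_gt0 hV tT fx.1.1).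
Qed.

Lemma face_le0 x X : face x -> perp T X -> q x X <= 0.
Proof.
move=> fx pX; have [N [Z [i [p [ss TN pZ]]]]] := tors_dec X tT1.
rewrite (q_ses x ss); case: ss => hi _ fi _ _.
rewrite (heart_q0 fx TN (perp_sub hi fi pX)) add0r.
have [Z0|Z0] := posnP (sz Z); first by rewrite q_sz0.
exact/ltW/(perp_lt0 hV fx.1.2).
Qed.

Lemma face_wall x : face x -> wall k x.
Proof.
move=> fx; split; first by rewrite (pairing_q tr) fx.2.
move=> j /(tr_sub tr)[f [hf ff]]; rewrite (pairing_q tr); apply: face_le0 => //.
exact: perp_sub hf ff (step_in st).2.
Qed.

Lemma face_closure x z : face x -> in_chamber T z -> closure (in_chamber T) x.
Proof.
move=> fx [z1 z2]; apply: closure_segment (z) _ => d /andP[d0 d1].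
split=> l h; rewrite qDl !qZl.
  by have := fx.1.1 l h; have := z1 l h => a c; nra.
by have := face_le0 fx h; have := z2 l h => a c; nra.
Qed.

Lemma face_closure1 x z : face x -> in_chamber T1 z -> closure (in_chamber T1) x.
Proof.
move=> fx [z1 z2]; apply: closure_segment (z) _ => d /andP[d0 d1].
split=> l h; rewrite qDl !qZl.
  by have := face_ge0 fx h; have := z1 l h => a c; nra.
by have := fx.1.2 l h; have := z2 l h => a c; nra.
Qed.

(** A positive combination of points of the two cones cancels their values of opposite sign at V k;
    the other inequalities hold for both points. *)
Lemma face_nonempty : exists x, face x.
Proof.
have [z [z1 z2]] := @chamber_ex _ _ _ R _ _ _ tr _ tT.
have [y [y1 y2]] := @chamber_ex _ _ _ R _ _ _ tr _ tT1.
have [T1k pk] := step_in st; have yk := y1 k T1k; have zk := z2 k pk.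
exists (q y (V k) *: z - q z (V k) *: y); split; last by rewrite -scaleNr qDl !qZl; ring.
split=> l h; rewrite -scaleNr qDl !qZl.
  by have := z1 l h; have := y1 l (TT1 h) => a c; nra.
by have := z2 l (perp_le h); have := y2 l h => a c; nra.
Qed.

Lemma transversal_open : open transversal.
Proof.
apply: open_of_small => x [h1 h2].
have s1 l : small (fun d => T (V l) -> forall y, (forall i, `|x 0 i - y 0 i| < d) -> 0 < q y (V l)).
  have [Tl|nTl] := pselect (T (V l)); last by exists 1.
  by apply: (small_imp (q_nbhs (h1 l Tl))) => d d0 h _.
have s2 l : small (fun d => perp T1 (V l) -> forall y, (forall i, `|x 0 i - y 0 i| < d) -> q y (V l) < 0).
  have [pl|npl] := pselect (perp T1 (V l)); last by exists 1.
  have qN : 0 < q (- x) (V l) by rewrite q_opp oppr_gt0 h2.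
  apply: (small_imp (q_nbhs qN)) => d d0 h _ y xy.
  rewrite -oppr_gt0 -q_opp; apply: h => i; by rewrite !mxE -opprD normrN.
apply: (small_imp (small_and (small_all s1) (small_all s2))) => d d0 [g1 g2] y xy.
by split=> l h; [apply: g1 xy|apply: g2 xy].
Qed.

Lemma step_wall_separated : wall_separated M k (in_chamber T : set 'rV[R]_n) (in_chamber T1).
Proof.
have [T1k pk] := step_in st; split.
  left; split=> x [h1 h2] /=; rewrite (pairing_q tr); [exact: h2|exact: h1].
have [z cz] := @chamber_ex _ _ _ R _ _ _ tr _ tT.
have [y cy] := @chamber_ex _ _ _ R _ _ _ tr _ tT1.
have fP x : transversal x /\ hyperplane M k x -> face x.
  by case=> tx hx; split=> //; rewrite -(pairing_q tr).
exists transversal; split; first exact: transversal_open.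
- by have [x [tx x0]] := face_nonempty; exists x; split=> //; rewrite /hyperplane /= (pairing_q tr).
- by move=> x /fP fx; split; [exact: face_closure fx cz|exact: face_closure1 fx cy].
by move=> x /fP; exact: face_wall.
Qed.

End Face.

Lemma chamber_signs e T : admissible e -> tors T -> compartment M e = in_chamber T ->
  forall k, (e k = SPlus -> T (V k)) /\ (e k = SMinus -> perp T (V k)).
Proof.
move=> ad tT ce; have [T' [tT' [x cx] ce' sg]] := compartment_chamber tr ad.
suff -> : T = T' by [].
apply: (chamber_inj hV (x := x)) => //.
by have := cx; rewrite -ce' ce.
Qed.

Lemma tors_perp_V T k : T (V k) -> perp T (V k) -> False.
Proof. by move=> h1 h2; have := tors_perp0 h1 h2; have := V_sz hV k; lia. Qed.

(** As long as the signs agree, so do the regions and hence the zeros. A difference at some j < k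
    would make V j torsion for T1 and torsion-free for T, forcing j = k. Points of the facet lie on
    the wall and in the common region, so the sign at k is nonzero on both sides. *)
Lemma step_signs e e1 T T1 k : admissible e -> admissible e1 -> step V T k T1 ->
  compartment M e = in_chamber T -> compartment M e1 = in_chamber T1 ->
  [/\ e k = SMinus, e1 k = SPlus & forall j, (j < k)%N -> e j = e1 j].
Proof.
move=> ad ad1 st ce ce1; have [tT tT1 TT1 sk] := st; have [T1k pk] := step_in st.
have sg := chamber_signs ad tT ce; have sg1 := chamber_signs ad1 tT1 ce1.
have eq j : (j < k)%N -> e j = e1 j.
  have [s] := ubnP j; elim: s j => // s IH j js jk.
  have re : region e j = region e1 j.
    by apply: region_ext => l lj; apply: IH; [move: js lj; clear; lia|exact: ltn_trans lj jk].
  have z : e j = SZero <-> e1 j = SZero by rewrite (ad j) (ad1 j) re.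
  have [p p'] := sg j; have [p1 p1'] := sg1 j.
  case ej : (e j); case e1j : (e1 j) => //.
  - by have := z.1 ej; rewrite e1j.
  - by have := z.1 ej; rewrite e1j.
  - by have := z.2 e1j; rewrite ej.
  - by case: (tors_perp_V (TT1 _ (p ej)) (p1' e1j)).
  - by have := z.2 e1j; rewrite ej.
  have /sk jk' : T1 (V j) /\ perp T (V j) by split; [exact: p1|exact: p'].
  by rewrite jk' ltnn in jk.
have re : region e k = region e1 k by apply: region_ext.
have [y fy] := face_nonempty st; have wy := face_wall st fy.
have ry : region e k y.
  apply/(regionP tr) => j jk; split=> ej; first exact: (fy.1.1 j ((sg j).1 ej)).
  by apply: (fy.1.2 j ((sg1 j).2 _)); rewrite -eq.
have nz : e k <> SZero by move/(ad k)/seteqP => [h _]; exact: (h y).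
have nz1 : e1 k <> SZero by move/(ad1 k)/seteqP => [h _]; apply: (h y); rewrite -re.
split=> //.
  by case ek : (e k) => //; case: (tors_perp_V ((sg k).1 ek) pk).
by case ek : (e1 k) => //; case: (tors_perp_V T1k ((sg1 k).2 ek)).
Qed.

Lemma closure_ge0 (A : set 'rV[R]_n) X x : (forall y, A y -> 0 < q y X) -> closure A x -> 0 <= q x X.
Proof.
move=> h cx; rewrite leNgt; apply/negP => qx.
have qN : 0 < q (- x) X by rewrite q_opp oppr_gt0.
have oO : open [set y : 'rV[R]_n | q y X < 0].
  apply: open_of_small => y /= qy; have qNy : 0 < q (- y) X by rewrite q_opp oppr_gt0.
  apply: (small_imp (q_nbhs qNy)) => d d0 g z yz.
  rewrite -oppr_gt0 -q_opp; apply: g => i; by rewrite !mxE -opprD normrN.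
have [y [Ay /= qy]] := cx _ (open_nbhs_nbhs (conj oO qx)).
by have := h y Ay; lra.
Qed.

Lemma closure_le0 (A : set 'rV[R]_n) X x : (forall y, A y -> q y X < 0) -> closure A x -> q x X <= 0.
Proof.
move=> h cx; rewrite leNgt; apply/negP => qx.
have oO : open [set y : 'rV[R]_n | 0 < q y X] by apply: open_of_small => y /= qy; exact: q_nbhs.
have [y [Ay /= qy]] := cx _ (open_nbhs_nbhs (conj oO qx)).
by have := h y Ay; lra.
Qed.

End Adjacency.

(** * Green sequences and maximal chains *)

Section Green.
Import numFieldNormedType.Exports.
Local Open Scope classical_set_scope.
Local Open Scope ring_scope.
Context {K : fieldType} {n : nat} {Q : modulated_quiver K n} {R : realType}.
Local Notation qmod := (@qmod K n Q).
Context {m : nat} {M : 'I_m -> rep Q} {V : 'I_m -> qmod}.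
Hypothesis tr : transfer M V.
Local Notation hV := (tr_listing tr).
Local Notation in_chamber := (@in_chamber K n Q R m V).
Local Notation admissible := (@admissible K n Q m M R).
Local Notation chain := (chain V).
Local Notation step := (step V).
Implicit Types (X Y Z N A B C W : qmod) (T S : qmod -> Prop) (x y z : 'rV[R]_n) (w : seq 'I_m).
Implicit Types (e : 'I_m -> sign) (j k l : 'I_m).

Lemma pr_delta i (d : 'rV[rat]_n) : pr (Q := Q) (delta_mx 0 i : 'rV[R]_n) d = ratr (d 0 i) * (vval Q i)%:R.
Proof.
rewrite /pr (bigD1 i) //= big1 => [|j ji]; first by rewrite mxE !eqxx addr0 mul1r.
by rewrite mxE (negPf ji) andbF !mul0r.
Qed.

(** A nonempty open piece of the hyperplane of k spans it, so the linear form of l vanishes on all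
    of it and is proportional to that of k; proportional roots coincide by [V_prop]. *)
Lemma hyperplane_inj (O : set 'rV[R]_n) k l : open O -> O `&` hyperplane M k !=set0 ->
  (forall x, O x -> q x (V k) = 0 -> q x (V l) = 0) -> l = k.
Proof.
move=> oO [x0 [Ox0 hx0]] h; rewrite /hyperplane /= (pairing_q tr) in hx0.
have h' (u : 'rV[R]_n) : q u (V k) = 0 -> q u (V l) = 0.
  move=> uk; have : nbhs x0 O by apply: open_nbhs_nbhs.
  move=> /nbhs_ballP[r /= r0 rO].
  have sm i : small (fun d => 0 < r + d * - `|u 0 i|) := small_lin _ r0.
  have [d d0 hd] := small_ex (small_all sm).
  have Ox : O (x0 + d *: u).
    apply: rO; split=> // i j; rewrite -ball_normE /= (ord1 i) !mxE opprD addrA subrr sub0r.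
    by rewrite normrN normrM (gtr0_norm d0); have := hd j; lra.
  have := h _ Ox; rewrite !qDl !qZl hx0 uk mulr0 addr0 => /(_ erefl).
  rewrite (h _ Ox0 hx0) add0r => /eqP; rewrite mulf_eq0 gt_eqF //= => /eqP //.
have [i0 bi0] : exists i, dv (V k) 0 i != 0.
  apply: contrapT => nb; have := V_sz hV k; rewrite dv0_sz //; apply/rowP => i.
  by rewrite [RHS]mxE; apply/eqP/negPn/negP => b; apply: nb; exists i.
apply: (V_prop hV (c := dv (V l) 0 i0 / dv (V k) 0 i0)).
apply/rowP => i; rewrite [RHS]mxE.
pose c j i : R := ratr (dv (V j) 0 i) * (vval Q i)%:R.
(* A test vector in the hyperplane of k, supported on the coordinates i and i0. *)
have := h' (c k i0 *: delta_mx 0 i - c k i *: delta_mx 0 i0).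
rewrite -scaleNr !qDl !qZl /q !pr_delta -!/(c _ _) => e.
have {e} := e ltac:(ring); rewrite /c => e.
have v0 v : (vval Q v)%:R != 0 :> R by rewrite pnatr_eq0 -lt0n vval_gt0.
have e' : ratr (dv (V k) 0 i0) * ratr (dv (V l) 0 i) = ratr (dv (V k) 0 i) * ratr (dv (V l) 0 i0) :> R.
  have vv : (vval Q i)%:R * (vval Q i0)%:R != 0 :> R by rewrite mulf_neq0.
  apply: (mulIf vv); apply/eqP; rewrite -subr_eq0 -e; apply/eqP; ring.
move: e'; rewrite -!rmorphM /= => /(fmorph_inj (ratr : {rmorphism rat -> R})) e'.
by apply: (mulfI bi0); rewrite e'; field.
Qed.

(** An indecomposable torsion for T1 and torsion-free for T has q >= 0 and q <= 0 on the common
    boundary piece, so q = 0 there and [hyperplane_inj] identifies it with V k. With T and T1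
    exchanged the same argument gives V k again, which is not in T; so T is contained in T1. *)
Lemma separated_step e e1 T T1 k : admissible e -> admissible e1 -> tors T -> tors T1 ->
  compartment M e = in_chamber T -> compartment M e1 = in_chamber T1 ->
  e k = SMinus -> e1 k = SPlus ->
  wall_separated M k (compartment M e : set 'rV[R]_n) (compartment M e1) -> step T k T1.
Proof.
move=> ad ad1 tT tT1 ce ce1 ek e1k [_ [S [oS neS clS _]]].
have pk := (chamber_signs tr ad tT ce k).2 ek.
have T1k := (chamber_signs tr ad1 tT1 ce1 k).1 e1k.
have cl x : S x -> q x (V k) = 0 -> closure (in_chamber T) x /\ closure (in_chamber T1) x.
  move=> Ox hx; have [] := clS x; last by rewrite ce ce1.
  by split=> //; rewrite /hyperplane /= (pairing_q tr).
have up l : T1 (V l) -> perp T (V l) -> l = k.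
  move=> T1l pl; apply: (hyperplane_inj oS neS) => x Ox xk; have [c c1] := cl x Ox xk.
  apply/eqP; rewrite eq_le (closure_le0 _ c) ?(closure_ge0 _ c1) // => y [h1 h2].
    exact: h1.
  exact: h2.
have down l : T (V l) -> perp T1 (V l) -> l = k.
  move=> Tl pl; apply: (hyperplane_inj oS neS) => x Ox xk; have [c c1] := cl x Ox xk.
  apply/eqP; rewrite eq_le (closure_le0 _ c1) ?(closure_ge0 _ c) // => y [h1 h2].
    exact: h1.
  exact: h2.
split=> // [X TX|l]; last by split=> [[]|->]; [exact: up|].
have [N [Z [i [p [ss TN pZ]]]]] := tors_dec X tT1; case: (ss) => _ hp _ fp _.
have [Z0|Z0] := posnP (sz Z).
  by apply: (tors_ext tT1 ss TN); exact: tors_sz0.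
have [l [A [iA sA]]] := nz_summand hV Z0.
have Tl : T (V l) := tors_iso tT iA (tors_summand tT sA (tors_quo tT hp fp TX)).
have pl : perp T1 (V l) := perp_iso iA (perp_summand sA pZ).
by case: (tors_perp_V tr Tl); rewrite (down l Tl pl).
Qed.

(** The cones visited by the chain from T with labels w; [gen_tors] recomputes each class from the
    preceding one and the label. *)
Fixpoint trace T (w : seq 'I_m) : seq (set 'rV[R]_n) :=
  (in_chamber T : set 'rV[R]_n) :: if w is k :: w' then trace (gen_tors T (V k)) w' else [::].

Lemma step_gen_tors T k T1 : step T k T1 -> gen_tors T (V k) = T1.
Proof. by move=> st; apply/funext => X; apply/propext; rewrite (step_gen hV X st). Qed.

Lemma chamber_set_inj T T1 : tors T -> tors T1 ->
  in_chamber T = in_chamber T1 -> T = T1.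
Proof.
move=> tT tT1 h; have [x cx] := @chamber_ex _ _ _ R _ _ _ tr _ tT.
by apply: (chamber_inj hV tT tT1 cx); rewrite -h.
Qed.

(** A cone determines its torsion class, and two consecutive classes determine the label. *)
Lemma trace_inj T w w' S S' : tors T -> chain T w S -> chain T w' S' -> trace T w = trace T w' ->
  w = w'.
Proof.
elim: w T w' => [|k w IH] T [|k' w'] tT //=.
- by move=> _ _ []; case: w'.
- by move=> _ _ []; case: w {IH}.
move=> [T1 [st c]] [T1' [st' c']]; rewrite (step_gen_tors st) (step_gen_tors st') => -[e].
have [_ tT1 _ sk] := st; have [_ tT1' _ _] := st'.
have eT : T1 = T1'.
  apply: chamber_set_inj => //.
  by move: e; clear; case: w w' => [|a w] [|a' w'] [].
have ek : k' = k by apply/sk; rewrite eT; exact: step_in st'.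
by subst k' T1'; rewrite (IH T1 w').
Qed.

Lemma green_chain s (e : nat -> 'I_m -> sign) (Tt : nat -> qmod -> Prop) :
  (forall t, (t <= s)%N -> admissible (e t)) ->
  (forall t, (t <= s)%N -> tors (Tt t) /\ compartment M (e t) = in_chamber (Tt t)) ->
  (forall t, (t < s)%N -> exists k : 'I_m,
     [/\ wall_separated M k (compartment M (e t) : set 'rV[R]_n) (compartment M (e t.+1)),
         e t k = SMinus, e t.+1 k = SPlus & forall j : 'I_m, (j < k)%N -> e t j = e t.+1 j]) ->
  forall d t, (t + d = s)%N -> exists w, chain (Tt t) w (Tt s) /\
    trace (Tt t) w = [seq compartment M (e i) | i <- iota t d.+1].
Proof.
move=> ad hT adj; elim=> [|d IH] t ts.
  rewrite addn0 in ts; subst t; exists [::]; split=> //=.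
  by rewrite (hT s (leqnn s)).2.
have [w [cw tw]] := IH t.+1 ltac:(lia).
have [k [ws ek e1k _]] := adj t ltac:(lia).
have lt : (t <= s)%N by lia. have lt1 : (t.+1 <= s)%N by lia.
have [tT ce] := hT t lt; have [tT1 ce1] := hT t.+1 lt1.
have st := separated_step (ad t lt) (ad _ lt1) tT tT1 ce ce1 ek e1k ws.
exists (k :: w); split; first by exists (Tt t.+1).
by rewrite /= (step_gen_tors st) tw -ce.
Qed.

Lemma chain_green T w S : tors T -> chain T w S -> exists e : nat -> 'I_m -> sign,
  [/\ forall t, (t <= size w)%N -> admissible (e t),
      forall t, (t < size w)%N -> exists k : 'I_m,
       [/\ wall_separated M k (compartment M (e t) : set 'rV[R]_n) (compartment M (e t.+1)),
         e t k = SMinus, e t.+1 k = SPlus & forall j : 'I_m, (j < k)%N -> e t j = e t.+1 j],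
      trace T w = mkseq (fun t => compartment M (e t)) (size w).+1,
      compartment M (e 0%N) = in_chamber T & compartment M (e (size w)) = in_chamber S].
Proof.
elim: w T => [|k w IH] T tT.
  move/chain_nil => <-; have [e [ad ce]] := admissible_ex tr tT (chamber_ex (R := R) tr tT).
  by exists (fun=> e); split=> //=; rewrite ce.
move=> [T1 [st c]]; have [_ tT1 _ _] := st.
have [e [ad adj tre e0 es]] := IH T1 tT1 c.
have [e' [ad' ce']] := admissible_ex tr tT (chamber_ex (R := R) tr tT).
exists (fun t => if t is t'.+1 then e t' else e'); split=> //.
- by case=> [|t] //= ts; apply: ad.
- case=> [|t] ts; last exact: adj.
  have [h1 h2 h3] := step_signs tr ad' (ad 0%N isT) st ce' e0.
  exists k; split=> //; rewrite ce' e0; exact: step_wall_separated.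
rewrite /= (step_gen_tors st) tre /mkseq /= ce'; congr (_ :: _ :: _).
by rewrite -[2%N]addn1 iotaDl -map_comp; apply: eq_map => i.
Qed.

Lemma negative_chamber T x : tors T -> (forall i, x 0 i < 0) -> in_chamber T x <-> T = @Tzero K n Q.
Proof.
move=> tT x0; have neg k : q x (V k) < 0.
  rewrite -oppr_gt0 -q_opp; apply: q_gt0 => [i|]; last exact: V_sz hV k.
  by rewrite mxE oppr_gt0.
have cz : in_chamber (@Tzero K n Q) x.
  by split=> k // h; have := V_sz hV k; rewrite h.
by split=> [cx|-> //]; apply: (chamber_inj hV tT tors_Tzero cx).
Qed.

Lemma positive_chamber T x : tors T -> (forall i, 0 < x 0 i) -> in_chamber T x <-> T = @Tall K n Q.
Proof.
move=> tT x0; have pos k : 0 < q x (V k) by apply: q_gt0 => //; exact: V_sz hV k.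
have cz : in_chamber (@Tall K n Q) x.
  by split=> k // h; case: (@tors_perp_V _ _ _ _ _ _ tr (@Tall K n Q) k).
by split=> [cx|-> //]; apply: (chamber_inj hV tT tors_Tall cx).
Qed.

Lemma green_trace (c : seq (set 'rV[R]_n)) : maximal_green_sequence M c <->
  exists2 w, chain (@Tzero K n Q) w (@Tall K n Q) & c = trace (@Tzero K n Q) w.
Proof.
split=> [[s [e [-> ad adj e0 es]]]|[w cw ->]]; last first.
  have [e [ad adj tre e0 es]] := chain_green tors_Tzero cw.
  exists (size w), e; split=> //.
    by rewrite e0 => x /= hx; apply/(negative_chamber tors_Tzero).
  by rewrite es => x /= hx; apply/(positive_chamber tors_Tall).
have /choice[Tt hT] : forall t, exists T, (t <= s)%N -> tors T /\ compartment M (e t) = in_chamber T.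
  move=> t; have [ts|ts] := leqP t s; last by exists (@Tall K n Q).
  by have [T [tT _ ce _]] := compartment_chamber tr (ad t ts); exists T.
have [w [cw tw]] := green_chain ad hT adj (add0n s).
have T0 : Tt 0%N = @Tzero K n Q.
  have [tT ce] := hT 0%N isT; have x0 i : (const_mx (-1) : 'rV[R]_n) 0 i < 0 by rewrite mxE; lra.
  by apply/(negative_chamber tT x0); rewrite -ce; apply: e0.
have Ts : Tt s = @Tall K n Q.
  have [tT ce] := hT s (leqnn s); have x0 i : 0 < (const_mx 1 : 'rV[R]_n) 0 i by rewrite mxE; lra.
  by apply/(positive_chamber tT x0); rewrite -ce; apply: es.
by exists w; rewrite -T0 -?Ts.
Qed.

End Green.

Theorem corollaryB (K : fieldType) (n : nat) (Q : modulated_quiver K n)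
    (hfin : finite_rep_type Q)
    (m : nat) (M : 'I_m -> rep Q) (hM : root_listing M)
    (s : seq 'I_m) (hs : simple_roots_listing M s)
    (R : realType) :
  exists f : seq (set 'rV[R]_n) -> seq 'I_m,
    set_bij [set c | maximal_green_sequence M c]%classic
            (positive_expressions M s) f.
Proof.
have [V tr] := transfer_ex hfin hM.
have cs := simple_chain tr hM hs.
have /choice[f hf] : forall c : seq (set 'rV[R]_n), exists w, maximal_green_sequence M c ->
    chain V (@Tzero K n Q) w (@Tall K n Q) /\ c = trace (V := V) (@Tzero K n Q) w.
  move=> c; have [/(green_trace tr)[w cw cE]|ng] := pselect (maximal_green_sequence M c).
    by exists w.
  (* Default value of f away from the green sequences. *)
  by exists [::].
exists f; split=> [c /hf[cw _]|c c' /set_mem/hf[_ e] /set_mem/hf[_ e'] fE|w /(word_chain tr cs) cw].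
- exact/(word_chain tr cs).
- by rewrite e e' fE.
have g : maximal_green_sequence M (trace (R := R) (V := V) (@Tzero K n Q) w).
  by apply/(green_trace tr); exists w.
exists (trace (V := V) (@Tzero K n Q) w) => //.
have [cw' e] := hf _ g; apply/esym; exact: (trace_inj tr tors_Tzero cw cw' e).
Qed.
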